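(* Let $X$ be the linear random field $X(t)=\sum_{s\in\mathbb{Z}^2} b(t-s)\varepsilon(s)$, $t\in\mathbb{Z}^2$, with i.i.d. innovations and coefficients $b$ satisfying Assumptions A and B stated in the context, with parameters $q_1,q_2>0$, $1<Q<2$, and nondegenerate matrix $B=(b_{ij})_{i,j=1,2}$. Let $q_1=q_2=:q$ and $\widetilde Q_1=\widetilde Q_2=:\widetilde Q$. Then, in each of the two cases (i), (ii) below, for every $\gamma>0$ there is $H(\gamma)>0$ such that, with $A_{\lambda,\gamma}:=\lambda^{H(\gamma)}$, in the sense of weak convergence of finite-dimensional distributions, $$\big\{A_{\lambda,\gamma}^{-1}S^X_{\lambda,\gamma}(x),\ x\in\mathbb{R}^2_+\big\}\ \longrightarrow\ V^X_\gamma=\begin{cases}V^X_+,&\gamma>\gamma^X_0,\\ V^X_-,&\gamma<\gamma^X_0,\\ V^X_0,&\gamma=\gamma^X_0,\end{cases}\qquad \lambda\to\infty,$$ where: (i) if $q\in(1,\frac32)$ (equivalently $\widetilde Q>1$): $\gamma^X_0=1$, $V^X_+=\tilde V_{02}$, $V^X_-=\tilde V_{01}$, $V^X_0=\tilde V_0$; (ii) if $q\in(\frac32,2)$ (equivalently $\widetilde Q<1$): $\gamma^X_0=1$, $V^X_+=V_{10}$, $V^X_-=V_{20}$, $V^X_0=V_0$.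
   Context: Notation: $\mathbb{R}^2_+=(0,\infty)^2$, $\mathbb{R}^2_0=\mathbb{R}^2\setminus\{(0,0)\}$, $(0,x]=(0,x_1]\times(0,x_2]$ for $x=(x_1,x_2)\in\mathbb{R}^2_+$, $|t|=|t_1|+|t_2|$. Vectors are column vectors. Parameters: $q_1,q_2>0$ with $Q:=\frac1{q_1}+\frac1{q_2}\in(1,2)$; $\widetilde Q_i:=Q-\frac1{2q_i}$, $i=1,2$. Put $\rho(u):=|u_1|^{q_1}+|u_2|^{q_2}$, $u\in\mathbb{R}^2$. Assumption A: $\varepsilon(t)$, $t\in\mathbb{Z}^2$, are i.i.d. random variables with $\mathrm{E}\,\varepsilon(0)=0$, $\mathrm{E}|\varepsilon(0)|^2=1$. Assumption B: $b:\mathbb{Z}^2\to\mathbb{R}$ satisfies $b(t)=\rho(Bt)^{-1}\big(L(Bt)+o(1)\big)$ as $|t|\to\infty$, where $B=(b_{ij})_{i,j=1,2}$ is a real nondegenerate $2\times2$ matrix and $$L(u):=L_+\big(u_1/\rho(u)^{1/q_1}\big)\mathbf 1(u_2\ge0)+L_-\big(u_1/\rho(u)^{1/q_1}\big)\mathbf 1(u_2<0),\quad u\in\mathbb{R}^2_0,$$ with $L_\pm:[-1,1]\to\mathbb{R}$ continuous, $L_+(1)=L_-(1)$, $L_+(-1)=L_-(-1)$. Partial sums: $S^X_{\lambda,\gamma}(x):=\sum_{t\in((0,\lambda x_1]\times(0,\lambda^\gamma x_2])\cap\mathbb{Z}^2}X(t)$, $x\in\mathbb{R}^2_+$. Limit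 fields: $W$ is real Gaussian white noise on $\mathbb{R}^2$ with zero mean and variance $\mathrm{E}W(\mathrm{d}u)^2=\mathrm{d}u$ (Lebesgue measure); $\int h\,\mathrm{d}W$ is defined for $h\in L^2(\mathbb{R}^2)$. Put $a_\infty(u):=\rho(u)^{-1}L(u)$, $u\in\mathbb{R}^2_0$, and for $2\times2$ matrices $\tilde D$, $D$ and $x\in\mathbb{R}^2_+$ $$\tilde V_{\tilde D}(x):=|\det B|^{-1/2}\int_{\mathbb{R}^2}\Big\{\int_{(0,x]}a_\infty(\tilde Dt-u)\,\mathrm{d}t\Big\}W(\mathrm{d}u),$$ $$V_D(x):=|\det B|^{-1}\int_{\mathbb{R}^2}\Big\{\int_{\mathbb{R}^2}a_\infty(t)\mathbf 1\big(Dt+u\in(0,x]\big)\,\mathrm{d}t\Big\}W(\mathrm{d}u).$$ Write $\tilde V_0:=\tilde V_B$, $V_0:=V_{B^{-1}}$, $\tilde V_{ij}:=\tilde V_{\tilde B_{ij}}$ and $V_{ij}:=V_{B_{ij}}$, where $$\tilde B_{01}=\begin{bmatrix}b_{11}&0\\ b_{21}&0\end{bmatrix},\quad \tilde B_{02}=\begin{bmatrix}0&b_{12}\\ 0&b_{22}\end{bmatrix},\quad B_{10}=\frac1{\det B}\begin{bmatrix}b_{22}&-b_{12}\\ 0&0\end{bmatrix},\quad B_{20}=\frac1{\det B}\begin{bmatrix}0&0\\ -b_{21}&b_{11}\end{bmatrix}.$$ *)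

(* Defs.v *)
From HB Require Import structures.
From mathcomp Require Import all_boot all_order all_algebra finmap.
From mathcomp Require Import all_classical all_reals all_analysis.

Set Implicit Arguments.
Unset Strict Implicit.
Unset Printing Implicit Defensive.

Import Order.TTheory GRing.Theory Num.Theory.
Import numFieldNormedType.Exports.

Local Open Scope classical_set_scope.
Local Open Scope ring_scope.

(* Points of R^2 are pairs in R * R and points of Z^2 are pairs in int * int. *)

Section plane.
Context {R : realType}.

Definition mu2 : {measure set (measurableTypeR R * measurableTypeR R) -> \bar R}
  := (lebesgue_measure \x lebesgue_measure)%E.

Definition quadrant : set (R * R) := [set x | 0 < x.1 /\ 0 < x.2].

Definition box (x : R * R) : set (R * R) :=
  [set u | (0 < u.1 <= x.1) /\ (0 < u.2 <= x.2)].

Definition mx2 (a b c d : R) : 'M[R]_2 :=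
  \matrix_(i, j) if i == 0 then (if j == 0 then a else b)
                 else (if j == 0 then c else d).

Definition mxact (D : 'M[R]_2) (u : R * R) : R * R :=
  (D 0 0 * u.1 + D 0 1 * u.2, D 1 0 * u.1 + D 1 1 * u.2).

Definition int2R (t : int * int) : R * R := (t.1%:~R, t.2%:~R).

End plane.

Section coefficients.
Context {R : realType}.
Variables (q1 q2 : R) (B : 'M[R]_2) (Lp Lm : R -> R).

Definition Qsum : R := q1^-1 + q2^-1.

Definition Qtilde (q : R) : R := Qsum - (2 * q)^-1.

Definition rho (u : R * R) : R := `|u.1| `^ q1 + `|u.2| `^ q2.

Definition Lang (u : R * R) : R :=
  if 0 <= u.2 then Lp (u.1 / rho u `^ q1^-1) else Lm (u.1 / rho u `^ q1^-1).

(* The value at the origin, where the mathematical a_oo is undefined, is 0. *)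
Definition a_oo (u : R * R) : R := (rho u)^-1 * Lang u.

(* The expansion is not imposed at t = 0: there rho (B t) = 0, and b (0, 0) is
   an arbitrary real number. *)
Definition assumptionB (b : int * int -> R) : Prop :=
  [/\ \det B != 0,
      [/\ {within `[-1, 1], continuous Lp}, {within `[-1, 1], continuous Lm},
          Lp 1 = Lm 1 & Lp (-1) = Lm (-1)] &
      exists o : int * int -> R,
        (forall e : R, 0 < e -> exists N : nat, forall t : int * int,
           (N%:Z <= `|t.1| + `|t.2|)%R -> `|o t| <= e) /\
        (forall t : int * int, t != 0 ->
           b t = (rho (mxact B (int2R t)))^-1 *
                 (Lang (mxact B (int2R t)) + o t))].

End coefficients.

Section random_fields.
Context {R : realType} d (T : measurableType d) (P : probability T R).

Definition mutually_independent (I : choiceType) (X : I -> {RV P >-> R}) :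
    Prop :=
  forall (F : {fset I}) (A : I -> set R), (forall i, measurable (A i)) ->
    P (\bigcap_(i in [set` F]) (X i @^-1` A i)) =
    (\prod_(i <- F) P (X i @^-1` A i))%E.

Definition identically_distributed (I : Type) (X : I -> {RV P >-> R}) : Prop :=
  forall (i j : I) (A : set R), measurable A ->
    distribution P (X i) A = distribution P (X j) A.

Definition assumptionA (eps : int * int -> {RV P >-> R}) : Prop :=
  [/\ mutually_independent eps, identically_distributed eps,
      ('E_P[eps 0%R] = 0)%E &
      ('E_P[fun w => (`|eps 0%R w| ^+ 2)%R] = 1)%E].

(* The series X(t) = \sum_s b(t - s) eps(s) converges in mean square,
   unconditionally, i.e. along the net of finite subsets of Z^2. *)
Definition linear_field (b : int * int -> R)
    (eps X : int * int -> {RV P >-> R}) : Prop :=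
  forall (t : int * int) (e : R), 0 < e ->
    exists F0 : {fset int * int}, forall F : {fset int * int},
      (F0 `<=` F)%fset ->
      ('E_P[fun w => ((X t w - \sum_(s <- F) b (t - s) * eps s w) ^+ 2)%R]
         <= e%:E)%E.

Definition partial_sum (X : int * int -> {RV P >-> R}) (lambda gamma : R)
    (x : R * R) (w : T) : R :=
  \sum_(t \in [set t : int * int |
     box (lambda * x.1, lambda `^ gamma * x.2) (int2R t)]) X t w.

(* N(0, s2); the library's normal_prob does not degenerate to a Dirac mass at
   standard deviation 0. *)
Definition centered_gaussian (Y : {RV P >-> R}) (s2 : R) : Prop :=
  forall A : set R, measurable A ->
    distribution P Y A =
    if s2 == 0 then dirac (0 : R) A else normal_prob 0 (Num.sqrt s2) A.

Definition finite_area (A : set (R * R)) : Prop :=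
  measurable (A : set (measurableTypeR R * measurableTypeR R)) /\
  (mu2 A < +oo)%E.

(* Gaussian white noise with control measure du: an independently scattered
   centered Gaussian random measure.  Only the sets of finite area matter. *)
Definition white_noise (W : set (R * R) -> {RV P >-> R}) : Prop :=
  [/\ forall A, finite_area A -> centered_gaussian (W A) (fine (mu2 A)),
      forall A A', finite_area A -> finite_area A' -> A `&` A' = set0 ->
        {ae P, forall w, W (A `|` A') w = W A w + W A' w} &
      forall (n : nat) (A : 'I_n -> set (R * R)),
        (forall i, finite_area (A i)) -> trivIset setT A ->
        mutually_independent (fun i => W (A i))].

(* I is (a version of) \int h dW: for square integrable h, the mean-square
   limit of the integrals \sum_i c_i W(A_i) of simple functions
   \sum_i c_i 1_{A_i} tending to h in L^2(R^2). *)
Definition wiener_integral (W : set (R * R) -> {RV P >-> R})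
    (h : R * R -> R) (I : {RV P >-> R}) : Prop :=
  h \in Lfun mu2 2%:E /\
  forall e : R, 0 < e ->
    exists (n : nat) (c : 'I_n -> R) (A : 'I_n -> set (R * R)),
      [/\ forall i, finite_area (A i),
          (\int[mu2]_u ((h u - \sum_(i < n) c i * \1_(A i) u) ^+ 2)%:E
             <= e%:E)%E &
          ('E_P[fun w => ((I w - \sum_(i < n) c i * W (A i) w) ^+ 2)%R]
             <= e%:E)%E].

End random_fields.

(* Weak convergence of the finite-dimensional distributions of the fields
   Y_lambda, indexed by the open quadrant, to those of Z as lambda -> +oo. *)
Definition fdd_cvg {R : realType} d (T : measurableType d)
    (P : probability T R) d' (T' : measurableType d') (P' : probability T' R)
    (Y : R -> R * R -> T -> R) (Z : R * R -> T' -> R) : Prop :=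
  forall (n : nat) (x : 'I_n -> R * R), (forall i, quadrant (x i)) ->
  forall f : 'rV[R]_n -> R, continuous f ->
    (exists M : R, forall v, `|f v| <= M) ->
    ('E_P[fun w => f (\row_i Y lambda (x i) w)%R])%E @[lambda --> +oo] -->
    ('E_P'[fun w => f (\row_i Z (x i) w)%R])%E.

(* Data of a Gaussian field
     V(x) = scale * \int_{R^2} { \int_{dom x} fn x u t dt } W(du). *)
Record gaussian_field (R : realType) := GaussianField {
  gf_scale : R;
  gf_dom : R * R -> set (R * R);
  gf_fun : R * R -> R * R -> R * R -> R }.

Section gaussian_field.
Context {R : realType} (G : gaussian_field R).

Definition gf_kernel (x u : R * R) : R :=
  \int[mu2]_(t in gf_dom G x) gf_fun G x u t.

Definition gf_well_defined : Prop :=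
  forall x, quadrant x ->
    {ae mu2, forall u, mu2.-integrable (gf_dom G x)
                         (fun t => (gf_fun G x u t)%:E)} /\
    gf_kernel x \in Lfun mu2 2%:E.

Definition gf_version d (T : measurableType d) (P : probability T R)
    (W : set (R * R) -> {RV P >-> R}) (V : R * R -> {RV P >-> R}) : Prop :=
  forall x, quadrant x -> exists2 I : {RV P >-> R},
    wiener_integral W (gf_kernel x) I &
    {ae P, forall w, V x w = gf_scale G * I w}.

(* With the normalization lambda ^ H for some H > 0, the partial sums of X
   converge to G, which includes that the integrals defining G make sense.  The
   limit is a law: any white noise on any probability space may realize it. *)
Definition scaling_limit d (T : measurableType d) (P : probability T R)
    (X : int * int -> {RV P >-> R}) (gamma : R) : Prop :=
  gf_well_defined /\
  exists2 H : R, 0 < H &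
    forall d' (T' : measurableType d') (P' : probability T' R)
      (W : set (R * R) -> {RV P' >-> R}) (V : R * R -> {RV P' >-> R}),
      white_noise W -> gf_version W V ->
      fdd_cvg P P'
        (fun lambda x w => (lambda `^ H)^-1 * partial_sum X lambda gamma x w)
        V.

End gaussian_field.

Definition scaling_transition {R : realType} d (T : measurableType d)
    (P : probability T R) (X : int * int -> {RV P >-> R})
    (gamma0 : R) (Gplus Gminus G0 : gaussian_field R) : Prop :=
  forall gamma : R, 0 < gamma ->
    [/\ gamma > gamma0 -> scaling_limit Gplus X gamma,
        gamma < gamma0 -> scaling_limit Gminus X gamma &
        gamma = gamma0 -> scaling_limit G0 X gamma].

Section limit_fields.
Context {R : realType}.
Variables (q1 q2 : R) (B : 'M[R]_2) (Lp Lm : R -> R).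
Let a := a_oo q1 q2 Lp Lm.

Definition Vtilde (D : 'M[R]_2) : gaussian_field R :=
  GaussianField (`|\det B| `^ (- 2^-1)) box (fun _ u t => a (mxact D t - u)).

Definition Vfield (D : 'M[R]_2) : gaussian_field R :=
  GaussianField `|\det B|^-1 (fun=> setT)
    (fun x u t => a t * \1_(box x) (mxact D t + u)).

Definition Vtilde0 := Vtilde B.
Definition Vtilde01 := Vtilde (mx2 (B 0 0) 0 (B 1 0) 0).
Definition Vtilde02 := Vtilde (mx2 0 (B 0 1) 0 (B 1 1)).
Definition V0 := Vfield (invmx B).
Definition V10 := Vfield ((\det B)^-1 *: mx2 (B 1 1) (- B 0 1) 0 0).
Definition V20 := Vfield ((\det B)^-1 *: mx2 0 0 (- B 1 0) (B 0 0)).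

End limit_fields.

(* Main.v *)
From HB Require Import structures.
Require Import Defs.
From mathcomp Require Import all_boot all_order all_algebra finmap.
From mathcomp Require Import all_classical all_reals all_analysis.
From mathcomp Require Import measurable_realfun.
From mathcomp Require Import ring lra zify.

(** The theorem splits into a central limit theorem and an L^2 computation.

    For finitely many boxes, a linear combination of normalized partial sums is
    a weighted sum of the innovations, with weights equal to sums of [b] over the
    translated boxes.  The innovations are independent with variance 1, so it is
    asymptotically normal as soon as the sum of the squared weights converges
    and the largest weight vanishes: [linear_field_weak_cvg], by comparing
    characteristic functions factor by factor.  Only cosines are ever computed,
    and [weak_cvg_of_cos] recovers bounded continuous functions by approximating
    them with trigonometric polynomials.  On the other side the stochastic
    integrals of an arbitrary white noise are shown by [wiener_integral_cos] to
    have Gaussian cosine transforms, so both sides are compared through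
    variances.

    The weights are handled as functions on the plane that are constant on the
    cells of a rescaled lattice: their square integral is the sum of squares, and
    [kernel_limit_cells] reduces everything to dominated convergence of these
    functions to a kernel [K x] in L^2.  They are integrals of [b] at rounded
    arguments themselves, and [power_kernel_a_oo] says that [b] looks like the
    homogeneous function [g u = a_oo (B u)] from far away.  The domination rests
    on one remark, [power_kernel_product]: a power [-q] of the sup norm is at
    most the product of powers [-al] and [-be] of the two coordinates, whenever
    [al + be = q].  Choosing the exponents according to the region makes every
    estimate one-dimensional.

    If [gamma > 1] and [q < 3/2], both coordinates of the innovations live on the
    scale [lambda ^ gamma] of the long side of the box, on which the short side
    degenerates to a point ([kernel_limit_degenerate]).  If [q > 3/2], this kernel
    is no longer square integrable at the origin of the first coordinate; the
    innovations live on the scale of the box, while the arguments of [b] live on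
    the scale of its short side ([kernel_limit_inverse]).  If [gamma = 1] both
    descriptions coincide ([kernel_limit_critical]), and [gamma < 1] follows by
    exchanging the coordinates ([regime_below]).  The linear substitution by [B]
    finally turns the kernels built from [g] into those of the limit fields. *)

Set Implicit Arguments.
Unset Strict Implicit.
Unset Printing Implicit Defensive.

Import Order.TTheory GRing.Theory Num.Theory.
Import numFieldNormedType.Exports.

Local Open Scope classical_set_scope.
Local Open Scope ring_scope.

(** * Bounded integrals and independence *)

Section bounded_integrals.
Context {R : realType}.

Section real_integrable.
Context d (T : measurableType d) (mu : {measure set T -> \bar R}).
Variables (D : set T) (mD : measurable D).

Lemma integrable_EFinD (f g : T -> R) : mu.-integrable D (EFin \o f) ->
  mu.-integrable D (EFin \o g) ->
  mu.-integrable D (EFin \o (fun x => f x + g x)).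
Proof.
by move=> h1 h2; have := integrableD mD h1 h2; apply: eq_integrable.
Qed.

Lemma integrable_EFinB (f g : T -> R) : mu.-integrable D (EFin \o f) ->
  mu.-integrable D (EFin \o g) ->
  mu.-integrable D (EFin \o (fun x => f x - g x)).
Proof.
by move=> h1 h2; have := integrableB mD h1 h2; apply: eq_integrable.
Qed.

Lemma integrable_EFinZ (k : R) (f : T -> R) : mu.-integrable D (EFin \o f) ->
  mu.-integrable D (EFin \o (fun x => k * f x)).
Proof.
by move=> h1; have := integrableZl mD k h1; apply: eq_integrable.
Qed.

End real_integrable.

Lemma integrable_bounded_mul d (T : measurableType d)
    (mu : {measure set T -> \bar R}) (h G : T -> R) (M : R) :
  measurable_fun setT h -> (forall w, `|h w| <= M) ->
  mu.-integrable setT (EFin \o G) ->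
  mu.-integrable setT (EFin \o (fun w => h w * G w)).
Proof.
move=> mh hM iG.
have mG : measurable_fun setT G by move/measurable_int: iG => /measurable_EFinP.
have M0 (w : T) : 0 <= M by by rewrite (le_trans _ (hM w)).
apply: (@le_integrable _ _ _ mu setT measurableT _ (EFin \o (fun w => M * G w))).
- by apply/measurable_EFinP; exact: measurable_funM.
- move=> w _ /=; rewrite lee_fin !normrM ler_wpM2r// (ger0_norm (M0 w)).
  exact: hM.
- exact: (integrable_EFinZ measurableT M iG).
Qed.

Lemma integrable_bounded d (T : measurableType d) (P : probability T R)
    (h : T -> R) (M : R) :
  measurable_fun setT h -> (forall w, `|h w| <= M) ->
  P.-integrable setT (EFin \o h).
Proof.
move=> mh hM.
have := @integrable_bounded_mul _ _ P h (cst 1) M mh hM.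
have /[swap]/[apply] : P.-integrable setT (EFin \o (cst 1 : T -> R)).
  exact: finite_measure_integrable_cst.
by congr (P.-integrable _ _); apply/funext => w /=; rewrite mulr1.
Qed.

Lemma Rintegral_probability_cst d (T : measurableType d) (P : probability T R)
    (r : R) : \int[P]_(w in setT) r = r.
Proof.
rewrite Rintegral_cst// -[RHS]mulr1; congr (_ * _).
exact: (congr1 fine (probability_setT P)).
Qed.

Lemma layer_count_approx (n : nat) (y : R) : 0 <= y <= n%:R ->
  `|y - \sum_(k < n) (if k.+1%:R <= y then 1 else 0)| <= 1.
Proof.
elim: n => [|n IH] /andP[y0 yn].
  by rewrite big_ord0 subr0 ger0_norm//; lra.
rewrite big_ord_recr/=.
have [le_y|lt_y] := leP n.+1%:R y.
  have -> : y = n.+1%:R by apply/eqP; rewrite eq_le yn.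
  rewrite (eq_bigr (fun=> 1)); last first.
    by move=> i _; rewrite ler_nat ltnS (ltnW (ltn_ord i)).
  by rewrite sumr_const card_ord -(natr1 n) subrr normr0.
rewrite addr0; have [yn'|yn'] := leP y n%:R.
  by apply: IH; rewrite y0 yn'.
rewrite (eq_bigr (fun=> 1)); last first.
  move=> i _; rewrite ifT//; apply: le_trans (ltW yn').
  by rewrite ler_nat.
rewrite sumr_const card_ord.
move: lt_y; rewrite -natr1 => lt_y; rewrite ler_norml; lra.
Qed.

(** The layer-cake sums of indicators approximate [f] uniformly, so the error on
    either side is controlled by the total mass of the density. *)
Lemma Rintegral_eq_of_indic d1 (T1 : measurableType d1)
    (m1 : {measure set T1 -> \bar R}) d2 (T2 : measurableType d2)
    (m2 : {measure set T2 -> \bar R}) (X1 : T1 -> R) (X2 : T2 -> R)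
    (G1 : T1 -> R) (G2 : T2 -> R) (f : R -> R) (M : R) :
  measurable_fun setT X1 -> measurable_fun setT X2 ->
  m1.-integrable setT (EFin \o G1) -> m2.-integrable setT (EFin \o G2) ->
  (forall A, measurable A ->
    \int[m1]_w (\1_A (X1 w) * G1 w) = \int[m2]_w (\1_A (X2 w) * G2 w)) ->
  measurable_fun setT f -> (forall x, `|f x| <= M) ->
  \int[m1]_w (f (X1 w) * G1 w) = \int[m2]_w (f (X2 w) * G2 w).
Proof.
move=> mX1 mX2 iG1 iG2 AE mf fM.
pose D (h : R -> R) :=
  \int[m1]_w (h (X1 w) * G1 w) - \int[m2]_w (h (X2 w) * G2 w).
have int1 (h : R -> R) (K : R) : measurable_fun setT h ->
    (forall x, `|h x| <= K) ->
    m1.-integrable setT (EFin \o (fun w => h (X1 w) * G1 w)).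
  move=> mh hK; apply: (@integrable_bounded_mul _ _ _ _ _ K) => //.
  exact: measurableT_comp.
have int2 (h : R -> R) (K : R) : measurable_fun setT h ->
    (forall x, `|h x| <= K) ->
    m2.-integrable setT (EFin \o (fun w => h (X2 w) * G2 w)).
  move=> mh hK; apply: (@integrable_bounded_mul _ _ _ _ _ K) => //.
  exact: measurableT_comp.
have DD (h1 h2 : R -> R) (K1 K2 : R) : measurable_fun setT h1 ->
    measurable_fun setT h2 ->
    (forall x, `|h1 x| <= K1) -> (forall x, `|h2 x| <= K2) ->
    D (fun x => h1 x + h2 x) = D h1 + D h2.
  move=> mh1 mh2 b1 b2; rewrite /D.
  under eq_Rintegral do rewrite mulrDl.
  under [X in _ - X]eq_Rintegral do rewrite mulrDl.
  rewrite !RintegralD//; [ring|exact: (int2 _ _ mh1 b1)|exact: (int2 _ _ mh2 b2)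
  |exact: (int1 _ _ mh1 b1)|exact: (int1 _ _ mh2 b2)].
have DZ (h : R -> R) (K k : R) : measurable_fun setT h ->
    (forall x, `|h x| <= K) -> D (fun x => k * h x) = k * D h.
  move=> mh b1; rewrite /D.
  under eq_Rintegral do rewrite -mulrA.
  under [X in _ - X]eq_Rintegral do rewrite -mulrA.
  by rewrite !RintegralZl//; [ring|exact: (int2 _ _ mh b1)|exact: (int1 _ _ mh b1)].
have D1 A : measurable A -> D (\1_A) = 0.
  by move=> mA; rewrite /D AE// subrr.
have indb (A : set R) x : `|(\1_A x : R)| <= 1.
  by rewrite indicE; case: (_ \in _); rewrite ?normr1 ?normr0.
pose C := \int[m1]_w `|G1 w| + \int[m2]_w `|G2 w|.
have Dle (h : R -> R) (K : R) : measurable_fun setT h ->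
    (forall x, `|h x| <= K) -> `|D h| <= K * C.
  move=> mh hK; rewrite /D (le_trans (ler_normB _ _))// /C mulrDr lerD//.
    rewrite -RintegralZl//; last exact: (integrable_norm iG1).
    rewrite (le_trans (le_normr_Rintegral _ _))//; first exact: (int1 _ _ mh hK).
    apply: le_Rintegral => //.
    - exact: (integrable_norm (int1 _ _ mh hK)).
    - exact: (integrable_EFinZ measurableT _ (integrable_norm iG1)).
    - by move=> w _; rewrite normrM ler_wpM2r.
  rewrite -RintegralZl//; last exact: (integrable_norm iG2).
  rewrite (le_trans (le_normr_Rintegral _ _))//; first exact: (int2 _ _ mh hK).
  apply: le_Rintegral => //.
  - exact: (integrable_norm (int2 _ _ mh hK)).
  - exact: (integrable_EFinZ measurableT _ (integrable_norm iG2)).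
  - by move=> w _; rewrite normrM ler_wpM2r.
have C0 : 0 <= C by apply: addr_ge0; apply: Rintegral_ge0.
suff D01 (h : R -> R) : measurable_fun setT h -> (forall x, 0 <= h x <= 1) ->
    D h = 0.
  have M0 : 0 <= M by by rewrite (le_trans _ (fM 0)).
  pose K := M + 1.
  pose h x := (2 * K)^-1 * (f x + K).
  have mh : measurable_fun setT h.
    by apply: measurable_funM => //; exact: measurable_funD.
  have K0 : 0 < K by rewrite /K; lra.
  have hb x : 0 <= h x <= 1.
    have := fM x; rewrite ler_norml => /andP[f1 f2].
    rewrite /h; apply/andP; split.
      by rewrite mulr_ge0// ?invr_ge0 /K; lra.
    by rewrite mulrC ler_pdivrMr /K; lra.
  have hb1 x : `|h x| <= 1 by case/andP: (hb x) => h0 h1; rewrite ger0_norm.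
  have fE : f = fun x => 2 * K * h x + (- K) * 1.
    by apply/funext => x; rewrite /h; field; lra.
  suff : D f = 0 by rewrite /D => /eqP; rewrite subr_eq0 => /eqP.
  rewrite fE (DD (fun x => 2 * K * h x) (fun=> - K * 1) (2 * K) K).
  - rewrite (DZ h 1)// (D01 h)// mulr0 add0r (DZ (fun=> 1) 1)//; last first.
      by move=> ?; rewrite normr1.
    have -> : (fun=> 1) = \1_[set: R] :> (R -> R).
      by apply/funext => x; rewrite indicT.
    by rewrite D1// mulr0.
  - by apply: measurable_funM => //.
  - exact: measurable_cst.
  - move=> x; rewrite normrM ger0_norm; last lra.
    by rewrite ler_piMr//; lra.
  - by move=> _; rewrite mulr1 normrN ger0_norm// ltW.
move=> mh hb.
have hb1 x : `|h x| <= 1 by case/andP: (hb x) => h0 h1; rewrite ger0_norm.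
pose A n k := [set x | k.+1%:R <= n.+1%:R * h x].
have mA n k : measurable (A n k).
  have -> : A n k = (fun x => n.+1%:R * h x) @^-1` `[k.+1%:R, +oo[.
    by apply/seteqP; split => x /=; rewrite in_itv/= andbT.
  rewrite -[X in measurable X]setTI; apply: (measurable_funM _ _) => //.
pose s n m x := \sum_(k < m) (\1_(A n k) x : R).
have ms n m : measurable_fun setT (s n m).
  by apply: measurable_sum => k; exact: measurable_indic.
have sb n m x : `|s n m x| <= m%:R.
  rewrite (le_trans (ler_norm_sum _ _ _))//.
  rewrite (le_trans (ler_sum _ (fun i _ => indb _ _)))//.
  by rewrite sumr_const card_ord.
have Ds n m : D (s n m) = 0.
  elim: m => [|m IH].
    have -> : s n 0%N = \1_set0.
      by apply/funext => x; rewrite /s big_ord0 indic0.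
    exact: D1.
  have -> : s n m.+1 = fun x => s n m x + \1_(A n m) x.
    by apply/funext => x; rewrite /s big_ord_recr.
  rewrite (DD _ _ m%:R 1 (ms n m) _ (sb n m) (indb _)).
    by rewrite IH D1// addr0.
  exact: measurable_indic.
have approx n : `|D h| <= n.+1%:R^-1 * C.
  pose g x := n.+1%:R^-1 * s n n.+1 x.
  have mg : measurable_fun setT g by exact: measurable_funM.
  have n0 : 0 < n.+1%:R :> R by rewrite ltr0n.
  have hg x : `|h x + -1 * g x| <= n.+1%:R^-1.
    have := @layer_count_approx n.+1 (n.+1%:R * h x).
    case/andP: (hb x) => h0 h1.
    rewrite mulr_ge0//= ler_piMr// => /(_ isT).
    rewrite (_ : \sum_(k < _) _ = s n n.+1 x); last first.
      apply: eq_bigr => k _; rewrite indicE.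
      case: ifPn => [le|/negP nle]; first by rewrite mem_set.
      by rewrite memNset.
    move=> le1; rewrite -(ler_pM2l n0) divff ?gt_eqF//.
    rewrite -{1}(ger0_norm (ltW n0)) -normrM; apply: le_trans le1.
    by rewrite le_eqVlt; apply/orP; left; apply/eqP; congr `|_|; rewrite /g; field; lra.
  have := Dle (fun x => h x + -1 * g x) n.+1%:R^-1.
  rewrite (DD _ _ 1 1)//.
  - rewrite (DZ _ 1)//; last first.
      move=> x; rewrite /g normrM ger0_norm ?invr_ge0//.
      by rewrite ler_pdivrMl// mulr1.
    rewrite /g (DZ _ n.+1%:R)// Ds !mulr0 addr0; apply=> //.
    by apply: measurable_funD => //; apply: measurable_funM.
  - exact: measurable_funM.
  - move=> x; rewrite mulN1r normrN /g normrM ger0_norm ?invr_ge0//.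
    by rewrite ler_pdivrMl// mulr1.
apply/eqP; rewrite -normr_le0; apply/ler_addgt0Pr => e e0; rewrite add0r.
have [n nC] : exists n : nat, C / e < n.+1%:R.
  exists (Num.trunc (C / e)); exact: truncnS_gt.
apply: le_trans (approx n) _.
rewrite mulrC ler_pdivrMr ?ltr0n// mulrC -ler_pdivrMr//.
exact: ltW.
Qed.

End bounded_integrals.

Section independence.
Context {R : realType} d (T : measurableType d) (P : probability T R).

Lemma prod_norm_le1 (I : Type) (l : seq I) (f : I -> R) :
  (forall i, `|f i| <= 1) -> `|\prod_(i <- l) f i| <= 1.
Proof.
move=> f1; elim: l => [|i l IH]; first by rewrite big_nil normr1.
by rewrite big_cons normrM mulr_ile1.
Qed.

Lemma mutually_independent_prod (I : choiceType) (X : I -> {RV P >-> R})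
    (l : seq I) (f : I -> R -> R) : mutually_independent X -> uniq l ->
  (forall i, measurable_fun setT (f i)) -> (forall i x, `|f i x| <= 1) ->
  \int[P]_w (\prod_(i <- l) f i (X i w)) =
  \prod_(i <- l) \int[P]_w (f i (X i w)).
Proof.
move=> indX ul mf fb.
have indic_fun (A : set R) : measurable A -> measurable_fun setT (\1_A : R -> R).
  by move=> mA; exact: measurable_indic.
have indb (A : set R) x : `|(\1_A x : R)| <= 1.
  by rewrite indicE; case: (_ \in _); rewrite ?normr1 ?normr0.
(* The functions indexed by l1 are still indicators. *)
suff H (l2 l1 : seq I) (A : I -> set R) : uniq (l1 ++ l2) ->
    (forall i, measurable (A i)) ->
    \int[P]_w (\prod_(i <- l1) \1_(A i) (X i w) * \prod_(i <- l2) f i (X i w)) =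
    \prod_(i <- l1) \int[P]_w (\1_(A i) (X i w)) *
    \prod_(i <- l2) \int[P]_w (f i (X i w)).
  have := H l [::] (fun=> setT) ul (fun=> measurableT).
  rewrite big_nil mul1r => <-; apply: eq_Rintegral => w _.
  by rewrite big_nil mul1r.
elim: l2 l1 A => [|i l2 IH] l1 A.
  rewrite cats0 => ul1 mA; rewrite big_nil mulr1.
  have E w : \prod_(i <- l1) (\1_(A i) (X i w) : R) * \prod_(i <- [::]) f i (X i w)
      = \1_(\bigcap_(i in [set` [fset i | i in l1]%fset]) (X i @^-1` A i)) w.
    rewrite big_nil mulr1 indicE.
    set S := \bigcap_(i in _) _.
    have [|nb] := boolP (w \in S); last first.
      have [i il1 nXi] : exists2 i, i \in l1 & ~ A i (X i w).
        apply: contrapT => /forall2NP h.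
        move/negP: nb; apply; apply/mem_set => i /=; rewrite !inE/= => il1.
        by case: (h i) => // /contrapT.
      by rewrite (big_rem i)//= indicE memNset// mul0r.
    rewrite inE => inb; rewrite big_seq big1//= => i il1.
    rewrite indicE mem_set//; apply: inb => /=.
    by rewrite !inE.
  have mI i : measurable (X i @^-1` A i).
    by rewrite -[X in measurable X]setTI; exact: measurable_funP.
  have mcap : measurable (\bigcap_(i in [set` [fset i | i in l1]%fset]) (X i @^-1` A i)).
    by apply: fin_bigcap_measurable => // ? _; exact: mI.
  rewrite /Rintegral; rewrite (eq_integral (EFin \o \1_(\bigcap_(i in [set` [fset i | i in l1]%fset]) (X i @^-1` A i)))); last by move=> w _; rewrite E.
  rewrite integral_indic// setIT. transitivity
      (fine (\prod_(i <- [fset i | i in l1]%fset) P (X i @^-1` A i))%E).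
    by congr fine; exact: indX.
  rewrite (perm_big l1)/=; last first.
    by apply: uniq_perm => [||j]; [exact: fset_uniq|exact: ul1|rewrite !inE].
  elim: (l1) => [|j l' IHl]; first by rewrite !big_nil.
  rewrite !big_cons fineM ?fin_num_measure//; last first.
    apply: (@big_ind _ (fun x => x \is a fin_num)) => //.
      by move=> x y; exact: fin_numM.
    by move=> k _; rewrite fin_num_measure.
  rewrite IHl; congr (_ * _).
  by rewrite -[in LHS](setIT (X j @^-1` A j)) -integral_indic.
rewrite cat_uniq /= => /and3P[ul1 nl1 /andP[il2 ul2]] mA.
pose G w := \prod_(i <- l1) \1_(A i) (X i w) * \prod_(i <- l2) f i (X i w).
pose k := \prod_(i <- l1) \int[P]_w (\1_(A i) (X i w) : R) *
          \prod_(i <- l2) \int[P]_w (f i (X i w)).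
have mG : measurable_fun setT G.
  apply: measurable_funM; apply: measurable_prod => j _; apply: measurableT_comp => //.
have Gb w : `|G w| <= 1.
  by rewrite normrM mulr_ile1//; apply: prod_norm_le1.
have iG := integrable_bounded P mG Gb.
under eq_Rintegral do rewrite big_cons mulrCA.
rewrite big_cons mulrCA -/k.
transitivity (\int[P]_w (f i (X i w) * k)); last first.
  rewrite RintegralZr//.
  by apply: (@integrable_bounded _ _ _ P _ 1) => //; exact: measurableT_comp.
apply: (@Rintegral_eq_of_indic _ _ _ P _ _ P (X i) (X i) G (cst k) (f i) 1) => //.
  exact: finite_measure_integrable_cst.
move=> B mB; rewrite RintegralZr//; last first.
  apply: (@integrable_bounded _ _ _ P _ 1) => //; apply: measurableT_comp => //.
pose A' j := if j == i then B else A j.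
have A'l1 j : j \in l1 -> A' j = A j.
  rewrite /A'; have [->|//] := eqVneq j i; move: nl1 => /=.
  by rewrite negb_or => /andP[/negbTE ->].
have := IH (i :: l1) A'; rewrite /= cat_uniq ul1 ul2 andbT.
rewrite mem_cat negb_or il2 andbT.
move: nl1 => /=; rewrite negb_or => /andP[-> ->] /(_ isT).
have mA' j : measurable (A' j) by rewrite /A'; case: ifP.
move=> /(_ mA'); rewrite big_cons {2}/A' eqxx -mulrA.
rewrite [in RHS]big_seq_cond.
under [X in _ = _ * (X * _)]eq_bigr => j /andP[jl _] do rewrite A'l1//.
rewrite -big_seq_cond => <-; apply: eq_Rintegral => w _.
rewrite big_cons /A' eqxx -mulrA; congr (_ * (_ * _)).
by apply: eq_big_seq => j jl; have := A'l1 j jl; rewrite /A' => ->.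
Qed.

End independence.

(** * Products of independent cosines *)

Section characteristic_functions.
Context {R : realType} d (T : measurableType d) (P : probability T R).

Lemma measurable_cos_comp (f : T -> R) :
  measurable_fun setT f -> measurable_fun setT (fun w => cos (f w)).
Proof.
apply: measurableT_comp; apply: continuous_measurable_fun; exact: continuous_cos.
Qed.

Lemma measurable_sin_comp (f : T -> R) :
  measurable_fun setT f -> measurable_fun setT (fun w => sin (f w)).
Proof.
apply: measurableT_comp; apply: continuous_measurable_fun; exact: continuous_sin.
Qed.

Lemma measurable_lincomb (I : Type) (X : I -> {RV P >-> R}) (l : seq I)
    (c : I -> R) : measurable_fun setT (fun w => \sum_(i <- l) c i * X i w).
Proof. by apply: measurable_sum => i; apply: measurable_funM. Qed.

(** For independent summands the function [cos (alpha + S)] is a sum of products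
    of functions of single variables, so that replacing one characteristic
    function by that of a centered Gaussian costs at most its own error. *)
Lemma cos_sum_independent (I : choiceType) (X : I -> {RV P >-> R}) (l : seq I)
    (c v r : I -> R) (alpha : R) : mutually_independent X -> uniq l ->
  (forall i, 0 <= v i) ->
  (forall i, i \in l -> `|\int[P]_w cos (c i * X i w) - expR (- (v i / 2))| +
             `|\int[P]_w sin (c i * X i w)| <= r i) ->
  `|\int[P]_w cos (alpha + \sum_(i <- l) c i * X i w)
    - expR (- ((\sum_(i <- l) v i) / 2)) * cos alpha| <= \sum_(i <- l) r i.
Proof.
move=> indX ul v0 vr.
pose ec i := \int[P]_w cos (c i * X i w).
pose es i := \int[P]_w sin (c i * X i w).
pose fix C (l : seq I) (alpha : R) {struct l} : R := if l is i :: l' then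
  ec i * C l' alpha - es i * C l' (alpha - pi / 2) else cos alpha.
have mcos i : measurable_fun setT (fun x : R => cos (c i * x)).
  apply: continuous_measurable_fun => x; apply: continuous_comp.
    by apply: (@continuousM _ R^o (cst (c i)) id) => //; exact: cst_continuous.
  exact: continuous_cos.
have msin i : measurable_fun setT (fun x : R => sin (c i * x)).
  apply: continuous_measurable_fun => x; apply: continuous_comp.
    by apply: (@continuousM _ R^o (cst (c i)) id) => //; exact: cst_continuous.
  exact: continuous_sin.
have key l2 : forall l1 (f : I -> R -> R) beta, uniq (l1 ++ l2) ->
    (forall i, measurable_fun setT (f i)) -> (forall i x, `|f i x| <= 1) ->
    \int[P]_w (\prod_(i <- l1) f i (X i w) *
               cos (beta + \sum_(i <- l2) c i * X i w)) =
    \prod_(i <- l1) \int[P]_w f i (X i w) * C l2 beta.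
  elim: l2 => [|i l2 IH] l1 f beta ul1 mf fb.
    under eq_Rintegral do rewrite big_nil addr0.
    rewrite RintegralZr//=; last first.
      apply: (@integrable_bounded _ _ _ P _ 1).
        by apply: measurable_prod => j _; exact: measurableT_comp.
      by move=> w; exact: prod_norm_le1.
    rewrite mutually_independent_prod//.
    by rewrite cats0 in ul1.
  move: ul1; rewrite cat_uniq /= => /and3P[ul1 nl1 /andP[il2 ul2]].
  have il1 : i \notin l1 by apply: contra nl1 => ->.
  have nl12 : ~~ has (mem l1) l2 by apply: contra nl1 => ->; rewrite orbT.
  pose upd (g : R -> R) j := if j == i then g else f j.
  have updl1 g w : \prod_(j <- l1) upd g j (X j w) = \prod_(j <- l1) f j (X j w).
    apply: eq_big_seq => j jl1; rewrite /upd; case: eqP => // ji.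
    by rewrite -ji jl1 in il1.
  have Eupdl1 g : \prod_(j <- l1) \int[P]_w upd g j (X j w) =
                  \prod_(j <- l1) \int[P]_w f j (X j w).
    apply: eq_big_seq => j jl1; rewrite /upd; case: eqP => // ji.
    by rewrite -ji jl1 in il1.
  have step (g : R -> R) (beta' : R) : measurable_fun setT g -> (forall x, `|g x| <= 1) ->
      \int[P]_w (\prod_(j <- l1) f j (X j w) * g (X i w) *
                 cos (beta' + \sum_(j <- l2) c j * X j w)) =
      \prod_(j <- l1) \int[P]_w f j (X j w) * \int[P]_w g (X i w) * C l2 beta'.
    move=> mg gb; have := IH (i :: l1) (upd g) beta'.
    rewrite /= mem_cat negb_or il1 il2 cat_uniq ul1 nl12 ul2 => /(_ isT).
    have mupd j : measurable_fun setT (upd g j) by rewrite /upd; case: ifP.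
    have updb j x : `|upd g j x| <= 1 by rewrite /upd; case: ifP.
    move=> /(_ mupd updb); rewrite big_cons {2}/upd eqxx Eupdl1.
    rewrite [\int[P]_w g (X i w) * _]mulrC => <-; apply: eq_Rintegral => w _.
    by rewrite big_cons {1}/upd eqxx updl1 [g _ * _]mulrC.
  transitivity (\int[P]_w (
      \prod_(j <- l1) f j (X j w) * cos (c i * X i w) *
        cos (beta + \sum_(j <- l2) c j * X j w) -
      \prod_(j <- l1) f j (X j w) * sin (c i * X i w) *
        cos (beta - pi / 2 + \sum_(j <- l2) c j * X j w))).
    apply: eq_Rintegral => w _; rewrite big_cons.
    set s := \sum_(j <- l2) _; set pr := \prod_(j <- l1) _.
    rewrite (_ : beta - pi / 2 + s = (beta + s) - pi / 2); last by ring.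
    by rewrite cosBpihalf addrCA (cosD (c i * X i w)); ring.
  have mS b : measurable_fun setT (fun w => cos (b + \sum_(j <- l2) c j * X j w)).
    apply: measurable_cos_comp; apply: measurable_funD => //.
    exact: measurable_lincomb.
  have intg (g : R -> R) b : measurable_fun setT g -> (forall x, `|g x| <= 1) ->
      P.-integrable setT (EFin \o (fun w => \prod_(j <- l1) f j (X j w) *
        g (X i w) * cos (b + \sum_(j <- l2) c j * X j w))).
    move=> mg gb; apply: (@integrable_bounded _ _ _ P _ 1).
      apply: measurable_funM => //; apply: measurable_funM.
        by apply: measurable_prod => j _; exact: measurableT_comp.
      exact: measurableT_comp.
    move=> w; rewrite !normrM mulr_ile1 ?mulr_ile1 ?cos_max ?mulr_ge0//.
    exact: prod_norm_le1.
  rewrite RintegralB//; last 2 first.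
  - by apply: (intg (fun x => cos (c i * x))) => // x; exact: cos_max.
  - by apply: (intg (fun x => sin (c i * x))) => // x; exact: sin_max.
  rewrite (step (fun x => cos (c i * x)))//; last by move=> x; exact: cos_max.
  rewrite (step (fun x => sin (c i * x)))//; last by move=> x; exact: sin_max.
  by rewrite /= /ec /es; ring.
have E l2 beta : uniq l2 ->
    \int[P]_w cos (beta + \sum_(i <- l2) c i * X i w) = C l2 beta.
  move=> ul2; have n1 (i : I) (x : R) : `|(fun _ _ => 1) i x : R| <= 1.
    by rewrite normr1.
  have m1 (i : I) : measurable_fun setT ((fun _ _ => 1) i : R -> R).
    exact: measurable_cst.
  rewrite -[RHS]mul1r; have := key l2 [::] (fun _ _ => 1) beta ul2 m1 n1.
  rewrite [X in _ = X * _ -> _]big_nil => <-.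
  by apply: eq_Rintegral => w _; rewrite big_nil mul1r.
have Cb l2 beta : uniq l2 -> `|C l2 beta| <= 1.
  move=> ul2; rewrite -E//.
  have mS : measurable_fun setT
      (fun w => cos (beta + \sum_(j <- l2) c j * X j w)).
    apply: measurable_cos_comp; apply: measurable_funD => //.
    exact: measurable_lincomb.
  have iS := integrable_bounded P mS (fun w => cos_max _).
  rewrite (le_trans (le_normr_Rintegral _ _))//.
  have -> : 1 = \int[P]_w (cst 1 w) :> R.
    by rewrite Rintegral_probability_cst.
  apply: le_Rintegral => //; first exact: (integrable_norm iS).
    exact: finite_measure_integrable_cst.
  by move=> w _; exact: cos_max.
rewrite E//.
have {}vr : forall i, i \in l -> `|ec i - expR (- (v i / 2))| + `|es i| <= r i.
  exact: vr.
elim: l ul alpha vr => [|i l IH] /= ul alpha vr.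
  by rewrite !big_nil mul0r oppr0 expR0 mul1r subrr normr0.
move: ul => /andP[il ul]; rewrite !big_cons.
set V := \sum_(j <- l) v j.
have {}IH beta : `|C l beta - expR (- (V / 2)) * cos beta| <= \sum_(j <- l) r j.
  by apply: IH => // j jl; apply: vr; rewrite inE jl orbT.
set e := expR (- (v i / 2)).
have -> : expR (- ((v i + V) / 2)) = e * expR (- (V / 2)).
  by rewrite -expRD; congr expR; lra.
have e1 : 0 <= e <= 1.
  rewrite expR_ge0/= -expR0 ler_expR oppr_le0 divr_ge0//.
rewrite (_ : _ - _ = (ec i - e) * C l alpha - es i * C l (alpha - pi / 2) +
    e * (C l alpha - expR (- (V / 2)) * cos alpha)); last by ring.
rewrite (le_trans (ler_normD _ _))//; apply: lerD; last first.
  rewrite normrM (ger0_norm (proj1 (andP e1))) (le_trans _ (IH alpha))//.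
  by rewrite ler_piMl//; case/andP: e1.
rewrite (le_trans (ler_normB _ _))// (le_trans _ (vr i _)) ?inE ?eqxx//.
by rewrite !normrM lerD// ler_piMr// Cb.
Qed.

End characteristic_functions.

(** * Dominated convergence and Taylor estimates *)

Section dominated_convergence_real.
Context {R : realType} d (T : measurableType d) (mu : {measure set T -> \bar R}).

Lemma Rintegral_ae_dominated_cvg (D : set T) (f_ : nat -> T -> R) (f g : T -> R) :
  measurable D -> (forall n, measurable_fun D (f_ n)) -> measurable_fun D f ->
  {ae mu, forall x, D x -> f_ ^~ x @ \oo --> f x} ->
  mu.-integrable D (EFin \o g) ->
  {ae mu, forall x, D x -> forall n, `|f_ n x| <= g x} ->
  mu.-integrable D (EFin \o f) /\
  \int[mu]_(x in D) f_ n x @[n --> \oo] --> \int[mu]_(x in D) f x.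
Proof.
move=> mD mf_ mf ff ig fg.
have [] := @dominated_convergence d T R mu D mD (fun n => EFin \o f_ n)
  (EFin \o f) (EFin \o g).
- by move=> n; exact/measurable_EFinP.
- exact/measurable_EFinP.
- apply: filterS ff => x ff Dx; apply/fine_cvgP; split.
    by apply: nearW.
  exact: ff.
- exact: ig.
- by apply: filterS fg => x h n Dx /=; rewrite lee_fin h.
move=> intf _ cv; split => //.
by move: cv; rewrite -[X in _ --> X]fineK ?integrable_fin_num// => /fine_cvgP[].
Qed.

Lemma Rintegral_dominated_cvg (D : set T) (f_ : nat -> T -> R) (f g : T -> R) :
  measurable D -> (forall n, measurable_fun D (f_ n)) -> measurable_fun D f ->
  {ae mu, forall x, D x -> f_ ^~ x @ \oo --> f x} ->
  mu.-integrable D (EFin \o g) -> (forall n x, D x -> `|f_ n x| <= g x) ->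
  mu.-integrable D (EFin \o f) /\
  \int[mu]_(x in D) f_ n x @[n --> \oo] --> \int[mu]_(x in D) f x.
Proof.
move=> mD mf_ mf ff ig fg; apply: (Rintegral_ae_dominated_cvg mD mf_ mf ff ig).
by apply: aeW => x Dx n; exact: fg.
Qed.

End dominated_convergence_real.

Section taylor_bounds.
Context {R : realType}.
Implicit Types x y : R.

Lemma sin_abs_le x : `|sin x| <= `|x|.
Proof.
wlog x0 : x / 0 <= x.
  move=> H; have [/H//|/ltW x0] := leP 0 x.
  by rewrite -normrN -sinN -[leRHS]normrN; apply: H; rewrite oppr_ge0.
have [|c _] := @MVT_segment R sin cos 0 x x0.
  by apply: continuous_subspaceT => y; exact: continuous_sin.
by rewrite sin0 !subr0 => ->; rewrite normrM ler_piMl// cos_max.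
Qed.

Lemma one_sub_cosE x : 1 - cos x = 2 * sin (x / 2) ^+ 2.
Proof.
have -> : cos x = cos (x / 2 + x / 2) by congr cos; lra.
by rewrite cosD -!expr2 cos2sin2; ring.
Qed.

Lemma one_sub_cos_le x : 0 <= 1 - cos x <= x ^+ 2 / 2.
Proof.
rewrite one_sub_cosE mulr_ge0 ?sqr_ge0//=.
have : sin (x / 2) ^+ 2 <= (x / 2) ^+ 2.
  by rewrite -[leLHS]real_normK ?num_real// -[leRHS]real_normK ?num_real//
    ler_sqr ?nnegrE// sin_abs_le.
by rewrite exprMn exprVn; lra.
Qed.

Lemma sub_sin_cube x : `|x - sin x| <= `|x| ^+ 3.
Proof.
wlog x0 : x / 0 <= x.
  move=> H; have [/H//|/ltW x0] := leP 0 x.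
  rewrite -normrN -[X in _ <= X ^+ _]normrN (_ : - (x - sin x) = - x - sin (- x)).
    by apply: H; rewrite oppr_ge0.
  by rewrite sinN opprD.
have [|c] :=
    @MVT_segment R (fun y => y - sin y) (fun y => 1 - cos y) 0 x x0.
  apply: continuous_subspaceT => y; apply: (@continuousB _ R^o) => //.
  exact: continuous_sin.
rewrite in_itv/= => /andP[c0 cx].
rewrite sin0 !subr0 => ->; rewrite normrM exprSr ler_wpM2r//.
have /andP[c1 c2] := one_sub_cos_le c.
rewrite ger0_norm// (le_trans c2)// (ger0_norm x0).
have : c ^+ 2 <= x ^+ 2 by rewrite ler_sqr.
by have := sqr_ge0 c; lra.
Qed.

Lemma sub_sin_sqr x : `|x - sin x| <= 2 * x ^+ 2.
Proof.
rewrite -[x ^+ 2]real_normK ?num_real//.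
have [x1|x1] := leP `|x| 1.
  rewrite (le_trans (sub_sin_cube x))// exprS.
  have : `|x| * `|x| ^+ 2 <= 1 * `|x| ^+ 2 by rewrite ler_wpM2r// sqr_ge0.
  by have := sqr_ge0 `|x|; lra.
rewrite (le_trans (ler_normB _ _))//.
have := sin_max x; have : 1 * `|x| <= `|x| * `|x| by rewrite ler_wpM2r// ltW.
by rewrite expr2; lra.
Qed.

Lemma cos_taylor2_cube x : `|cos x - 1 + x ^+ 2 / 2| <= `|x| ^+ 3.
Proof.
rewrite (_ : _ + _ = 2 * ((x / 2 - sin (x / 2)) * (x / 2 + sin (x / 2)))).
  rewrite !normrM.
  have h1 := sub_sin_sqr (x / 2).
  have h2 : `|x / 2 + sin (x / 2)| <= `|x|.
    rewrite (le_trans (ler_normD _ _))//; have := sin_abs_le (x / 2).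
    have -> : `|x / 2| = `|x| / 2 by rewrite normrM (@ger0_norm _ 2^-1).
    by lra.
  have -> : `|2 : R| = 2 by rewrite ger0_norm.
  have : `|x / 2 - sin (x / 2)| * `|x / 2 + sin (x / 2)| <=
         (2 * (x / 2) ^+ 2) * `|x| by rewrite ler_pM.
  rewrite exprMn exprVn -[x ^+ 2]real_normK ?num_real// !exprS expr0 !mulr1.
  by lra.
by have := one_sub_cosE x; lra.
Qed.

Lemma cos_taylor2_sqr x : `|cos x - 1 + x ^+ 2 / 2| <= x ^+ 2.
Proof.
have /andP[h1 h2] := one_sub_cos_le x; rewrite ler_norml.
by have := sqr_ge0 x; lra.
Qed.

Lemma expRN_taylor1 x : 0 <= x -> `|expR (- x) - 1 + x| <= x ^+ 2.
Proof.
move=> x0; have h1 := expR_ge1Dx (- x).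
rewrite ger0_norm; last by lra.
have h2 := expR_ge1Dx x.
have : expR (- x) * (1 + x) <= 1.
  by have := ler_wpM2r (expR_ge0 (- x)) h2; rewrite expRxMexpNx_1 mulrC.
have := expR_ge0 (- x); move: (expR (- x)) h1 => e h1 e0.
have : e * (1 + x) * (1 - x + x ^+ 2) = e * (1 + x ^+ 3) by ring.
have x3 : 0 <= x ^+ 3 by rewrite exprn_ge0.
have : e * 1 <= e * (1 + x ^+ 3) by rewrite ler_wpM2l//; lra.
move=> h3 h4 h5; have x2 := sqr_ge0 (x - 1 / 2).
have h6 : 0 <= 1 - x + x ^+ 2 by move: x2; rewrite sqrrB; lra.
have : e * (1 + x) * (1 - x + x ^+ 2) <= 1 * (1 - x + x ^+ 2) by rewrite ler_wpM2r.
lra.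
Qed.

End taylor_bounds.

Section small_coefficient.
Context {R : realType} d (T : measurableType d) (P : probability T R).

Lemma measurable_indic_comp (X : T -> R) (A : set R) : measurable A ->
  measurable_fun setT X -> measurable_fun setT (fun w => \1_A (X w) : R).
Proof.
move=> mA mX; have mI : measurable_fun setT (\1_A : R -> R).
  exact: measurable_indic.
exact: (measurableT_comp mI mX).
Qed.

Lemma Rintegral_tail_sqr (X : {RV P >-> R}) (eta : R) :
  P.-integrable setT (EFin \o (fun w => X w ^+ 2)) -> 0 < eta ->
  exists K : nat,
    \int[P]_w (X w ^+ 2 * \1_[set x : R | K%:R < `|x|] (X w)) <= eta.
Proof.
move=> iX eta0.
have mA (n : nat) : measurable [set x : R | n%:R < `|x|].
  have -> : [set x : R | n%:R < `|x|] = (fun x : R => `|x|) @^-1` `]n%:R, +oo[.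
    by apply/seteqP; split => x /=; rewrite in_itv/= andbT.
  by rewrite -[X in measurable X]setTI; exact: normr_measurable.
have mX2 : measurable_fun setT (fun w => X w ^+ 2) by apply: measurable_funX.
have mf (n : nat) : measurable_fun setT
    (fun w => X w ^+ 2 * \1_[set x : R | n%:R < `|x|] (X w)).
  by apply: measurable_funM => //; exact: measurable_indic_comp.
have [] := @Rintegral_dominated_cvg _ _ _ P setT
  (fun (n : nat) w => X w ^+ 2 * \1_[set x : R | n%:R < `|x|] (X w))
  (cst 0) _ measurableT mf (measurable_cst _) _ iX.
- apply: aeW => w _; apply/cvgrPdist_le => e e0.
  exists (Num.trunc `|X w|).+1 => // n /= nX.
  rewrite indicE memNset/= ?mulr0 ?subrr ?normr0 ?ltW//.
  apply/negP; rewrite -leNgt; apply: (le_trans (ltW (truncnS_gt _))).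
  by rewrite ler_nat.
- move=> n w _; rewrite normrM ger0_norm ?sqr_ge0// ler_piMr ?sqr_ge0//.
  by rewrite indicE; case: (_ \in _); rewrite ?normr1 ?normr0.
rewrite Rintegral_probability_cst => _ /cvgrPdist_le/(_ _ eta0)[N _ /(_ N (leqnn _))].
rewrite sub0r normrN => h; exists N; apply: le_trans h; exact: ler_norm.
Qed.

Lemma characteristic_small (X : {RV P >-> R}) (eta : R) :
  P.-integrable setT (EFin \o X) ->
  P.-integrable setT (EFin \o (fun w => X w ^+ 2)) ->
  \int[P]_w X w = 0 -> \int[P]_w (X w ^+ 2) = 1 -> 0 < eta ->
  exists2 delta : R, 0 < delta & forall c, `|c| <= delta ->
    `|\int[P]_w cos (c * X w) - expR (- (c ^+ 2 / 2))| +
    `|\int[P]_w sin (c * X w)| <= eta * c ^+ 2.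
Proof.
move=> iX iX2 EX EX2 eta0.
have [K hK] := Rintegral_tail_sqr iX2 (divr_gt0 eta0 (ltr0Sn R 7)).
set tail := \int[P]_w _ in hK.
have tail0 : 0 <= tail.
  apply: Rintegral_ge0 => w _; rewrite mulr_ge0 ?sqr_ge0// indicE ler0n//.
pose A := [set x : R | K%:R < `|x|].
have mA : measurable A.
  have -> : A = (fun x : R => `|x|) @^-1` `]K%:R, +oo[.
    by apply/seteqP; split => x /=; rewrite in_itv/= andbT.
  by rewrite -[X in measurable X]setTI; exact: normr_measurable.
have mX2 : measurable_fun setT (fun w => X w ^+ 2) by apply: measurable_funX.
have mXA : measurable_fun setT (fun w => (\1_A (X w) : R)).
  exact: measurable_indic_comp.
have iXA : P.-integrable setT (EFin \o (fun w => X w ^+ 2 * \1_A (X w))).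
  have -> : (fun w => X w ^+ 2 * \1_A (X w)) = (fun w => \1_A (X w) * X w ^+ 2).
    by apply/funext => w; rewrite mulrC.
  apply: (@integrable_bounded_mul _ _ _ _ _ _ 1) => // w.
  by rewrite indicE; case: (_ \in _); rewrite ?normr1 ?normr0.
(* On the event |X| <= K the cubic Taylor bound is used, elsewhere the
   quadratic one. *)
pose D (c : R) w := 2 * c ^+ 2 * (X w ^+ 2 * \1_A (X w)) +
                    K%:R * `|c| ^+ 3 * X w ^+ 2.
have iD1 (c : R) : P.-integrable setT
    (EFin \o (fun w => 2 * c ^+ 2 * (X w ^+ 2 * \1_A (X w)))).
  exact: (integrable_EFinZ measurableT _ iXA).
have iD2 (c : R) : P.-integrable setT (EFin \o (fun w => K%:R * `|c| ^+ 3 * X w ^+ 2)).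
  exact: (integrable_EFinZ measurableT _ iX2).
have iD (c : R) : P.-integrable setT (EFin \o D c).
  by have := integrable_EFinD measurableT (iD1 c) (iD2 c).
have ED (c : R) : \int[P]_w D c w = 2 * c ^+ 2 * tail + K%:R * `|c| ^+ 3.
  by rewrite /D RintegralD// !RintegralZl// EX2 mulr1.
have DP (c : R) (h : R -> R) : (forall x, `|h x| <= `|x| ^+ 3) ->
    (forall x, `|h x| <= 2 * x ^+ 2) -> forall w, `|h (c * X w)| <= D c w.
  move=> h3 h2 w; rewrite /D indicE.
  have D20 : 0 <= K%:R * `|c| ^+ 3 * X w ^+ 2.
    by apply: mulr_ge0; rewrite ?sqr_ge0// mulr_ge0 ?exprn_ge0.
  have [wA|wA] := boolP (X w \in A).
    by have := h2 (c * X w); rewrite mulr1 exprMn; lra.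
  rewrite mulr0 mulr0 add0r (le_trans (h3 _))// normrM exprMn.
  have -> : K%:R * `|c| ^+ 3 * X w ^+ 2 = `|c| ^+ 3 * (K%:R * X w ^+ 2) by ring.
  apply: ler_wpM2l; first by rewrite exprn_ge0.
  rewrite exprS real_normK ?num_real// ler_wpM2r ?sqr_ge0//.
  by move: wA; rewrite notin_setE /A/= => /negP; rewrite -leNgt.
have ic (c : R) : P.-integrable setT (EFin \o (fun w => cos (c * X w))).
  apply: (@integrable_bounded _ _ _ P _ 1) => [|w]; last exact: cos_max.
  by apply: measurable_cos_comp; apply: measurable_funM.
have is_ (c : R) : P.-integrable setT (EFin \o (fun w => sin (c * X w))).
  apply: (@integrable_bounded _ _ _ P _ 1) => [|w]; last exact: sin_max.
  by apply: measurable_sin_comp; apply: measurable_funM.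
have icX (c : R) : P.-integrable setT (EFin \o (fun w => c * X w)).
  exact: (integrable_EFinZ measurableT _ iX).
have iX2c (c : R) : P.-integrable setT (EFin \o (fun w => c ^+ 2 / 2 * X w ^+ 2)).
  exact: (integrable_EFinZ measurableT _ iX2).
have i1 : P.-integrable setT (EFin \o (cst 1 : T -> R)).
  exact: finite_measure_integrable_cst.
have Hs (c : R) : `|\int[P]_w sin (c * X w)| <= \int[P]_w D c w.
  have -> : \int[P]_w sin (c * X w) = - \int[P]_w (c * X w - sin (c * X w)).
    by rewrite RintegralB// RintegralZl// EX; ring.
  rewrite normrN (le_trans (le_normr_Rintegral _ _))//.
    exact: (integrable_EFinB measurableT (icX c) (is_ c)).
  apply: le_Rintegral => //.
    by apply: integrable_norm; exact: (integrable_EFinB measurableT (icX c) (is_ c)).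
  move=> w _; apply: (DP c (fun x => x - sin x)) => x; first exact: sub_sin_cube.
  exact: sub_sin_sqr.
have Hc (c : R) : `|\int[P]_w cos (c * X w) - 1 + c ^+ 2 / 2| <= \int[P]_w D c w.
  have iB : P.-integrable setT (EFin \o (fun w => cos (c * X w) - 1)).
    exact: (integrable_EFinB measurableT (ic c) i1).
  have iBD : P.-integrable setT
      (EFin \o (fun w => cos (c * X w) - 1 + c ^+ 2 / 2 * X w ^+ 2)).
    exact: (integrable_EFinD measurableT iB (iX2c c)).
  have -> : \int[P]_w cos (c * X w) - 1 + c ^+ 2 / 2 =
      \int[P]_w (cos (c * X w) - 1 + c ^+ 2 / 2 * X w ^+ 2).
    rewrite RintegralD// RintegralB// RintegralZl// EX2 mulr1.
    by rewrite Rintegral_probability_cst.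
  rewrite (le_trans (le_normr_Rintegral _ _))//.
  apply: le_Rintegral => //; first exact: integrable_norm.
  move=> w _; have := DP c (fun x => cos x - 1 + x ^+ 2 / 2) _ _ w.
  rewrite exprMn mulrAC; apply => x; first exact: cos_taylor2_cube.
  rewrite (le_trans (cos_taylor2_sqr _))//; have := sqr_ge0 x; lra.
pose delta := Num.min 1 (eta / (8 * (K.+1)%:R)).
exists delta; first by rewrite lt_min ltr01 divr_gt0// mulr_gt0.
move=> c; rewrite le_min => /andP[c1 cK].
have := Hs c; have := Hc c; rewrite ED.
have cK' : K.+1%:R * `|c| <= eta / 8.
  move: cK; rewrite invfM mulrA ler_pdivlMr ?ltr0n//.
  by rewrite [_ * K.+1%:R]mulrC.
have hc3 : K%:R * `|c| ^+ 3 <= eta / 8 * c ^+ 2.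
  rewrite exprS real_normK ?num_real// mulrA ler_wpM2r ?sqr_ge0//.
  by move: cK'; rewrite -natr1; have := normr_ge0 c; lra.
have hc4 : `|expR (- (c ^+ 2 / 2)) - 1 + c ^+ 2 / 2| <= eta / 8 * c ^+ 2.
  rewrite (le_trans (expRN_taylor1 _))// ?divr_ge0 ?sqr_ge0//.
  rewrite (_ : (c ^+ 2 / 2) ^+ 2 = c ^+ 2 / 4 * c ^+ 2); last by field.
  rewrite ler_wpM2r ?sqr_ge0// -[c ^+ 2]real_normK ?num_real//.
  have c8 : `|c| <= eta / 8.
    apply: le_trans cK'; rewrite ler_peMl// -natr1.
    by have := ler0n R K; lra.
  have : `|c| * `|c| <= 1 * (eta / 8) by rewrite ler_pM.
  by rewrite expr2; lra.
have ht : 2 * c ^+ 2 * tail <= eta / 4 * c ^+ 2.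
  by have : c ^+ 2 * tail <= c ^+ 2 * (eta / 8) by [rewrite ler_wpM2l ?sqr_ge0]; lra.
move: hc4 => hc4 hc hs.
have : `|\int[P]_w cos (c * X w) - expR (- (c ^+ 2 / 2))| <=
   `|\int[P]_w cos (c * X w) - 1 + c ^+ 2 / 2| +
   `|expR (- (c ^+ 2 / 2)) - 1 + c ^+ 2 / 2|.
  by rewrite (le_trans _ (ler_normB _ _))// le_eqVlt; apply/orP; left;
    apply/eqP; congr `|_|; ring.
have : 0 <= eta * c ^+ 2 by rewrite mulr_ge0 ?sqr_ge0 ?ltW.
lra.
Qed.

End small_coefficient.

(** * Characteristic function of the normal law *)

Section normal_characteristic.
Context {R : realType}.
Notation mu := (@lebesgue_measure R).
Variables (s : R) (s0 : s != 0).
Let N (x : R) := normal_fun 0 s x.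

Let s2_gt0 : 0 < s ^+ 2. Proof. by rewrite exprn_even_gt0. Qed.

Let NE x : N x = expR (- (x ^+ 2 / (2 * s ^+ 2))).
Proof. by rewrite /N /normal_fun subr0 mulNr mulr_natl. Qed.

Let is_derive_N (x : R) : is_derive x 1 N (- (x / s ^+ 2) * N x).
Proof.
have -> : N = expR \o (fun y => (- (2 * s ^+ 2)^-1) *: (y ^+ 2)).
  apply/funext => y; rewrite NE /=; congr expR.
  by rewrite /GRing.scale/= mulNr mulrC.
apply: is_derive_eq; rewrite /GRing.scale/=.
by set e := expR _; field.
Qed.

Let N_ge0 x : 0 <= N x. Proof. exact: normal_fun_ge0. Qed.

Let mN : measurable_fun setT N. Proof. exact: measurable_normal_fun. Qed.

Let integrable_normal_fun (r : R) : r != 0 ->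
  mu.-integrable setT (EFin \o normal_fun 0 r).
Proof.
move=> r0; have := @integrable_normal_pdf R 0 r.
rewrite normal_pdfE// => h.
have := integrable_EFinZ measurableT (normal_peak r)^-1 h.
apply: eq_integrable => // x _ /=; congr EFin.
by rewrite mulrA mulVf ?mul1r// gt_eqF// normal_peak_gt0.
Qed.

(* Half of the Gaussian exponent absorbs the linear factor. *)
Let absN_le x : `|x| * N x <= `|s| * normal_fun 0 (Num.sqrt 2 * s) x.
Proof.
rewrite NE /normal_fun subr0 exprMn sqr_sqrtr// -[_ * s ^+ 2 *+ 2]mulr_natl mulNr.
set y := x ^+ 2 / (4 * s ^+ 2).
have -> : x ^+ 2 / (2 * s ^+ 2) = y + y.
  by rewrite /y; field.
have -> : x ^+ 2 / (2 * (2 * s ^+ 2)) = y.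
  by rewrite /y; field.
rewrite opprD expRD mulrA ler_wpM2r ?expR_ge0//.
rewrite expRN ler_pdivrMr ?expR_gt0//.
have : 1 + y <= expR y by exact: expR_ge1Dx.
have sn : 0 < `|s| by rewrite normr_gt0.
have : `|x| <= `|s| * (1 + y).
  rewrite /y -(@real_normK _ x) ?num_real// -(@real_normK _ s) ?num_real//.
  have -> : `|s| * (1 + `|x| ^+ 2 / (4 * `|s| ^+ 2)) =
      `|x| + (`|x| - 2 * `|s|) ^+ 2 / (4 * `|s|).
    by field; rewrite gt_eqF.
  by rewrite lerDl divr_ge0 ?sqr_ge0// mulr_ge0// ltW.
move=> h1 h2; rewrite (le_trans h1)// ler_wpM2l// ltW//.
Qed.

Let sqrt2s : Num.sqrt 2 * s != 0 :> R.
Proof. by rewrite mulf_neq0// gt_eqF// sqrtr_gt0. Qed.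

Let integrable_absN : mu.-integrable setT (EFin \o (fun x => `|x| * N x)).
Proof.
apply: (@le_integrable _ _ _ mu setT measurableT _
  (EFin \o (fun x => `|s| * normal_fun 0 (Num.sqrt 2 * s) x))).
- by apply/measurable_EFinP; apply: measurable_funM.
- move=> x _ /=; rewrite lee_fin ger0_norm ?mulr_ge0//.
  by rewrite (le_trans (absN_le x))// ler_norm.
- exact: (integrable_EFinZ measurableT _ (integrable_normal_fun sqrt2s)).
Qed.

Let continuous_N : continuous N.
Proof.
by move=> x; apply/differentiable_continuous/derivable1_diffP; case: (is_derive_N x).
Qed.

Let continuous_phase (g : R -> R) (c a : R) : continuous g ->
  continuous (fun x => g (c * x + a)).
Proof.
move=> cg x; apply: (@continuous_comp _ _ _ (fun x => c * x + a) g); last exact: cg.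
apply: (@continuousD _ R^o); last exact: cst_continuous.
by apply: (@continuousM _ R^o) => //; exact: cst_continuous.
Qed.

Let bounded_mul_N (g : R -> R) (c a : R) : continuous g -> (forall y, `|g y| <= 1) ->
  mu.-integrable setT (EFin \o (fun x => g (c * x + a) * N x)).
Proof.
move=> cg g1; apply: (@integrable_bounded_mul _ _ _ mu _ _ 1) => //.
  by apply: continuous_measurable_fun; exact: continuous_phase.
exact: integrable_normal_fun.
Qed.

Let bounded_mul_xN (g : R -> R) (c a : R) : continuous g -> (forall y, `|g y| <= 1) ->
  mu.-integrable setT (EFin \o (fun x => x * g (c * x + a) * N x)).
Proof.
move=> cg g1; apply: (@le_integrable _ _ _ mu setT measurableT _ _ _ _ integrable_absN).
  apply/measurable_EFinP; apply: measurable_funM => //.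
  apply: measurable_funM => //.
  by apply: continuous_measurable_fun; exact: continuous_phase.
move=> x _ /=; rewrite lee_fin !normrM !normr_id ler_wpM2r//.
by rewrite ler_piMr.
Qed.

(** The boundary terms of the integration by parts vanish. *)
Let integral_by_parts (c a : R) :
  \int[mu]_x (x * sin (c * x + a) * N x) =
  s ^+ 2 * c * \int[mu]_x (cos (c * x + a) * N x).
Proof.
pose h x := c * (cos (c * x + a) * N x) - (s ^+ 2)^-1 * (x * sin (c * x + a) * N x).
pose H x := sin (c * x + a) * N x.
have iC := @bounded_mul_N _ c a (@continuous_cos R) (@cos_max R).
have iS := @bounded_mul_xN _ c a (@continuous_sin R) (@sin_max R).
have ih : mu.-integrable setT (EFin \o h).
  by apply: integrable_EFinB => //; apply: integrable_EFinZ.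
have Eh : \int[mu]_x h x = c * \int[mu]_x (cos (c * x + a) * N x) -
    (s ^+ 2)^-1 * \int[mu]_x (x * sin (c * x + a) * N x).
  rewrite RintegralB//; try exact: integrable_EFinZ.
  by rewrite !RintegralZl.
suff h0 : \int[mu]_x h x = 0.
  move: Eh; rewrite h0 => /eqP; rewrite eq_sym subr_eq0 => /eqP E.
  by rewrite -mulrA E mulrA divff ?mul1r// gt_eqF.
have dH (x : R) : is_derive x 1 H (h x).
  have dN := is_derive_N x.
  have -> : H = (sin \o (fun y => c *: y + a)) \* N.
    by apply/funext => y.
  apply: is_derive_eq; rewrite /h /GRing.scale/= addr0 mulr1.
  by field.
have ch : continuous h.
  have cx : continuous (fun x : R => x * sin (c * x + a) * N x).
    move=> x; apply: (@continuousM R R^o (fun x => x * sin (c * x + a)) N);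
      last exact: continuous_N.
    apply: (@continuousM R R^o id (fun x => sin (c * x + a))) => //.
    exact: (@continuous_phase _ c a (@continuous_sin R)).
  have cc : continuous (fun x : R => cos (c * x + a) * N x).
    move=> x; apply: (@continuousM R R^o (fun x => cos (c * x + a)) N);
      last exact: continuous_N.
    exact: (@continuous_phase _ c a (@continuous_cos R)).
  have ccZ : continuous (fun x : R => c * (cos (c * x + a) * N x)).
    move=> x; apply: (@continuousM R R^o (cst c) (fun x => cos (c * x + a) * N x)).
      exact: cst_continuous.
    exact: cc.
  have cxZ : continuous (fun x : R => (s ^+ 2)^-1 * (x * sin (c * x + a) * N x)).
    move=> x; apply: (@continuousM R R^o (cst _) (fun x => x * sin (c * x + a) * N x)).
      exact: cst_continuous.
    exact: cx.
  by move=> x; apply: (@continuousB R R^o _ _ _ x (ccZ x) (cxZ x)).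
have cH : continuous H.
  by move=> x; apply/differentiable_continuous/derivable1_diffP; case: (dH x).
have FTC (n : nat) : \int[mu]_(x in `[- n.+1%:R, n.+1%:R]) h x =
    H n.+1%:R - H (- n.+1%:R).
  rewrite /Rintegral (@continuous_FTC2 _ h H)//.
  - by have := ltr0Sn R n; lra.
  - exact: continuous_subspaceT.
  - split.
    + by move=> x _; case: (dH x).
    + by apply: cvg_at_right_filter; exact: cH.
    + by apply: cvg_at_left_filter; exact: cH.
  - by move=> x _; rewrite derive1E; case: (dH x).
have mh : measurable_fun setT h by exact: continuous_measurable_fun.
pose A (n : nat) : set R := `[- n.+1%:R, n.+1%:R]%classic.
have [] := @Rintegral_dominated_cvg _ _ _ mu setT (fun n => h \_ (A n)) h
  (fun x => `|h x|) measurableT _ mh.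
- move=> n; apply/(measurable_restrictT _ (measurable_itv _)); exact: (measurable_funTS mh).
- apply: aeW => x _; apply/cvgrPdist_le => e e0.
  exists (Num.trunc `|x|).+1 => // n /= nX.
  rewrite patchE mem_set/= ?subrr ?normr0 ?ltW//.
  rewrite /A/= in_itv/= -ler_norml; apply: (le_trans (ltW (truncnS_gt _))).
  by rewrite ler_nat ltnW.
- exact: integrable_norm.
- move=> n x _; rewrite patchE; case: ifP => // _; by rewrite normr0.
move=> _ cv1; apply: (cvg_unique _ cv1) => //=.
under eq_fun do rewrite -Rintegral_mkcond FTC.
have C0 : 0 <= `|s| by [].
apply/cvgrPdist_le => e e0.
exists (Num.trunc (2 * `|s| / e)) => // n /= nE; rewrite sub0r normrN.
have n0 : 0 < n.+1%:R :> R by rewrite ltr0n.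
have Hle x : x != 0 -> `|H x| <= `|s| / `|x|.
  move=> x0; rewrite ler_pdivlMr ?normr_gt0// normrM mulrC mulrCA.
  rewrite (ger0_norm (N_ge0 x)).
  have : `|x| * N x <= `|s|.
    apply: le_trans (absN_le x) _; rewrite ler_piMr// /normal_fun.
    rewrite -expR0 ler_expR mulNr oppr_le0 divr_ge0 ?sqr_ge0// mulrn_wge0//.
    by rewrite sqr_ge0.
  apply: le_trans; rewrite ler_piMl ?sin_max// mulr_ge0//.
rewrite (le_trans (ler_normB _ _))//.
have := Hle n.+1%:R; have := Hle (- n.+1%:R).
rewrite oppr_eq0 pnatr_eq0 normrN (ger0_norm (ltW n0)) => /(_ isT) h1 /(_ isT) h2.
apply: (le_trans (lerD h2 h1)).
have : 2 * `|s| / e <= n.+1%:R.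
  apply: ltW; apply: lt_le_trans (truncnS_gt _) _.
  by rewrite ler_nat ltnS.
rewrite ler_pdivrMr// => h3.
rewrite -mulrDl ler_pdivrMr// mulrC; lra.
Qed.

Lemma Rintegral_cos_normal (c a : R) :
  \int[mu]_x (cos (c * x + a) * normal_pdf 0 s x) =
  expR (- (c ^+ 2 * s ^+ 2 / 2)) * cos a.
Proof.
pose F c := \int[mu]_x (cos (c * x + a) * N x).
have dF (b : R) : is_derive b 1 F (- (s ^+ 2 * b * F b)).
  pose f (c x : R) := cos (c * x + a) * N x.
  have dfE (b' x : R) : is_derive b' 1 (f ^~ x) (- (x * sin (b' * x + a) * N x)).
    have -> : f ^~ x = (cos \o (fun y => y *: x + a)) \* cst (N x).
      by apply/funext => y.
    apply: is_derive_eq; rewrite /GRing.scale/=; ring.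
  have d1E (b' x : R) : partial1of2 f b' x = - (x * sin (b' * x + a) * N x).
    by rewrite partial1of2E; case: (dfE b' x).
  have h : b - 1 < b < b + 1 by apply/andP; split; lra.
  have intf (x : R) : `]b - 1, b + 1[%classic x -> mu.-integrable setT (EFin \o f x).
    by move=> _; exact: (@bounded_mul_N _ _ _ (@continuous_cos R) (@cos_max R)).
  have derf (x y : R) : `]b - 1, b + 1[%classic x -> setT y -> derivable (f ^~ y) x 1.
    by move=> _ _; case: (dfE x y).
  have G0 (y : R) : 0 <= `|y| * N y by rewrite mulr_ge0.
  have Gub (x y : R) : `]b - 1, b + 1[%classic x -> setT y ->
      `|partial1of2 f x y| <= `|y| * N y.
    move=> _ _; rewrite d1E normrN !normrM (ger0_norm (N_ge0 y)) ler_wpM2r//.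
    by rewrite ler_piMr// sin_max.
  have hb : (`]b - 1, b + 1[%classic : set R) b by rewrite /= in_itv.
  split.
    exact: (derivable_under_integral measurableT hb intf derf G0 integrable_absN Gub).
  rewrite -derive1E.
  rewrite (differentiation_under_integral measurableT hb intf derf G0 integrable_absN Gub).
  under eq_Rintegral do rewrite d1E -mulN1r.
  rewrite RintegralZl//; last exact: (@bounded_mul_xN _ _ _ (@continuous_sin R) (@sin_max R)).
  by rewrite integral_by_parts mulN1r.
pose E (c : R) := expR (s ^+ 2 / 2 *: c ^+ 2).
have dE (b : R) : is_derive b 1 E (s ^+ 2 * b * E b).
  have -> : E = expR \o (fun c => s ^+ 2 / 2 *: c ^+ 2) by [].
  by apply: is_derive_eq; rewrite /E /GRing.scale/=; field.
have FE : F c * E c = F 0 * E 0.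
  apply: (@is_derive_0_is_cst R (F \* E)) => z.
  have d1 := dF z; have d2 := dE z.
  apply: is_derive_eq; rewrite /GRing.scale/=; ring.
have F0 : F 0 = (normal_peak s)^-1 * cos a.
  rewrite /F; under eq_Rintegral do rewrite mul0r add0r mulrC.
  rewrite RintegralZr//; last exact: integrable_normal_fun.
  congr (_ * _); have := @integral_normal_pdf R 0 s.
  rewrite normal_pdfE// => h; have := congr1 fine h => /=.
  rewrite -[fine _]/(\int[mu]_x (normal_peak s * N x)) RintegralZl//; last first.
    exact: integrable_normal_fun.
  have p0 : normal_peak s != 0 by rewrite gt_eqF// normal_peak_gt0.
  by move=> /(congr1 (fun x => (normal_peak s)^-1 * x)); rewrite mulrA mulVf// mul1r mulr1.
transitivity (normal_peak s * F c).
  rewrite /F -RintegralZl//; last exact: (@bounded_mul_N _ _ _ (@continuous_cos R) (@cos_max R)).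
  by apply: eq_Rintegral => x _; rewrite normal_pdfE// mulrCA.
have E0 : E c != 0 by rewrite gt_eqF// expR_gt0.
have -> : F c = F 0 * E 0 / E c by rewrite -FE mulfK.
rewrite F0 /E expr0n/= scaler0 expR0 mulr1 /GRing.scale/= -expRN.
have p0 : normal_peak s != 0 by rewrite gt_eqF// normal_peak_gt0.
rewrite !mulrA divff// mul1r mulrC; congr (expR (- _) * _); ring.
Qed.

End normal_characteristic.

Section centered_gaussian_cos.
Context {R : realType} d (T : measurableType d) (P : probability T R).

Lemma centered_gaussian_cos (X : {RV P >-> R}) (v c a : R) : 0 <= v ->
  centered_gaussian X v ->
  \int[P]_w cos (c * X w + a) = expR (- (c ^+ 2 * v / 2)) * cos a.
Proof.
move=> v0 gX.
have mcos : measurable_fun setT (fun x : R => cos (c * x + a)).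
  apply: continuous_measurable_fun => x; apply: continuous_comp.
    apply: (@continuousD _ R^o); last exact: cst_continuous.
    by apply: (@continuousM _ R^o) => //; exact: cst_continuous.
  exact: continuous_cos.
have mX : measurable_fun setT X by [].
have iP : P.-integrable setT (EFin \o (cst 1 : T -> R)).
  exact: finite_measure_integrable_cst.
have distE (A : set R) : measurable A ->
    \int[P]_w (\1_A (X w) * cst 1 w) = fine (distribution P X A).
  move=> mA; rewrite /Rintegral.
  rewrite (eq_integral (EFin \o \1_(X @^-1` A))); last first.
    by move=> w _ /=; rewrite mulr1.
  rewrite integral_indic// ?setIT//.
  by rewrite -[X in measurable X]setTI; exact: measurable_funP.
have [vE|v1] := eqVneq v 0.
  rewrite vE mulr0 mul0r oppr0 expR0 mul1r.
  transitivity (\int[P]_w (cos (c * X w + a) * cst 1 w)).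
    by apply: eq_Rintegral => w _; rewrite mulr1.
  have := @Rintegral_eq_of_indic R _ _ P _ _ P X (cst 0) (cst 1) (cst 1)
    (fun x => cos (c * x + a)) 1 mX (measurable_cst _) iP iP _ mcos.
  move=> ->.
  - under eq_Rintegral do rewrite /= mulr0 add0r mulr1.
    by rewrite Rintegral_probability_cst.
  - move=> A mA; rewrite distE// gX// vE eqxx diracE.
    under eq_Rintegral do rewrite /= mulr1.
    by rewrite Rintegral_probability_cst indicE.
  - by move=> x; exact: cos_max.
have s0 : Num.sqrt v != 0 by rewrite gt_eqF// sqrtr_gt0 lt_neqAle eq_sym v1.
transitivity (\int[lebesgue_measure]_x (cos (c * x + a) * normal_pdf 0 (Num.sqrt v) x)).
  transitivity (\int[P]_w (cos (c * X w + a) * cst 1 w)).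
    by apply: eq_Rintegral => w _; rewrite mulr1.
  have := @Rintegral_eq_of_indic R _ _ P _ _ lebesgue_measure X id (cst 1)
    (normal_pdf 0 (Num.sqrt v)) (fun x => cos (c * x + a)) 1 mX _ iP
    (integrable_normal_pdf _ _) _ mcos.
  apply => //.
  - move=> A mA; rewrite distE// gX// (negbTE v1) /normal_prob integral_mkcond.
    congr fine; apply: eq_integral => x _; rewrite patchE indicE.
    by case: (x \in A); rewrite ?mul1r ?mul0r.
  - by move=> x; exact: cos_max.
by rewrite Rintegral_cos_normal// sqr_sqrtr.
Qed.

End centered_gaussian_cos.

(** * Linear functionals of a white noise *)

Section square_mean_estimates.
Context {R : realType}.

Lemma cos_lipschitz (x y : R) : `|cos x - cos y| <= `|x - y|.
Proof.
wlog xy : x y / y <= x.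
  move=> H; have [/H//|/ltW xy] := leP y x.
  by rewrite distrC [leRHS]distrC; apply: H.
have [|c _ ->] := @MVT_segment R cos (fun z => - sin z) y x xy.
  by apply: continuous_subspaceT => z; exact: continuous_cos.
by rewrite normrM normrN ler_piMl// sin_max.
Qed.

Lemma expRN_lipschitz (x y : R) : 0 <= x -> 0 <= y ->
  `|expR (- x) - expR (- y)| <= `|x - y|.
Proof.
wlog xy : x y / x <= y.
  move=> H x0 y0; have [/H|/ltW xy] := leP x y; first exact.
  by rewrite distrC [leRHS]distrC; apply: H.
move=> x0 y0; have exy : expR (- y) <= expR (- x) by rewrite ler_expR lerN2.
rewrite ger0_norm ?subr_ge0// distrC ger0_norm ?subr_ge0//.
have -> : expR (- y) = expR (- x) * expR (- (y - x)).
  by rewrite -expRD; congr expR; ring.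
have h1 := expR_ge1Dx (- (y - x)).
have h2 : expR (- x) <= 1 by rewrite -expR0 ler_expR oppr_le0.
have h3 := expR_ge0 (- x).
have : expR (- x) * (1 - expR (- (y - x))) <= 1 * (y - x).
  by apply: ler_pM => //; [rewrite subr_ge0 -expR0 ler_expR oppr_le0 subr_ge0|lra].
by lra.
Qed.

Lemma sum_sqr_le (n : nat) (x : 'I_n -> R) :
  (\sum_(i < n) x i) ^+ 2 <= n%:R * \sum_(i < n) x i ^+ 2.
Proof.
rewrite expr2 mulr_suml.
have : \sum_(i < n) x i * (\sum_(j < n) x j) <=
    \sum_(i < n) \sum_(j < n) (x i ^+ 2 + x j ^+ 2) / 2.
  apply: ler_sum => i _; rewrite mulr_sumr; apply: ler_sum => j _.
  by have := sqr_ge0 (x i - x j); lra.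
move=> /le_trans; apply.
rewrite le_eqVlt; apply/orP; left; apply/eqP.
set S := \sum_(j < n) x j ^+ 2.
have inner i : \sum_(j < n) (x i ^+ 2 + x j ^+ 2) / 2 = (x i ^+ 2 *+ n + S) / 2.
  by rewrite -mulr_suml big_split/= sumr_const card_ord.
under eq_bigr do rewrite inner.
rewrite -mulr_suml big_split/= sumr_const card_ord sumrMnl -/S -mulr_natl.
by field.
Qed.

Lemma sqr_dist_le (delta h k : R) : 0 < delta ->
  `|k ^+ 2 - h ^+ 2| <= delta * h ^+ 2 + (1 + delta^-1) * (h - k) ^+ 2.
Proof.
move=> d0; have di : 0 < delta^-1 by rewrite invr_gt0.
have -> : k ^+ 2 - h ^+ 2 = (h - k) ^+ 2 - 2 * h * (h - k) by ring.
rewrite (le_trans (ler_normB _ _))// (ger0_norm (sqr_ge0 _)).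
have -> : `|2 * h * (h - k)| = 2 * (`|h| * `|h - k|).
  by rewrite !normrM (@ger0_norm _ 2)// mulrA.
rewrite -(@real_normK _ h) ?num_real// -(@real_normK _ (h - k)) ?num_real//.
have := sqr_ge0 (delta * `|h| - `|h - k|).
rewrite -(pmulr_rge0 _ di) => h1.
have : delta^-1 * (delta * `|h| - `|h - k|) ^+ 2 =
   delta * `|h| ^+ 2 + delta^-1 * `|h - k| ^+ 2 - 2 * (`|h| * `|h - k|).
  by field; rewrite gt_eqF.
lra.
Qed.

Lemma integrable_sqr_lty d (T : measurableType d) (mu : {measure set T -> \bar R})
    (f : T -> R) (e : R) : measurable_fun setT f ->
  (\int[mu]_w ((f w) ^+ 2)%:E <= e%:E)%E ->
  mu.-integrable setT (EFin \o (fun w => f w ^+ 2)) /\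
  \int[mu]_w (f w ^+ 2) <= e.
Proof.
move=> mf fe; have i : mu.-integrable setT (EFin \o (fun w => f w ^+ 2)).
  apply/integrableP; split; first by apply/measurable_EFinP; exact: measurable_funX.
  under eq_integral do rewrite /= ger0_norm ?sqr_ge0//.
  by apply: (le_lt_trans fe); rewrite ltry.
split => //; rewrite -lee_fin fineK//; exact: integrable_fin_num.
Qed.

Lemma Rintegral_sqr_dist_le d (T : measurableType d)
    (mu : {measure set T -> \bar R}) (h k : T -> R) (delta : R) : 0 < delta ->
  mu.-integrable setT (EFin \o (fun w => h w ^+ 2)) ->
  mu.-integrable setT (EFin \o (fun w => k w ^+ 2)) ->
  mu.-integrable setT (EFin \o (fun w => (h w - k w) ^+ 2)) ->
  `|\int[mu]_w (k w ^+ 2) - \int[mu]_w (h w ^+ 2)| <=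
  delta * \int[mu]_w (h w ^+ 2) + (1 + delta^-1) * \int[mu]_w ((h w - k w) ^+ 2).
Proof.
move=> d0 ih ik ihk; rewrite -RintegralB//.
have i1 := integrable_EFinZ measurableT delta ih.
have i2 := integrable_EFinZ measurableT (1 + delta^-1) ihk.
rewrite -RintegralZl// -RintegralZl// -RintegralD//.
rewrite (le_trans (le_normr_Rintegral _ _))//; first exact: integrable_EFinB.
apply: le_Rintegral => //.
- apply: integrable_norm; exact: integrable_EFinB.
- exact: integrable_EFinD.
- by move=> w _; exact: sqr_dist_le.
Qed.

Lemma Rintegral_cos_dist_le d (T : measurableType d) (P : probability T R)
    (Y Z : T -> R) (a delta : R) : measurable_fun setT Y -> measurable_fun setT Z ->
  0 < delta -> (\int[P]_w ((Y w - Z w) ^+ 2)%:E <= (delta ^+ 2)%:E)%E ->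
  `|\int[P]_w cos (a + Y w) - \int[P]_w cos (a + Z w)| <= delta.
Proof.
move=> mY mZ d0 /integrable_sqr_lty[|i le]; first exact: measurable_funB.
have ic (U : T -> R) : measurable_fun setT U ->
    P.-integrable setT (EFin \o (fun w => cos (a + U w))).
  move=> mU; apply: (@integrable_bounded _ _ _ P _ 1) => [|w]; last exact: cos_max.
  by apply: measurable_cos_comp; exact: measurable_funD.
have i1 : P.-integrable setT (EFin \o (cst (delta / 2) : T -> R)).
  exact: finite_measure_integrable_cst.
have i2 := integrable_EFinZ measurableT (2 * delta)^-1 i.
rewrite -RintegralB ?ic// (le_trans (le_normr_Rintegral _ _))//.
  by apply: integrable_EFinB; rewrite ?ic.
apply: (@le_trans _ _ (\int[P]_w (delta / 2 + (2 * delta)^-1 * (Y w - Z w) ^+ 2))).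
  apply: le_Rintegral => //.
  - by apply: integrable_norm; apply: integrable_EFinB; rewrite ?ic.
  - exact: (integrable_EFinD measurableT i1 i2).
  - move=> w _; rewrite (le_trans (cos_lipschitz _ _))//.
    rewrite (_ : a + Y w - (a + Z w) = Y w - Z w); last by ring.
    rewrite -(@real_normK _ (Y w - Z w)) ?num_real//.
    set y := `|_|; rewrite -subr_ge0.
    have -> : delta / 2 + (2 * delta)^-1 * y ^+ 2 - y =
        (2 * delta)^-1 * (y - delta) ^+ 2 by field; rewrite gt_eqF.
    by rewrite mulr_ge0 ?sqr_ge0// invr_ge0 mulr_ge0// ltW.
rewrite RintegralD// Rintegral_probability_cst RintegralZl//.
have : (2 * delta)^-1 * \int[P]_w ((Y w - Z w) ^+ 2) <= (2 * delta)^-1 * delta ^+ 2.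
  by rewrite ler_wpM2l// invr_ge0 mulr_ge0// ltW.
have -> : (2 * delta)^-1 * delta ^+ 2 = delta / 2 by field; rewrite gt_eqF.
lra.
Qed.

Lemma ae_eq_Rintegral d (T : measurableType d) (mu : {measure set T -> \bar R})
    (f g : T -> R) : measurable_fun setT f -> measurable_fun setT g ->
  {ae mu, forall w, f w = g w} -> \int[mu]_w f w = \int[mu]_w g w.
Proof.
move=> mf mg fg; congr fine; apply: ae_eq_integral => //.
- exact/measurable_EFinP.
- exact/measurable_EFinP.
- by apply: filterS fg => w -> _.
Qed.

End square_mean_estimates.

Section white_noise_functional.
Context {R : realType} d (T : measurableType d) (P : probability T R).
Variables (W : set (R * R) -> {RV P >-> R}) (wn : white_noise W).

Let W0 : {ae P, forall w, W set0 w = 0}.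
Proof.
case: wn => _ add _; have fa0 : finite_area (set0 : set (R * R)).
  by split; rewrite ?measure0.
have := add set0 set0 fa0 fa0 (set0I _); rewrite setU0.
by apply: filterS => w /eqP; rewrite addrC -subr_eq subrr eq_sym => /eqP.
Qed.

Lemma finite_area_setU (A B : set (R * R)) : finite_area A -> finite_area B ->
  finite_area (A `|` B).
Proof.
move=> [mA fA] [mB fB]; split; first exact: measurableU.
by rewrite (le_lt_trans (measureU2 _ _ _))// lte_add_pinfty.
Qed.

Let white_noise_bigU (n : nat) (E : 'I_n -> set (R * R)) (l : seq 'I_n) :
  (forall k, finite_area (E k)) -> trivIset setT E -> uniq l ->
  finite_area (\big[setU/set0]_(k <- l) E k) /\
  {ae P, forall w, W (\big[setU/set0]_(k <- l) E k) w = \sum_(k <- l) W (E k) w}.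
Proof.
move=> fE tE; elim: l => [_|k l IH /= /andP[kl ul]].
  rewrite big_nil; split; first by split; rewrite ?measure0.
  by apply: filterS W0 => w ->; rewrite big_nil.
have [fA WA] := IH ul; rewrite big_cons; split; first exact: finite_area_setU.
case: wn => _ add _; have := add (E k) _ (fE k) fA.
have /[swap]/[apply] : E k `&` \big[setU/set0]_(j <- l) E j = set0.
  apply/seteqP; split => // u /= [Eku]; rewrite -bigcup_seq => -[j /= jl Eju].
  have jk : j = k by apply: tE => //; exists u.
  by rewrite -jk jl in kl.
by apply: filterS2 WA => w h1 h2; rewrite h2 h1 big_cons.
Qed.

(** The sets are refined into the disjoint atoms of the algebra they generate,
    on which the noise is independent. *)
Lemma white_noise_simple_cos (m : nat) (c : 'I_m -> R) (A : 'I_m -> set (R * R))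
    (a : R) : (forall i, finite_area (A i)) ->
  \int[P]_w cos (a + \sum_(i < m) c i * W (A i) w) =
  expR (- ((\int[mu2]_u (\sum_(i < m) c i * \1_(A i) u) ^+ 2) / 2)) * cos a.
Proof.
move=> fA; pose N := #|{: {set 'I_m}}|.
pose S (k : 'I_N) : {set 'I_m} := enum_val k.
pose E (k : 'I_N) : set (R * R) := if S k == finset.set0 then set0 else
  [set u | forall i, (i \in S k) = (u \in A i)].
have mA i : measurable (A i : set (measurableTypeR R * measurableTypeR R)).
  by case: (fA i).
have atomE k : [set u | forall i, (i \in S k) = (u \in A i)] =
    \bigcap_(i in [set: 'I_m]) (if i \in S k then A i else ~` A i).
  apply/seteqP; split => u /= h i.
    move=> _; have := h i; case: (i \in S k) => /esym uA; first exact: set_mem.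
    by move/mem_set; rewrite uA.
  have := h i I; case: (i \in S k) => uA; first by rewrite mem_set.
  by rewrite memNset.
have mE k : measurable (E k : set (measurableTypeR R * measurableTypeR R)).
  rewrite /E; case: ifP => // _; rewrite atomE.
  apply: fin_bigcap_measurable => // i _; case: ifP => // _; exact: measurableC.
have EA k i : i \in S k -> E k `<=` A i.
  move=> iS u; rewrite /E; case: eqP => [S0|_]; first by [].
  by move=> /(_ i); rewrite iS => /esym uA; exact: set_mem.
have fE k : finite_area (E k).
  split => //; have [S0|/finset.set0Pn[i iS]] := eqVneq (S k) finset.set0.
    by rewrite /E S0 eqxx measure0.
  case: (fA i) => _; apply: le_lt_trans; apply: le_measure; rewrite ?inE//.
  exact: EA.
have tE : trivIset setT E.
  move=> k1 k2 _ _ [u []]; rewrite /E; case: eqP => // _ h1; case: eqP => // _ h2.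
  by apply: enum_val_inj; apply/setP => i; rewrite -/(S k1) -/(S k2) h1 h2.
have AE i : A i = \big[setU/set0]_(k <- [seq k <- enum 'I_N | i \in S k]) E k.
  rewrite -bigcup_seq; apply/seteqP; split => u /=; last first.
    by move=> [k /=]; rewrite mem_filter => /andP[iS _]; exact: EA.
  move=> Au; pose Su := [set j | u \in A j]%SET.
  have SE : S (enum_rank Su) = Su by rewrite /S enum_rankK.
  exists (enum_rank Su).
    by rewrite /= mem_filter mem_enum SE inE mem_set.
  rewrite /E SE; case: eqP => [/setP/(_ i)|_ j]; rewrite inE//.
  by rewrite finset.in_set0 mem_set.
pose D k := \sum_(i in S k) c i.
have sumE (x : 'I_N -> R) (y : 'I_m -> R) :
    (forall i, y i = \sum_(k <- [seq k <- enum 'I_N | i \in S k]) x k) ->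
    \sum_(i < m) c i * y i = \sum_(k < N) D k * x k.
  move=> yE; under eq_bigr => i _.
    rewrite yE big_filter mulr_sumr big_enum_cond/=; over.
  rewrite (exchange_big_dep predT)//=; apply: eq_bigr => k _.
  by rewrite /D mulr_suml.
have WE : {ae P, forall w, \sum_(i < m) c i * W (A i) w =
    \sum_(k < N) D k * W (E k) w}.
  have : {ae P, forall w, forall i, W (A i) w =
      \sum_(k <- [seq k <- enum 'I_N | i \in S k]) W (E k) w}.
    apply: filter_forall => i.
    have ul : uniq [seq k <- enum 'I_N | i \in S k].
      by rewrite filter_uniq// enum_uniq.
    by have [_] := white_noise_bigU fE tE ul; rewrite -AE.
  by apply: filterS => w h; exact: sumE.
case: (wn) => gW _ indW.
pose v k := D k ^+ 2 * fine (mu2 (E k)).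
have mu0 k : 0 <= fine (mu2 (E k)) by exact: fine_ge0.
have v0 k : 0 <= v k by rewrite mulr_ge0 ?sqr_ge0.
have rE k : k \in index_enum 'I_N ->
    `|\int[P]_w cos (D k * W (E k) w) - expR (- (v k / 2))| +
    `|\int[P]_w sin (D k * W (E k) w)| <= 0.
  move=> _.
  have h b := centered_gaussian_cos (D k) b (mu0 k) (gW _ (fE k)).
  have -> : \int[P]_w cos (D k * W (E k) w) = expR (- (v k / 2)).
    by have := h 0; rewrite cos0 mulr1 => <-; apply: eq_Rintegral => w _; rewrite addr0.
  have -> : \int[P]_w sin (D k * W (E k) w) = 0.
    have := h (- (pi / 2)); rewrite cosN cos_pihalf mulr0 => <-.
    by apply: eq_Rintegral => w _; rewrite cosBpihalf.
  by rewrite subrr !normr0 addr0.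
have := @cos_sum_independent R _ T P 'I_N (fun k => W (E k)) (index_enum 'I_N)
  D v (fun=> 0) a (indW N E fE tE) (index_enum_uniq _) v0 rE.
rewrite [leRHS]big1// normr_le0 subr_eq0 => /eqP h.
transitivity (\int[P]_w cos (a + \sum_(k < N) D k * W (E k) w)).
  apply: ae_eq_Rintegral.
  - apply: measurable_cos_comp; apply: measurable_funD => //.
    exact: (@measurable_lincomb _ _ _ P _ (fun i => W (A i))).
  - apply: measurable_cos_comp; apply: measurable_funD => //.
    exact: (@measurable_lincomb _ _ _ P _ (fun i => W (E i))).
  - by apply: filterS WE => w ->.
rewrite h; congr (expR (- (_ / 2)) * _).
have E1 u : (\sum_(i < m) c i * \1_(A i) u) ^+ 2 =
    \sum_(k < N) D k ^+ 2 * \1_(E k) u.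
  rewrite (sumE (fun k => \1_(E k) u)); last first.
    move=> i; have [uA|uA] := boolP (u \in A i).
      have := set_mem uA; rewrite {1}AE -bigcup_seq => -[k /= kl Eku].
      rewrite (big_rem k)//= !indicE uA (mem_set Eku) big_seq big1 ?addr0// => j.
      move=> jr; have jk : j != k.
        by apply: contraTneq jr => ->; rewrite mem_rem_uniqF// filter_uniq// enum_uniq.
      rewrite indicE memNset// => Eju; move/eqP: jk; apply.
      by apply: tE => //; exists u.
    rewrite indicE (negbTE uA) big_seq big1// => k.
    rewrite mem_filter => /andP[iS _]; rewrite indicE memNset//.
    by move/(EA _ _ iS)/mem_set; rewrite (negbTE uA).
  have [[k Eku]|noE] := pselect (exists k, E k u).
    have other j : j != k -> (\1_(E j) u : R) = 0.
      move=> jk; rewrite indicE memNset// => Eju; move/eqP: jk; apply.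
      by apply: tE => //; exists u.
    rewrite (bigD1 k)//= big1 ?addr0; last by move=> j /other ->; rewrite mulr0.
    rewrite [RHS](bigD1 k)//= big1 ?addr0; last by move=> j /other ->; rewrite mulr0.
    by rewrite indicE mem_set// !mulr1.
  by rewrite !big1 ?expr0n// => k _; rewrite indicE memNset ?mulr0// => Eku;
    apply: noE; exists k.
have mI k : measurable_fun setT
    (\1_(E k) : measurableTypeR R * measurableTypeR R -> R).
  exact: measurable_indic.
have mEI k : measurable_fun setT
    (EFin \o (\1_(E k) : measurableTypeR R * measurableTypeR R -> R)).
  by apply/measurable_EFinP; exact: mI.
rewrite /v /Rintegral; under eq_integral do rewrite E1.
under eq_integral do rewrite -sumEFin.
rewrite ge0_integral_sum//; last 2 first.
- by move=> k; apply/measurable_EFinP; exact: measurable_funM.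
- by move=> k u _; rewrite lee_fin mulr_ge0 ?sqr_ge0// indicE.
have intE k : (\int[mu2]_u (D k ^+ 2 * \1_(E k) u)%:E = (v k)%:E)%E.
  under eq_integral do rewrite EFinM.
  rewrite ge0_integralZl//; [|exact: mEI|by rewrite lee_fin sqr_ge0].
  rewrite integral_indic// setIT /v [RHS]EFinM; congr (_ * _)%E.
  by rewrite fineK// ge0_fin_numE//; case: (fE k).
by rewrite [in RHS](eq_bigr (fun k => (v k)%:E)) ?sumEFin.
Qed.

Lemma white_noise_seq_cos (l : seq (R * set (R * R))) (a : R) :
  (forall p, p \in l -> finite_area p.2) ->
  \int[P]_w cos (a + \sum_(p <- l) p.1 * W p.2 w) =
  expR (- ((\int[mu2]_u (\sum_(p <- l) p.1 * \1_(p.2) u) ^+ 2) / 2)) * cos a.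
Proof.
move=> fl; pose p0 : R * set (R * R) := (0, set0).
have fA (i : 'I_(size l)) : finite_area (nth p0 l i).2.
  by apply: fl; exact: mem_nth.
have := white_noise_simple_cos (fun i => (nth p0 l i).1) a fA.
congr (_ = expR (- (_ / 2)) * _); apply: eq_Rintegral => w _.
  by rewrite (big_nth p0) big_mkord.
by rewrite (big_nth p0) big_mkord.
Qed.

Lemma wiener_integral_cos (n : nat) (h : 'I_n -> R * R -> R)
    (I_ : 'I_n -> {RV P >-> R}) (theta : 'I_n -> R) (a : R) :
  (forall j, wiener_integral W (h j) (I_ j)) ->
  \int[P]_w cos (a + \sum_(j < n) theta j * I_ j w) =
  expR (- ((\int[mu2]_u (\sum_(j < n) theta j * h j u) ^+ 2) / 2)) * cos a.
Proof.
move=> wI.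
have mh j : measurable_fun setT (h j : measurableTypeR R * measurableTypeR R -> R).
  by case: (wI j) => /andP[+ _] _; rewrite inE.
have ih j : mu2.-integrable setT (EFin \o (fun u => h j u ^+ 2)).
  by apply: Lfun2_integrable_sqr; case: (wI j).
pose H u := \sum_(j < n) theta j * h j u.
have mH : measurable_fun setT (H : measurableTypeR R * measurableTypeR R -> R).
  by apply: measurable_sum => j; exact: measurable_funM.
pose K : R := n%:R * \sum_(j < n) theta j ^+ 2 + 1.
have K1 : 1 <= K.
  by rewrite lerDr mulr_ge0// sumr_ge0// => j _; exact: sqr_ge0.
have K0 : 0 < K by apply: lt_le_trans K1.
pose Q := \int[mu2]_u (H u ^+ 2).
have Q0 : 0 <= Q by apply: Rintegral_ge0 => u _; exact: sqr_ge0.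
(* Sums of n functions that are small in mean square *)
have small d' (T' : measurableType d') (mu : {measure set T' -> \bar R})
    (f : 'I_n -> T' -> R) (e : R) : 0 <= e ->
    (forall j, measurable_fun setT (f j)) ->
    (forall j, (\int[mu]_w (f j w ^+ 2)%:E <= e%:E)%E) ->
    (\int[mu]_w ((\sum_(j < n) theta j * f j w) ^+ 2)%:E <= (K * e)%:E)%E.
  move=> e0 mf fe.
  apply: (@le_trans _ _ (\int[mu]_w (\sum_(j < n)
      (n%:R * theta j ^+ 2)%:E * (f j w ^+ 2)%:E))%E).
    apply: ge0_le_integral => //.
    - by move=> w _; rewrite lee_fin sqr_ge0.
    - apply/measurable_EFinP; apply: measurable_funX; apply: measurable_sum => j.
      exact: measurable_funM.
    - apply: emeasurable_sum => j.
      by apply: measurable_funeM; apply/measurable_EFinP; exact: measurable_funX.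
    - move=> w _; rewrite (eq_bigr (fun j => (n%:R * theta j ^+ 2 * f j w ^+ 2)%:E))//.
      rewrite sumEFin lee_fin (le_trans (sum_sqr_le _))//.
      by rewrite mulr_sumr ler_sum// => j _; rewrite exprMn mulrA.
  rewrite ge0_integral_sum//; last 2 first.
  - move=> j; apply: measurable_funeM; apply/measurable_EFinP.
    exact: measurable_funX.
  - move=> j w _; rewrite -EFinM lee_fin; apply: mulr_ge0; last exact: sqr_ge0.
    by rewrite mulr_ge0 ?sqr_ge0.
  apply: (@le_trans _ _ (\sum_(j < n) (n%:R * theta j ^+ 2 * e)%:E)%E).
    apply: lee_sum => j _; rewrite ge0_integralZl//; last 3 first.
    - by apply/measurable_EFinP; exact: measurable_funX.
    - by move=> w _; rewrite lee_fin sqr_ge0.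
    - by rewrite lee_fin mulr_ge0 ?sqr_ge0.
    by rewrite [leRHS]EFinM lee_wpmul2l ?fe// lee_fin mulr_ge0 ?sqr_ge0.
  rewrite sumEFin lee_fin -mulr_suml -mulr_sumr ler_wpM2r//.
  by rewrite /K lerDl.
have iH : mu2.-integrable setT (EFin \o (fun u => H u ^+ 2)).
  have mx : exists e : R, 0 <= e /\
      forall j, (\int[mu2]_u (h j u ^+ 2)%:E <= e%:E)%E.
    exists (\sum_(j < n) \int[mu2]_u (h j u ^+ 2)); split.
      by apply: sumr_ge0 => j _; apply: Rintegral_ge0 => u _; exact: sqr_ge0.
    move=> j; rewrite -[leLHS]fineK; last exact: (integrable_fin_num measurableT (ih j)).
    rewrite lee_fin (bigD1 j)//= lerDl; apply: sumr_ge0 => k _.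
    by apply: Rintegral_ge0 => u _; exact: sqr_ge0.
  have [e [e0 he]] := mx.
  by have [] := integrable_sqr_lty mH (small _ _ _ _ _ e0 mh he).
apply/eqP; rewrite -subr_eq0 -normr_le0; apply/ler_addgt0Pr => eps eps0.
rewrite add0r.
pose dl := Num.min 1 (eps / (2 * (Q + 3))).
have Q3 : 0 < Q + 3 by rewrite ltr_wpDl.
have dl0 : 0 < dl.
  by rewrite lt_min ltr01/= divr_gt0// mulr_gt0.
have dl1 : dl <= 1 by rewrite ge_min lexx.
have dlQ : dl * (Q + 3) <= eps / 2.
  by rewrite -ler_pdivlMr// -mulrA -invfM ge_min lexx orbT.
pose e := dl ^+ 2 / K.
have e0 : 0 < e by rewrite divr_gt0// exprn_gt0.
have Ke : K * e = dl ^+ 2 by rewrite /e mulrC divfK// gt_eqF.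
have /choice[L PL] : forall j, exists l : seq (R * set (R * R)),
    [/\ forall p, p \in l -> finite_area p.2,
      (\int[mu2]_u ((h j u - \sum_(p <- l) p.1 * \1_(p.2) u) ^+ 2)%:E <= e%:E)%E &
      (\int[P]_w ((I_ j w - \sum_(p <- l) p.1 * W p.2 w) ^+ 2)%:E <= e%:E)%E].
  move=> j; case: (wI j) => _ /(_ e e0) [m [c [A [fA h1 h2]]]].
  exists [seq (c i, A i) | i <- enum 'I_m]; split.
  - by move=> p /mapP[i _ ->]; exact: fA.
  - by under eq_integral do rewrite big_map big_enum/=.
  - move: h2; rewrite unlock.
    by under [X in _ -> (X <= _)%E]eq_integral do rewrite big_map big_enum/=.
pose l := [seq (theta j * p.1, p.2) | j <- enum 'I_n, p <- L j].
have fl p : p \in l -> finite_area p.2.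
  case/allpairsPdep => j [p' [_ p'L ->]] /=.
  by have [fA _ _] := PL j; exact: fA.
pose Sf (F : set (R * R) -> R) := \sum_(p <- l) p.1 * F p.2.
have SfE F : Sf F = \sum_(j < n) theta j * \sum_(p <- L j) p.1 * F p.2.
  rewrite /Sf big_allpairs_dep big_enum/=; apply: eq_bigr => j _.
  by rewrite mulr_sumr; apply: eq_bigr => p _; rewrite mulrA.
have mSl (l' : seq (R * set (R * R))) : (forall p, p \in l' -> finite_area p.2) ->
    measurable_fun setT ((fun u => \sum_(p <- l') p.1 * \1_(p.2) u) :
      measurableTypeR R * measurableTypeR R -> R).
  elim: l' => [|p l' IH] fl'.
    by under eq_fun do rewrite big_nil; exact: measurable_cst.
  under eq_fun do rewrite big_cons.
  apply: measurable_funD.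
    apply: measurable_funM => //; apply: measurable_indic.
    by case: (fl' p _); rewrite ?inE ?eqxx.
  by apply: IH => p' p'l; apply: fl'; rewrite inE p'l orbT.
have mWl (l' : seq (R * set (R * R))) :
    measurable_fun setT (fun w => \sum_(p <- l') p.1 * W p.2 w).
  by apply: measurable_sum => p; exact: measurable_funM.
have H1 : (\int[mu2]_u ((H u - Sf (fun A => \1_A u)) ^+ 2)%:E <= (dl ^+ 2)%:E)%E.
  rewrite -Ke; under eq_integral => u _.
    rewrite SfE -sumrB; under eq_bigr do rewrite -mulrBr; over.
  apply: small => [|j|j]; first exact: ltW.
    by apply: measurable_funB => //; apply: mSl; case: (PL j).
  by case: (PL j).
have H2 : (\int[P]_w (((\sum_(j < n) theta j * I_ j w) - Sf (fun A => W A w)) ^+ 2)%:E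
    <= (dl ^+ 2)%:E)%E.
  rewrite -Ke; under eq_integral => u _.
    rewrite SfE -sumrB; under eq_bigr do rewrite -mulrBr; over.
  apply: small => [|j|j]; first exact: ltW.
    by apply: measurable_funB => //; exact: mWl.
  by case: (PL j).
have mI : measurable_fun setT (fun w => \sum_(j < n) theta j * I_ j w).
  exact: (@measurable_lincomb _ _ _ P _ I_).
have C1 := Rintegral_cos_dist_le a mI (mWl l) dl0 H2.
rewrite white_noise_seq_cos// in C1.
have mSH : measurable_fun setT ((fun u => H u - Sf (fun A => \1_A u)) :
    measurableTypeR R * measurableTypeR R -> R).
  by apply: measurable_funB => //; exact: mSl.
have [iD leD] := integrable_sqr_lty mSH H1.
have iS : mu2.-integrable setT (EFin \o (fun u => Sf (fun A => \1_A u) ^+ 2)).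
  apply: (@le_integrable _ _ _ mu2 setT measurableT _
    (EFin \o (fun u => 2 * H u ^+ 2 + 2 * (H u - Sf (fun A => \1_A u)) ^+ 2))).
  - by apply/measurable_EFinP; apply: measurable_funX; exact: mSl.
  - move=> u _ /=; rewrite lee_fin ger0_norm ?sqr_ge0// (le_trans _ (ler_norm _))//.
    set x := H u; set y := Sf _; rewrite -subr_ge0.
    by have -> : 2 * x ^+ 2 + 2 * (x - y) ^+ 2 - y ^+ 2 = (2 * x - y) ^+ 2
      by [ring]; exact: sqr_ge0.
  - by apply: integrable_EFinD => //; exact: integrable_EFinZ.
have C2 := Rintegral_sqr_dist_le dl0 iH iS iD.
have C3 : `|\int[mu2]_u (Sf (fun A => \1_A u) ^+ 2) - Q| <= dl * (Q + 2).
  apply: (le_trans C2); rewrite -/Q mulrDr lerD2l.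
  have : (1 + dl^-1) * \int[mu2]_u ((H u - Sf (fun A => \1_A u)) ^+ 2) <=
    (1 + dl^-1) * dl ^+ 2.
    by rewrite ler_wpM2l// addr_ge0// invr_ge0 ltW.
  move=> /le_trans; apply.
  have -> : (1 + dl^-1) * dl ^+ 2 = dl * (dl + 1) by field; rewrite gt_eqF.
  by apply: ler_wpM2l; [exact: ltW|lra].
move: C1; rewrite -/(Sf _).
set QS := \int[mu2]_u _ in C3 *; move=> C1.
have QS0 : 0 <= QS by apply: Rintegral_ge0 => u _; exact: sqr_ge0.
have C4 := expRN_lipschitz (divr_ge0 QS0 (ler0n R 2)) (divr_ge0 Q0 (ler0n R 2)).
rewrite -/H -/Q in C1 *.
have -> : \int[P]_w cos (a + \sum_(j < n) theta j * I_ j w) -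
    expR (- (Q / 2)) * cos a =
    (\int[P]_w cos (a + \sum_(j < n) theta j * I_ j w) - expR (- (QS / 2)) * cos a)
    + (expR (- (QS / 2)) - expR (- (Q / 2))) * cos a by ring.
rewrite (le_trans (ler_normD _ _))// (le_trans (lerD C1 (lexx _)))//.
rewrite normrM.
have C5 : `|expR (- (QS / 2)) - expR (- (Q / 2))| * `|cos a| <= `|QS / 2 - Q / 2|.
  by rewrite (le_trans _ C4)// ler_piMr// cos_max.
have C6 : `|QS / 2 - Q / 2| <= `|QS - Q|.
  by rewrite -mulrBl normrM ler_piMr// ger0_norm// invf_le1//; lra.
have : dl * (Q + 3) = dl + dl * (Q + 2) by ring.
lra.
Qed.

End white_noise_functional.

(** * From characteristic functions to weak convergence *)

Section bernstein.
Context {R : realType}.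

Definition bernstein (N k : nat) (x : R) : R :=
  'C(N, k)%:R * (x ^+ k * (1 - x) ^+ (N - k)).

Lemma bernstein_ge0 N k x : 0 <= x <= 1 -> 0 <= bernstein N k x.
Proof.
by move=> /andP[x0 x1]; rewrite mulr_ge0// mulr_ge0// exprn_ge0// subr_ge0.
Qed.

Lemma sum_bernstein N x : \sum_(k < N.+1) bernstein N k x = 1.
Proof.
have := exprDn (1 - x) x N; rewrite subrK expr1n => ->.
by apply: eq_bigr => k _; rewrite /bernstein mulr_natl mulrC [_ * x ^+ _]mulrC.
Qed.

Lemma bernstein_step N k x :
  k.+1%:R * bernstein N.+1 k.+1 x = N.+1%:R * x * bernstein N k x.
Proof.
have := mul_bin_diag N.+1 k; rewrite /= => /(congr1 (fun n => n%:R : R)).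
by rewrite !natrM /bernstein subSS exprS => h; rewrite mulrA -h; ring.
Qed.

Lemma bernstein_mean N x : \sum_(k < N.+1) k%:R * bernstein N k x = N%:R * x.
Proof.
case: N => [|N]; first by rewrite big_ord1 mul0r mul0r.
rewrite big_ord_recl mul0r add0r.
under eq_bigr do rewrite bernstein_step.
by rewrite -mulr_sumr sum_bernstein mulr1.
Qed.

Lemma bernstein_sqr_mean N x :
  \sum_(k < N.+1) k%:R ^+ 2 * bernstein N k x =
  N%:R * x * (1 + (N%:R - 1) * x).
Proof.
case: N => [|N]; first by rewrite big_ord1 expr0n mul0r mul0r mul0r.
rewrite big_ord_recl expr0n mul0r add0r.
have E (k : nat) : k.+1%:R ^+ 2 * bernstein N.+1 k.+1 x =
    N.+1%:R * x * (bernstein N k x + k%:R * bernstein N k x).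
  by rewrite expr2 -mulrA bernstein_step -natr1; ring.
under eq_bigr do rewrite E.
rewrite -mulr_sumr big_split/= sum_bernstein bernstein_mean -natr1; ring.
Qed.

Lemma bernstein_variance N x : (0 < N)%N -> 0 <= x <= 1 ->
  \sum_(k < N.+1) (k%:R / N%:R - x) ^+ 2 * bernstein N k x <= N%:R^-1.
Proof.
move=> N0 /andP[x0 x1]; have n0 : 0 < N%:R :> R by rewrite ltr0n.
have E (k : 'I_N.+1) : (k%:R / N%:R - x) ^+ 2 * bernstein N k x =
    (N%:R ^+ 2)^-1 * (k%:R ^+ 2 * bernstein N k x)
    - 2 * x / N%:R * (k%:R * bernstein N k x) + x ^+ 2 * bernstein N k x.
  by field; rewrite gt_eqF.
under eq_bigr do rewrite E.
rewrite big_split/= sumrB -!mulr_sumr sum_bernstein bernstein_mean bernstein_sqr_mean.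
have -> : (N%:R ^+ 2)^-1 * (N%:R * x * (1 + (N%:R - 1) * x)) -
    2 * x / N%:R * (N%:R * x) + x ^+ 2 * 1 = N%:R^-1 * (x * (1 - x)).
  by field; rewrite gt_eqF.
rewrite ler_piMr ?invr_ge0// mulr_ile1//; lra.
Qed.

End bernstein.

Section trigonometric_polynomials.
Context {R : realType} (n : nat).
Implicit Types v : 'rV[R]_n.

Inductive trig_poly : ('rV[R]_n -> R) -> Prop :=
| trig_poly_cos (a : R) (theta : 'I_n -> R) :
    trig_poly (fun v => cos (a + \sum_(j < n) theta j * v 0 j))
| trig_poly_lin (c : R) (g1 g2 : 'rV[R]_n -> R) :
    trig_poly g1 -> trig_poly g2 -> trig_poly (fun v => c * g1 v + g2 v).

Lemma trig_poly_eq g1 g2 : trig_poly g1 -> g1 =1 g2 -> trig_poly g2.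
Proof. by move=> t1 /funext <-. Qed.

Lemma trig_poly0 : trig_poly (fun=> 0).
Proof.
have t := trig_poly_cos 0 (fun=> 0); have t' := trig_poly_lin (- 1) t t.
by apply: trig_poly_eq t' _ => v; rewrite mulN1r addNr.
Qed.

Lemma trig_polyZ c g : trig_poly g -> trig_poly (fun v => c * g v).
Proof.
move=> t; have := trig_poly_lin c t trig_poly0.
by move=> t'; apply: trig_poly_eq t' _ => v; rewrite addr0.
Qed.

Lemma trig_polyD g1 g2 : trig_poly g1 -> trig_poly g2 ->
  trig_poly (fun v => g1 v + g2 v).
Proof.
move=> t1 t2; have t' := trig_poly_lin 1 t1 t2.
by apply: trig_poly_eq t' _ => v; rewrite mul1r.
Qed.

Lemma trig_poly_cst c : trig_poly (fun=> c).
Proof.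
have t := trig_polyZ c (trig_poly_cos 0 (fun=> 0)).
apply: trig_poly_eq t _ => v.
by rewrite big1 ?addr0 ?cos0 ?mulr1// => j _; rewrite mul0r.
Qed.

Lemma trig_poly_sum (I : Type) (l : seq I) (F : I -> 'rV[R]_n -> R) :
  (forall i, trig_poly (F i)) -> trig_poly (fun v => \sum_(i <- l) F i v).
Proof.
move=> tF; elim: l => [|i l IH].
  by apply: trig_poly_eq trig_poly0 _ => v; rewrite big_nil.
by apply: trig_poly_eq (trig_polyD (tF i) IH) _ => v; rewrite big_cons.
Qed.

Lemma trig_polyM g1 g2 : trig_poly g1 -> trig_poly g2 ->
  trig_poly (fun v => g1 v * g2 v).
Proof.
move=> t1 t2; elim: t1 => {g1} [a1 th1|c h1 h2 _ IH1 _ IH2]; last first.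
  by apply: trig_poly_eq (trig_poly_lin c IH1 IH2) _ => v; ring.
elim: t2 => {g2} [a2 th2|c h1 h2 _ IH1 _ IH2]; last first.
  by apply: trig_poly_eq (trig_poly_lin c IH1 IH2) _ => v; ring.
have t := trig_polyZ 2^-1 (trig_polyD
  (trig_poly_cos (a1 + a2) (fun j => th1 j + th2 j))
  (trig_poly_cos (a1 - a2) (fun j => th1 j - th2 j))).
apply: trig_poly_eq t _ => v /=.
set x := a1 + \sum_(j < n) _; set y := a2 + _.
have -> : a1 + a2 + \sum_(j < n) (th1 j + th2 j) * v 0 j = x + y.
  by under eq_bigr do rewrite mulrDl; rewrite big_split/= /x /y; ring.
have -> : a1 - a2 + \sum_(j < n) (th1 j - th2 j) * v 0 j = x - y.
  by under eq_bigr do rewrite mulrBl; rewrite sumrB /x /y; ring.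
by rewrite cosD cosB; field.
Qed.

Lemma trig_poly_prod (I : Type) (l : seq I) (F : I -> 'rV[R]_n -> R) :
  (forall i, trig_poly (F i)) -> trig_poly (fun v => \prod_(i <- l) F i v).
Proof.
move=> tF; elim: l => [|i l IH].
  by apply: trig_poly_eq (trig_poly_cst 1) _ => v; rewrite big_nil.
by apply: trig_poly_eq (trig_polyM (tF i) IH) _ => v; rewrite big_cons.
Qed.

Lemma trig_polyX g k : trig_poly g -> trig_poly (fun v => g v ^+ k).
Proof.
move=> t; elim: k => [|k IH]; first by apply: trig_poly_eq (trig_poly_cst 1) _.
by apply: trig_poly_eq (trig_polyM t IH) _ => v; rewrite exprS.
Qed.

Lemma trig_poly_sin (omega : R) (j : 'I_n) :
  trig_poly (fun v => sin (omega * v 0 j)).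
Proof.
have t := trig_poly_cos (- (pi / 2)) (fun i => if i == j then omega else 0).
apply: trig_poly_eq t _ => v; rewrite (bigD1 j)//= eqxx big1 ?addr0.
  by rewrite addrC cosBpihalf.
by move=> i /negbTE ->; rewrite mul0r.
Qed.

(** Sines separate points at distances below a half period quantitatively. *)
Lemma sin_expansive (a b : R) : `|a| <= pi / 2 -> `|b| <= 1 ->
  cos ((pi / 2 + 1) / 2) ^+ 2 * `|a - b| <= `|sin a - sin b|.
Proof.
move=> ha hb; set c0 := cos _.
have pi2 := @pi_ge2 R.
have c0pos x : `|x| <= (pi / 2 + 1) / 2 -> c0 <= cos x.
  move=> hx; have -> : cos x = cos `|x|.
    by case: (ger0P x) => // _; rewrite cosN.
  have [->//|ne] := eqVneq `|x| ((pi / 2 + 1) / 2).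
  apply: ltW; rewrite ltr_cos ?lt_neqAle ?ne//; rewrite in_itv/=.
    by rewrite (le_trans _ (normr_ge0 x))//=; lra.
  by apply/andP; split; lra.
have c00 : 0 <= c0.
  apply: cos_ge0_pihalf; apply/andP; split; lra.
pose s := (a + b) / 2; pose t := (a - b) / 2.
have -> : sin a - sin b = 2 * cos s * sin t.
  have -> : a = s + t by rewrite /s /t; field.
  have -> : b = s - t by rewrite /s /t; field.
  by rewrite sinD sinB; ring.
have hs : `|s| <= (pi / 2 + 1) / 2.
  rewrite /s normrM (@ger0_norm _ 2^-1)// ler_wpM2r//.
  by rewrite (le_trans (ler_normD _ _))// lerD.
have ht : `|t| <= (pi / 2 + 1) / 2.
  rewrite /t normrM (@ger0_norm _ 2^-1)// ler_wpM2r//.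
  by rewrite (le_trans (ler_normB _ _))// lerD.
have hsin : c0 * `|t| <= `|sin t|.
  have sE : `|sin t| = `|sin `|t| |.
    by case: (ger0P t) => // _; rewrite sinN normrN.
  have [|c] := @MVT_segment R sin cos 0 `|t| (normr_ge0 t).
    by apply: continuous_subspaceT => z; exact: continuous_sin.
  rewrite in_itv/= => /andP[c1 c2]; rewrite sin0 !subr0 sE => ->.
  rewrite (normrM (cos c)) normr_id ler_wpM2r//.
  apply: le_trans (ler_norm _); apply: c0pos.
  by rewrite (ger0_norm c1) (le_trans c2).
have -> : `|a - b| = 2 * `|t|.
  by rewrite /t normrM (@ger0_norm _ 2^-1)//; field.
rewrite (normrM (2 * cos s)) (normrM 2) (@ger0_norm _ 2)// expr2.
have h1 : c0 <= `|cos s| by apply: le_trans (ler_norm _); exact: c0pos.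
have : c0 * (c0 * `|t|) <= `|cos s| * `|sin t|.
  by apply: ler_pM => //; rewrite mulr_ge0.
lra.
Qed.

Lemma cube_unif_continuous (f : 'rV[R]_n -> R) (K e : R) : continuous f -> 0 < e ->
  exists2 delta : R, 0 < delta & forall v v', (forall j, `|v 0 j| <= K) ->
    (forall j, `|v 0 j - v' 0 j| <= delta) -> `|f v - f v'| <= e.
Proof.
move=> cf e0.
have cK : compact [set v : 'rV[R]_n | forall j, `[- K, K]%classic (v ord0 j)].
  apply: (@rV_compact R n (fun=> `[- K, K]%classic)) => j.
  exact: (@segment_compact R (- K) K).
pose P (delta : R) (v : 'rV[R]_n) := forall v',
  (forall j, `|v 0 j - v' 0 j| <= delta) -> `|f v - f v'| <= e.
have : \forall delta \near 0^'+,
    [set v : 'rV[R]_n | forall j, `[- K, K]%classic (v ord0 j)] `<=` P delta.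
  apply: ((compact_near_coveringP _).1 cK) => x _.
  have e2 : 0 < e / 2 by rewrite divr_gt0.
  have /cvgrPdist_lt/(_ _ e2)/nbhs_ballP[r /= r0 hr] := cf x.
  exists (ball x (r / 2), [set d | d < r / 2]).
    split => /=; first by apply: nbhsx_ballx; rewrite divr_gt0.
    by apply: nbhs_right_lt; rewrite divr_gt0.
  move=> [x' d] [/= bx' dr] v' hv'.
  have r2 : r / 2 <= r by rewrite ler_pdivrMr// ler_peMr ?ltW//; lra.
  have h1 := hr x' (le_ball r2 bx').
  have h2 : ball x r v'.
    have [_ hx] := bx'; split => // i j; have := hx i j; rewrite ord1 /ball/=.
    have := hv' j; rewrite !ler_norml !ltr_norml => /andP[a1 a2] /andP[b1 b2].
    by apply/andP; split; lra.
  have {}h2 := hr v' h2; rewrite /= in h1 h2.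
  have -> : f x' - f v' = (f x - f v') - (f x - f x') by ring.
  rewrite (le_trans (ler_normB _ _))//; lra.
move=> H; have [delta [d0 hd]] := filter_ex (filterI (nbhs_right_gt (0 : R)) H).
exists delta => // v v' hv; apply: hd => j.
by rewrite /= in_itv/= -ler_norml.
Qed.

(** Weierstrass approximation in the variables [sin (v j / K)], whose values
    on the cube of half-width [K] determine [v]; Bernstein polynomials keep the
    bound of [f] on the whole space. *)
Lemma trig_poly_approx (f : 'rV[R]_n -> R) (M K e : R) : continuous f ->
  (forall v, `|f v| <= M) -> 0 < K -> 0 < e ->
  exists g, [/\ trig_poly g, forall v, `|g v| <= M &
    forall v, (forall j, `|v 0 j| <= K) -> `|f v - g v| <= e].
Proof.
move=> cf fM K0 e0.
have M0 : 0 <= M by rewrite (le_trans _ (fM 0)).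
have e2 : 0 < e / 2 by rewrite divr_gt0.
have [d1 d10 hd1] := cube_unif_continuous K cf e2.
pose c0 : R := cos ((pi / 2 + 1) / 2) ^+ 2.
have c00 : 0 < c0.
  rewrite /c0 exprn_gt0//; apply: cos_gt0_pihalf.
  have pi2 : 2 < pi :> R.
    rewrite lt_neqAle pi_ge2 andbT; apply/eqP => E.
    have := @cos1_gt0 R; have -> : (1 : R) = pi / 2 by rewrite -E divff.
    by rewrite cos_pihalf ltxx.
  by apply/andP; split; lra.
pose d := d1 * c0 / (2 * K).
have d0 : 0 < d by rewrite /d divr_gt0// mulr_gt0.
pose y (j : 'I_n) v := (1 + sin (K^-1 * v 0 j)) / 2.
have y01 j v : 0 <= y j v <= 1.
  rewrite /y; have := sin_max (K^-1 * v 0 j); rewrite ler_norml => /andP[s1 s2].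
  by apply/andP; split; lra.
pose z (x : R) := K * asin (2 * x - 1).
pose F (x : 'I_n -> R) := f (\row_j z (x j)).
pose N := (Num.trunc (4 * M * n%:R / (d ^+ 2 * e))).+1.
have N0 : 0 < N%:R :> R by rewrite ltr0n.
have hN : 4 * M * n%:R / (d ^+ 2 * e) <= N%:R by exact: ltW (truncnS_gt _).
pose w (k : {ffun 'I_n -> 'I_N.+1}) v := \prod_(j < n) bernstein N (k j) (y j v).
pose pt (k : {ffun 'I_n -> 'I_N.+1}) (j : 'I_n) : R := (k j)%:R / N%:R.
pose g v := \sum_(k : {ffun 'I_n -> 'I_N.+1}) F (pt k) * w k v.
have w0 k v : 0 <= w k v.
  by apply: prodr_ge0 => j _; exact: bernstein_ge0.
have sumw v : \sum_(k : {ffun 'I_n -> 'I_N.+1}) w k v = 1.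
  rewrite /w -(bigA_distr_bigA (fun j (i : 'I_N.+1) => bernstein N i (y j v))).
  by rewrite big1// => j _; exact: sum_bernstein.
have var v (j : 'I_n) :
    \sum_(k : {ffun 'I_n -> 'I_N.+1}) (pt k j - y j v) ^+ 2 * w k v <= N%:R^-1.
  pose G (j' : 'I_n) (i : 'I_N.+1) : R :=
    (if j' == j then (i%:R / N%:R - y j v) ^+ 2 else 1) * bernstein N i (y j' v).
  have -> : \sum_(k : {ffun 'I_n -> 'I_N.+1}) (pt k j - y j v) ^+ 2 * w k v =
      \sum_(k : {ffun 'I_n -> 'I_N.+1}) \prod_(j' < n) G j' (k j').
    apply: eq_bigr => k _; rewrite /w (bigD1 j)//= [RHS](bigD1 j)//= /G eqxx.
    rewrite mulrA; congr (_ * _); apply: eq_bigr => j' /negbTE ->.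
    by rewrite mul1r.
  rewrite -(bigA_distr_bigA G) (bigD1 j)//= [X in _ * X]big1 ?mulr1.
    rewrite (eq_bigr (fun i : 'I_N.+1 =>
        (i%:R / N%:R - y j v) ^+ 2 * bernstein N i (y j v))).
      exact: bernstein_variance.
    by move=> i _; rewrite /G eqxx.
  move=> j' /negbTE j'j; rewrite /G j'j.
  by under eq_bigr do rewrite mul1r; exact: sum_bernstein.
exists g; split.
- apply: trig_poly_sum => k; apply: trig_polyZ; apply: trig_poly_prod => j.
  have ty : trig_poly (y j).
    have t := trig_polyZ 2^-1 (trig_polyD (trig_poly_cst 1) (trig_poly_sin K^-1 j)).
    by apply: trig_poly_eq t _ => v; rewrite /y mulrC.
  apply: trig_polyZ; apply: trig_polyM; apply: trig_polyX => //.
  have t := trig_polyD (trig_poly_cst 1) (trig_polyZ (- 1) ty).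
  by apply: trig_poly_eq t _ => v; rewrite mulN1r.
- move=> v; rewrite /g (le_trans (ler_norm_sum _ _ _))//.
  apply: (@le_trans _ _ (\sum_(k : {ffun 'I_n -> 'I_N.+1}) M * w k v)).
    apply: ler_sum => k _; rewrite normrM (ger0_norm (w0 k v)).
    by apply: ler_wpM2r; [exact: w0|exact: fM].
  by rewrite -mulr_sumr sumw mulr1.
move=> v hv.
have hw j : `|K^-1 * v 0 j| <= 1.
  by rewrite normrM gtr0_norm ?invr_gt0// ler_pdivrMl// mulr1.
have close k : `|f v - F (pt k)| <=
    e / 2 + 2 * M / d ^+ 2 * \sum_(j < n) (pt k j - y j v) ^+ 2.
  have S0 : 0 <= \sum_(j < n) (pt k j - y j v) ^+ 2.
    by apply: sumr_ge0 => j _; exact: sqr_ge0.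
  have Md : 0 <= 2 * M / d ^+ 2 by rewrite divr_ge0 ?sqr_ge0// mulr_ge0.
  have [near_|/existsNP[j /negP]] := pselect (forall j, `|pt k j - y j v| <= d).
    apply: (@le_trans _ _ (e / 2)); last by rewrite lerDl mulr_ge0.
    apply: hd1 => // j; rewrite mxE /z.
    have p01 : -1 <= 2 * pt k j - 1 <= 1.
      have : pt k j <= 1 by rewrite /pt ler_pdivrMr// mul1r ler_nat -ltnS ltn_ord.
      have : 0 <= pt k j by rewrite divr_ge0.
      by move=> ? ?; apply/andP; split; lra.
    set a := asin _.
    have sa : sin a = 2 * pt k j - 1 by rewrite /a asinK// in_itv.
    have ha : `|a| <= pi / 2.
      by rewrite ler_norml asin_geNpi2//= asin_lepi2.
    have := sin_expansive ha (hw j); rewrite -/c0 sa => hs.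
    have E : 2 * pt k j - 1 - sin (K^-1 * v 0 j) = 2 * (pt k j - y j v).
      by rewrite /y; field.
    rewrite E normrM (@ger0_norm _ 2)// in hs.
    have -> : v 0 j - K * a = - (K * (a - K^-1 * v 0 j)).
      by field; rewrite gt_eqF.
    rewrite normrN normrM (gtr0_norm K0) -ler_pdivlMl//.
    rewrite -(ler_pM2l c00) (le_trans hs)//.
    have -> : c0 * (K^-1 * d1) = 2 * d by rewrite /d; field; rewrite gt_eqF.
    by rewrite ler_pM2l.
  (* One coordinate is far, and the quadratic term dominates. *)
  rewrite -ltNge => far.
  rewrite (le_trans (ler_normB _ _))// (le_trans (lerD (fM _) (fM _)))//.
  have h1 : d ^+ 2 <= (pt k j - y j v) ^+ 2.
    rewrite -[leRHS]real_normK ?num_real// ler_sqr ?nnegrE ?ltW//.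
    exact: lt_trans far.
  have h2 : (pt k j - y j v) ^+ 2 <= \sum_(j < n) (pt k j - y j v) ^+ 2.
    by rewrite (bigD1 j)//= lerDl; apply: sumr_ge0 => i _; exact: sqr_ge0.
  have : 2 * M / d ^+ 2 * d ^+ 2 <=
      2 * M / d ^+ 2 * \sum_(j < n) (pt k j - y j v) ^+ 2.
    by rewrite ler_wpM2l// (le_trans h1).
  rewrite divfK ?gt_eqF ?exprn_gt0//; lra.
have -> : f v - g v = \sum_(k : {ffun 'I_n -> 'I_N.+1}) (f v - F (pt k)) * w k v.
  by under eq_bigr do rewrite mulrBl; rewrite sumrB -mulr_sumr sumw mulr1.
rewrite (le_trans (ler_norm_sum _ _ _))//.
apply: (@le_trans _ _ (\sum_(k : {ffun 'I_n -> 'I_N.+1})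
   (e / 2 * w k v + 2 * M / d ^+ 2 * \sum_(j < n) (pt k j - y j v) ^+ 2 * w k v))).
  apply: ler_sum => k _; rewrite normrM (ger0_norm (w0 k v)).
  by rewrite -mulr_suml mulrA -mulrDl; apply: ler_wpM2r; [exact: w0|exact: close].
rewrite big_split/= -!mulr_sumr sumw mulr1 exchange_big/=.
have h1 : \sum_(j < n) \sum_(k : {ffun 'I_n -> 'I_N.+1})
    (pt k j - y j v) ^+ 2 * w k v <= n%:R * N%:R^-1.
  rewrite (le_trans (ler_sum _ (fun j _ => var v j)))//.
  by rewrite sumr_const card_ord mulr_natl.
have Md : 0 <= 2 * M / d ^+ 2 by rewrite divr_ge0 ?sqr_ge0// mulr_ge0.
have h2 := ler_wpM2l Md h1.
have h3 : 2 * M / d ^+ 2 * (n%:R * N%:R^-1) <= e / 2.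
  rewrite mulrA ler_pdivrMr//.
  have h4 : 4 * M * n%:R / (d ^+ 2 * e) * (e / 2) <= N%:R * (e / 2).
    by rewrite ler_wpM2r// ltW.
  have -> : 2 * M / d ^+ 2 * n%:R = 4 * M * n%:R / (d ^+ 2 * e) * (e / 2).
    by field; rewrite !gt_eqF.
  by rewrite [e / 2 * _]mulrC.
lra.
Qed.

End trigonometric_polynomials.

Section weak_convergence.
Context {R : realType}.

Lemma trig_poly_measurable (n : nat) (g : 'rV[R]_n -> R) d (T : measurableType d)
    (U : 'I_n -> T -> R) : trig_poly g -> (forall j, measurable_fun setT (U j)) ->
  measurable_fun setT (fun w => g (\row_j U j w)).
Proof.
move=> tg mU; elim: tg => {g} [a th|c g1 g2 _ m1 _ m2].
  apply: measurable_cos_comp; apply: measurable_funD => //.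
  apply: measurable_sum => j; apply: measurable_funM => //.
  by under eq_fun do rewrite mxE; exact: mU.
by apply: measurable_funD => //; exact: measurable_funM.
Qed.

Lemma trig_poly_bounded (n : nat) (g : 'rV[R]_n -> R) : trig_poly g ->
  exists B, forall v, `|g v| <= B.
Proof.
move=> tg; elim: tg => {g} [a th|c g1 g2 _ [B1 h1] _ [B2 h2]].
  by exists 1 => v; exact: cos_max.
exists (`|c| * B1 + B2) => v; rewrite (le_trans (ler_normD _ _))// lerD//.
by rewrite normrM ler_wpM2l.
Qed.

Lemma continuous_row_measurable (n : nat) (f : 'rV[R]_n -> R) (M : R)
    d (T : measurableType d) (U : 'I_n -> T -> R) : continuous f ->
  (forall v, `|f v| <= M) -> (forall j, measurable_fun setT (U j)) ->
  measurable_fun setT (fun w => f (\row_j U j w)).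
Proof.
move=> cf fM mU.
have /choice[g Pg] : forall k : nat, exists g : 'rV[R]_n -> R,
    [/\ trig_poly g, forall v : 'rV[R]_n, `|g v| <= M &
    forall v : 'rV[R]_n, (forall j, `|v 0 j| <= k.+1%:R) -> `|f v - g v| <= k.+1%:R^-1].
  by move=> k; apply: trig_poly_approx => //; rewrite ?invr_gt0.
apply: (@measurable_fun_cvg _ _ _ _ (fun k w => g k (\row_j U j w))).
  by move=> k; apply: trig_poly_measurable => //; case: (Pg k).
move=> w _; apply/cvgrPdist_le => e e0.
exists (Num.trunc (e^-1 + \sum_(j < n) `|U j w|)).+1 => // k /= hk.
have hk' : e^-1 + \sum_(j < n) `|U j w| <= k.+1%:R.
  rewrite (le_trans (ltW (truncnS_gt _)))// ler_nat.
  exact: leq_trans hk (leqnSn _).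
have S0 : 0 <= \sum_(j < n) `|U j w| by apply: sumr_ge0.
have ei : 0 < e^-1 by rewrite invr_gt0.
have [_ _ h] := Pg k; rewrite (le_trans (h _ _))//.
  move=> j; rewrite mxE (le_trans _ hk')// (bigD1 j)//= addrCA lerDl.
  by apply: addr_ge0; [exact: ltW|exact: sumr_ge0].
rewrite invf_ple ?posrE//; lra.
Qed.

(** Fatou's lemma for [2 m^2 (1 - cos (Z / m))], which increases to [Z^2]. *)
Lemma second_moment_of_cos d (T : measurableType d) (P : probability T R)
    d' (T' : measurableType d') (P' : probability T' R)
    (Y : nat -> T -> R) (Z : T' -> R) (C : R) :
  (forall k, measurable_fun setT (Y k)) -> measurable_fun setT Z ->
  (forall k, (\int[P]_w (Y k w ^+ 2)%:E <= C%:E)%E) ->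
  (forall u : R, \int[P]_w cos (u * Y k w) @[k --> \oo] -->
    \int[P']_w cos (u * Z w)) ->
  (\int[P']_w (Z w ^+ 2)%:E <= C%:E)%E.
Proof.
move=> mY mZ hY hcos.
pose q (m : nat) (x : R) := 2 * m.+1%:R ^+ 2 * (1 - cos (m.+1%:R^-1 * x)).
have q0 m x : 0 <= q m x.
  have /andP[h _] := one_sub_cos_le (m.+1%:R^-1 * x).
  by rewrite mulr_ge0// mulr_ge0// sqr_ge0.
have qle m x : q m x <= x ^+ 2.
  have /andP[_ h] := one_sub_cos_le (m.+1%:R^-1 * x).
  have m0 : 0 <= 2 * m.+1%:R ^+ 2 :> R by rewrite mulr_ge0// sqr_ge0.
  have := ler_wpM2l m0 h; rewrite -/(q m x) => /le_trans; apply.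
  by rewrite le_eqVlt; apply/orP; left; apply/eqP; field; rewrite gt_eqF.
have mq d1 (T1 : measurableType d1) (U : T1 -> R) m : measurable_fun setT U ->
    measurable_fun setT (fun w => q m (U w)).
  move=> mU; apply: measurable_funM => //; apply: measurable_funB => //.
  by apply: measurable_cos_comp; exact: measurable_funM.
have Eq d1 (T1 : measurableType d1) (P1 : probability T1 R) (U : T1 -> R) m :
    measurable_fun setT U -> \int[P1]_w q m (U w) =
    2 * m.+1%:R ^+ 2 * (1 - \int[P1]_w cos (m.+1%:R^-1 * U w)) /\
    P1.-integrable setT (EFin \o (fun w => q m (U w))).
  move=> mU.
  have i1 : P1.-integrable setT (EFin \o (cst 1 : T1 -> R)).
    exact: finite_measure_integrable_cst.
  have ic : P1.-integrable setT (EFin \o (fun w => cos (m.+1%:R^-1 * U w))).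
    apply: (@integrable_bounded _ _ _ P1 _ 1) => [|w]; last exact: cos_max.
    by apply: measurable_cos_comp; exact: measurable_funM.
  have iB := integrable_EFinB measurableT i1 ic.
  split; last exact: integrable_EFinZ.
  by rewrite RintegralZl// RintegralB// Rintegral_probability_cst.
have qC m : (\int[P']_w (q m (Z w))%:E <= C%:E)%E.
  have [E1 i1] := Eq _ _ P' Z m mZ.
  rewrite -[leLHS]fineK ?(integrable_fin_num _ i1)// lee_fin.
  rewrite -[fine _]/(\int[P']_w (q m (Z w))) E1.
  have cv : 2 * m.+1%:R ^+ 2 * (1 - \int[P]_w cos (m.+1%:R^-1 * Y k w)) @[k --> \oo] -->
      2 * m.+1%:R ^+ 2 * (1 - \int[P']_w cos (m.+1%:R^-1 * Z w)).
    by apply: cvgMl_tmp; apply: cvgB; [exact: cvg_cst|exact: hcos].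
  rewrite -(cvg_lim _ cv)//; apply: limr_le; first by apply/cvg_ex; eexists; exact: cv.
  apply: nearW => k; have [E2 i2] := Eq _ _ P (Y k) m (mY k).
  rewrite -E2; have [i3 le3] := integrable_sqr_lty (mY k) (hY k).
  by rewrite (le_trans _ le3)//; apply: le_Rintegral.
have fat := @fatou _ _ _ P' setT measurableT (fun m => EFin \o (fun w => q m (Z w))).
apply: (@le_trans _ _ (limn_einf (fun m => \int[P']_w (q m (Z w))%:E)%E)); last first.
  rewrite limn_einf_lim; apply: lime_le; first exact: is_cvg_einfs.
  apply: nearW => m; apply: le_trans (qC m).
  by apply: ereal_inf_lbound; exists m => /=.
apply: le_trans (fat _ _); last 2 first.
- by move=> m; apply/measurable_EFinP; exact: mq.
- by move=> m w _; rewrite lee_fin.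
rewrite le_eqVlt; apply/orP; left; apply/eqP; apply: eq_integral => w _.
apply/esym; have cv : (q m (Z w))%:E @[m --> \oo] --> (Z w ^+ 2)%:E.
  apply/fine_cvgP; split; first exact: nearW.
  apply/cvgrPdist_le => e e0 /=.
  exists (Num.trunc (2 * `|Z w| ^+ 3 / e)).+1 => // m /= hm.
  have m0 : 0 < m.+1%:R :> R by [].
  have h := cos_taylor2_cube (m.+1%:R^-1 * Z w).
  have -> : Z w ^+ 2 - q m (Z w) = 2 * m.+1%:R ^+ 2 *
      (cos (m.+1%:R^-1 * Z w) - 1 + (m.+1%:R^-1 * Z w) ^+ 2 / 2).
    by rewrite /q; field; rewrite gt_eqF.
  have c0 : 0 <= 2 * m.+1%:R ^+ 2 :> R by rewrite mulr_ge0// sqr_ge0.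
  rewrite normrM (ger0_norm c0).
  apply: le_trans (ler_wpM2l c0 h) _.
  rewrite normrM (gtr0_norm (_ : 0 < m.+1%:R^-1)) ?invr_gt0//.
  have -> : 2 * m.+1%:R ^+ 2 * (m.+1%:R^-1 * `|Z w|) ^+ 3 = 2 * `|Z w| ^+ 3 / m.+1%:R.
    by field; rewrite gt_eqF.
  rewrite ler_pdivrMr// [e * _]mulrC -ler_pdivrMr// (le_trans (ltW (truncnS_gt _)))//.
  by rewrite ler_nat; apply: leq_trans hm (leqnSn _).
rewrite is_cvg_limn_einfE; last by apply/cvg_ex; eexists; exact: cv.
exact/cvg_lim.
Qed.

(** Convergence of the cosine transforms determines the weak limit once second
    moments are bounded: these control [f] off the cube where it is compared
    with a trigonometric polynomial. *)
Lemma weak_cvg_of_cos (n : nat) d (T : measurableType d) (P : probability T R)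
    d' (T' : measurableType d') (P' : probability T' R)
    (Y : nat -> 'I_n -> T -> R) (Z : 'I_n -> T' -> R) (C : R) :
  (forall k j, measurable_fun setT (Y k j)) -> (forall j, measurable_fun setT (Z j)) ->
  (forall k j, (\int[P]_w (Y k j w ^+ 2)%:E <= C%:E)%E) ->
  (forall (theta : 'I_n -> R) (a : R),
    \int[P]_w cos (a + \sum_(j < n) theta j * Y k j w) @[k --> \oo] -->
    \int[P']_w cos (a + \sum_(j < n) theta j * Z j w)) ->
  forall (f : 'rV[R]_n -> R) (M : R), continuous f -> (forall v, `|f v| <= M) ->
    \int[P]_w f (\row_j Y k j w) @[k --> \oo] --> \int[P']_w f (\row_j Z j w).
Proof.
move=> mY mZ hY hcos f M cf fM.
have hZ j : (\int[P']_w (Z j w ^+ 2)%:E <= C%:E)%E.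
  apply: second_moment_of_cos (fun k => mY k j) (mZ j) (fun k => hY k j) _ => u.
  have E d1 (T1 : measurableType d1) (P1 : probability T1 R) (U : 'I_n -> T1 -> R) :
      \int[P1]_w cos (0 + \sum_(i < n) (if i == j then u else 0) * U i w) =
      \int[P1]_w cos (u * U j w).
    apply: eq_Rintegral => w _; rewrite add0r (bigD1 j)//= eqxx big1 ?addr0// => i.
    by move=> /negbTE ->; rewrite mul0r.
  have := hcos (fun i => if i == j then u else 0) 0.
  by rewrite E; under eq_fun do rewrite E.
have M0 : 0 <= M by rewrite (le_trans _ (fM 0)).
have trig_cvg g : trig_poly g ->
    \int[P]_w g (\row_j Y k j w) @[k --> \oo] --> \int[P']_w g (\row_j Z j w).
  elim=> {g} [a th|c g1 g2 t1 h1 t2 h2].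
    have E d1 (T1 : measurableType d1) (P1 : probability T1 R) (U : 'I_n -> T1 -> R) :
        \int[P1]_w cos (a + \sum_(j < n) th j * (\row_j U j w : 'rV_n) 0 j) =
        \int[P1]_w cos (a + \sum_(j < n) th j * U j w).
      apply: eq_Rintegral => w _; congr (cos (a + _)).
      by apply: eq_bigr => j _; rewrite mxE.
    by rewrite E; under eq_fun do rewrite E; exact: hcos.
  have [B1 b1] := trig_poly_bounded t1; have [B2 b2] := trig_poly_bounded t2.
  have E d1 (T1 : measurableType d1) (P1 : probability T1 R) (U : 'I_n -> T1 -> R) :
      (forall j, measurable_fun setT (U j)) ->
      \int[P1]_w (c * g1 (\row_j U j w) + g2 (\row_j U j w)) =
      c * \int[P1]_w g1 (\row_j U j w) + \int[P1]_w g2 (\row_j U j w).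
    move=> mU.
    have i1 : P1.-integrable setT (EFin \o (fun w => g1 (\row_j U j w))).
      by apply: (@integrable_bounded _ _ _ P1 _ B1) => //; exact: trig_poly_measurable.
    have i2 : P1.-integrable setT (EFin \o (fun w => g2 (\row_j U j w))).
      by apply: (@integrable_bounded _ _ _ P1 _ B2) => //; exact: trig_poly_measurable.
    rewrite RintegralD// ?RintegralZl//; exact: integrable_EFinZ.
  rewrite E//; under eq_fun do rewrite E//.
  by apply: cvgD => //; apply: cvgMl_tmp.
apply/cvgrPdist_le => e e0.
pose C' := `|C| + 1.
have C'0 : 0 < C' by rewrite ltr_wpDl.
pose K := 1 + 2 * M * n%:R * C' / (e / 6).
have K1 : 1 <= K.
  by rewrite lerDl divr_ge0 ?mulr_ge0 ?divr_ge0// ltW.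
have K0 : 0 < K by apply: lt_le_trans K1.
have e6 : 0 < e / 6 by rewrite divr_gt0.
have [g [tg gM fg]] := trig_poly_approx cf fM K0 e6.
have dist d1 (T1 : measurableType d1) (P1 : probability T1 R) (U : 'I_n -> T1 -> R) :
    (forall j, measurable_fun setT (U j)) ->
    (forall j, (\int[P1]_w (U j w ^+ 2)%:E <= C%:E)%E) ->
    `|\int[P1]_w f (\row_j U j w) - \int[P1]_w g (\row_j U j w)| <= e / 3.
  move=> mU hU.
  have mf1 : measurable_fun setT (fun w => f (\row_j U j w)).
    exact: continuous_row_measurable cf fM mU.
  have mg1 := trig_poly_measurable tg mU.
  have i1 : P1.-integrable setT (EFin \o (fun w => f (\row_j U j w))).
    exact: (@integrable_bounded _ _ _ P1 _ M).
  have i2 : P1.-integrable setT (EFin \o (fun w => g (\row_j U j w))).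
    exact: (@integrable_bounded _ _ _ P1 _ M).
  have iU j : P1.-integrable setT (EFin \o (fun w => U j w ^+ 2)).
    by have [] := integrable_sqr_lty (mU j) (hU j).
  have iS (l : seq 'I_n) : P1.-integrable setT (EFin \o (fun w => \sum_(j <- l) U j w ^+ 2))
      /\ \int[P1]_w (\sum_(j <- l) U j w ^+ 2) <= (size l)%:R * C'.
    elim: l => [|j l [IH1 IH2]].
      under eq_fun do rewrite big_nil; rewrite Rintegral_probability_cst mul0r; split => //.
      exact: finite_measure_integrable_cst.
    under eq_fun do rewrite big_cons; split; first exact: integrable_EFinD.
    rewrite RintegralD// /= -natr1 mulrDl mul1r addrC lerD//.
    have [_ h] := integrable_sqr_lty (mU j) (hU j).
    by rewrite (le_trans h)// /C' (le_trans (ler_norm _))// lerDl.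
  have [iS1 iS2] := iS (index_enum 'I_n).
  have szE : size (index_enum 'I_n) = n.
    rewrite -[RHS]size_enum_ord; apply/perm_size/uniq_perm => [||i].
    - exact: index_enum_uniq.
    - exact: enum_uniq.
    - by rewrite mem_index_enum mem_enum.
  rewrite szE in iS2.
  have ic : P1.-integrable setT (EFin \o (cst (e / 6) : T1 -> R)).
    exact: finite_measure_integrable_cst.
  have iSZ := integrable_EFinZ measurableT (2 * M / K) iS1.
  rewrite -RintegralB// (le_trans (le_normr_Rintegral _ _))//.
    exact: integrable_EFinB.
  apply: (@le_trans _ _ (\int[P1]_w (e / 6 + 2 * M / K * \sum_(j < n) U j w ^+ 2))).
    apply: le_Rintegral => //.
    - by apply: integrable_norm; exact: integrable_EFinB.
    - exact: (integrable_EFinD measurableT ic iSZ).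
    - move=> w _.
      have S0 (Q : pred 'I_n) : 0 <= \sum_(j < n | Q j) U j w ^+ 2.
        by apply: sumr_ge0 => j _; exact: sqr_ge0.
      have MK0 : 0 <= 2 * M / K.
        by apply: divr_ge0; [exact: mulr_ge0|exact: ltW].
      have [h|/existsNP[j /negP]] := pselect (forall j, `|U j w| <= K).
        rewrite (le_trans (fg _ _))//; first by move=> j; rewrite mxE.
        by rewrite lerDl mulr_ge0.
      rewrite -ltNge => hj.
      rewrite (le_trans (ler_normB _ _))// (le_trans (lerD (fM _) (gM _)))//.
      have h1 : K <= \sum_(j < n) U j w ^+ 2.
        rewrite (bigD1 j)//= (@le_trans _ _ (U j w ^+ 2)) ?lerDl ?S0//.
        rewrite -(@real_normK _ (U j w)) ?num_real// expr2.
        have : 1 * K <= `|U j w| * `|U j w|.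
          by apply: ler_pM; rewrite ?ltW//; apply: le_lt_trans hj.
        by rewrite mul1r.
      have : 2 * M / K * K <= 2 * M / K * \sum_(j < n) U j w ^+ 2 by rewrite ler_wpM2l.
      rewrite divfK ?gt_eqF//; lra.
  rewrite RintegralD// Rintegral_probability_cst RintegralZl//.
  have : 2 * M / K * \int[P1]_w (\sum_(j < n) U j w ^+ 2) <= e / 6.
    apply: (@le_trans _ _ (2 * M / K * (n%:R * C'))).
      apply: ler_wpM2l iS2; apply: divr_ge0; last exact: ltW.
      by rewrite mulr_ge0.
    rewrite mulrAC ler_pdivrMr// mulrA.
    have : 2 * M * n%:R * C' = e / 6 * (2 * M * n%:R * C' / (e / 6)).
      by rewrite [RHS]mulrC divfK// gt_eqF.
    move=> ->; rewrite ler_wpM2l ?ltW// /K; lra.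
  lra.
have /cvgrPdist_le/(_ (e / 3)) := trig_cvg g tg.
have e3 : 0 < e / 3 by rewrite divr_gt0.
move=> /(_ e3) [k0 _ hk0]; exists k0 => // k /= kk0.
have h1 := hk0 k kk0; rewrite /= in h1.
have h2 := dist _ _ _ _ (mY k) (hY k).
have h3 := dist _ _ _ _ mZ hZ.
move: h1 h2 h3; set a := \int[P']_w f _; set b := \int[P]_w f _.
set a' := \int[P']_w g _; set b' := \int[P]_w g _ => h1 h2 h3.
have -> : a - b = (a - a') + (a' - b') - (b - b') by ring.
rewrite (le_trans (ler_normB _ _))// (le_trans (lerD (ler_normD _ _) (lexx _)))//.
lra.
Qed.

End weak_convergence.

(** * The central limit theorem for linear fields *)

Section sums_to.
Context {R : realType} {I : choiceType}.

(** Unconditional summation of a nonnegative family over an infinite index set. *)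
Definition sums_to (c : I -> R) (v : R) : Prop :=
  (forall F : {fset I}, \sum_(s <- F) c s <= v) /\
  (forall eta : R, 0 < eta -> exists F : {fset I}, v - eta <= \sum_(s <- F) c s).

Lemma fset_sum_le (c : I -> R) (F G : {fset I}) : (forall s, 0 <= c s) ->
  (F `<=` G)%fset -> \sum_(s <- F) c s <= \sum_(s <- G) c s.
Proof.
move=> c0 FG; rewrite (big_fsetID _ (fun s => s \in F) G)/=.
have -> : [fset x in G | x \in F]%fset = F.
  by apply/fsetP => s; rewrite !inE/= andbC; case: (boolP (s \in F)) => //= /(fsubsetP FG) ->.
by rewrite lerDl sumr_ge0.
Qed.

End sums_to.

Section independent_moments.
Context {R : realType}.

(** Truncation extends the comparison of integrals from bounded functions to the
    identity. *)
Lemma Rintegral_eq_of_indic_id d1 (T1 : measurableType d1)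
    (m1 : {measure set T1 -> \bar R}) d2 (T2 : measurableType d2)
    (m2 : {measure set T2 -> \bar R}) (X1 : T1 -> R) (X2 : T2 -> R)
    (G1 : T1 -> R) (G2 : T2 -> R) :
  measurable_fun setT X1 -> measurable_fun setT X2 ->
  m1.-integrable setT (EFin \o G1) -> m2.-integrable setT (EFin \o G2) ->
  m1.-integrable setT (EFin \o (fun w => X1 w * G1 w)) ->
  m2.-integrable setT (EFin \o (fun w => X2 w * G2 w)) ->
  (forall A, measurable A ->
    \int[m1]_w (\1_A (X1 w) * G1 w) = \int[m2]_w (\1_A (X2 w) * G2 w)) ->
  \int[m1]_w (X1 w * G1 w) = \int[m2]_w (X2 w * G2 w).
Proof.
move=> mX1 mX2 iG1 iG2 iX1 iX2 AE.
pose clip (n : nat) (x : R) : R := if `|x| <= n%:R then x else 0.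
have mA n : measurable [set x : R | `|x| <= n%:R].
  have -> : [set x : R | `|x| <= n%:R] = (fun x : R => `|x|) @^-1` `]-oo, n%:R].
    by apply/seteqP; split => x /=; rewrite in_itv.
  by rewrite -[X in measurable X]setTI; exact: normr_measurable.
have clipE n : clip n = fun x => x * \1_[set x : R | `|x| <= n%:R] x.
  apply/funext => x; rewrite /clip indicE; case: ifPn => h.
    by rewrite mem_set// mulr1.
  by rewrite memNset ?mulr0//; apply/negP.
have mclip n : measurable_fun setT (clip n).
  rewrite clipE; apply: measurable_funM => //; exact: measurable_indic.
have bclip n x : `|clip n x| <= n%:R.
  by rewrite /clip; case: ifP => //; rewrite normr0.
have lim d (T : measurableType d) (m : {measure set T -> \bar R}) (X G : T -> R) :
    measurable_fun setT X -> m.-integrable setT (EFin \o G) ->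
    m.-integrable setT (EFin \o (fun w => X w * G w)) ->
    \int[m]_w (clip n (X w) * G w) @[n --> \oo] --> \int[m]_w (X w * G w).
  move=> mX iG iXG.
  have mG : measurable_fun setT G by move/measurable_int: iG => /measurable_EFinP.
  have [] := @Rintegral_dominated_cvg _ _ _ m setT
    (fun n w => clip n (X w) * G w) (fun w => X w * G w)
    (fun w => `|X w * G w|) measurableT _ _ _ _ _ => //.
  - by move=> n; apply: measurable_funM => //; exact: measurableT_comp.
  - exact: measurable_funM.
  - apply: aeW => w _; apply/cvgrPdist_le => e e0.
    exists (Num.trunc `|X w|).+1 => // n /= hn.
    rewrite /clip ifT; first by rewrite subrr normr0 ltW.
    by rewrite (le_trans (ltW (truncnS_gt _)))// ler_nat.
  - exact: integrable_norm.
  - move=> n w _; rewrite !normrM ler_wpM2r// /clip.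
    by case: ifP => // _; rewrite normr0.
have h1 := lim _ _ m1 X1 G1 mX1 iG1 iX1.
have h2 := lim _ _ m2 X2 G2 mX2 iG2 iX2.
have E : (fun n => \int[m1]_w (clip n (X1 w) * G1 w)) =
         (fun n => \int[m2]_w (clip n (X2 w) * G2 w)).
  apply/funext => n.
  exact: (Rintegral_eq_of_indic mX1 mX2 iG1 iG2 AE (mclip n) (bclip n)).
by rewrite E in h1; apply: (cvg_unique _ h1 h2).
Qed.

Lemma integrable_of_sqr d (T : measurableType d) (P : probability T R) (X : T -> R) :
  measurable_fun setT X -> P.-integrable setT (EFin \o (fun w => X w ^+ 2)) ->
  P.-integrable setT (EFin \o X).
Proof.
move=> mX iX2.
have i1 : P.-integrable setT (EFin \o (cst 1 : T -> R)).
  exact: finite_measure_integrable_cst.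
apply: (le_integrable measurableT _ _ (integrable_EFinD measurableT i1 iX2)).
  exact/measurable_EFinP.
move=> w _ /=; rewrite lee_fin; have x0 := sqr_ge0 (X w).
rewrite (ger0_norm (addr_ge0 ler01 x0)) -[X w ^+ 2]real_normK ?num_real//.
have := sqr_ge0 (`|X w| - 1); rewrite sqrrB mulr1 expr1n mulr2n.
by have := normr_ge0 (X w); lra.
Qed.

Lemma integrable_mul_of_sqr d (T : measurableType d) (P : probability T R)
    (X Y : T -> R) :
  measurable_fun setT X -> measurable_fun setT Y ->
  P.-integrable setT (EFin \o (fun w => X w ^+ 2)) ->
  P.-integrable setT (EFin \o (fun w => Y w ^+ 2)) ->
  P.-integrable setT (EFin \o (fun w => X w * Y w)).
Proof.
move=> mX mY iX2 iY2.
apply: (le_integrable measurableT _ _ (integrable_EFinD measurableT iX2 iY2)).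
  by apply/measurable_EFinP; exact: measurable_funM.
move=> w _ /=; rewrite lee_fin normrM.
rewrite (ger0_norm (addr_ge0 (sqr_ge0 (X w)) (sqr_ge0 (Y w)))).
rewrite -[X w ^+ 2]real_normK ?num_real// -[Y w ^+ 2]real_normK ?num_real//.
have := sqr_ge0 (`|X w| - `|Y w|); have := mulr_ge0 (normr_ge0 (X w)) (normr_ge0 (Y w)).
by rewrite sqrrB mulr2n; lra.
Qed.

Lemma independent_centered_mul d (T : measurableType d) (P : probability T R)
    (I : choiceType) (X : I -> {RV P >-> R}) (s t : I) :
  mutually_independent X -> s != t ->
  (forall i, P.-integrable setT (EFin \o (fun w => X i w ^+ 2))) ->
  \int[P]_w X t w = 0 -> \int[P]_w (X s w * X t w) = 0.
Proof.
move=> indX st iX2 EX.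
have iX i : P.-integrable setT (EFin \o X i) by exact: integrable_of_sqr.
have i1 (c : R) : P.-integrable setT (EFin \o (cst c : T -> R)).
  exact: finite_measure_integrable_cst.
have mI (A : set R) i : measurable A -> measurable_fun setT (fun w => \1_A (X i w) : R).
  by move=> mA; exact: measurable_indic_comp.
have bI (A : set R) x : `|(\1_A x : R)| <= 1.
  by rewrite indicE; case: (_ \in _); rewrite ?normr1 ?normr0.
have iI (A : set R) i : measurable A ->
    P.-integrable setT (EFin \o (fun w => \1_A (X i w) : R)).
  by move=> mA; apply: (@integrable_bounded _ _ _ P _ 1) => //; exact: mI.
have step (A : set R) : measurable A -> \int[P]_w (\1_A (X s w) * X t w) = 0.
  move=> mA; pose c := \int[P]_w (\1_A (X s w) : R).
  transitivity (\int[P]_w (X t w * \1_A (X s w))).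
    by apply: eq_Rintegral => w _; rewrite mulrC.
  transitivity (\int[P]_w (X t w * cst c w)); last first.
    by rewrite RintegralZr// EX mul0r.
  have ist : P.-integrable setT (EFin \o (fun w => X t w * \1_A (X s w))).
    have := @integrable_bounded_mul _ _ _ P _ _ 1 (mI A s mA) (fun w => bI A _) (iX t).
    by apply: eq_integrable => // w _ /=; rewrite mulrC.
  have istc : P.-integrable setT (EFin \o (fun w => X t w * cst c w)).
    have := integrable_EFinZ measurableT c (iX t).
    by apply: eq_integrable => // w _ /=; rewrite mulrC.
  apply: Rintegral_eq_of_indic_id => //; first exact: iI.
  move=> B mB; rewrite /= RintegralZr//; last exact: iI.
  pose f i := if i == s then \1_A else (\1_B : R -> R).
  have mf i : measurable_fun setT (f i).
    by rewrite /f; case: ifP => _; exact: measurable_indic.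
  have fb i x : `|f i x| <= 1 by rewrite /f; case: ifP => _; exact: bI.
  have ust : uniq [:: t; s] by rewrite /= inE eq_sym st.
  have := mutually_independent_prod indX ust mf fb.
  rewrite !big_cons big_nil mulr1 /f eqxx eq_sym (negbTE st) => <-.
  by apply: eq_Rintegral => w _; rewrite !big_cons big_nil mulr1 eqxx eq_sym (negbTE st).
transitivity (\int[P]_w (X s w * cst 0 w)); last first.
  by rewrite RintegralZr// mulr0.
apply: Rintegral_eq_of_indic_id => //.
- exact: integrable_mul_of_sqr.
- have := integrable_EFinZ measurableT 0 (iX s).
  by apply: eq_integrable => // w _ /=; rewrite mulrC.
- move=> A mA; rewrite step//= RintegralZr ?mulr0//; exact: iI.
Qed.

End independent_moments.

Section linear_fields.
Context {R : realType} d (T : measurableType d) (P : probability T R).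
Variables (b : int * int -> R) (eps X : int * int -> {RV P >-> R}).
Hypothesis hA : assumptionA eps.
Hypothesis hX : linear_field b eps X.

Let indeps : mutually_independent eps. Proof. by case: hA. Qed.

Let eps_sqr s : P.-integrable setT (EFin \o (fun w => eps s w ^+ 2)) /\
  \int[P]_w (eps s w ^+ 2) = 1.
Proof.
case: hA => _ iid _ E2.
have msq : measurable_fun setT (fun x : R => (x ^+ 2)%:E).
  by apply/measurable_EFinP; exact: exprn_measurable.
have E s' : (\int[P]_w (eps s' w ^+ 2)%:E = \int[distribution P (eps s')]_x (x ^+ 2)%:E)%E.
  by rewrite ge0_integral_distribution// => x; rewrite lee_fin sqr_ge0.
have E1 : (\int[P]_w (eps s w ^+ 2)%:E = 1)%E.
  rewrite E; transitivity (\int[distribution P (eps 0%R)]_x (x ^+ 2)%:E)%E.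
    by apply: eq_measure_integral => A mA _; exact: iid.
  rewrite -E -E2 unlock; apply: eq_integral => w _.
  by rewrite real_normK// num_real.
have [||i _] := @integrable_sqr_lty R _ T P (eps s) 1 => //.
  by rewrite E1.
by split => //; rewrite /Rintegral E1.
Qed.

Let eps_int s : P.-integrable setT (EFin \o eps s).
Proof. by apply: integrable_of_sqr => //; case: (eps_sqr s). Qed.

Let eps_indic s A : measurable A ->
  \int[P]_w (\1_A (eps s w) * cst 1 w) = \int[P]_w (\1_A (eps 0 w) * cst 1 w).
Proof.
move=> mA; case: hA => _ iid _ _.
have E s' : \int[P]_w (\1_A (eps s' w) * cst 1 w) = fine (distribution P (eps s') A).
  rewrite /Rintegral (eq_integral (EFin \o \1_(eps s' @^-1` A))); last first.
    by move=> w _ /=; rewrite mulr1.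
  rewrite integral_indic// ?setIT//.
  by rewrite -[X in measurable X]setTI; exact: measurable_funP.
by rewrite !E (iid s 0 A mA).
Qed.

Let i1 : P.-integrable setT (EFin \o (cst 1 : T -> R)).
Proof. exact: finite_measure_integrable_cst. Qed.

Let eps_mean s : \int[P]_w eps s w = 0.
Proof.
have E (s' : int * int) : \int[P]_w eps s' w = \int[P]_w (eps s' w * cst 1 w).
  by apply: eq_Rintegral => w _; rewrite mulr1.
have i s' : P.-integrable setT (EFin \o (fun w => eps s' w * cst 1 w)).
  by have := eps_int s'; apply: eq_integrable => // w _ /=; rewrite mulr1.
transitivity (\int[P]_w eps 0 w).
  rewrite !E; apply: Rintegral_eq_of_indic_id => //; exact: eps_indic.
by case: hA => _ _ + _; rewrite unlock => /(congr1 fine).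
Qed.

Let eps_characteristic (eta : R) : 0 < eta ->
  exists2 delta : R, 0 < delta & forall s c, `|c| <= delta ->
    `|\int[P]_w cos (c * eps s w) - expR (- (c ^+ 2 / 2))| +
    `|\int[P]_w sin (c * eps s w)| <= eta * c ^+ 2.
Proof.
move=> eta0; have [i E] := eps_sqr 0.
have [delta d0 h] := characteristic_small (eps_int 0) i (eps_mean 0) E eta0.
exists delta => // s c hc; have := h c hc.
have tr (g : R -> R) : continuous g -> (forall x, `|g x| <= 1) ->
    \int[P]_w g (c * eps s w) = \int[P]_w g (c * eps 0 w).
  move=> cg gb.
  have E1 s' : \int[P]_w g (c * eps s' w) = \int[P]_w (g (c * eps s' w) * cst 1 w).
    by apply: eq_Rintegral => w _; rewrite mulr1.
  rewrite !E1; apply: (Rintegral_eq_of_indic (f := fun x => g (c * x)) (M := 1)) => //.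
    exact: eps_indic.
  apply: continuous_measurable_fun => x; apply: (@continuous_comp _ _ _ ( *%R c) g).
    exact: mulrl_continuous.
  exact: cg.
rewrite (tr cos (@continuous_cos R))//; last exact: cos_max.
by rewrite (tr sin (@continuous_sin R))//; exact: sin_max.
Qed.

Let noise (D : int * int -> R) (F : {fset int * int}) w := \sum_(s <- F) D s * eps s w.

Let mnoise D F : measurable_fun setT (noise D F).
Proof. exact: (@measurable_lincomb _ _ _ P _ eps). Qed.

Let noise_sqr D (F : {fset int * int}) :
  P.-integrable setT (EFin \o (fun w => noise D F w ^+ 2)) /\
  \int[P]_w (noise D F w ^+ 2) = \sum_(s <- F) D s ^+ 2.
Proof.
rewrite /noise; have := fset_uniq F; elim: (F : seq _) => [_|s l IH].
  under eq_fun do rewrite big_nil expr0n; rewrite big_nil.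
  rewrite Rintegral_probability_cst; split => //.
  exact: finite_measure_integrable_cst.
move=> /= /andP[sl ul]; have [IH1 IH2] := IH ul; have [is_ Es] := eps_sqr s.
pose U w := \sum_(t <- l) D t * eps t w.
have mU : measurable_fun setT U by exact: (@measurable_lincomb _ _ _ P _ eps).
have isU (l' : seq (int * int)) : s \notin l' ->
    P.-integrable setT (EFin \o (fun w => \sum_(t <- l') D t * (eps s w * eps t w))) /\
    \int[P]_w (\sum_(t <- l') D t * (eps s w * eps t w)) = 0.
  elim: l' => [_|t l' IH'].
    under eq_fun do rewrite big_nil; rewrite Rintegral_probability_cst; split => //.
    exact: finite_measure_integrable_cst.
  rewrite inE negb_or => /andP[st sl']; have [h1 h2] := IH' sl'.
  have ist : P.-integrable setT (EFin \o (fun w => eps s w * eps t w)).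
    by apply: integrable_mul_of_sqr => //; exact: (proj1 (eps_sqr _)).
  have istZ := integrable_EFinZ measurableT (D t) ist.
  under eq_fun do rewrite big_cons; split; first exact: integrable_EFinD.
  rewrite RintegralD// h2 RintegralZl// independent_centered_mul ?mulr0 ?addr0//.
  by move=> i; case: (eps_sqr i).
have [isl Esl] := isU l sl.
have E w : (D s * eps s w + U w) ^+ 2 =
    D s ^+ 2 * eps s w ^+ 2 + U w ^+ 2 +
    2 * D s * \sum_(t <- l) D t * (eps s w * eps t w).
  have -> : \sum_(t <- l) D t * (eps s w * eps t w) = eps s w * U w.
    by rewrite mulr_sumr; apply: eq_bigr => t _; ring.
  by ring.
have E' : (fun w => (\sum_(t <- s :: l) D t * eps t w) ^+ 2) =
    (fun w => D s ^+ 2 * eps s w ^+ 2 + U w ^+ 2 +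
    2 * D s * \sum_(t <- l) D t * (eps s w * eps t w)).
  by apply/funext => w; rewrite big_cons E.
rewrite E'.
have a1 := integrable_EFinZ measurableT (D s ^+ 2) is_.
have a2 := integrable_EFinZ measurableT (2 * D s) isl.
have a3 := integrable_EFinD measurableT a1 IH1.
split; first exact: integrable_EFinD.
by rewrite RintegralD// RintegralD// !RintegralZl// Es Esl IH2 big_cons; ring.
Qed.

Let lin (S : {fset int * int}) (e : int * int -> R) w := \sum_(t <- S) e t * X t w.
Let coef (S : {fset int * int}) (e : int * int -> R) s := \sum_(t <- S) e t * b (t - s).

Let mlin S e : measurable_fun setT (lin S e).
Proof. exact: (@measurable_lincomb _ _ _ P _ X). Qed.

Let lin_approx S e (delta : R) : 0 < delta ->
  exists F0 : {fset int * int}, forall F : {fset int * int}, (F0 `<=` F)%fset ->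
    (\int[P]_w ((lin S e w - noise (coef S e) F w) ^+ 2)%:E <= (delta ^+ 2)%:E)%E.
Proof.
rewrite /lin /coef /noise; elim: (S : seq _) delta => [|t l IH] delta d0.
  exists fset0 => F _; rewrite integral0_eq ?lee_fin ?sqr_ge0// => w _.
  rewrite big_nil big1 ?subrr ?expr0n// => s _; by rewrite big_nil mul0r.
have [F1 h1] := IH (delta / 2) (divr_gt0 d0 (ltr0Sn R 1)).
pose c := e t ^+ 2 + 1.
have c0 : 0 < c by rewrite ltr_wpDl ?sqr_ge0.
have [F2 h2] := hX t (divr_gt0 (exprn_gt0 2 d0) (mulr_gt0 (ltr0Sn R 3) c0)).
exists (F1 `|` F2)%fset => F; rewrite fsubUset => /andP[/h1 {}h1 /h2 {}h2].
pose Y w := X t w - \sum_(s <- F) b (t - s) * eps s w.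
pose Z w := \sum_(t <- l) e t * X t w -
  \sum_(s <- F) (\sum_(t <- l) e t * b (t - s)) * eps s w.
have mY : measurable_fun setT Y.
  by apply: measurable_funB => //; exact: (@measurable_lincomb _ _ _ P _ eps).
have mZ : measurable_fun setT Z.
  by apply: measurable_funB; exact: measurable_lincomb.
have E w : (\sum_(t <- t :: l) e t * X t w -
    \sum_(s <- F) (\sum_(t <- t :: l) e t * b (t - s)) * eps s w) ^+ 2 <=
    2 * e t ^+ 2 * Y w ^+ 2 + 2 * Z w ^+ 2.
  under [X in (_ - X) ^+ 2]eq_bigr do rewrite big_cons mulrDl -mulrA.
  rewrite big_cons big_split/= -mulr_sumr.
  rewrite (_ : _ - _ = e t * Y w + Z w); last by rewrite /Y /Z; ring.
  rewrite -subr_ge0.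
  have -> : 2 * e t ^+ 2 * Y w ^+ 2 + 2 * Z w ^+ 2 - (e t * Y w + Z w) ^+ 2 =
     (e t * Y w - Z w) ^+ 2 by ring.
  exact: sqr_ge0.
rewrite unlock in h2.
apply: (@le_trans _ _ (\int[P]_w ((2 * e t ^+ 2 * Y w ^+ 2)%:E + (2 * Z w ^+ 2)%:E))%E).
  apply: ge0_le_integral => //.
  - by move=> w _; rewrite lee_fin sqr_ge0.
  - apply/measurable_EFinP; apply: measurable_funX; apply: measurable_funB;
      exact: measurable_lincomb.
  - by apply: emeasurable_funD; apply/measurable_EFinP; apply: measurable_funM => //;
      exact: measurable_funX.
  - by move=> w _; rewrite -EFinD lee_fin E.
have [iY leY] := integrable_sqr_lty mY h2.
have [iZ leZ] := integrable_sqr_lty mZ h1.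
have e2 : 0 <= 2 * e t ^+ 2 by rewrite mulr_ge0 ?sqr_ge0.
have jY := integrable_EFinZ measurableT (2 * e t ^+ 2) iY.
have jZ := integrable_EFinZ measurableT 2 iZ.
rewrite -[leLHS]fineK; last first.
  exact: (integrable_fin_num measurableT (integrable_EFinD measurableT jY jZ)).
rewrite lee_fin -[leLHS]/(\int[P]_w (2 * e t ^+ 2 * Y w ^+ 2 + 2 * Z w ^+ 2)).
rewrite RintegralD// !RintegralZl//.
have l1 := ler_wpM2l e2 leY; have l2 := ler_wpM2l (ler0n R 2) leZ.
have l3 : 2 * e t ^+ 2 * (delta ^+ 2 / (4 * c)) <= delta ^+ 2 / 2.
  have -> : 2 * e t ^+ 2 * (delta ^+ 2 / (4 * c)) = e t ^+ 2 / c * (delta ^+ 2 / 2).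
    by field; rewrite gt_eqF.
  rewrite ler_piMl ?divr_ge0 ?sqr_ge0// ler_pdivrMr// mul1r /c lerDl//.
have : 2 * (delta / 2) ^+ 2 = delta ^+ 2 / 2 by field.
lra.
Qed.

Let lin_cos (eta : R) : 0 < eta -> exists2 delta0 : R, 0 < delta0 &
  forall S e (v a : R), sums_to (fun s => coef S e s ^+ 2) v ->
    (forall s, `|coef S e s| <= delta0) ->
    `|\int[P]_w cos (a + lin S e w) - expR (- (v / 2)) * cos a| <= eta * v.
Proof.
move=> eta0; have [delta0 d00 hch] := eps_characteristic eta0.
exists delta0 => // S e v a [vub vlub] small.
apply/ler_addgt0Pr => k k0.
have k2 : 0 < k / 2 by rewrite divr_gt0.
have [F0 hF0] := lin_approx S e k2; have [F1 hF1] := vlub _ k2.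
pose F := (F0 `|` F1)%fset; pose D := coef S e.
have h1 := Rintegral_cos_dist_le a (mlin S e) (mnoise D F) k2 (hF0 F (fsubsetUl _ _)).
have D2 s : 0 <= D s ^+ 2 by exact: sqr_ge0.
have h2 := @cos_sum_independent R _ T P _ eps F D (fun s => D s ^+ 2)
  (fun s => eta * D s ^+ 2) a indeps (fset_uniq _) D2
  (fun s _ => hch s (D s) (small s)).
rewrite -mulr_sumr in h2.
set VF := \sum_(s <- F) D s ^+ 2 in h2.
have VFv : VF <= v by exact: vub.
have vVF : v - k / 2 <= VF.
  by rewrite (le_trans hF1)//; apply: fset_sum_le => //; exact: fsubsetUr.
have VF0 : 0 <= VF by apply: sumr_ge0.
have v0 : 0 <= v by rewrite (le_trans VF0).
have h3 := expRN_lipschitz (divr_ge0 VF0 (ler0n R 2)) (divr_ge0 v0 (ler0n R 2)).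
have h4 : `|(expR (- (VF / 2)) - expR (- (v / 2))) * cos a| <= k / 4.
  rewrite normrM (@le_trans _ _ `|expR (- (VF / 2)) - expR (- (v / 2))|)//.
    by rewrite ler_piMr// cos_max.
  rewrite (le_trans h3)// -mulrBl normrM (@ger0_norm _ 2^-1)//.
  by rewrite distrC ger0_norm ?subr_ge0//; lra.
have h5 : eta * VF <= eta * v by rewrite ler_wpM2l// ltW.
set A := \int[P]_w cos (a + lin S e w) in h1 *.
set B := \int[P]_w cos (a + noise D F w) in h1.
have -> : A - expR (- (v / 2)) * cos a = (A - B) +
    ((B - expR (- (VF / 2)) * cos a) +
     (expR (- (VF / 2)) - expR (- (v / 2))) * cos a) by ring.
rewrite (le_trans (ler_normD _ _))//.
have := ler_normD (B - expR (- (VF / 2)) * cos a)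
  ((expR (- (VF / 2)) - expR (- (v / 2))) * cos a).
have h2' : `|B - expR (- (VF / 2)) * cos a| <= eta * VF by exact: h2.
lra.
Qed.

Let lin_sqr S e (v : R) : sums_to (fun s => coef S e s ^+ 2) v ->
  (\int[P]_w (lin S e w ^+ 2)%:E <= (2 * v + 2)%:E)%E.
Proof.
move=> [vub _]; have [F hF] := lin_approx S e ltr01.
have {}hF := hF F (fsubset_refl _); rewrite expr1n in hF.
pose D := coef S e.
have [iN EN] := noise_sqr D F.
have mD : measurable_fun setT (fun w => lin S e w - noise D F w).
  exact: measurable_funB.
have [iD leD] := integrable_sqr_lty mD hF.
have j1 := integrable_EFinZ measurableT 2 iN.
have j2 := integrable_EFinZ measurableT 2 iD.
apply: (@le_trans _ _ (\int[P]_w (2 * noise D F w ^+ 2 +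
    2 * (lin S e w - noise D F w) ^+ 2)%:E)%E).
  apply: ge0_le_integral => //.
  - by move=> w _; rewrite lee_fin sqr_ge0.
  - by apply/measurable_EFinP; exact: measurable_funX.
  - by apply/measurable_EFinP; apply: measurable_funD; apply: measurable_funM => //;
      exact: measurable_funX.
  - move=> w _; rewrite lee_fin; set x := lin _ _ _; set y := noise _ _ _.
    rewrite -subr_ge0.
    by have -> : 2 * y ^+ 2 + 2 * (x - y) ^+ 2 - x ^+ 2 = (x - 2 * y) ^+ 2
      by [ring]; exact: sqr_ge0.
rewrite -[leLHS]fineK; last first.
  exact: (integrable_fin_num measurableT (integrable_EFinD measurableT j1 j2)).
rewrite lee_fin -[leLHS]/(\int[P]_w (2 * noise D F w ^+ 2 +
    2 * (lin S e w - noise D F w) ^+ 2)).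
rewrite RintegralD// !RintegralZl// EN.
have := vub F; rewrite -/D; lra.
Qed.

(** Central limit theorem for arrays of finite linear combinations of the field:
    the coefficients of the innovations are uniformly small and their squares
    sum to an asymptotically constant variance. *)
Theorem linear_field_weak_cvg (n : nat) (S : nat -> 'I_n -> {fset int * int})
    (A : nat -> R) (sigma2 : ('I_n -> R) -> R)
    d' (T' : measurableType d') (P' : probability T' R) (Z : 'I_n -> {RV P' >-> R}) :
  (forall theta, exists2 v : nat -> R,
     forall k, sums_to (fun s => (\sum_(j < n) theta j *
       (A k * \sum_(t <- S k j) b (t - s))) ^+ 2) (v k) &
     v k @[k --> \oo] --> sigma2 theta) ->
  (forall eta : R, 0 < eta -> exists N : nat, forall k, (N <= k)%N -> forall j s,
     `|A k * \sum_(t <- S k j) b (t - s)| <= eta) ->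
  (forall theta a, \int[P']_w cos (a + \sum_(j < n) theta j * Z j w) =
     expR (- (sigma2 theta / 2)) * cos a) ->
  forall (f : 'rV[R]_n -> R) (M : R), continuous f -> (forall v, `|f v| <= M) ->
    \int[P]_w f (\row_j (A k * \sum_(t <- S k j) X t w)) @[k --> \oo] -->
    \int[P']_w f (\row_j Z j w).
Proof.
move=> hv hsmall hZ f M cf fM.
pose e theta k t := \sum_(j < n) theta j * (A k * (t \in S k j)%:R).
pose U k := (\bigcup_(j <- enum 'I_n) S k j)%fset.
have SU k j : (S k j `<=` U k)%fset.
  by apply: bigfcup_sup => //; rewrite mem_enum.
have sumS k j (g : int * int -> R) : \sum_(t <- S k j) g t =
    \sum_(t <- U k) (t \in S k j)%:R * g t.
  rewrite (big_fsetID _ (fun t => t \in S k j) (U k))/=.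
  rewrite [X in _ + X]big_seq [X in _ + X]big1 ?addr0; last first.
    by move=> t; rewrite !inE/= => /andP[_ /negbTE ->]; rewrite mul0r.
  have -> : [fset x in U k | x \in S k j]%fset = S k j.
    apply/fsetP => s; rewrite !inE/= andbC.
    by case: (boolP (s \in S k j)) => //= /(fsubsetP (SU k j)) ->.
  by rewrite big_seq [RHS]big_seq; apply: eq_bigr => t ->; rewrite mul1r.
have combE theta k (g : int * int -> R) :
    \sum_(j < n) theta j * (A k * \sum_(t <- S k j) g t) =
    \sum_(t <- U k) e theta k t * g t.
  under eq_bigr do rewrite sumS mulr_sumr mulr_sumr.
  rewrite exchange_big/=; apply: eq_bigr => t _.
  by rewrite /e mulr_suml; apply: eq_bigr => j _; ring.
have coefE theta k s : coef (U k) (e theta k) s =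
    \sum_(j < n) theta j * (A k * \sum_(t <- S k j) b (t - s)).
  by rewrite combE.
have linE theta k w : lin (U k) (e theta k) w =
    \sum_(j < n) theta j * (A k * \sum_(t <- S k j) X t w).
  by rewrite combE.
have sumsE theta v k : sums_to (fun s => (\sum_(j < n) theta j *
       (A k * \sum_(t <- S k j) b (t - s))) ^+ 2) v ->
    sums_to (fun s => coef (U k) (e theta k) s ^+ 2) v.
  congr sums_to; apply/funext => s; by rewrite coefE.
have unit_sum k j w : A k * \sum_(t <- S k j) X t w =
    lin (U k) (e (fun i => (i == j)%:R) k) w.
  rewrite linE (bigD1 j)//= eqxx mul1r [X in _ + X]big1 ?addr0// => i /negbTE ->.
  by rewrite mul0r.
have mY k j : measurable_fun setT (fun w => A k * \sum_(t <- S k j) X t w).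
  by under eq_fun do rewrite unit_sum; exact: mlin.
have [C hC] : exists C : R, forall k j,
    (\int[P]_w ((A k * \sum_(t <- S k j) X t w) ^+ 2)%:E <= C%:E)%E.
  have /choice[B hB] : forall j : 'I_n, exists B : R, forall k,
      (\int[P]_w ((A k * \sum_(t <- S k j) X t w) ^+ 2)%:E <= B%:E)%E.
    move=> j; have [v sv cv] := hv (fun i => (i == j)%:R).
    have [B [_ hB]] := cvg_seq_bounded (cvgP _ cv).
    exists (2 * (B + 1) + 2) => k; under eq_integral do rewrite unit_sum.
    apply: (le_trans (lin_sqr (sumsE _ _ _ (sv k)))).
    have := hB (B + 1) (ltr_pwDr ltr01 (lexx _)) k I => hk.
    have := le_trans (ler_norm _) hk.
    by rewrite lee_fin /=; lra.
  exists (\sum_(j < n) `|B j|) => k j; apply: (le_trans (hB j k)).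
  rewrite lee_fin (bigD1 j)//= (le_trans (ler_norm _))// lerDl.
  by apply: sumr_ge0.
apply: (weak_cvg_of_cos mY (fun j => _) hC _ cf fM) => // theta a.
rewrite hZ; have [v sv cv] := hv theta.
apply/cvgrPdist_le => eta eta0.
have [B [Br hB]] := cvg_seq_bounded (cvgP _ cv).
pose B1 := `|B| + 1.
have B10 : 0 < B1 by rewrite ltr_wpDl.
have vB k : `|v k| <= B1.
  by apply: (hB B1 _ k I); rewrite /B1 (le_lt_trans (ler_norm _))// ltrDl.
have e20 : 0 < eta / (2 * B1) by rewrite divr_gt0 ?mulr_gt0.
have [delta0 d00 hcos] := lin_cos e20.
pose Th := \sum_(j < n) `|theta j| + 1.
have Th0 : 0 < Th by rewrite ltr_wpDl// sumr_ge0.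
have [N1 hN1] := hsmall _ (divr_gt0 d00 Th0).
have e2 : 0 < eta / 2 by rewrite divr_gt0.
have [N2 _ hN2] := (cvgrPdist_le _ _).1 cv _ e2.
exists (maxn N1 N2) => // k /=; rewrite geq_max => /andP[k1 k2].
have small s : `|coef (U k) (e theta k) s| <= delta0.
  rewrite coefE (le_trans (ler_norm_sum _ _ _))//.
  apply: (@le_trans _ _ (\sum_(j < n) `|theta j| * (delta0 / Th))).
    by apply: ler_sum => j _; rewrite normrM ler_wpM2l// hN1.
  rewrite -mulr_suml mulrA ler_pdivrMr// mulrC.
  by apply: ler_wpM2l; [exact: ltW|rewrite /Th lerDl].
have := hcos (U k) (e theta k) (v k) a (sumsE _ _ _ (sv k)) small.
have -> : \int[P]_w cos (a + lin (U k) (e theta k) w) =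
   \int[P]_w cos (a + \sum_(j < n) theta j * (A k * \sum_(t <- S k j) X t w)).
  by apply: eq_Rintegral => w _; rewrite linE.
set I1 := \int[P]_w _ => h1.
have h2 := hN2 k k2; rewrite /= in h2.
have v0 : 0 <= v k.
  by have [vub _] := sv k; have := vub fset0; rewrite big_seq_fset0.
have s0 : 0 <= sigma2 theta.
  apply: (cvgr_to_ge cv); apply: nearW => k'.
  by have [vub _] := sv k'; have := vub fset0; rewrite big_seq_fset0.
have h3 := expRN_lipschitz (divr_ge0 s0 (ler0n R 2)) (divr_ge0 v0 (ler0n R 2)).
have h4 : `|(expR (- (sigma2 theta / 2)) - expR (- (v k / 2))) * cos a| <= eta / 4.
  rewrite normrM (@le_trans _ _ `|expR (- (sigma2 theta / 2)) - expR (- (v k / 2))|)//.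
    by rewrite ler_piMr// cos_max.
  rewrite (le_trans h3)// -mulrBl normrM (@ger0_norm _ 2^-1)//; lra.
have h5 : eta / (2 * B1) * v k <= eta / 2.
  have -> : eta / 2 = eta / (2 * B1) * B1 by field; rewrite gt_eqF.
  by apply: ler_wpM2l; [exact: ltW|rewrite (le_trans (ler_norm _))].
have -> : expR (- (sigma2 theta / 2)) * cos a - I1 =
  (expR (- (sigma2 theta / 2)) - expR (- (v k / 2))) * cos a -
  (I1 - expR (- (v k / 2)) * cos a) by ring.
rewrite (le_trans (ler_normB _ _))//; lra.
Qed.

End linear_fields.

(** * Integrals of powers on the line *)

Section one_dimensional_integrals.
Context {R : realType}.
Notation mu := (@lebesgue_measure R).

Lemma lebesgue_affine_itv (c d a b : R) : c != 0 -> a <= b ->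
  (`|c|%:E * mu ((fun x : R => c * x + d)%R @^-1` `]a, b]) = (b - a)%:E)%E.
Proof.
move=> c0 ab; have [cp|cn|c00] := ltgtP c 0; last by rewrite c00 eqxx in c0.
- have -> : (fun x => c * x + d) @^-1` `]a, b] = `[(b - d) / c, (a - d) / c[%classic.
    apply/seteqP; split => x /=; rewrite !in_itv/= ler_ndivrMr// ltr_ndivlMr//;
      rewrite [x * c]mulrC; move=> /andP[h1 h2]; apply/andP; split; lra.
  rewrite lebesgue_measure_itv/= lte_fin ltr0_norm//.
  have [ab'|ab'] := ltP a b.
    rewrite ltr_nM2r ?invr_lt0// ltrD2r ab' -EFinB -EFinM; congr EFin.
    by field; rewrite lt_eqF.
  have -> : a = b by apply/eqP; rewrite eq_le ab ab'.
  by rewrite ltxx mule0 subrr.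
- have -> : (fun x => c * x + d) @^-1` `]a, b] = `](a - d) / c, (b - d) / c]%classic.
    apply/seteqP; split => x /=; rewrite !in_itv/= ltr_pdivrMr// ler_pdivlMr//;
      rewrite [x * c]mulrC; move=> /andP[h1 h2]; apply/andP; split; lra.
  rewrite lebesgue_measure_itv/= lte_fin gtr0_norm//.
  have [ab'|ab'] := ltP a b.
    rewrite ltr_pM2r ?invr_gt0// ltrD2r ab' -EFinB -EFinM; congr EFin.
    by field; rewrite gt_eqF.
  have -> : a = b by apply/eqP; rewrite eq_le ab ab'.
  by rewrite ltxx mule0 subrr.
Qed.

Lemma measurable_affine (c d : R) :
  measurable_fun setT (fun x : measurableTypeR R => c * x + d).
Proof. exact: measurable_funD. Qed.

Lemma ge0_integral_affine (c d : R) (f : R -> \bar R) : c != 0 ->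
  measurable_fun setT f -> (forall x, 0 <= f x)%E ->
  (`|c|%:E * \int[mu]_x f (c * x + d)%R = \int[mu]_x f x)%E.
Proof.
move=> c0 mf f0; pose phi (x : measurableTypeR R) : measurableTypeR R := c * x + d.
have mphi : measurable_fun setT phi by exact: measurable_affine.
pose c_nng : {nonneg R} := NngNum (normr_ge0 c).
pose pf : {measure set (measurableTypeR R) -> \bar R} :=
  measure_function_pushforward__canonical__measure_function_Measure mu mphi.
pose nu : {measure set (measurableTypeR R) -> \bar R} := mscale c_nng pf.
transitivity (\int[nu]_x f x)%E.
  rewrite ge0_integral_mscale// ge0_integral_pushforward//.
apply: eq_measure_integral => A mA _; apply/esym.
apply: (lebesgue_measure_unique (mu := nu)) => // X.
move=> [[a b]] /= _ <-.
have [ab|ba] := leP a b; last by rewrite set_itv_ge ?measure0 // bnd_simp -leNgt ltW.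
rewrite -[RHS]/(`|c|%:E * mu (phi @^-1` `]a, b]))%E lebesgue_affine_itv//.
rewrite lebesgue_measure_itv/= lte_fin; case: ltP => [//|ba].
by have -> : a = b by [apply/eqP; rewrite eq_le ab ba]; rewrite subrr.
Qed.

Lemma integral_powR (p s t : R) : p != -1 -> 0 < s -> s <= t ->
  (\int[mu]_(x in `[s, t]) (x `^ p)%:E = ((t `^ (p + 1) - s `^ (p + 1)) / (p + 1))%:E)%E.
Proof.
move=> p1 s0 st.
have p10 : p + 1 != 0 by apply: contra p1 => /eqP h; apply/eqP; lra.
have [st'|ts] := ltP s t; last first.
  have -> : t = s by apply/eqP; rewrite eq_le st ts.
  by rewrite set_itv1 integral_set1 subrr mul0r.
have dF (x : R) : 0 < x -> is_derive x 1 (fun y => (p + 1)^-1 *: (y `^ (p + 1))) (x `^ p).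
  move=> x0; have := is_derive1_powR (p + 1) x0 => d1.
  apply: is_derive_eq; rewrite /GRing.scale/= addrK mulrA mulVf// mul1r//.
have cF (x : R) : 0 < x -> {for x, continuous (fun y => (p + 1)^-1 *: (y `^ (p + 1)))}.
  move=> x0; apply/differentiable_continuous/derivable1_diffP.
  by case: (dF x x0).
rewrite (@continuous_FTC2 _ _ (fun y => (p + 1)^-1 *: (y `^ (p + 1))))//.
- by rewrite -EFinB /GRing.scale/=; congr EFin; field.
- apply: continuous_in_subspaceT => x; rewrite inE/= in_itv/= => /andP[sx _].
  have x0 : 0 < x by apply: lt_le_trans sx.
  by apply/differentiable_continuous/derivable1_diffP; case: (is_derive1_powR p x0).
- split.
  + by move=> x; rewrite in_itv/= => /andP[sx _]; case: (dF x (lt_trans s0 sx)).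
  + by apply: cvg_at_right_filter; exact: cF.
  + by apply: cvg_at_left_filter; apply: cF; exact: lt_trans st'.
- by move=> x; rewrite in_itv/= => /andP[sx _]; rewrite derive1E; case: (dF x (lt_trans s0 sx)).
Qed.

Lemma ge0_integral_bigcup_le (F : (set R)^nat) (f : R -> R) (C : R) :
  (forall i, measurable (F i)) -> nondecreasing_seq F -> (forall x, 0 <= f x) ->
  measurable_fun setT f -> (forall i, (\int[mu]_(x in F i) (f x)%:E <= C%:E)%E) ->
  (\int[mu]_(x in \bigcup_i F i) (f x)%:E <= C%:E)%E.
Proof.
move=> mF ndF f0 mf FC.
have cv : (\int[mu]_(x in F i) (f x)%:E @[i --> \oo] -->
    \int[mu]_(x in \bigcup_i F i) (f x)%:E)%E.
  apply: ge0_nondecreasing_set_cvg_integral => //.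
  - by move=> i; apply/measurable_EFinP; exact: measurable_funTS.
  - by move=> i x _; rewrite lee_fin.
rewrite -(cvg_lim _ cv)//; apply: lime_le; last by apply: nearW.
by apply/cvg_ex; eexists; exact: cv.
Qed.

Definition pw (a r : R) : R := `|r| `^ (- a).

Lemma pw_ge0 a r : 0 <= pw a r. Proof. exact: powR_ge0. Qed.

Lemma pw0 r : pw 0 r = 1. Proof. by rewrite /pw oppr0 powRr0. Qed.

Lemma measurable_pw a : measurable_fun setT (pw a).
Proof.
exact: (measurableT_comp (@measurable_powR R (- a)) (@normr_measurable R setT)).
Qed.

Lemma pw_le a (r s : R) : 0 <= a -> 0 < `|r| -> `|r| <= `|s| -> pw a s <= pw a r.
Proof.
move=> a0 r0 rs; rewrite /pw !powRN lef_pV2 ?posrE ?powR_gt0//; last first.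
  exact: lt_le_trans rs.
by rewrite ge0_ler_powR// nnegrE.
Qed.

Lemma pwM a (c r : R) : pw a (c * r) = pw a c * pw a r.
Proof. by rewrite /pw normrM powRM. Qed.

Let half (f : R -> R) (x : R) : R := if 0 <= x then f x else 0.

Let mhalf f : measurable_fun setT f -> measurable_fun setT (half f).
Proof.
move=> mf; have -> : half f = fun x => f x * \1_(`[0, +oo[%classic) x.
  apply/funext => x; rewrite /half indicE.
  by case: ifPn => h; [rewrite mem_set ?mulr1// /= in_itv/= h
    |rewrite memNset ?mulr0// /= in_itv/= andbT; apply/negP].
by apply: measurable_funM => //; exact: measurable_indic.
Qed.

Let integral_even_le (f : R -> R) (C : R) : measurable_fun setT f ->
  (forall x, 0 <= f x) -> (forall x, f (- x) = f x) ->
  (\int[mu]_(x in `[0%R, +oo[) (f x)%:E <= C%:E)%E ->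
  (\int[mu]_x (f x)%:E <= (2 * C)%:E)%E.
Proof.
move=> mf f0 fN fC; have mh := mhalf mf.
have h0 x : 0 <= half f x by rewrite /half; case: ifP.
have hE : (\int[mu]_x (half f x)%:E <= C%:E)%E.
  apply: le_trans fC; rewrite [leRHS]integral_mkcond le_eqVlt.
  apply/orP; left; apply/eqP; apply: eq_integral => x _; rewrite patchE/half.
  case: ifPn => h; first by rewrite mem_set// /= in_itv/= h.
  by rewrite memNset// /= in_itv/= andbT; apply/negP.
have mhN : measurable_fun setT (fun x : R => half f (-1 * x + 0)).
  by apply: (measurableT_comp mh); exact: measurable_affine.
apply: (@le_trans _ _ (\int[mu]_x ((half f x)%:E + (half f (-1 * x + 0)%R)%:E))%E).
  apply: ge0_le_integral => //.
  - by move=> x _; rewrite lee_fin.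
  - exact/measurable_EFinP.
  - by apply: emeasurable_funD; apply/measurable_EFinP.
  - move=> x _; rewrite -EFinD lee_fin mulN1r addr0 /half oppr_ge0.
    case: (leP 0 x) => h.
      by rewrite lerDl; case: ifP; rewrite ?fN.
    by rewrite (ltW h) fN add0r.
rewrite ge0_integralD//.
- have := @ge0_integral_affine (-1) 0 (fun x => (half f x)%:E) _ _ _.
  rewrite oppr_eq0 oner_eq0 normrN1 mul1e => -> //.
  + by rewrite mulr2n mulrDl mul1r EFinD leeD.
  + exact/measurable_EFinP.
  + by move=> x; rewrite lee_fin.
all: try by move=> x _; rewrite lee_fin.
all: exact/measurable_EFinP.
Qed.

Definition near_pw (A a r : R) : R := if `|r| <= A then pw a r else 0.
Definition far_pw (a r : R) : R := if `|r| <= 1 then 0 else pw a r.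

Lemma near_pw_ge0 A a r : 0 <= near_pw A a r.
Proof. by rewrite /near_pw; case: ifP => // _; exact: pw_ge0. Qed.

Lemma far_pw_ge0 a r : 0 <= far_pw a r.
Proof. by rewrite /far_pw; case: ifP => // _; exact: pw_ge0. Qed.

Let mball (A : R) : measurable [set r : R | `|r| <= A].
Proof.
have -> : [set r : R | `|r| <= A] = (fun r : R => `|r|) @^-1` `]-oo, A].
  by apply/seteqP; split => x /=; rewrite in_itv.
by rewrite -[X in measurable X]setTI; exact: normr_measurable.
Qed.

Lemma measurable_near_pw A a : measurable_fun setT (near_pw A a).
Proof.
have -> : near_pw A a = fun r => pw a r * \1_[set r : R | `|r| <= A] r.
  apply/funext => r; rewrite /near_pw indicE; case: ifPn => h.
    by rewrite mem_set// mulr1.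
  by rewrite memNset ?mulr0//; apply/negP.
apply: measurable_funM; first exact: measurable_pw.
exact: measurable_indic.
Qed.

Lemma measurable_far_pw a : measurable_fun setT (far_pw a).
Proof.
have -> : far_pw a = fun r => pw a r - near_pw 1 a r.
  by apply/funext => r; rewrite /far_pw /near_pw; case: ifP; rewrite ?subrr ?subr0.
apply: measurable_funB; first exact: measurable_pw.
exact: measurable_near_pw.
Qed.

Lemma integral_near_pw (a A : R) : a < 1 -> 0 < A ->
  (\int[mu]_r (near_pw A a r)%:E <= (2 / (1 - a) * A `^ (1 - a))%:E)%E.
Proof.
move=> a1 A0; have mN := measurable_near_pw A a.
have a10 : 0 < 1 - a by lra.
rewrite -mulrA; apply: integral_even_le => //.
- exact: near_pw_ge0.
- by move=> x; rewrite /near_pw /pw normrN.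
rewrite -integral_itv_obnd_cbnd; last by apply/measurable_EFinP; exact: measurable_funTS.
have -> : `]0, +oo[%classic = \bigcup_(i : nat) `[i.+1%:R^-1, +oo[%classic :> set R.
  apply/seteqP; split => x /=.
    rewrite in_itv/= andbT => x0; exists (Num.trunc x^-1) => //=.
    rewrite in_itv/= andbT invf_ple ?posrE//; exact: ltW (truncnS_gt _).
  move=> [i _ /=]; rewrite !in_itv/= !andbT; apply: lt_le_trans.
  by rewrite invr_gt0.
apply: ge0_integral_bigcup_le => //.
- move=> i j ij; apply/subsetPset => x /=; rewrite !in_itv/= !andbT; apply: le_trans.
  by rewrite lef_pV2 ?posrE// ler_nat.
- exact: near_pw_ge0.
move=> i; have i0 : 0 < i.+1%:R^-1 :> R by rewrite invr_gt0.
have [iA|Ai] := leP i.+1%:R^-1 A; last first.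
  rewrite integral0_eq ?lee_fin ?mulr_ge0 ?invr_ge0 ?powR_ge0 ?ltW// => x /=.
  rewrite in_itv/= andbT => ix; rewrite /near_pw ifN// -ltNge.
  by rewrite (lt_le_trans Ai)// (le_trans ix)// ler_norm.
have -> : (\int[mu]_(x in `[(i.+1%:R^-1)%R, +oo[) (near_pw A a x)%:E =
    \int[mu]_(x in `[(i.+1%:R^-1)%R, A]) (x `^ (- a))%:E)%E.
  rewrite integral_mkcond [RHS]integral_mkcond; apply: eq_integral => x _.
  rewrite !patchE; case: ifPn => [|/negP]; rewrite inE/= in_itv/= andbT => h.
    have x0 : 0 <= x by rewrite (le_trans (ltW i0)).
    rewrite /near_pw /pw (ger0_norm x0); case: ifPn => xA.
      by rewrite mem_set//= in_itv/= h xA.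
    by rewrite memNset//= in_itv/= h/=; apply/negP.
  by rewrite memNset//= in_itv/=; apply/negP; rewrite negb_and; apply/orP; left; apply/negP.
rewrite integral_powR//; last by apply/eqP; lra.
rewrite lee_fin [- a + 1]addrC mulrC.
by apply: ler_wpM2l; [rewrite invr_ge0 ltW|rewrite gerBl powR_ge0].
Qed.

Lemma integral_far_pw (a : R) : 1 < a ->
  (\int[mu]_r (far_pw a r)%:E <= (2 / (a - 1))%:E)%E.
Proof.
move=> a1; have mN := measurable_far_pw a.
have a10 : 0 < a - 1 by lra.
apply: integral_even_le => //.
- exact: far_pw_ge0.
- by move=> x; rewrite /far_pw /pw normrN.
have -> : `[0, +oo[%classic = \bigcup_(i : nat) `[0, i.+1%:R]%classic :> set R.
  apply/seteqP; split => x /=.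
    rewrite in_itv/= andbT => x0; exists (Num.trunc x) => //=.
    by rewrite in_itv/= x0 ltW// truncnS_gt.
  by move=> [i _ /=]; rewrite !in_itv/= andbT => /andP[].
apply: ge0_integral_bigcup_le => //.
- move=> i j ij; apply/subsetPset => x /=; rewrite !in_itv/= => /andP[-> h] /=.
  by rewrite (le_trans h)// ler_nat.
- exact: far_pw_ge0.
move=> i; apply: (@le_trans _ _ (\int[mu]_(x in `[1%R, i.+1%:R%R]) (x `^ (- a))%:E)%E).
  rewrite integral_mkcond [leRHS]integral_mkcond; apply: ge0_le_integral => //.
  - by move=> x _; rewrite patchE; case: ifP => // _; rewrite lee_fin far_pw_ge0.
  - apply/(measurable_restrictT _ (measurable_itv _)); apply/measurable_EFinP.
    exact: measurable_funTS.
  - apply/(measurable_restrictT _ (measurable_itv _)); apply/measurable_EFinP.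
    apply: measurable_funTS; exact: measurable_powR.
  - move=> x _; rewrite !patchE; case: ifPn => [|_]; last first.
      by case: ifP => // _; rewrite lee_fin powR_ge0.
    rewrite inE/= in_itv/= => /andP[x0 xi]; rewrite /far_pw (ger0_norm x0).
    case: ifPn => x1; first by case: ifP => // _; rewrite lee_fin powR_ge0.
    rewrite mem_set /pw ?(ger0_norm x0)//= in_itv/= xi andbT ltW//.
    by rewrite ltNge.
rewrite integral_powR//; last 2 first.
- by apply/eqP; lra.
- by rewrite ler1n.
rewrite powR1 lee_fin.
have -> : (i.+1%:R `^ (- a + 1) - 1) / (- a + 1) = (1 - i.+1%:R `^ (- a + 1)) / (a - 1).
  by field; apply/andP; split; apply/eqP; lra.
by rewrite ler_pdivrMr// mulVf ?gt_eqF// gerBl powR_ge0.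
Qed.

Definition psi (a c r : R) : R := near_pw 1 a r + far_pw c r.

Lemma psi_ge0 a c r : 0 <= psi a c r.
Proof. by rewrite addr_ge0 ?near_pw_ge0 ?far_pw_ge0. Qed.

Lemma measurable_psi a c : measurable_fun setT (psi a c).
Proof.
apply: measurable_funD; [exact: measurable_near_pw|exact: measurable_far_pw].
Qed.

Lemma psiE a c r : psi a c r = if `|r| <= 1 then pw a r else pw c r.
Proof.
by rewrite /psi /near_pw /far_pw; case: ifP => _; rewrite ?addr0 ?add0r.
Qed.

Lemma pw_sqr a r : a != 0 -> pw a r ^+ 2 = pw (2 * a) r.
Proof.
by move=> a0; rewrite /pw -powR_mulrn ?powR_ge0// -powRrM; congr (_ `^ _); ring.
Qed.

Lemma integral_psi_sqr (a c : R) : a < 1 / 2 -> 1 / 2 < c ->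
  (\int[mu]_r (psi a c r ^+ 2)%:E < +oo)%E.
Proof.
move=> a2 c2.
have E r : psi a c r ^+ 2 = near_pw 1 (2 * a) r + far_pw (2 * c) r.
  rewrite psiE /near_pw /far_pw; case: ifP => _; rewrite ?addr0 ?add0r; last first.
    by rewrite pw_sqr// gt_eqF//; lra.
  by rewrite /pw -powR_mulrn ?powR_ge0// -powRrM; congr (_ `^ _); ring.
under eq_integral do rewrite E EFinD.
have a21 : 2 * a < 1 by lra.
have c21 : 1 < 2 * c by lra.
rewrite ge0_integralD//.
- apply: lte_add_pinfty.
    by apply: le_lt_trans (integral_near_pw a21 ltr01) _; rewrite ltry.
  by apply: le_lt_trans (integral_far_pw c21) _; rewrite ltry.
all: try by move=> x _; rewrite lee_fin ?near_pw_ge0 ?far_pw_ge0.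
all: apply/measurable_EFinP; by [exact: measurable_near_pw|exact: measurable_far_pw].
Qed.

Let mshift A a c d : measurable_fun setT (fun x : R => near_pw A a (c * x + d)).
Proof.
exact: (measurableT_comp (measurable_near_pw A a) (measurable_affine c d)).
Qed.

(** Averages of the singular power over an interval: a maximal-function bound,
    uniform in the dilation factor. *)
Lemma integral_pw_dilate (a X : R) : 0 <= a < 1 -> 0 < X ->
  exists2 C : R, 0 < C & forall delta u : R, 0 < delta -> u != 0 ->
    (\int[mu]_(t in `[(- X)%R, X]) (pw a (delta * t - u)%R)%:E <= (C * pw a u)%:E)%E.
Proof.
move=> /andP[a0 a1] X0.
pose C1 := 2 * X * pw a (2^-1).
pose C2 := 2 / (1 - a) * (3 * X) `^ (1 - a) * (2 * X) `^ a.
have C10 : 0 < C1 by rewrite mulr_gt0 ?mulr_gt0// powR_gt0// normr_gt0.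
have C20 : 0 < C2.
  by rewrite mulr_gt0 ?powR_gt0 ?mulr_gt0 ?powR_gt0 ?mulr_gt0// invr_gt0; lra.
exists (C1 + C2); first exact: addr_gt0.
move=> delta u d0 u0.
have nu : 0 < `|u| by rewrite normr_gt0.
have mp : measurable_fun setT (fun t : R => pw a (delta * t - u)).
  exact: (measurableT_comp (measurable_pw a) (measurable_affine delta (- u))).
have [far|near_] := leP (2 * (delta * X)) `|u|.
  apply: (@le_trans _ _ (\int[mu]_(t in `[(- X)%R, X]) (pw a (2^-1 * u))%:E)%E).
    apply: ge0_le_integral => //.
    - by move=> x _; rewrite lee_fin pw_ge0.
    - by apply/measurable_EFinP; exact: measurable_funTS.
    - move=> t /=; rewrite in_itv/= -ler_norml => tX; rewrite lee_fin.
      apply: pw_le => //; first by rewrite normr_gt0 mulf_neq0.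
      rewrite normrM (@ger0_norm _ 2^-1)// distrC.
      have h1 : `|delta * t| <= delta * X.
        by rewrite normrM (gtr0_norm d0) ler_pM2l.
      have := lerB_dist u (delta * t); lra.
  rewrite integral_cst//= lebesgue_measure_itv/= lte_fin.
  rewrite ifT; last by lra.
  rewrite -EFinB -EFinM lee_fin pwM.
  have -> : pw a 2^-1 * pw a u * (X - - X) = C1 * pw a u by rewrite /C1; ring.
  by rewrite ler_wpM2r ?pw_ge0// lerDl ltW.
apply: (@le_trans _ _ (\int[mu]_t (near_pw (3 * (delta * X)) a (delta * t - u)%R)%:E)%E).
  rewrite integral_mkcond; apply: ge0_le_integral => //.
  - by move=> x _; rewrite patchE; case: ifP => // _; rewrite lee_fin pw_ge0.
  - apply/(measurable_restrictT _ (measurable_itv _)); apply/measurable_EFinP.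
    exact: measurable_funTS.
  - by apply/measurable_EFinP; exact: mshift.
  - move=> t _; rewrite patchE; case: ifPn => [|_]; last by rewrite lee_fin near_pw_ge0.
    rewrite inE/= in_itv/= -ler_norml => tX; rewrite lee_fin /near_pw ifT//.
    rewrite (le_trans (ler_normB _ _))//.
    have h1 : `|delta * t| <= delta * X by rewrite normrM (gtr0_norm d0) ler_pM2l.
    lra.
have := @ge0_integral_affine delta (- u) (fun x => (near_pw (3 * (delta * X)) a x)%:E).
rewrite gt_eqF// (gtr0_norm d0) => /(_ isT) E.
have dX : 0 < 3 * (delta * X) by rewrite !mulr_gt0.
have h := integral_near_pw a1 dX; rewrite -E in h; last 2 first.
- by apply/measurable_EFinP; exact: measurable_near_pw.
- by move=> x; rewrite lee_fin near_pw_ge0.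
rewrite -(@lee_pmul2l _ delta%:E) ?lte_fin// (le_trans h)// -EFinM lee_fin.
have -> : 3 * (delta * X) = delta * (3 * X) by ring.
have X3 : 0 <= 3 * X by rewrite mulr_ge0// ltW.
rewrite (powRM _ (ltW d0) X3).
have dE : delta `^ (1 - a) = delta * delta `^ (- a).
  by rewrite powRD ?(gt_eqF d0) ?implybT// powRr1// ltW.
have h2 : delta `^ (- a) <= (2 * X) `^ a * pw a u.
  have -> : delta `^ (- a) = pw a delta by rewrite /pw gtr0_norm.
  have -> : (2 * X) `^ a * pw a u = pw a ((2 * X)^-1 * u).
    rewrite pwM; congr (_ * _); rewrite /pw gtr0_norm ?invr_gt0 ?mulr_gt0//.
    by rewrite -[(2 * X)^-1]powR_inv1 ?mulr_ge0 ?ltW// -powRrM mulN1r opprK.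
  apply: pw_le => //.
    by rewrite normr_gt0 mulf_neq0// invr_neq0// gt_eqF// mulr_gt0.
  rewrite normrM gtr0_norm ?invr_gt0 ?mulr_gt0// (gtr0_norm d0).
  by rewrite ler_pdivrMl ?mulr_gt0// ltW//; lra.
rewrite dE; have p0 := pw_ge0 a u.
have -> : 2 / (1 - a) * (delta * delta `^ (- a) * (3 * X) `^ (1 - a)) =
  delta * (2 / (1 - a) * (3 * X) `^ (1 - a) * delta `^ (- a)) by ring.
rewrite ler_pM2l// mulrDl.
have : 2 / (1 - a) * (3 * X) `^ (1 - a) * delta `^ (- a) <= C2 * pw a u.
  rewrite /C2 -[X in _ <= X]mulrA ler_wpM2l// mulr_ge0 ?powR_ge0// mulr_ge0// invr_ge0; lra.
have := mulr_ge0 (ltW C10) p0; lra.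
Qed.

Lemma integral_pw_shift (a X : R) : 0 <= a < 1 -> 0 < X ->
  exists2 C : R, 0 < C & forall u : R,
    (\int[mu]_(t in `[(- X)%R, X]) (pw a (t - u))%:E <= (C * psi 0 a u)%:E)%E.
Proof.
move=> a01 X0; have [C C0 hC] := integral_pw_dilate a01 X0.
have /andP[a0 a1] := a01.
pose C' := 2 / (1 - a) * (X + 1) `^ (1 - a).
have X1 : 0 < X + 1 by lra.
have C'0 : 0 < C' by rewrite mulr_gt0 ?powR_gt0// divr_gt0//; lra.
exists (C + C'); first exact: addr_gt0.
move=> u; rewrite psiE pw0; case: ifPn => [u1|]; last first.
  rewrite -ltNge => u1.
  have u0 : u != 0 by rewrite -normr_gt0 (lt_trans ltr01).
  have := hC 1 u ltr01 u0; under eq_integral do rewrite mul1r.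
  move=> /le_trans; apply; rewrite lee_fin ler_wpM2r ?pw_ge0// lerDl ltW//.
apply: (@le_trans _ _ (\int[mu]_t (near_pw (X + 1) a (1 * t + - u)%R)%:E)%E).
  rewrite integral_mkcond; apply: ge0_le_integral => //.
  - by move=> x _; rewrite patchE; case: ifP => // _; rewrite lee_fin pw_ge0.
  - apply/(measurable_restrictT _ (measurable_itv _)); apply/measurable_EFinP.
    apply: measurable_funTS.
    have -> : (fun t => pw a (t - u)) = (fun t => pw a (1 * t + - u)).
      by apply/funext => t; rewrite mul1r.
    exact: (measurableT_comp (measurable_pw a) (measurable_affine 1 (- u))).
  - by apply/measurable_EFinP; exact: mshift.
  - move=> t _; rewrite patchE; case: ifPn => [|_]; last by rewrite lee_fin near_pw_ge0.
    rewrite inE/= in_itv/= -ler_norml => tX; rewrite lee_fin mul1r /near_pw ifT//.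
    by rewrite (le_trans (ler_normB _ _))// lerD.
have := @ge0_integral_affine 1 (- u) (fun x => (near_pw (X + 1) a x)%:E).
rewrite oner_neq0 normr1 mul1e => -> //.
- by apply: le_trans (integral_near_pw a1 X1) _; rewrite lee_fin mulr1 -/C' lerDr ltW.
- by apply/measurable_EFinP; exact: measurable_near_pw.
- by move=> x; rewrite lee_fin near_pw_ge0.
Qed.

End one_dimensional_integrals.

(** * Integrals over the plane *)

Section planar_integrals.
Context {R : realType}.
Notation mu := (@lebesgue_measure R).
Notation plane := (measurableTypeR R * measurableTypeR R)%type.

Lemma det_mx22 (D : 'M[R]_2) : \det D = D 0 0 * D 1 1 - D 0 1 * D 1 0.
Proof.
rewrite (expand_det_row _ 0) !big_ord_recl big_ord0 addr0 /cofactor !det_mx11 !mxE /=.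
have -> : lift 0 0 = 1 :> 'I_2 by apply/val_inj.
have -> : lift 1 0 = 0 :> 'I_2 by apply/val_inj.
by rewrite expr0 expr1 mul1r mulN1r mulrN.
Qed.

Lemma measurable_plane (f g : plane -> R) :
  measurable_fun setT f -> measurable_fun setT g ->
  measurable_fun setT ((fun u => (f u, g u)) : plane -> plane).
Proof. by move=> mf mg; exact: measurable_fun_pair. Qed.

Lemma measurable_coord1 : measurable_fun setT ((fun u => u.1) : plane -> R).
Proof. exact: measurable_fst. Qed.

Lemma measurable_coord2 : measurable_fun setT ((fun u => u.2) : plane -> R).
Proof. exact: measurable_snd. Qed.

Lemma integral_prod_coord (f g : R -> R) : measurable_fun setT f ->
  measurable_fun setT g -> (forall x, 0 <= f x) -> (forall x, 0 <= g x) ->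
  (\int[mu2]_(u in [set: plane]) (f u.1 * g u.2)%:E =
   \int[mu]_x (f x)%:E * \int[mu]_y (g y)%:E)%E.
Proof.
move=> mf mg f0 g0; rewrite fubini_tonelli1//=; last 2 first.
- apply/measurable_EFinP; apply: measurable_funM.
    exact: (measurableT_comp mf measurable_coord1).
  exact: (measurableT_comp mg measurable_coord2).
- by move=> u; rewrite lee_fin mulr_ge0.
under eq_integral => x _.
  rewrite /fubini_F; under eq_integral do rewrite /= EFinM.
  rewrite ge0_integralZl//; [|exact/measurable_EFinP|by move=> y _; rewrite lee_fin
    |by rewrite lee_fin].
  over.
rewrite ge0_integralZr//.
- exact/measurable_EFinP.
- by move=> x _; rewrite lee_fin.
- by apply: integral_ge0 => y _; rewrite lee_fin.
Qed.

Lemma ge0_integral_swap (F : plane -> \bar R) : measurable_fun setT F ->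
  (forall u, 0 <= F u)%E ->
  (\int[mu2]_(u in [set: plane]) F (u.2, u.1) = \int[mu2]_u F u)%E.
Proof.
move=> mF F0; rewrite fubini_tonelli1//=; last first.
  apply: (measurableT_comp mF); apply: measurable_plane.
    exact: measurable_coord2.
  exact: measurable_coord1.
by rewrite [RHS]fubini_tonelli2.
Qed.

Lemma Rintegral_swap (F : plane -> R) : measurable_fun setT F ->
  \int[mu2]_(u in [set: plane]) F (u.2, u.1) = \int[mu2]_u F u.
Proof.
move=> mF; have mE : measurable_fun setT (EFin \o F) by exact/measurable_EFinP.
rewrite /Rintegral; congr fine; rewrite integralE [RHS]integralE; congr (_ - _)%E.
- rewrite -(@ge0_integral_swap (EFin \o F)^\+%E _ (fun=> _)) ?funepos_ge0//; last exact: measurable_funepos.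
  by apply: eq_integral => u _; rewrite !funeposE.
- rewrite -(@ge0_integral_swap (EFin \o F)^\-%E _ (fun=> _)) ?funeneg_ge0//; last exact: measurable_funeneg.
  by apply: eq_integral => u _; rewrite !funenegE.
Qed.

Lemma measurable_ge0_integral_param (F : plane * plane -> \bar R) :
  measurable_fun setT F -> (forall z, 0 <= F z)%E ->
  measurable_fun setT ((fun u => \int[mu2]_t F (u, t)) : plane -> \bar R)%E.
Proof.
move=> mF F0.
have -> : (fun u => \int[mu2]_t F (u, t))%E =
    (fun u => \int[mu]_x \int[mu]_y F (u, (x, y)))%E.
  apply/funext => u; rewrite fubini_tonelli1//.
  exact: (measurable_fun_pair2 u mF).
pose F1 (z : (plane * measurableTypeR R) * measurableTypeR R) := F (z.1.1, (z.1.2, z.2)).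
have m1 : measurable_fun setT (fubini_F mu F1).
  apply: measurable_fun_fubini_tonelli_F; last by move=> z; exact: F0.
  have mphi : measurable_fun setT (fun z : (plane * measurableTypeR R) * measurableTypeR R =>
      (z.1.1, (z.1.2, z.2)) : plane * plane).
    apply: measurable_fun_pair; first exact: (measurableT_comp measurable_fst measurable_fst).
    apply: measurable_fun_pair; last exact: measurable_snd.
    exact: (measurableT_comp measurable_snd measurable_fst).
  exact: (measurableT_comp mF mphi).
have F2 z : (0 <= fubini_F mu F1 z)%E by apply: integral_ge0 => y _; exact: F0.
exact: (@measurable_fun_fubini_tonelli_F _ _ _ _ _ mu (fubini_F mu F1) m1 F2).
Qed.

Lemma measurable_Rintegral_param (F : plane * plane -> R) (D : set plane) :
  measurable D -> measurable_fun setT F ->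
  measurable_fun setT ((fun u => \int[mu2]_(t in D) F (u, t)) : plane -> R).
Proof.
move=> mD mF.
pose G (z : plane * plane) : R := F z * \1_D z.2.
have mG : measurable_fun setT G.
  apply: measurable_funM => //.
  by apply: (measurableT_comp (measurable_indic mD)); exact: measurable_snd.
have mE : measurable_fun setT (EFin \o G) by exact/measurable_EFinP.
have -> : (fun u => \int[mu2]_(t in D) F (u, t)) =
    fun u => fine (\int[mu2]_t (EFin \o G)^\+%E (u, t) - \int[mu2]_t (EFin \o G)^\-%E (u, t))%E.
  apply/funext => u; rewrite /Rintegral integral_mkcond integralE.
  have E : (fun t => (F (u, t))%:E) \_ D = (fun t => (EFin \o G) (u, t)).
    apply/funext => t; rewrite patchE /G/= indicE.
    by case: (t \in D); rewrite ?mulr1 ?mulr0.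
  rewrite E; congr (fine (_ - _)%E); apply: eq_integral => t _.
    by rewrite !funeposE.
  by rewrite !funenegE.
apply: measurableT_comp; first exact: fine_measurable.
apply: emeasurable_funB.
- apply: (@measurable_ge0_integral_param (EFin \o G)^\+%E) => //.
  exact: measurable_funepos.
- apply: (@measurable_ge0_integral_param (EFin \o G)^\-%E) => //.
  exact: measurable_funeneg.
Qed.

Lemma mu2_rectangle (A B : set R) : measurable (A : set (measurableTypeR R)) ->
  measurable (B : set (measurableTypeR R)) -> mu2 (A `*` B) = (mu A * mu B)%E.
Proof. exact: product_measure1E. Qed.

Lemma ae_coord1_neq (c : R) : {ae mu2, forall u : plane, u.1 != c}.
Proof.
exists ([set c] `*` setT); split.
- by apply: measurableX => //; exact: measurable_set1.
- rewrite mu2_rectangle//.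
  by rewrite lebesgue_measure_set1 mul0e.
- by move=> u /= /negP; rewrite negbK => /eqP.
Qed.

Lemma ae_coord2_neq (c : R) : {ae mu2, forall u : plane, u.2 != c}.
Proof.
exists (setT `*` [set c]); split.
- by apply: measurableX => //; exact: measurable_set1.
- rewrite mu2_rectangle//.
  by rewrite lebesgue_measure_set1 mule0.
- by move=> u /= /negP; rewrite negbK => /eqP.
Qed.

Lemma measurable_mxact (D : 'M[R]_2) :
  measurable_fun setT (mxact D : plane -> plane).
Proof.
apply: measurable_plane; apply: measurable_funD; apply: measurable_funM => //;
  solve [exact: measurable_coord1|exact: measurable_coord2].
Qed.

(** Two one-dimensional affine substitutions; the second coordinate of the
    intermediate point is integrated first, in the order that the pivot allows. *)
Lemma ge0_integral_mxact (D : 'M[R]_2) (F : plane -> \bar R) : \det D != 0 ->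
  measurable_fun setT F -> (forall u, 0 <= F u)%E ->
  (`|\det D|%:E * \int[mu2]_(u in [set: plane]) F (mxact D u) = \int[mu2]_u F u)%E.
Proof.
rewrite det_mx22 => D0 mF F0.
set a := D 0 0 in D0 *; set b := D 0 1 in D0 *; set c := D 1 0 in D0 *;
  set d := D 1 1 in D0 *.
have mFD : measurable_fun setT (fun u => F (mxact D u)).
  exact: (measurableT_comp mF (measurable_mxact D)).
have sec1 y : measurable_fun setT (fun x => F (x, y)).
  exact: (measurable_fun_pair1 y mF).
have sec2 x : measurable_fun setT (fun y => F (x, y)).
  exact: (measurable_fun_pair2 x mF).
have line (p q r s : R) : measurable_fun setT (fun x : R => F (p * x + q, r * x + s)%R).
  apply: (measurableT_comp mF); apply: measurable_fun_pair; exact: measurable_affine.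
have mG (p q : R) : measurable_fun setT
    ((fun u => F (u.1, p * u.1 + q * u.2)%R) : plane -> \bar R).
  apply: (measurableT_comp mF); apply: measurable_plane; first exact: measurable_coord1.
  by apply: measurable_funD; apply: measurable_funM.
have [a0|a0] := eqVneq a 0; last first.
  rewrite fubini_tonelli2//=.
  have step1 y : (`|a|%:E * \int[mu]_x F (mxact D (x, y)) =
      \int[mu]_x F (x, c / a * x + (a * d - b * c) / a * y)%R)%E.
    rewrite -(@ge0_integral_affine _ a (b * y)
      (fun x => F (x, c / a * x + (a * d - b * c) / a * y)%R))//.
      congr (_ * _)%E; apply: eq_integral => x _; congr (F (_, _)); rewrite /=.
      by rewrite -/c -/d; field.
    have := line 1 0 (c / a) ((a * d - b * c) / a * y)%R.
    by under eq_fun do rewrite mul1r addr0.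
  transitivity (`|(a * d - b * c) / a|%:E *
      \int[mu]_y (`|a|%:E * \int[mu]_x F (mxact D (x, y))))%E.
    rewrite ge0_integralZl//=; last 2 first.
    - exact: (@measurable_fun_fubini_tonelli_G _ _ _ _ _ mu _ mFD (fun=> F0 _)).
    - by move=> y _; apply: integral_ge0.
    rewrite muleA -EFinM -normrM; congr ((`|_|)%:E * _)%E; field; exact: a0.
  under eq_integral do rewrite step1.
  transitivity (`|(a * d - b * c) / a|%:E * \int[mu2]_(u in [set: plane])
      F (u.1, c / a * u.1 + (a * d - b * c) / a * u.2)%R)%E.
    congr (_ * _)%E; rewrite [RHS]fubini_tonelli2//.
  rewrite fubini_tonelli1//= [RHS]fubini_tonelli1//=.
  rewrite -ge0_integralZl//=; last 2 first.
  - exact: (@measurable_fun_fubini_tonelli_F _ _ _ _ _ mu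
      _ (mG _ _) (fun=> F0 _)).
  - by move=> y _; apply: integral_ge0.
  apply: eq_integral => x _.
  have p0 : (a * d - b * c) / a != 0 by rewrite mulf_neq0// invr_eq0.
  etransitivity; last exact: (@ge0_integral_affine _ _ (c / a * x) (fun y => F (x, y)) p0 (sec2 x) (fun=> F0 _)).
  congr (_ * _)%E; apply: eq_integral => y _ /=; congr (F (_, _)); ring.
have b0 : b != 0 by apply: contra D0 => /eqP ->; rewrite a0 !mul0r subrr.
have c0 : c != 0 by apply: contra D0 => /eqP ->; rewrite a0 mulr0 mul0r subrr.
rewrite fubini_tonelli2//= a0 mul0r sub0r normrN normrM EFinM -muleA.
have step1 y : (`|c|%:E * \int[mu]_x F (mxact D (x, y)) = \int[mu]_x F (b * y, x)%R)%E.
  rewrite -(@ge0_integral_affine _ c (d * y) (fun x => F (b * y, x)%R) c0 (sec2 _))//.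
  congr (_ * _)%E; apply: eq_integral => x _; congr (F (_, _)) => /=.
  by rewrite -/a a0 mul0r add0r.
rewrite -ge0_integralZl//=; last 2 first.
- exact: (@measurable_fun_fubini_tonelli_G _ _ _ _ _ mu _ mFD (fun=> F0 _)).
- by move=> y _; apply: integral_ge0.
under eq_integral do rewrite step1.
rewrite [RHS]fubini_tonelli1//=.
have := @ge0_integral_affine _ b 0 (fun y => \int[mu]_x F (y, x))%E b0.
move=> <-.
- by congr (_ * _)%E; apply: eq_integral => y _; rewrite addr0.
- exact: (@measurable_fun_fubini_tonelli_F _ _ _ _ _ mu F).
- by move=> y; apply: integral_ge0.
Qed.

Lemma ae_mxact (D : 'M[R]_2) (N : plane -> Prop) : \det D != 0 ->
  {ae mu2, forall u, N u} -> {ae mu2, forall u : plane, N (mxact D u)}.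
Proof.
move=> D0 [Z [mZ Z0 sub]].
have mpre : measurable (mxact D @^-1` Z : set plane).
  by rewrite -[X in measurable X]setTI; exact: measurable_mxact.
exists (mxact D @^-1` Z); split => //; last by move=> u h; exact: sub.
have area (A : set plane) : measurable A ->
    (\int[mu2]_(u in [set: plane]) (\1_A u)%:E = mu2 A)%E.
  by move=> mA; rewrite integral_indic// setIT.
have mZe : measurable_fun setT (fun u : plane => (\1_Z u)%:E : \bar R).
  by apply/measurable_EFinP; exact: measurable_indic.
have pos u : (0 <= (\1_Z u)%:E :> \bar R)%E by rewrite lee_fin.
have /eqP := etrans (ge0_integral_mxact D0 mZe pos) (etrans (area Z mZ) Z0).
rewrite mule_eq0 eqe normr_eq0 (negbTE D0) /= => /eqP h.
by rewrite -area// -[RHS]h; apply: eq_integral => u _; rewrite !indicE.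
Qed.

End planar_integrals.

(** * Lattice cells *)

Section lattice_cells.
Context {R : realType}.
Notation mu := (@lebesgue_measure R).
Notation plane := (measurableTypeR R * measurableTypeR R)%type.
Notation lattice := (int * int)%type.

Definition cell_index (M1 M2 : R) (u : R * R) : lattice :=
  (Num.ceil (M1 * u.1), Num.ceil (M2 * u.2)).

Definition cell (M1 M2 : R) (s : lattice) : set plane :=
  [set u | cell_index M1 M2 u = s].

Definition slab (M : R) (k : int) : set R := `](k - 1)%:~R / M, k%:~R / M]%classic.

Lemma cellE (M1 M2 : R) (s : lattice) : 0 < M1 -> 0 < M2 ->
  cell M1 M2 s = slab M1 s.1 `*` slab M2 s.2.
Proof.
move=> M10 M20.
have ceilE (M x : R) (k : int) : 0 < M -> Num.ceil (M * x) = k <-> slab M k x.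
  move=> M0; rewrite /slab /= in_itv/= ltr_pdivrMr// ler_pdivlMr// [x * M]mulrC.
  by split => [<-|]; [exact: ceil_itv|exact: ceil_def].
case: s => s1 s2; apply/seteqP; split => u; rewrite /cell /cell_index /=.
  by move=> [e1 e2]; split; apply/ceilE.
by move=> [/= /(ceilE _ _ _ M10) -> /(ceilE _ _ _ M20) ->].
Qed.

Lemma measurable_cell (M1 M2 : R) (s : lattice) : 0 < M1 -> 0 < M2 ->
  measurable (cell M1 M2 s).
Proof. by move=> M10 M20; rewrite cellE//; apply: measurableX; exact: measurable_itv. Qed.

Lemma mu2_cell (M1 M2 : R) (s : lattice) : 0 < M1 -> 0 < M2 ->
  mu2 (cell M1 M2 s) = ((M1 * M2)^-1)%:E.
Proof.
move=> M10 M20; rewrite cellE// mu2_rectangle; [|exact: measurable_itv..].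
have slabE M k : 0 < M -> mu (slab M k) = (M^-1)%:E.
  move=> M0; rewrite lebesgue_measure_itv/= lte_fin ltr_pM2r ?invr_gt0// ltr_int.
  by rewrite gtrBl ltr01 -EFinB -mulrBl intrB opprB addrCA subrr addr0 mul1r.
by rewrite !slabE// -EFinM invfM.
Qed.

Lemma measurable_fun_cell (M1 M2 : R) (G : lattice -> R) : 0 < M1 -> 0 < M2 ->
  measurable_fun setT ((fun u => G (cell_index M1 M2 u)) : plane -> R).
Proof.
move=> M10 M20 _ Y mY; rewrite setTI.
have -> : (fun u => G (cell_index M1 M2 u)) @^-1` Y =
    \bigcup_s (if `[< Y (G s) >] then cell M1 M2 s else set0).
  apply/seteqP; split => u /=.
    by move=> Yu; exists (cell_index M1 M2 u) => //=; rewrite asboolT.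
  by move=> [s _]; case: asboolP => [Ys|_ []//]; rewrite /cell /= => ->.
apply: countable_bigcupT_measurable => [|s]; first exact: countableP.
by case: asboolP => _ //; exact: measurable_cell.
Qed.

Lemma integrable_cell (M1 M2 : R) (s : lattice) : 0 < M1 -> 0 < M2 ->
  mu2.-integrable setT (EFin \o (\1_(cell M1 M2 s) : plane -> R)).
Proof.
move=> M10 M20; have mC := measurable_cell s M10 M20.
apply/integrableP; split; first by apply/measurable_EFinP; exact: measurable_indic.
rewrite (eq_integral (fun u => (\1_(cell M1 M2 s) u)%:E)); last first.
  by move=> u _; rewrite /= ger0_norm.
by rewrite integral_indic// setIT mu2_cell// ltry.
Qed.

Lemma integral_finite_cells (M1 M2 : R) (G : lattice -> R) (r : seq lattice) :
  0 < M1 -> 0 < M2 ->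
  let f u := \sum_(s <- r) G s * \1_(cell M1 M2 s) u in
  mu2.-integrable setT (EFin \o f) /\
  \int[mu2]_u f u = \sum_(s <- r) G s / (M1 * M2).
Proof.
move=> M10 M20 /=; have i1 s : mu2.-integrable setT (EFin \o (fun u => G s * \1_(cell M1 M2 s) u)).
  by apply: integrable_EFinZ => //; exact: integrable_cell.
elim: r => [|s r [IHi IH]].
  split; first by under eq_fun do rewrite big_nil; exact: integrable0.
  by rewrite big_nil; under eq_Rintegral do rewrite big_nil; rewrite /Rintegral integral0.
split; first by under eq_fun do rewrite big_cons; exact: integrable_EFinD.
under eq_Rintegral do rewrite big_cons.
rewrite RintegralD//= IH big_cons; congr (_ + _).
rewrite RintegralZl//=; last exact: integrable_cell.
by congr (_ * _); rewrite /Rintegral integral_indic//= ?setIT ?mu2_cell//; exact: measurable_cell.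
Qed.

(** The finite sets of lattice points that are exhausted by an enumeration. *)
Definition first_points (m : nat) : {fset lattice} :=
  [fset s in pmap pickle_inv (iota 0 m)]%fset.

Lemma mem_first_points (m : nat) (s : lattice) :
  (s \in first_points m) = (choice.pickle s < m)%N.
Proof.
rewrite inE /= mem_pmap; apply/mapP/idP => [[k]|lt].
  rewrite mem_iota add0n => /andP[_ km] sk.
  by have := @pickle_invK lattice k; rewrite -sk /= => ->.
by exists (choice.pickle s); rewrite ?mem_iota// pickleK_inv.
Qed.

Lemma sum_over_cells (G : lattice -> R) (M1 M2 : R) (F : {fset lattice}) (u : plane) :
  \sum_(s <- F) G s * \1_(cell M1 M2 s) u =
  if cell_index M1 M2 u \in F then G (cell_index M1 M2 u) else 0.
Proof.
case: ifPn => [uF|uF].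
  rewrite (big_fsetD1 (cell_index M1 M2 u))//= indicE mem_set// mulr1 big_seq big1 ?addr0//.
  move=> s; rewrite !inE/= => /andP[su _]; rewrite indicE memNset ?mulr0//.
  by move=> us; rewrite -us eqxx in su.
rewrite big_seq big1// => s sF; rewrite indicE memNset ?mulr0//.
by move=> us; rewrite -us in sF; rewrite sF in uF.
Qed.

Lemma sums_to_cells (M1 M2 : R) (G : lattice -> R) : 0 < M1 -> 0 < M2 ->
  (forall s, 0 <= G s) ->
  mu2.-integrable setT (EFin \o (fun u => G (cell_index M1 M2 u))) ->
  sums_to (fun s => G s / (M1 * M2)) (\int[mu2]_u G (cell_index M1 M2 u)).
Proof.
move=> M10 M20 G0 iG.
have pointE := sum_over_cells G M1 M2.
split => [F|eta eta0].
  have [iF <-] := integral_finite_cells G F M10 M20.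
  by apply: le_Rintegral => // u _; rewrite pointE; case: ifP.
pose f_ m u := \sum_(s <- first_points m) G s * \1_(cell M1 M2 s) u.
have [_ cv] : mu2.-integrable setT (EFin \o (fun u => G (cell_index M1 M2 u))) /\
    \int[mu2]_u f_ m u @[m --> \oo] --> \int[mu2]_u G (cell_index M1 M2 u).
  apply: (Rintegral_dominated_cvg (mu := mu2) (D := setT) (f_ := f_)
    (g := fun u => G (cell_index M1 M2 u))) => //.
  - move=> m; have [/integrableP[] /measurable_EFinP + _ _] := integral_finite_cells G (first_points m) M10 M20.
    exact.
  - exact: measurable_fun_cell.
  - apply: aeW => u _; apply: cvg_near_cst.
    exists (choice.pickle (cell_index M1 M2 u)).+1 => // m /= um.
    by rewrite /f_ pointE mem_first_points um.
  - by move=> m u _; rewrite /f_ pointE; case: ifP; rewrite ?normr0// ger0_norm.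
have /cvgrPdist_le/(_ _ eta0)[m _ /(_ m (leqnn m)) h] := cv.
exists (first_points m); have [_ <-] := integral_finite_cells G (first_points m) M10 M20.
by move: h => /=; rewrite ler_distlC => /andP[]; rewrite lerBlDr -lerBlDr.
Qed.

(** What the central limit theorem asks of the normalized coefficients
    [c k x s] of the innovation at [s] in the [k]-th normalized sum over the box
    of shape [x]: the variances of linear combinations converge to those of the
    stochastic integrals of [K x], and no single coefficient matters. *)
Definition kernel_limit (c : nat -> R * R -> lattice -> R) (K : R * R -> plane -> R) : Prop :=
  [/\ forall x, quadrant x -> measurable_fun setT (K x) /\
        mu2.-integrable setT (EFin \o (fun u => K x u ^+ 2)),
      forall n (x : 'I_n -> R * R) (theta : 'I_n -> R), (forall j, quadrant (x j)) ->
        exists2 v : nat -> R,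
          forall k, sums_to (fun s => (\sum_j theta j * c k (x j) s) ^+ 2) (v k) &
          v k @[k --> \oo] --> \int[mu2]_u (\sum_j theta j * K (x j) u) ^+ 2 &
      forall x eta, quadrant x -> 0 < eta -> exists N : nat, forall k, (N <= k)%N ->
        forall s, `|c k x s| <= eta].

Lemma cvg_norm_le (f : nat -> R) (l v : R) :
  (forall k, `|f k| <= v) -> f k @[k --> \oo] --> l -> `|l| <= v.
Proof.
move=> fv cf; apply/ler_addgt0Pr => e e0.
have /cvgrPdist_le/(_ _ e0)[k _ /(_ k (leqnn k)) h] := cf.
by rewrite -[l](subrK (f k)) (le_trans (ler_normD _ _))// addrC lerD.
Qed.

Instance ae_mu2_filter : Filter (nbhs (almost_everywhere (@mu2 R))).
Proof. exact: ae_filter_ringOfSetsType. Qed.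

Lemma integrable_sqr_le (f g : plane -> R) : measurable_fun setT f ->
  mu2.-integrable setT (EFin \o (fun u => g u ^+ 2)) ->
  {ae mu2, forall u, `|f u| <= g u} ->
  mu2.-integrable setT (EFin \o (fun u => f u ^+ 2)).
Proof.
move=> mf ig fg; apply/integrableP; split.
  by apply/measurable_EFinP; exact: measurable_funX.
have /integrableP[mg] := ig; apply: le_lt_trans.
apply: ae_ge0_le_integral => //.
- by apply: measurableT_comp => //; apply/measurable_EFinP; exact: measurable_funX.
- exact: measurableT_comp.
- apply: filterS fg => u fgu _ /=; rewrite lee_fin !normrX lerXn2r ?nnegrE//.
  exact: le_trans fgu (ler_norm _).
Qed.

(** Rescaling the lattice turns the coefficients into the function
    [u |-> sqrt (M1 k M2 k) c k x (cell of u)], whose square integral is the sum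
    of the squared coefficients; so dominated convergence in the plane does all
    the work.  A single coefficient is the integral over one cell, whose area
    vanishes. *)
Lemma kernel_limit_cells (M1 M2 : nat -> R) (c : nat -> R * R -> lattice -> R)
    (K D : R * R -> plane -> R) :
  (forall k, 0 < M1 k) -> (forall k, 0 < M2 k) ->
  (M1 k * M2 k)^-1 @[k --> \oo] --> (0 : R) ->
  let h k x (u : plane) : R := Num.sqrt (M1 k * M2 k) * c k x (cell_index (M1 k) (M2 k) u) in
  (forall x, quadrant x ->
     [/\ measurable_fun setT (K x), mu2.-integrable setT (EFin \o (fun u => D x u ^+ 2)),
         {ae mu2, forall u, forall k, `|h k x u| <= D x u} &
         {ae mu2, forall u, h k x u @[k --> \oo] --> K x u}]) ->
  kernel_limit c K.
Proof.
move=> M10 M20 M0 h H.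
have MM k : 0 < M1 k * M2 k by exact: mulr_gt0.
have hE k x u : c k x (cell_index (M1 k) (M2 k) u) ^+ 2 * (M1 k * M2 k) = h k x u ^+ 2.
  by rewrite /h exprMn sqr_sqrtr ?(ltW (MM k))// mulrC.
have mh k x : measurable_fun setT (h k x).
  exact: (measurable_fun_cell (fun s => Num.sqrt (M1 k * M2 k) * c k x s)).
split.
- move=> x qx; have [mK iD bound cv] := H x qx; split => //.
  apply: (integrable_sqr_le mK iD); apply: filterS2 bound cv => u bu cu.
  exact: cvg_norm_le bu cu.
- move=> n x theta qx.
  pose F k (u : plane) : R := \sum_j theta j * h k (x j) u.
  pose g (u : plane) : R := n%:R * \sum_j (theta j * D (x j) u) ^+ 2.
  have ig : mu2.-integrable setT (EFin \o g).
    apply: integrable_EFinZ => //.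
    rewrite (_ : EFin \o _ = fun u => (\sum_j ((theta j * D (x j) u) ^+ 2)%:E)%E); last first.
      by apply/funext => u /=; rewrite sumEFin.
    apply: integrable_sum => // j _.
    rewrite (_ : (fun u => _) = EFin \o (fun u => theta j ^+ 2 * D (x j) u ^+ 2)).
      by have [_ iD _ _] := H _ (qx j); exact: integrable_EFinZ.
    by apply/funext => u /=; rewrite exprMn.
  have aeI (Q : 'I_n -> plane -> Prop) : (forall j, {ae mu2, forall u, Q j u}) ->
      {ae mu2, forall u, forall j, Q j u}.
    by move=> aeQ; exact: (@filter_forall plane _ (fun j => [set u | Q j u]) _ ae_mu2_filter aeQ).
  have bound : {ae mu2, forall u, forall k, `|F k u ^+ 2| <= g u}.
    have : {ae mu2, forall u, forall j, forall k, `|h k (x j) u| <= D (x j) u}.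
      by apply: aeI => j; have [] := H _ (qx j).
    apply: filterS => u bu k; rewrite ger0_norm ?sqr_ge0//.
    rewrite (le_trans (sum_sqr_le _))// ler_wpM2l// ler_sum// => j _.
    rewrite 2!(exprMn _ (theta j)) ler_wpM2l ?sqr_ge0// -[leLHS]real_normK ?num_real//.
    by rewrite lerXn2r ?nnegrE// (le_trans _ (bu j k)).
  have mF k : measurable_fun setT (F k).
    by apply: measurable_sum => j; apply: measurable_funM.
  have mKs : measurable_fun setT (fun u => \sum_j theta j * K (x j) u).
    by apply: measurable_sum => j; apply: measurable_funM => //; have [] := H _ (qx j).
  have iF k : mu2.-integrable setT (EFin \o (fun u => F k u ^+ 2)).
    have /integrableP[mg] := ig; move=> ig1; apply/integrableP; split.
      apply/measurable_EFinP; apply: measurable_funX; exact: mF.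
    apply: le_lt_trans ig1; apply: ae_ge0_le_integral => //.
    - by apply: measurableT_comp => //; apply/measurable_EFinP; exact: measurable_funX.
    - exact: measurableT_comp.
    - apply: filterS bound => u bu _ /=; rewrite lee_fin.
      exact: le_trans (bu k) (ler_norm _).
  exists (fun k => \int[mu2]_u F k u ^+ 2).
    move=> k; have -> : (fun s => (\sum_j theta j * c k (x j) s) ^+ 2) = fun s =>
        (\sum_j theta j * (Num.sqrt (M1 k * M2 k) * c k (x j) s)) ^+ 2 / (M1 k * M2 k).
      apply/funext => s; under [in RHS]eq_bigr do rewrite mulrCA.
      rewrite -mulr_sumr exprMn sqr_sqrtr ?(ltW (MM k))// mulrAC divff ?mul1r// gt_eqF//.
    apply: (sums_to_cells (G := fun s =>
      (\sum_j theta j * (Num.sqrt (M1 k * M2 k) * c k (x j) s)) ^+ 2)) => //.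
      by move=> s; exact: sqr_ge0.
    exact: iF.
  apply: (Rintegral_ae_dominated_cvg (g := g) _ _ _ _ _ _).2 => //.
  + by move=> k; exact: measurable_funX.
  + exact: measurable_funX.
  + have : {ae mu2, forall u, forall j, h k (x j) u @[k --> \oo] --> K (x j) u}.
      by apply: aeI => j; have [] := H _ (qx j).
    apply: filterS => u cu _; rewrite expr2; under eq_fun do rewrite expr2.
    have cF : F k u @[k --> \oo] --> \sum_j theta j * K (x j) u.
      apply: cvg_big; first exact: add_continuous.
      by move=> j _; apply: cvgMr; exact: cu.
    exact: cvgM.
  + by apply: filterS bound => u bu _.
- move=> x eta qx eta0; have [mK iD bound _] := H x qx.
  have [del [del0 small]] := integral_normr_continuous iD (exprn_gt0 2 eta0).
  have /cvgrPdist_lt/(_ _ del0)[N _ HN] := M0.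
  exists N => k Nk s; have eta1 := ltW eta0.
  rewrite -(@ler_pXn2r _ 2) ?nnegrE// real_normK ?num_real//.
  have mc := measurable_cell s (M10 k) (M20 k).
  have small_cell : (mu2 (cell (M1 k) (M2 k) s) < del%:E)%E.
    rewrite mu2_cell// lte_fin; have := HN k Nk; rewrite /= sub0r normrN.
    by apply: le_lt_trans; exact: ler_norm.
  apply: le_trans (ltW (small _ mc small_cell)).
  have -> : c k x s ^+ 2 = \int[mu2]_(u in cell (M1 k) (M2 k) s) h k x u ^+ 2.
    transitivity (\int[mu2]_(u in cell (M1 k) (M2 k) s) (c k x s ^+ 2 * (M1 k * M2 k))).
      by rewrite Rintegral_cst// mu2_cell//= -mulrA divff ?mulr1// gt_eqF.
    by apply: eq_Rintegral => u /set_mem us; rewrite -hE us.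
  have mD := (integrableP _ _ _ iD).1.
  rewrite /Rintegral fine_le//.
  - apply: integrable_fin_num => //; apply: (integrableS measurableT) => //.
    by apply: (integrable_sqr_le (mh k x) iD); apply: filterS bound => u bu.
  - apply: integrable_fin_num => //; apply: (integrableS measurableT) => //.
    exact: (integrable_abse iD).
  apply: ae_ge0_le_integral => //.
  - by move=> u _; rewrite lee_fin sqr_ge0.
  - by apply/measurable_EFinP; apply: measurable_funTS; exact: measurable_funX.
  - by apply/measurable_EFinP; apply: measurable_funTS; apply: measurableT_comp => //; exact/measurable_EFinP.
  - apply: filterS bound => u bu _; rewrite lee_fin ger0_norm ?sqr_ge0//.
    rewrite -[leLHS]real_normK ?num_real// lerXn2r ?nnegrE//.
    exact: le_trans (bu k).
Qed.

End lattice_cells.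

(** * Power-law kernels *)

Section power_kernels.
Context {R : realType}.
Notation mu := (@lebesgue_measure R).
Notation plane := (measurableTypeR R * measurableTypeR R)%type.
Notation lattice := (int * int)%type.

Definition box_pts (N1 N2 : R) (x : R * R) : {fset lattice} :=
  fset_set [set t : lattice | box (N1 * x.1, N2 * x.2) (int2R t)].

Lemma finite_box_pts (y : R * R) : finite_set [set t : lattice | box y (int2R t)].
Proof.
pose n1 := `|Num.ceil y.1|%N; pose n2 := `|Num.ceil y.2|%N.
have bound (z : R) (k : int) : 0 < (k%:~R : R) -> (k%:~R : R) <= z ->
    (`|k|%N < `|Num.ceil z|.+1)%N /\ (`|k|%N)%:Z = k.
  move=> k0 kz; have kp : 0 <= k by rewrite -(ler0z R) ltW.
  have kc : k <= Num.ceil z by rewrite -(ler_int R) (le_trans kz)// ceil_ge.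
  by rewrite gez0_abs//; split => //; rewrite ltnS -lez_nat !gez0_abs// (le_trans kp).
apply: (@sub_finite_set _ _ ((fun p : nat * nat => (p.1%:Z, p.2%:Z)) @` (`I_n1.+1 `*` `I_n2.+1))).
  move=> [t1 t2] [/= /andP[a1 b1] /andP[a2 b2]].
  have [c1 d1] := bound _ _ a1 b1; have [c2 d2] := bound _ _ a2 b2.
  by exists (`|t1|%N, `|t2|%N); rewrite /= ?d1 ?d2.
by apply: finite_image; apply: finite_setX; exact: finite_II.
Qed.

Lemma mem_box_pts (N1 N2 : R) (x : R * R) (t : lattice) :
  (t \in box_pts N1 N2 x) =
  (0 < (t.1%:~R : R) <= N1 * x.1) && (0 < (t.2%:~R : R) <= N2 * x.2).
Proof.
rewrite in_fset_set; last exact: finite_box_pts.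
apply/idP/andP => [/set_mem[]|[h1 h2]]; first by [].
by apply/mem_set; split.
Qed.

(** The sup norm of a lattice point, bounded away from 0. *)
Definition msize (t : lattice) : R :=
  Num.max 1 (Num.max `|t.1%:~R| `|t.2%:~R|).

(** What remains of the assumption on the coefficients [b]: they decay like the
    power [-q] of the distance and, seen from far away, look like the function
    [g], the homogeneous kernel of degree [-q]. *)
Definition power_kernel (q C : R) (b : lattice -> R) (g : plane -> R) : Prop :=
  [/\ 0 <= C, measurable_fun setT g,
      forall t, `|b t| <= C * msize t `^ (- q) &
      forall (t : nat -> lattice) (m : nat -> R) (w : R * R), (forall k, 0 < m k) ->
        m k @[k --> \oo] --> +oo ->
        (t k).1%:~R / m k @[k --> \oo] --> w.1 ->
        (t k).2%:~R / m k @[k --> \oo] --> w.2 -> w != (0, 0) ->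
        m k `^ q * b (t k) @[k --> \oo] --> g w].

Lemma msize_gt0 t : 0 < msize t.
Proof. by rewrite lt_max ltr01. Qed.

(** The sup norm dominates both coordinates, so a negative power of it is at
    most a product of negative powers of the coordinates, in any proportion:
    all estimates below become one-dimensional. *)
Lemma power_kernel_product (q C : R) b g (al be m y1 y2 : R) (t : lattice) :
  power_kernel q C b g -> 0 <= al -> 0 <= be -> al + be = q -> 0 < m ->
  y1 != 0 -> y2 != 0 ->
  `|m * y1| <= 2 * msize t -> `|m * y2| <= 2 * msize t ->
  `|m `^ q * b t| <= C * 2 `^ q * (pw al y1 * pw be y2).
Proof.
move=> [C0 _ hb _] al0 be0 qE m0 y10 y20 h1 h2; subst q.
have s0 := msize_gt0 t.
have key (a y : R) : 0 <= a -> y != 0 -> `|m * y| <= 2 * msize t ->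
    m `^ a * msize t `^ (- a) <= 2 `^ a * pw a y.
  move=> a0 y0 h; have ny0 : 0 < `|y| by rewrite normr_gt0.
  have le : m `^ a * `|y| `^ a <= 2 `^ a * msize t `^ a.
    rewrite -!powRM// ?(ltW m0)// ?(ltW s0)//.
    apply: ge0_ler_powR => //.
    - by rewrite nnegrE mulr_ge0// ltW.
    - by rewrite nnegrE mulr_ge0// ltW.
    - by rewrite -{1}(gtr0_norm m0) -normrM.
  rewrite /pw !powRN ler_pdivrMr ?powR_gt0// mulrAC ler_pdivlMr ?powR_gt0//.
rewrite normrM (ger0_norm (powR_ge0 _ _)).
apply: (@le_trans _ _ (m `^ (al + be) * (C * msize t `^ (- (al + be))))).
  by apply: ler_wpM2l; [exact: powR_ge0|exact: hb].
have powD (x y z : R) : 0 < x -> x `^ (y + z) = x `^ y * x `^ z.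
  by move=> x0; rewrite powRD ?(gt_eqF x0) ?implybT.
rewrite opprD !powD//.
have perm1 (x y z v r : R) : (x * y) * (z * (v * r)) = z * ((x * v) * (y * r)) by ring.
have perm2 (z x y v r : R) : z * (x * y) * (v * r) = z * ((x * v) * (y * r)) by ring.
rewrite perm1 perm2.
apply: ler_wpM2l => //; apply: ler_pM; rewrite ?mulr_ge0 ?powR_ge0//; exact: key.
Qed.

Lemma ceil_diff (a b : R) : `|a - b| <= 2 * Num.max 1 `|(Num.ceil a - Num.ceil b)%:~R|.
Proof.
have /andP[a1 a2] := ceil_itv a; have /andP[b1 b2] := ceil_itv b.
rewrite intrB in a1; rewrite intrB in b1; rewrite intrB.
set x : R := (Num.ceil a)%:~R in a1 a2 *; set y : R := (Num.ceil b)%:~R in b1 b2 *.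
have h : `|a - b| <= `|x - y| + 1.
  have n1 : x - y <= `|x - y| by exact: ler_norm.
  have n2 : - (x - y) <= `|x - y| by rewrite -normrN; exact: ler_norm.
  by rewrite ler_norml; lra.
have [m1 m2] : 1 <= Num.max 1 `|x - y| /\ `|x - y| <= Num.max 1 `|x - y|.
  by rewrite !le_max !lexx orbT.
lra.
Qed.

Lemma le_msize1 (t : lattice) : Num.max 1 `|t.1%:~R| <= msize t.
Proof. by rewrite /msize ge_max !le_max !lexx !orbT. Qed.

Lemma le_msize2 (t : lattice) : Num.max 1 `|t.2%:~R| <= msize t.
Proof. by rewrite /msize ge_max !le_max !lexx !orbT. Qed.

(** Rounding is invisible at a scale that tends to infinity. *)
Lemma cvg_ceil_div (a m : nat -> R) (l : R) : (forall k, 0 < m k) ->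
  m k @[k --> \oo] --> +oo -> a k / m k @[k --> \oo] --> l ->
  (Num.ceil (a k))%:~R / m k @[k --> \oo] --> l.
Proof.
move=> m0 moo al.
have inv0 : (m k)^-1 @[k --> \oo] --> (0 : R) by apply/gtr0_cvgV0 => //; exact: nearW.
have up : (a k / m k + (m k)^-1) @[k --> \oo] --> l.
  by rewrite -[l]addr0; exact: cvgD.
apply: squeeze_cvgr al up; apply: nearW => k; apply/andP; split.
  by rewrite ler_pM2r ?invr_gt0// ceil_ge.
rewrite -[X in _ + X]mul1r -mulrDl ler_pM2r ?invr_gt0//.
by have /andP[h _] := ceil_itv (a k); rewrite intrB in h; rewrite ltW// -ltrBlDr.
Qed.

End power_kernels.

(** * Asymptotics of the coefficients *)

Section coefficient_asymptotics.
Context {R : realType}.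
Notation plane := (measurableTypeR R * measurableTypeR R)%type.
Notation lattice := (int * int)%type.

Lemma cvg_powR (x : nat -> R) (l p : R) : 0 < p -> (forall k, 0 <= x k) ->
  x k @[k --> \oo] --> l -> x k `^ p @[k --> \oo] --> l `^ p.
Proof.
move=> p0 x0 cx; have l0 : 0 <= l.
  by rewrite -(cvg_lim _ cx)//; apply: limr_ge; [apply/cvg_ex; exists l|exact: nearW].
have [l1|l1] := eqVneq l 0.
  rewrite l1 powR0 ?gt_eqF//; apply/cvgrPdist_lt => e e0.
  have e1 : 0 < e `^ p^-1 by exact: powR_gt0.
  move/cvgrPdist_lt : cx => /(_ _ e1); apply: filterS => k.
  rewrite l1 !sub0r !normrN !ger0_norm ?powR_ge0// => h.
  have := gt0_ltr_powR p0 _ _ h; rewrite !nnegrE powR_ge0 x0 => /(_ isT isT).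
  by rewrite -powRrM mulVf ?gt_eqF// powRr1// ltW.
have l2 : 0 < l by rewrite lt_neqAle eq_sym l1.
have E : \forall k \near \oo, expR (p * ln (x k)) = x k `^ p.
  near=> k; rewrite /powR gt_eqF//; near: k; exact: (cvgr_gt l).
rewrite {2}/powR gt_eqF//; apply: cvg_trans (near_eq_cvg E) _.
have cl : p * ln (x k) @[k --> \oo] --> p * ln l.
  by apply: cvgMr; apply: (cvg_comp _ _ cx); exact: continuous_ln.
by apply: (cvg_comp _ _ cl); exact: continuous_expR.
Unshelve. all: by end_near. Qed.

Variables (q : R) (B : 'M[R]_2) (Lp Lm : R -> R).
Hypothesis q0 : 0 < q.
Notation rho := (rho q q).
Notation Lang := (Lang q q Lp Lm).
Let ratio (u : R * R) : R := u.1 / rho u `^ q^-1.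

Lemma rho_ge0 u : 0 <= rho u.
Proof. by rewrite addr_ge0// powR_ge0. Qed.

Lemma rho_gt0 u : u != (0, 0) -> 0 < rho u.
Proof.
move=> u0; rewrite lt_neqAle rho_ge0 andbT eq_sym; apply: contra u0.
rewrite paddr_eq0 ?powR_ge0// !powR_eq0 !normr_eq0 (gt_eqF q0) !andbT.
by case: u => a b /= /andP[/eqP -> /eqP ->].
Qed.

Lemma rhoM (c : R) u : 0 < c -> rho (c * u.1, c * u.2) = c `^ q * rho u.
Proof.
by move=> c0; rewrite /Defs.rho/= !normrM !powRM ?normr_ge0// mulrDr (gtr0_norm c0).
Qed.

Lemma ratioM (c : R) u : 0 < c -> ratio (c * u.1, c * u.2) = ratio u.
Proof.
move=> c0; rewrite /ratio rhoM// powRM ?powR_ge0 ?rho_ge0// -powRrM mulfV ?gt_eqF//.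
by rewrite powRr1 ?ltW//= invfM mulrACA divff ?mul1r ?gt_eqF.
Qed.

Lemma LangM (c : R) u : 0 < c -> Lang (c * u.1, c * u.2) = Lang u.
Proof.
by move=> c0; rewrite /Defs.Lang -/(ratio _) -/(ratio u) ratioM//= pmulr_rge0.
Qed.

Lemma ratio_itv u : -1 <= ratio u <= 1.
Proof.
have h : `|u.1| <= rho u `^ q^-1.
  rewrite -[leLHS](@powRr1 _ `|u.1|)// -(@mulfV _ q) ?gt_eqF// powRrM.
  apply: ge0_ler_powR; rewrite ?invr_ge0 ?(ltW q0)// ?nnegrE ?powR_ge0 ?rho_ge0//.
  by rewrite lerDl powR_ge0.
rewrite -ler_norml /ratio normrM normfV (ger0_norm (powR_ge0 _ _)).
have [->|r0] := eqVneq (rho u `^ q^-1) 0; first by rewrite invr0 mulr0.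
by rewrite ler_pdivrMr ?mul1r// lt_neqAle eq_sym r0 powR_ge0.
Qed.

Lemma ratio_axis u : u.2 = 0 -> u.1 != 0 -> ratio u = 1 \/ ratio u = -1.
Proof.
move=> u2 u1; have -> : ratio u = u.1 / `|u.1|.
  by rewrite /ratio /Defs.rho u2 normr0 powR0 ?gt_eqF// addr0 -powRrM mulfV ?gt_eqF// powRr1.
have [h|h] := ltP 0 u.1; first by left; rewrite gtr0_norm// divff.
by right; rewrite ler0_norm// invrN mulrN divff.
Qed.

Definition clip (r : R) : R := Num.max (-1) (Num.min 1 r).

Lemma clip_id r : -1 <= r <= 1 -> clip r = r.
Proof. by move=> /andP[h1 h2]; rewrite /clip min_r// max_r. Qed.

Lemma clip_itv r : clip r \in `[(-1), 1].
Proof. by rewrite in_itv/= /clip le_max lexx/= ge_max ge_min lexx/= andbT; lra. Qed.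

Lemma continuous_clip (f : R -> R) : {within `[(-1), 1], continuous f} ->
  continuous (f \o clip).
Proof.
move=> cf x; have cl : continuous clip.
  move=> y; apply: (@continuous_max _ _ (fun=> -1)); first exact: cvg_cst.
  by apply: (@continuous_min _ _ (fun=> 1)); [exact: cvg_cst|exact: cvg_id].
move=> V /((proj1 (subspace_continuousP _ _) cf) (clip x) (clip_itv x)) h.
have h2 : \forall z \near x, `[(-1), 1]%classic (clip z) -> V (f (clip z)) := cl x _ h.
by apply: (@filterS _ (nbhs x) _ _ _ _ h2) => z; apply; exact: clip_itv.
Qed.

Hypothesis (cLp : {within `[(-1), 1], continuous Lp}) (cLm : {within `[(-1), 1], continuous Lm}).
Hypotheses (Lp1 : Lp 1 = Lm 1) (LpN1 : Lp (-1) = Lm (-1)).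

Lemma Lang_clip u : Lang u = if 0 <= u.2 then (Lp \o clip) (ratio u) else (Lm \o clip) (ratio u).
Proof. by rewrite /= clip_id ?ratio_itv. Qed.

Lemma Lang_bounded : exists2 M : R, 0 < M & forall u, `|Lang u| <= M.
Proof.
have bound (f : R -> R) : {within `[(-1), 1], continuous f} ->
    exists M : R, forall r, -1 <= r <= 1 -> `|f r| <= M.
  move=> cf; have := continuous_compact cf (@segment_compact R (-1) 1).
  move=> /compact_bounded[M [_ /(_ (M + 1))]]; rewrite ltrDl ltr01 => /(_ isT) h.
  by exists (M + 1) => r r1; apply: h; exists r => //=; rewrite in_itv.
have [[M1 h1] [M2 h2]] := (bound _ cLp, bound _ cLm).
exists (`|M1| + `|M2| + 1) => [|u]; first by rewrite ltr_wpDl// addr_ge0.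
have := h1 _ (ratio_itv u); have := h2 _ (ratio_itv u).
have := ler_norm M1; have := ler_norm M2; have := normr_ge0 M1; have := normr_ge0 M2.
by rewrite /Defs.Lang -/(ratio u); case: ifP => _; lra.
Qed.

Lemma cvg_rho (u : nat -> R * R) (w : R * R) :
  (u k).1 @[k --> \oo] --> w.1 -> (u k).2 @[k --> \oo] --> w.2 ->
  rho (u k) @[k --> \oo] --> rho w.
Proof.
move=> c1 c2; apply: cvgD; apply: cvg_powR => //; exact: cvg_norm.
Qed.

Lemma cvg_ratio (u : nat -> R * R) (w : R * R) : w != (0, 0) ->
  (u k).1 @[k --> \oo] --> w.1 -> (u k).2 @[k --> \oo] --> w.2 ->
  ratio (u k) @[k --> \oo] --> ratio w.
Proof.
move=> w0 c1 c2; apply: cvgM => //; apply: cvgV.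
  by rewrite gt_eqF// powR_gt0// rho_gt0.
apply: cvg_powR; [by rewrite invr_gt0|by move=> k; exact: rho_ge0|exact: cvg_rho].
Qed.

(** On the horizontal axis the two branches meet, because the ratio is 1 or -1
    there. *)
Lemma cvg_Lang (u : nat -> R * R) (w : R * R) : w != (0, 0) ->
  (u k).1 @[k --> \oo] --> w.1 -> (u k).2 @[k --> \oo] --> w.2 ->
  Lang (u k) @[k --> \oo] --> Lang w.
Proof.
move=> w0 c1 c2; have cr := cvg_ratio w0 c1 c2.
have cP : (Lp \o clip) (ratio (u k)) @[k --> \oo] --> (Lp \o clip) (ratio w).
  by apply: (cvg_comp _ _ cr); exact: continuous_clip cLp _.
have cM : (Lm \o clip) (ratio (u k)) @[k --> \oo] --> (Lm \o clip) (ratio w).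
  by apply: (cvg_comp _ _ cr); exact: continuous_clip cLm _.
have [w2|w2|w2] := ltgtP w.2 0.
- rewrite Lang_clip leNgt w2 /=; apply: cvg_trans cM; apply: near_eq_cvg.
  near=> k; rewrite [RHS]Lang_clip leNgt.
  by rewrite (_ : (u k).2 < 0)//; near: k; exact: (cvgr_lt w.2).
- rewrite Lang_clip (ltW w2) /=; apply: cvg_trans cP; apply: near_eq_cvg.
  near=> k; rewrite [RHS]Lang_clip.
  by rewrite (_ : 0 <= (u k).2)//; near: k; exact: (cvgr_ge w.2).
have w1 : w.1 != 0 by apply: contra w0 => /eqP h; rewrite [w]surjective_pairing h w2.
have eqPM : (Lm \o clip) (ratio w) = (Lp \o clip) (ratio w).
  by have [->|->] := ratio_axis w2 w1; rewrite /= clip_id//; lra.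
rewrite Lang_clip w2 lexx; apply/cvgrPdist_lt => e e0.
have {}cM := eq_rect _ (fun l => (Lm \o clip) (ratio (u k)) @[k --> \oo] --> l) cM _ eqPM.
near=> k; rewrite Lang_clip; case: ifP => _; near: k.
  by move/cvgrPdist_lt : cP => /(_ _ e0).
by move/cvgrPdist_lt : cM => /(_ _ e0).
Unshelve. all: by end_near. Qed.

Lemma measurable_a_oo : measurable_fun setT (a_oo q q Lp Lm : plane -> R).
Proof.
have mcoord1 : measurable_fun setT ((fun u => u.1) : plane -> R) := measurable_fst.
have mcoord2 : measurable_fun setT ((fun u => u.2) : plane -> R) := measurable_snd.
have mrho : measurable_fun setT (rho : plane -> R).
  by apply: measurable_funD; apply: (measurableT_comp (measurable_powR _));
    apply: measurableT_comp.
have mratio : measurable_fun setT (ratio : plane -> R).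
  rewrite (_ : (ratio : plane -> R) = fun u => u.1 * rho u `^ (- q^-1)); last first.
    by apply/funext => u; rewrite /ratio powRN.
  by apply: measurable_funM => //; exact: (measurableT_comp (measurable_powR _)).
apply: measurable_funM.
  rewrite (_ : (fun u => (rho u)^-1) = fun u : plane => rho u `^ (- 1)); last first.
    by apply/funext => u; rewrite powRN powRr1// rho_ge0.
  exact: (measurableT_comp (measurable_powR _)).
rewrite (_ : (Lang : plane -> R) = fun u : plane =>
  if 0 <= u.2 then (Lp \o clip) (ratio u) else (Lm \o clip) (ratio u)); last first.
  by apply/funext => u; exact: Lang_clip.
apply: measurable_fun_ifT.
- by apply: measurable_fun_ler.
- apply: measurableT_comp => //; apply: continuous_measurable_fun; exact: continuous_clip.
- apply: measurableT_comp => //; apply: continuous_measurable_fun; exact: continuous_clip.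
Qed.

Hypothesis B0 : \det B != 0.

Lemma mxact_bound : exists2 C : R, 0 < C & forall v : R * R,
  Num.max `|v.1| `|v.2| <= C * Num.max `|(mxact B v).1| `|(mxact B v).2|.
Proof.
pose n := `|B 0 0| + `|B 0 1| + `|B 1 0| + `|B 1 1|.
exists ((n + 1) / `|\det B|) => [|v].
  by rewrite divr_gt0 ?normr_gt0// ltr_wpDl// !addr_ge0.
set u := mxact B v; set m := Num.max `|u.1| `|u.2|.
have [m1 m2] : `|u.1| <= m /\ `|u.2| <= m by rewrite !le_max !lexx orbT.
have m0 : 0 <= m by rewrite (le_trans _ m1).
have le (a b : R) : `|a| + `|b| <= n -> `|a * u.1 - b * u.2| <= (n + 1) * m.
  move=> ab; rewrite (le_trans (ler_normB _ _))// !normrM.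
  apply: (@le_trans _ _ ((`|a| + `|b|) * m)).
    by rewrite mulrDl lerD// ler_wpM2l.
  by apply: ler_wpM2r => //; rewrite (le_trans ab)// lerDl.
have nb (c : 'I_2) (c' : 'I_2) : 0 <= `|B c c'| by [].
rewrite mulrAC ler_pdivlMr ?normr_gt0// maxr_pMl ?normr_ge0// -!normrM ge_max.
apply/andP; split.
- rewrite (_ : v.1 * \det B = B 1 1 * u.1 - B 0 1 * u.2); last first.
    by rewrite det_mx22 /u /mxact /=; ring.
  apply: le; rewrite /n; have := nb 0 0; have := nb 1 0; have := nb 1 1; have := nb 0 1; lra.
- rewrite (_ : v.2 * \det B = - (B 1 0 * u.1 - B 0 0 * u.2)); last first.
    by rewrite det_mx22 /u /mxact /=; ring.
  rewrite normrN; apply: le; rewrite /n; have := nb 0 0; have := nb 1 0; have := nb 1 1; have := nb 0 1; lra.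
Qed.

Variable b : lattice -> R.
Hypothesis hb : exists o : lattice -> R,
  (forall e : R, 0 < e -> exists N : nat, forall t : lattice,
     (N%:Z <= `|t.1| + `|t.2|)%R -> `|o t| <= e) /\
  (forall t : lattice, t != 0 ->
     b t = (rho (mxact B (int2R t)))^-1 * (Lang (mxact B (int2R t)) + o t)).

Let g (u : plane) : R := a_oo q q Lp Lm (mxact B u).

Lemma coefficient_bound : exists2 C : R, 0 <= C &
  forall t, `|b t| <= C * msize t `^ (- q).
Proof.
have [oo [small bE]] := hb; have [M M0 LM] := Lang_bounded; have [C C0 hC] := mxact_bound.
have [N0 hN0] := small 1 ltr01.
pose N := N0.+1.
pose S : R := \sum_(i < (N.*2).+1) \sum_(j < (N.*2).+1) `|b (i%:Z - N%:Z, j%:Z - N%:Z)|.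
have S0 : 0 <= S by apply: sumr_ge0 => i _; apply: sumr_ge0.
exists (S * N%:R `^ q + C `^ q * (M + 1)) => [|t].
  by rewrite addr_ge0// mulr_ge0 ?powR_ge0// addr_ge0// ltW.
rewrite mulrDl.
have [near0|far] := ltP (`|t.1| + `|t.2|) (N%:Z).
  have [i it] : exists i : 'I_(N.*2).+1, t.1 = i%:Z - N%:Z.
    have hlt : (`|(t.1 + N%:Z)%R| < (N.*2).+1)%N by lia.
    by exists (Ordinal hlt) => /=; lia.
  have [j jt] : exists j : 'I_(N.*2).+1, t.2 = j%:Z - N%:Z.
    have hlt : (`|(t.2 + N%:Z)%R| < (N.*2).+1)%N by lia.
    by exists (Ordinal hlt) => /=; lia.
  rewrite -[leLHS]addr0; apply: lerD; last first.
    by rewrite !mulr_ge0 ?powR_ge0// addr_ge0// ltW.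
  apply: (@le_trans _ _ S).
    rewrite /S (bigD1 i)//= (bigD1 j)//= -it -jt -surjective_pairing -addrA lerDl.
    by rewrite addr_ge0// sumr_ge0// => *; rewrite sumr_ge0.
  rewrite -mulrA ler_peMr// powRN ler_pdivlMr ?powR_gt0 ?msize_gt0// mul1r.
  apply: ge0_ler_powR; rewrite ?nnegrE ?(ltW q0) ?ler0n ?(ltW (msize_gt0 _))//.
  have cst (k : int) : `|k| <= N%:Z -> `|k%:~R : R| <= N%:R.
    by move=> h; rewrite -intr_norm pmulrn ler_int.
  rewrite /msize ge_max ge_max !cst ?ler1n//; lia.
rewrite -[leLHS]add0r; apply: lerD; first by rewrite !mulr_ge0 ?powR_ge0.
have t0 : t != 0 by apply: contraTneq far => ->; rewrite -ltNge /=; lia.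
rewrite bE//; set u := mxact B _.
have big : 1 <= Num.max `|t.1%:~R : R| `|t.2%:~R|.
  have one (k : int) : k != 0 -> 1 <= `|k%:~R : R|.
    by move=> k0; rewrite -intr_norm -[1]/(1%:~R) ler_int; lia.
  have [t1|t1] := eqVneq t.1 0; last by rewrite le_max one.
  have t2 : t.2 != 0 by lia.
  by rewrite le_max (one _ t2) orbT.
have msE : msize t = Num.max `|t.1%:~R : R| `|t.2%:~R| by rewrite /msize max_r.
have sz : msize t `^ q <= C `^ q * rho u.
  have m0 : 0 <= Num.max `|u.1| `|u.2| by rewrite le_max normr_ge0.
  apply: (@le_trans _ _ (C `^ q * (Num.max `|u.1| `|u.2|) `^ q)).
    rewrite -powRM ?(ltW C0)//; apply: ge0_ler_powR; rewrite ?nnegrE ?(ltW q0)//.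
    - by rewrite (ltW (msize_gt0 _)).
    - by rewrite mulr_ge0// ltW.
    - by rewrite msE; exact: (hC (int2R t)).
  apply: ler_wpM2l; first exact: powR_ge0.
  by rewrite /Order.max; case: ifP => _; [rewrite lerDr powR_ge0|rewrite lerDl powR_ge0].
have r0 : 0 < rho u.
  by move: sz; rewrite -(pmulr_rgt0 _ (powR_gt0 q C0)); apply: lt_le_trans; rewrite powR_gt0// msize_gt0.
have inv : (rho u)^-1 <= C `^ q * msize t `^ (- q).
  rewrite powRN ler_pdivlMr ?powR_gt0 ?msize_gt0// mulrC ler_pdivrMr//.
have L1 : `|Lang u + oo t| <= M + 1.
  by rewrite (le_trans (ler_normD _ _))// lerD//; apply: hN0; move: far; rewrite /N; lia.
rewrite normrM normfV (gtr0_norm r0) mulrAC; apply: ler_pM => //.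
by rewrite invr_ge0 ltW.
Qed.

Lemma power_kernel_a_oo : exists C, power_kernel q C b g.
Proof.
have [C C0 hC] := coefficient_bound; exists C; split => //.
  exact: (measurableT_comp measurable_a_oo (measurable_mxact B)).
move=> t m w m0 moo c1 c2 w0; have [oo [small bE]] := hb; have [A A0 hA] := mxact_bound.
pose u k := mxact B ((t k).1%:~R / m k, (t k).2%:~R / m k).
have cu1 : (u k).1 @[k --> \oo] --> (mxact B w).1.
  by apply: cvgD; apply: cvgMr.
have cu2 : (u k).2 @[k --> \oo] --> (mxact B w).2.
  by apply: cvgD; apply: cvgMr.
have Bw0 : mxact B w != (0, 0).
  apply: contra w0 => /eqP h; have := hA w; rewrite h normr0 maxxx mulr0 => hw.
  have [h1 h2] : `|w.1| <= 0 /\ `|w.2| <= 0.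
    by split; apply: le_trans hw; rewrite le_max lexx ?orbT.
  by move: h1 h2; rewrite !normr_le0; case: (w) => /= ? ? /eqP -> /eqP ->.
have uE k : mxact B (int2R (t k)) = (m k * (u k).1, m k * (u k).2).
  by rewrite /u /mxact /int2R /=; congr (_, _); field; rewrite gt_eqF.
have big : forall N : nat, \forall k \near \oo, (N%:Z <= `|(t k).1| + `|(t k).2|)%R.
  have grow (s : nat -> int) (z : R) N : z != 0 -> (s k)%:~R / m k @[k --> \oo] --> z ->
      \forall k \near \oo, (N%:Z <= `|s k|)%R.
    move=> z0 cs; have nz : 0 < `|z| by rewrite normr_gt0.
    have half : `|z| / 2 < `|z| by lra.
    move/cvg_norm : cs => /cvgr_gt/(_ _ half) h1.
    move/cvgryPgt : (moo) => /(_ (2 * N%:R / `|z|)) h2.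
    apply: filterS2 h1 h2 => k h1 h2; rewrite -(ler_int R) intr_norm.
    move: h1; rewrite normrM normfV (gtr0_norm (m0 k)) ltr_pdivlMr// => h1.
    move: h2; rewrite ltr_pdivrMr// => h2; apply: le_trans (ltW h1).
    rewrite -pmulrn; nra.
  move=> N; have [w1|w1] := eqVneq w.1 0.
    have w2 : w.2 != 0 by apply: contra w0; move: w1; case: (w) => /= ? ? -> /eqP ->.
    by have := grow _ _ N w2 c2; apply: filterS => k; lia.
  by have := grow _ _ N w1 c1; apply: filterS => k; lia.
have co : oo (t k) @[k --> \oo] --> 0.
  apply/cvgrPdist_le => e e0; have [N hN] := small e e0.
  by have := big N; apply: filterS => k /hN; rewrite sub0r normrN.
have E : \forall k \near \oo, (rho (u k))^-1 * (Lang (u k) + oo (t k)) = m k `^ q * b (t k).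
  have := big 1%N; apply: filterS => k k1; rewrite bE ?uE ?rhoM ?LangM//.
    rewrite invfM mulrA mulrA mulfV ?mul1r//.
    by rewrite gt_eqF// powR_gt0.
  by apply: contraTneq k1 => ->; rewrite -ltNge /=; lia.
apply: cvg_trans (near_eq_cvg E) _.
rewrite /g /a_oo; apply: cvgM.
  by apply: cvgV; [rewrite gt_eqF// rho_gt0|exact: cvg_rho].
by rewrite -[Lang _]addr0; apply: cvgD => //; exact: cvg_Lang.
Qed.

End coefficient_asymptotics.

(** * Coefficients as integrals *)

Section integral_kernels.
Context {R : realType}.
Notation mu := (@lebesgue_measure R).
Notation plane := (measurableTypeR R * measurableTypeR R)%type.
Notation lattice := (int * int)%type.

Lemma integral_mulindic d (T : measurableType d) (nu : {measure set T -> \bar R})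
    (D : set T) (f : T -> R) :
  (\int[nu]_x (f x * \1_D x)%:E = \int[nu]_(x in D) (f x)%:E)%E.
Proof.
rewrite [RHS]integral_mkcond; apply: eq_integral => x _.
by rewrite patchE indicE; case: (x \in D); rewrite ?mulr1 ?mulr0.
Qed.

Lemma norm_Rintegral_le d (T : measurableType d) (nu : {measure set T -> \bar R})
    (f F : T -> R) (e : R) : measurable_fun setT f -> measurable_fun setT F ->
  (forall x, 0 <= F x) -> {ae nu, forall x, `|f x| <= F x} ->
  (\int[nu]_x (F x)%:E <= e%:E)%E -> `|\int[nu]_x f x| <= e.
Proof.
move=> mf mF F0 fF Fe.
have le : (\int[nu]_x `|(f x)%:E| <= \int[nu]_x (F x)%:E)%E.
  apply: ae_ge0_le_integral => //.
  - by apply: measurableT_comp => //; exact/measurable_EFinP.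
  - by move=> x _; rewrite lee_fin.
  - exact/measurable_EFinP.
  - by apply: (@filterS _ _ (ae_filter_ringOfSetsType nu) _ _ _ fF) => x fx _; rewrite lee_fin.
have i : nu.-integrable setT (EFin \o f).
  apply/integrableP; split; first exact/measurable_EFinP.
  by apply: (le_lt_trans le); apply: (le_lt_trans Fe); rewrite ltry.
apply: (le_trans (le_normr_Rintegral measurableT i)).
rewrite -lee_fin; apply: le_trans Fe; apply: le_trans le.
rewrite /Rintegral fineK//; apply: integrable_fin_num => //.
exact: (integrable_abse i).
Qed.

Lemma measurable_box (x : R * R) : measurable (box x : set plane).
Proof.
rewrite (_ : box x = `]0, x.1]%classic `*` `]0, x.2]%classic).
  by apply: measurableX; exact: measurable_itv.
by apply/seteqP; split => u; rewrite /box /= !in_itv.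
Qed.

Lemma ceil_gt0_real (a : R) : (0 < (Num.ceil a)%:~R :> R) = (0 < a).
Proof.
have /andP[h1 h2] := ceil_itv a; apply/idP/idP => [h|h]; last exact: lt_le_trans h2.
have c1 : 1 <= (Num.ceil a) by move: h; rewrite ltr0z gtz0_ge1.
by apply: le_lt_trans h1; rewrite ler0z subr_ge0.
Qed.

Lemma box_of_cell (N1 N2 : R) (x : R * R) (u : plane) : 0 < N1 -> 0 < N2 ->
  cell_index N1 N2 u \in box_pts N1 N2 x -> box x u.
Proof.
move=> N10 N20; rewrite mem_box_pts /cell_index /= !ceil_gt0_real !pmulr_rgt0//.
move=> /andP[/andP[a1 a2] /andP[b1 b2]]; rewrite /box /= a1 b1 /=.
split; [rewrite -(ler_pM2l N10)|rewrite -(ler_pM2l N20)].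
  exact: le_trans (ceil_ge _) a2.
exact: le_trans (ceil_ge _) b2.
Qed.

(** Both passages to the limit at once: the rescaled coefficients are themselves
    integrals, convergent for almost every [u] by domination in [tau], and then
    in L^2 by domination in [u]. *)
Lemma kernel_limit_integral (M1 M2 : nat -> R) (c : nat -> R * R -> lattice -> R)
    (Phi : nat -> R * R -> plane -> plane -> R) (Phi_oo : R * R -> plane -> plane -> R)
    (D : R * R -> plane -> R) :
  (forall k, 0 < M1 k) -> (forall k, 0 < M2 k) ->
  (M1 k * M2 k)^-1 @[k --> \oo] --> (0 : R) ->
  (forall x, quadrant x ->
    [/\ forall k u, measurable_fun setT (Phi k x u),
        measurable_fun setT ((fun z => Phi_oo x z.1 z.2) : plane * plane -> R),
        forall k u, Num.sqrt (M1 k * M2 k) * c k x (cell_index (M1 k) (M2 k) u) =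
          \int[mu2]_t Phi k x u t,
        measurable_fun setT (D x) /\ (\int[mu2]_u ((D x u) ^+ 2)%:E < +oo)%E &
        {ae mu2, forall u, forall k, exists F : plane -> R,
          [/\ measurable_fun setT F, forall t, 0 <= F t,
              {ae mu2, forall t, `|Phi k x u t| <= F t} &
              (\int[mu2]_t (F t)%:E <= (D x u)%:E)%E]} /\
        {ae mu2, forall u, exists k0 : nat, exists E : plane -> R,
          [/\ measurable_fun setT E, forall t, 0 <= E t, (\int[mu2]_t (E t)%:E < +oo)%E,
              forall k, (k0 <= k)%N -> {ae mu2, forall t, `|Phi k x u t| <= E t} &
              {ae mu2, forall t, Phi k x u t @[k --> \oo] --> Phi_oo x u t}]}]) ->
  kernel_limit c (fun x u => \int[mu2]_t Phi_oo x u t) /\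
  forall x, quadrant x ->
    {ae mu2, forall u, mu2.-integrable setT (EFin \o Phi_oo x u)}.
Proof.
move=> M10 M20 M0 H.
have lim x u : quadrant x -> (exists k0 : nat, exists E : plane -> R,
          [/\ measurable_fun setT E, forall t, 0 <= E t, (\int[mu2]_t (E t)%:E < +oo)%E,
              forall k, (k0 <= k)%N -> {ae mu2, forall t, `|Phi k x u t| <= E t} &
              {ae mu2, forall t, Phi k x u t @[k --> \oo] --> Phi_oo x u t}]) ->
    mu2.-integrable setT (EFin \o Phi_oo x u) /\
    \int[mu2]_t Phi k x u t @[k --> \oo] --> \int[mu2]_t Phi_oo x u t.
  move=> qx [k0 [E [mE E0 iE bE cE]]]; have [mP mPo _ _ _] := H x qx.
  have [] := @Rintegral_ae_dominated_cvg _ _ _ mu2 setT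
    (fun k t => Phi (k + k0)%N x u t) (Phi_oo x u) E.
  - exact: measurableT.
  - by move=> k; exact: mP.
  - exact: (measurable_fun_pair2 u mPo).
  - apply: filterS cE => t ct _; rewrite (cvg_shiftn k0 (fun k => Phi k x u t)).
    exact: ct.
  - apply/integrableP; split; first exact/measurable_EFinP.
    by under eq_integral do rewrite /= ger0_norm//.
  - have : {ae mu2, forall t, forall k, `|Phi (k + k0)%N x u t| <= E t}.
      by apply: ae_foralln => k; apply: bE; exact: leq_addl.
    by apply: filterS => t bt _ k.
  move=> i cv; split => //.
  by rewrite -(cvg_shiftn k0 (fun k => \int[mu2]_t Phi k x u t)).
split; last first.
  move=> x qx; have [_ _ _ _ [_ h]] := H x qx.
  by apply: filterS h => u /(lim x u qx)[].
apply: (kernel_limit_cells (D := D) M10 M20 M0) => x qx.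
have [mP mPo hE [mD iD] [h1 h2]] := H x qx; split.
- exact: (@measurable_Rintegral_param _ (fun z => Phi_oo x z.1 z.2) setT).
- apply/integrableP; split; first by apply/measurable_EFinP; exact: measurable_funX.
  by under eq_integral do rewrite /= ger0_norm ?sqr_ge0//.
- apply: filterS h1 => u hu k; rewrite hE; have [F [mF F0 bF FD]] := hu k.
  exact: (norm_Rintegral_le (mP k u) mF F0 bF FD).
- apply: filterS h2 => u hu; under eq_fun do rewrite hE.
  by have [] := lim x u qx hu.
Qed.

End integral_kernels.

(** * Kernels integrated over the box *)

Section direct_scaling.
Context {R : realType}.
Notation mu := (@lebesgue_measure R).
Notation plane := (measurableTypeR R * measurableTypeR R)%type.
Notation lattice := (int * int)%type.

Lemma eventually_in_range (a M : nat -> R) (l x : R) : (forall k, 0 < M k) ->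
  a k / M k @[k --> \oo] --> l -> l != 0 -> l != x ->
  \forall k \near \oo, (0 < a k <= M k * x) = (0 < l <= x).
Proof.
move=> M0 cv l0 lx.
have e1 : \forall k \near \oo, (0 < a k / M k) = (0 < l).
  have [h|h] := ltP 0 l; first by near=> k; near: k; exact: (cvgr_gt l).
  have h' : l < 0 by rewrite lt_neqAle l0.
  by near=> k; apply/negbTE; rewrite -leNgt; near: k; exact: (cvgr_le l).
have e2 : \forall k \near \oo, (a k / M k <= x) = (l <= x).
  have [h|h] := leP l x.
    have h' : l < x by rewrite lt_neqAle lx.
    by near=> k; near: k; exact: (cvgr_le l).
  by near=> k; apply/negbTE; rewrite -ltNge; near: k; exact: (cvgr_gt l).
near=> k; have <- : (0 < a k / M k) = (0 < l) by near: k.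
have <- : (a k / M k <= x) = (l <= x) by near: k.
by rewrite pmulr_lgt0 ?invr_gt0// ler_pdivrMr// [M k * x]mulrC.
Unshelve. all: by end_near. Qed.

Definition window (X : R) : set R := `[- X, X]%classic.

Lemma windowE (X t : R) : (t \in window X) = (`|t| <= X).
Proof. by apply/idP/idP => [/set_mem|h]; [|apply/mem_set]; rewrite /window /= in_itv/= -?ler_norml. Qed.

Lemma measurable_window X : measurable (window X : set (measurableTypeR R)).
Proof. exact: measurable_itv. Qed.

Lemma mu_window (X : R) : 0 < X -> mu (window X) = (2 * X)%:E.
Proof.
move=> X0; rewrite /window lebesgue_measure_itv/= lte_fin gtrN// -EFinB.
by congr EFin; ring.
Qed.

Lemma measurable_pw_affine (a c d : R) :
  measurable_fun setT (fun t : measurableTypeR R => pw a (c * t + d)).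
Proof. by apply: (measurableT_comp (measurable_pw a)); exact: measurable_affine. Qed.

Lemma measurable_prod_coord (f1 f2 : R -> R) : measurable_fun setT f1 -> measurable_fun setT f2 ->
  measurable_fun setT ((fun t => f1 t.1 * f2 t.2) : plane -> R).
Proof.
move=> m1 m2; apply: measurable_funM.
  exact: (measurableT_comp m1 measurable_coord1).
exact: (measurableT_comp m2 measurable_coord2).
Qed.

Lemma integral_prod_scaled (K : R) (f1 f2 : R -> R) : 0 <= K -> measurable_fun setT f1 ->
  measurable_fun setT f2 -> (forall t, 0 <= f1 t) -> (forall t, 0 <= f2 t) ->
  (\int[mu2]_(t in [set: plane]) (K * (f1 t.1 * f2 t.2))%:E =
   K%:E * (\int[mu]_t (f1 t)%:E * \int[mu]_t (f2 t)%:E))%E.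
Proof.
move=> K0 m1 m2 p1 p2; under eq_integral do rewrite EFinM.
rewrite ge0_integralZl//.
- by rewrite integral_prod_coord.
- by apply/measurable_EFinP; exact: measurable_prod_coord.
- by move=> t _; rewrite lee_fin mulr_ge0.
Qed.

Lemma integral_prod_sqr_lty (K : R) (f1 f2 : R -> R) : measurable_fun setT f1 ->
  measurable_fun setT f2 ->
  (\int[mu]_t (f1 t ^+ 2)%:E < +oo)%E -> (\int[mu]_t (f2 t ^+ 2)%:E < +oo)%E ->
  (\int[mu2]_(t in [set: plane]) ((K * (f1 t.1 * f2 t.2)) ^+ 2)%:E < +oo)%E.
Proof.
move=> m1 m2 i1 i2; under eq_integral do rewrite !exprMn.
rewrite (integral_prod_scaled (f1 := fun t => f1 t ^+ 2) (f2 := fun t => f2 t ^+ 2)) ?sqr_ge0//.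
- by rewrite lte_mul_pinfty ?lee_fin ?sqr_ge0// lte_mul_pinfty// ?ge0_fin_numE//;
    apply: integral_ge0 => t _; rewrite lee_fin sqr_ge0.
- exact: measurable_funX.
- exact: measurable_funX.
- by move=> t; rewrite sqr_ge0.
- by move=> t; rewrite sqr_ge0.
Qed.

Lemma psi_decr (a b r : R) : a <= b -> psi 0 b r <= psi 0 a r.
Proof.
move=> ab; rewrite !psiE; case: ifP => // /negbT; rewrite -ltNge => r1.
by rewrite /pw ler_powR ?lerN2// ltW.
Qed.

Variables (q C : R) (b : lattice -> R) (g : plane -> R).
Hypothesis hb : power_kernel q C b g.
Let Cq : R := C * 2 `^ q.

Lemma Cq_ge0 : 0 <= Cq.
Proof. by rewrite mulr_ge0 ?powR_ge0//; have [] := hb. Qed.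

Lemma kernel_limit_direct (m delta : nat -> R) (dl : R) :
  (forall k, 0 < m k) -> m k @[k --> \oo] --> +oo -> (forall k, 0 < delta k) ->
  delta k @[k --> \oo] --> dl -> delta k * m k @[k --> \oo] --> +oo ->
  (forall X u1 : R, 0 < X -> u1 != 0 -> exists al be w k0,
    [/\ 0 <= al, 0 <= be < 1, al + be = q,
        measurable_fun setT (w : R -> R) /\ (forall t, 0 <= w t) &
        (\int[mu]_(t in window X) (w t)%:E < +oo)%E /\
        forall k, (k0 <= k)%N -> forall t, `|t| <= X -> pw al (delta k * t - u1) <= w t]) ->
  (forall X : R, 0 < X -> exists D : plane -> R,
    [/\ measurable_fun setT D, (\int[mu2]_u ((D u) ^+ 2)%:E < +oo)%E &
        forall k u, u.1 != 0 -> u.2 != 0 -> exists al be, [/\ 0 <= al, 0 <= be, al + be = q &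
        (\int[mu]_(t in window X) (pw al (delta k * t - u.1))%:E *
         \int[mu]_(t in window X) (pw be (t - u.2))%:E <= (D u)%:E)%E]]) ->
  let Phi_oo x u t := g (dl * t.1 - u.1, t.2 - u.2) * \1_(box x) t in
  kernel_limit (fun k x s => m k `^ (q - 1) / (delta k * m k * m k) *
      \sum_(t <- box_pts (delta k * m k) (m k) x) b (t - s))
    (fun x u => \int[mu2]_(t in [set: plane]) Phi_oo x u t) /\
  forall x, quadrant x ->
    {ae mu2, forall u : plane, mu2.-integrable setT (EFin \o Phi_oo x u)}.
Proof.
move=> m0 moo d0 dcv Noo Hin Hout Phi_oo.
pose N k := delta k * m k; have N0 k : 0 < N k by exact: mulr_gt0.
pose G k (u : plane) (t : lattice) := m k `^ q * b (t - cell_index (m k) (m k) u).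
pose Phi k x u (t : plane) : R := if cell_index (N k) (m k) t \in box_pts (N k) (m k) x
  then G k u (cell_index (N k) (m k) t) else 0.
pose X (x : R * R) : R := Num.max 1 (Num.max x.1 x.2).
have X0 x : 0 < X x by rewrite lt_max ltr01.
pose D x (u : plane) : R := Cq * projT1 (cid (Hout (X x) (X0 x))) u.
have bound k x (u t : plane) al be : 0 <= al -> 0 <= be -> al + be = q ->
    delta k * t.1 - u.1 != 0 -> t.2 - u.2 != 0 ->
    `|Phi k x u t| <= Cq * ((pw al (delta k * t.1 - u.1) * \1_(window (X x)) t.1) *
                            (pw be (t.2 - u.2) * \1_(window (X x)) t.2)).
  move=> al0 be0 ab n1 n2; rewrite /Phi; case: ifP => [/(box_of_cell (N0 k) (m0 k))|_]; last first.
    by rewrite normr0 mulr_ge0 ?Cq_ge0// mulr_ge0// mulr_ge0 ?pw_ge0.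
  move=> [/andP[t1 t1x] /andP[t2 t2x]].
  have inX (i y : R) : 0 < i -> i <= y -> y <= X x -> \1_(window (X x)) i = 1 :> R.
    by move=> i0 iy yX; rewrite indicE windowE gtr0_norm// (le_trans iy yX).
  rewrite (inX _ _ t1 t1x) ?(inX _ _ t2 t2x) ?mulr1; try by rewrite !le_max lexx !orbT.
  apply: (power_kernel_product hb) => //.
    rewrite (le_trans _ (ler_wpM2l _ (le_msize1 _)))//.
    rewrite (_ : m k * _ = N k * t.1 - m k * u.1); last by rewrite /N; ring.
    exact: ceil_diff.
  rewrite (le_trans _ (ler_wpM2l _ (le_msize2 _)))// mulrBr; exact: ceil_diff.
have ae1 k (u : plane) : {ae mu2, forall t : plane, delta k * t.1 - u.1 != 0}.
  have := @ae_coord1_neq R (u.1 / delta k); apply: filterS => t; apply: contra.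
  by rewrite subr_eq0 => /eqP <-; rewrite mulrC mulrA mulVf ?mul1r// gt_eqF.
have ae2 (u : plane) : {ae mu2, forall t : plane, t.2 - u.2 != 0}.
  by have := @ae_coord2_neq R u.2; apply: filterS => t; rewrite subr_eq0.
have mwin (w : R -> R) x : measurable_fun setT w ->
    measurable_fun setT (fun t => w t * \1_(window (X x)) t).
  by move=> mw; apply: measurable_funM => //; exact: measurable_indic (measurable_window _).
have mpw al (c d : R) : measurable_fun setT (fun t : R => pw al (c * t - d)).
  exact: measurable_pw_affine.
have mpw1 al (d : R) : measurable_fun setT (fun t : R => pw al (t - d)).
  by have := mpw al 1 d; under eq_fun do rewrite mul1r.
have intF x (w1 w2 : R -> R) : measurable_fun setT w1 -> measurable_fun setT w2 ->
    (forall t, 0 <= w1 t) -> (forall t, 0 <= w2 t) ->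
    (\int[mu2]_(t in [set: plane]) (Cq * ((w1 t.1 * \1_(window (X x)) t.1) *
                            (w2 t.2 * \1_(window (X x)) t.2)))%:E =
     Cq%:E * (\int[mu]_(t in window (X x)) (w1 t)%:E * \int[mu]_(t in window (X x)) (w2 t)%:E))%E.
  move=> mw1 mw2 p1 p2.
  rewrite (integral_prod_scaled (f1 := fun t => w1 t * \1_(window (X x)) t)
    (f2 := fun t => w2 t * \1_(window (X x)) t)) ?Cq_ge0//; last 4 first.
  - exact: mwin.
  - exact: mwin.
  - by move=> t; rewrite mulr_ge0.
  - by move=> t; rewrite mulr_ge0.
  by rewrite !integral_mulindic.
apply: (kernel_limit_integral (M1 := m) (M2 := m) (Phi := Phi) (D := D)) => //.
  have inv0 : (m k)^-1 @[k --> \oo] --> (0 : R) by apply/gtr0_cvgV0 => //; exact: nearW.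
  by under eq_fun do rewrite invfM; rewrite -[0](mulr0 0); exact: cvgM.
move=> x qx; have [C0 mg _ gcv] := hb; split.
- move=> k u; exact: (measurable_fun_cell (fun t =>
    if t \in box_pts (N k) (m k) x then G k u t else 0)).
- have mu11 : measurable_fun setT (fun z : plane * plane => z.1.1 : R).
    exact: (measurableT_comp measurable_coord1 measurable_fst).
  have mu12 : measurable_fun setT (fun z : plane * plane => z.1.2 : R).
    exact: (measurableT_comp measurable_coord2 measurable_fst).
  have mt1 : measurable_fun setT (fun z : plane * plane => z.2.1 : R).
    exact: (measurableT_comp measurable_coord1 measurable_snd).
  have mt2 : measurable_fun setT (fun z : plane * plane => z.2.2 : R).
    exact: (measurableT_comp measurable_coord2 measurable_snd).
  have mshift : measurable_fun setT ((fun z => (dl * z.2.1 - z.1.1, z.2.2 - z.1.2)) :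
      plane * plane -> plane).
    apply: measurable_fun_pair; apply: measurable_funB => //.
    exact: measurable_funM.
  apply: measurable_funM; first exact: (measurableT_comp mg mshift).
  exact: (measurableT_comp (measurable_indic (measurable_box x)) measurable_snd).
- move=> k u; have [_] := integral_finite_cells (G k u) (box_pts (N k) (m k) x) (N0 k) (m0 k).
  have PhiE : Phi k x u = fun t =>
      \sum_(s <- box_pts (N k) (m k) x) G k u s * \1_(cell (N k) (m k) s) t.
    by apply/funext => t; rewrite sum_over_cells.
  rewrite PhiE => ->; rewrite -expr2 sqrtr_sqr gtr0_norm// -mulr_suml -mulr_sumr.
  have -> : m k `^ q = m k * m k `^ (q - 1).
    rewrite -{2}[m k](@powRr1 R) ?(ltW (m0 k))// -powRD; first by congr (_ `^ _); ring.
    by rewrite (gt_eqF (m0 k)) implybT.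
  by rewrite /N; ring.
- rewrite /D; case: cid => D0 [mD0 iD0 _] /=; split; first exact: measurable_funM.
  under eq_integral do rewrite exprMn EFinM.
  rewrite ge0_integralZl//.
  + by rewrite lte_mul_pinfty ?lee_fin ?sqr_ge0.
  + by apply/measurable_EFinP; exact: measurable_funX.
  + by move=> u _; rewrite lee_fin sqr_ge0.
  + by rewrite lee_fin sqr_ge0.
split.
- rewrite /D; case: cid => D0 [mD0 iD0 HD0] /=.
  apply: filterS2 (@ae_coord1_neq R 0) (@ae_coord2_neq R 0) => u u1 u2 k.
  have [al [be [al0 be0 ab le]]] := HD0 k u u1 u2.
  exists (fun t => Cq * ((pw al (delta k * t.1 - u.1) * \1_(window (X x)) t.1) *
                            (pw be (t.2 - u.2) * \1_(window (X x)) t.2))); split.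
  + apply: measurable_funM => //; apply: (measurable_prod_coord
      (f1 := fun t => pw al (delta k * t - u.1) * \1_(window (X x)) t)
      (f2 := fun t => pw be (t - u.2) * \1_(window (X x)) t)); exact: mwin.
  + by move=> t; rewrite mulr_ge0 ?Cq_ge0// mulr_ge0// mulr_ge0 ?pw_ge0.
  + by apply: filterS2 (ae1 k u) (ae2 u) => t h1 h2; exact: bound.
  + rewrite (intF x (fun t => pw al (delta k * t - u.1)) (fun t => pw be (t - u.2)))//;
      try by move=> t; exact: pw_ge0.
    rewrite [leRHS]EFinM; apply: lee_pmul => //; first by rewrite lee_fin Cq_ge0.
    by rewrite mule_ge0//; apply: integral_ge0 => t _; rewrite lee_fin pw_ge0.
- apply: filterS (@ae_coord1_neq R 0) => u u1.
  have [al [be [w [k0 [al0 be01 ab [mw w0] [iw hw]]]]]] := Hin (X x) u.1 (X0 x) u1.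
  have /andP[be0 be1] := be01.
  have [C1 C10 hC1] := integral_pw_shift be01 (X0 x).
  exists k0, (fun t => Cq * ((w t.1 * \1_(window (X x)) t.1) *
                            (pw be (t.2 - u.2) * \1_(window (X x)) t.2))); split.
  + apply: measurable_funM => //; apply: (measurable_prod_coord
      (f1 := fun t => w t * \1_(window (X x)) t)
      (f2 := fun t => pw be (t - u.2) * \1_(window (X x)) t)); exact: mwin.
  + by move=> t; rewrite mulr_ge0 ?Cq_ge0// mulr_ge0// mulr_ge0 ?pw_ge0.
  + rewrite (intF x w (fun t => pw be (t - u.2)))//; last by move=> t; exact: pw_ge0.
    have i1 : (0 <= \int[mu]_(t in window (X x)) (w t)%:E)%E.
      by apply: integral_ge0 => t _; rewrite lee_fin.
    have i2 : (0 <= \int[mu]_(t in window (X x)) (pw be (t - u.2))%:E)%E.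
      by apply: integral_ge0 => t _; rewrite lee_fin pw_ge0.
    rewrite lte_mul_pinfty ?lee_fin ?Cq_ge0// lte_mul_pinfty// ?ge0_fin_numE//.
    exact: le_lt_trans (hC1 u.2) (ltry _).
  + move=> k kk0; apply: filterS2 (ae1 k u) (ae2 u) => t h1 h2.
    apply: (le_trans (bound k x u t al be al0 be0 ab h1 h2)).
    apply: ler_wpM2l; first exact: Cq_ge0.
    apply: ler_wpM2r; first by rewrite mulr_ge0 ?pw_ge0.
    rewrite indicE windowE; case: (leP `|t.1| (X x)) => [h|_]; last by rewrite !mulr0.
    by rewrite !mulr1; exact: hw.
  + have aex : {ae mu2, forall t : plane, t.1 != x.1 /\ t.2 != x.2}.
      by apply: filterS2 (@ae_coord1_neq R x.1) (@ae_coord2_neq R x.2).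
    have ae0 : {ae mu2, forall t : plane, t.1 != 0 /\ t.2 != 0}.
      by apply: filterS2 (@ae_coord1_neq R 0) (@ae_coord2_neq R 0).
    apply: filterS3 (ae2 u) ae0 aex => t h2 [t10 t20] [t1x t2x].
    have scale (M : nat -> R) y : (forall k, 0 < M k) -> (fun k => M k * y / M k) @ \oo --> y.
      by move=> M0; under eq_fun => k do rewrite mulrAC mulfV ?mul1r ?gt_eqF//; exact: cvg_cst.
    have c1 := cvg_ceil_div N0 Noo (scale N t.1 N0).
    have c2 := cvg_ceil_div m0 moo (scale m t.2 m0).
    have r1 := eventually_in_range N0 c1 t10 t1x.
    have r2 := eventually_in_range m0 c2 t20 t2x.
    pose inside := (0 < t.1 <= x.1) && (0 < t.2 <= x.2).
    have PhiE : \forall k \near \oo, (if inside then G k u (cell_index (N k) (m k) t) else 0) =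
        Phi k x u t.
      by apply: filterS2 r1 r2 => k e1 e2; rewrite /Phi mem_box_pts /cell_index /= e1 e2.
    apply: cvg_trans (near_eq_cvg PhiE) _.
    rewrite /Phi_oo indicE.
    have -> : (t \in box x) = inside.
      by apply/idP/idP => [/set_mem[h1' h2']|/andP[h1' h2']];
        [rewrite /inside h1' h2'|apply/mem_set].
    case: (inside); last by rewrite mulr0; exact: cvg_cst.
    rewrite mulr1.
    have := gcv (fun k => cell_index (N k) (m k) t - cell_index (m k) (m k) u) m
      (dl * t.1 - u.1, t.2 - u.2) m0 moo; apply.
    * under eq_fun do rewrite /= intrB mulrBl; apply: cvgB.
        apply: cvg_ceil_div => //.
        rewrite (_ : (fun k => _) = fun k => delta k * t.1); first exact: cvgMl.
        by apply/funext => k; rewrite /N; field; rewrite gt_eqF.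
      by apply: cvg_ceil_div => //; exact: scale.
    * under eq_fun do rewrite /= intrB mulrBl; apply: cvgB.
        by apply: cvg_ceil_div => //; exact: scale.
      by apply: cvg_ceil_div => //; exact: scale.
    * by apply: contra h2 => /eqP[_ ->].
Unshelve. all: by end_near. Qed.

Lemma kernel_limit_critical (m : nat -> R) : 1 < q < 2 ->
  (forall k, 0 < m k) -> m k @[k --> \oo] --> +oo ->
  let Phi_oo x u t := g (1 * t.1 - u.1, t.2 - u.2) * \1_(box x) t in
  kernel_limit (fun k x s => m k `^ (q - 1) / (m k * m k) *
      \sum_(t <- box_pts (m k) (m k) x) b (t - s))
    (fun x u => \int[mu2]_(t in [set: plane]) Phi_oo x u t) /\
  forall x, quadrant x ->
    {ae mu2, forall u : plane, mu2.-integrable setT (EFin \o Phi_oo x u)}.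
Proof.
move=> q12 m0 moo /=.
have h01 : 0 <= q / 2 < 1 by apply/andP; split; lra.
have [] := @kernel_limit_direct m (fun=> 1) 1 m0 moo (fun=> ltr01) (cvg_cst _).
- by under eq_fun do rewrite mul1r.
- move=> X u1 X0 u10; exists (q / 2), (q / 2), (fun t => pw (q / 2) (t - u1)), 0%N; split => //.
  + by case/andP: h01.
  + lra.
  + split => [|t]; last exact: pw_ge0.
    by have := measurable_pw_affine (q / 2) 1 (- u1); under eq_fun do rewrite mul1r.
  + split; last by move=> k _ t _; rewrite mul1r.
    have [C1 _ hC] := integral_pw_shift h01 X0.
    exact: le_lt_trans (hC u1) (ltry _).
- move=> X X0; have [C1 C10 hC] := integral_pw_shift h01 X0.
  exists (fun u => C1 ^+ 2 * (psi 0 (q / 2) u.1 * psi 0 (q / 2) u.2)); split.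
  + by apply: measurable_funM => //; apply: measurable_prod_coord; exact: measurable_psi.
  + by apply: integral_prod_sqr_lty; rewrite ?integral_psi_sqr//; try exact: measurable_psi; lra.
  + move=> k u _ _; exists (q / 2), (q / 2); split; [lra|lra|lra|].
    rewrite (_ : (_ ^+ 2 * _) = (C1 * psi 0 (q / 2) u.1) * (C1 * psi 0 (q / 2) u.2)); last by ring.
    rewrite EFinM; apply: lee_pmul => //.
    * by apply: integral_ge0 => t _; rewrite lee_fin pw_ge0.
    * by apply: integral_ge0 => t _; rewrite lee_fin pw_ge0.
    * by under eq_integral do rewrite mul1r; exact: hC.
move=> h1 h2; split => //; move: h1.
rewrite (_ : (fun k x s => m k `^ (q - 1) / (1 * m k * m k) * _) = (fun k x s =>
  m k `^ (q - 1) / (m k * m k) * \sum_(t <- box_pts (m k) (m k) x) b (t - s)))//.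
by apply/funext => k; apply/funext => x; apply/funext => s; rewrite !mul1r.
Qed.

Lemma kernel_limit_degenerate (m delta : nat -> R) : 1 < q < 3 / 2 ->
  (forall k, 0 < m k) -> m k @[k --> \oo] --> +oo -> (forall k, 0 < delta k) ->
  delta k @[k --> \oo] --> (0 : R) -> delta k * m k @[k --> \oo] --> +oo ->
  let Phi_oo x u t := g (0 * t.1 - u.1, t.2 - u.2) * \1_(box x) t in
  kernel_limit (fun k x s => m k `^ (q - 1) / (delta k * m k * m k) *
      \sum_(t <- box_pts (delta k * m k) (m k) x) b (t - s))
    (fun x u => \int[mu2]_(t in [set: plane]) Phi_oo x u t) /\
  forall x, quadrant x ->
    {ae mu2, forall u : plane, mu2.-integrable setT (EFin \o Phi_oo x u)}.
Proof.
move=> q12 m0 moo d0 dcv Noo; apply: kernel_limit_direct => //.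
- move=> X u1 X0 u10; have nu : 0 < `|u1| by rewrite normr_gt0.
  have eps0 : 0 < `|u1| / 2 / X by rewrite !divr_gt0.
  have /cvgrPdist_le/(_ _ eps0)[k0 _ hk0] := dcv.
  exists (q / 2), (q / 2), (fun=> pw (q / 2) (u1 / 2)), k0; split.
  + lra.
  + apply/andP; split; lra.
  + lra.
  + by split => // t; exact: pw_ge0.
  + split.
      rewrite integral_cst//; last exact: measurable_window.
      by rewrite -[X in (_ * X)%E]/(mu (window X)) mu_window// -EFinM ltry.
    move=> k kk t tX; apply: pw_le; first lra.
      by rewrite normr_gt0 mulf_neq0// invr_eq0.
    have := hk0 k kk; rewrite sub0r normrN gtr0_norm// ler_pdivlMr// => dX.
    have : `|delta k * t| <= `|u1| / 2.
      rewrite normrM (gtr0_norm (d0 k)); apply: le_trans dX.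
      by apply: ler_wpM2l => //; exact: ltW.
    have : `|u1| <= `|delta k * t - u1| + `|delta k * t|.
      have e : `|u1| = `|(delta k * t - u1) - delta k * t|.
        by rewrite -[LHS]normrN; congr `|_|; ring.
      by rewrite e; exact: ler_normB.
    have -> : `|u1 / 2| = `|u1| / 2 by rewrite normrM [ `|2^-1|]ger0_norm.
    lra.
- move=> X X0; pose a1 := q / 2 - 4^-1; pose b1 := q / 2 + 4^-1; pose a2 := q / 2.
  have ha1 : 0 <= a1 < 1 by rewrite /a1; apply/andP; split; lra.
  have hb1 : 0 <= b1 < 1 by rewrite /b1; apply/andP; split; lra.
  have ha2 : 0 <= a2 < 1 by rewrite /a2; apply/andP; split; lra.
  have [C1 C10 h1] := integral_pw_dilate ha1 X0; have [C2 C20 h2] := integral_pw_shift hb1 X0.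
  have [C3 C30 h3] := integral_pw_dilate ha2 X0; have [C4 C40 h4] := integral_pw_shift ha2 X0.
  pose K := C1 * C2 + C3 * C4.
  have p12 : 0 <= C1 * C2 by rewrite mulr_ge0// ltW.
  have p34 : 0 <= C3 * C4 by rewrite mulr_ge0// ltW.
  exists (fun u => K * (psi a1 a2 u.1 * psi 0 a2 u.2)); split.
  + by apply: measurable_funM => //; apply: measurable_prod_coord; exact: measurable_psi.
  + by apply: integral_prod_sqr_lty; rewrite ?integral_psi_sqr//; try exact: measurable_psi;
      rewrite /a1 /a2; lra.
  + have ig (f : R -> R) : (forall t, 0 <= f t) -> (0 <= \int[mu]_(t in window X) (f t)%:E)%E.
      by move=> f0; apply: integral_ge0 => t _; rewrite lee_fin.
    have perm (x y z t : R) : (x * y) * (z * t) = (x * z) * (y * t) by ring.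
    move=> k u u1 u2; have [r1|r1] := leP `|u.1| 1.
      exists a1, b1; split; [lra|lra|by rewrite /a1 /b1; lra|].
      apply: (@le_trans _ _ ((C1 * pw a1 u.1) * (C2 * psi 0 a2 u.2))%:E).
        rewrite EFinM; apply: lee_pmul; rewrite ?ig//; try by move=> t; exact: pw_ge0.
          exact: h1.
        apply: (le_trans (h2 u.2)); rewrite lee_fin; apply: ler_wpM2l; first exact: ltW.
        by apply: psi_decr; rewrite /a2 /b1; lra.
      rewrite lee_fin perm [psi a1 a2 u.1]psiE r1; apply: ler_wpM2r; last by rewrite /K lerDl.
      by rewrite mulr_ge0 ?pw_ge0 ?psi_ge0.
    exists a2, a2; split; [lra|lra|by rewrite /a2; lra|].
    apply: (@le_trans _ _ ((C3 * pw a2 u.1) * (C4 * psi 0 a2 u.2))%:E).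
      rewrite EFinM; apply: lee_pmul; rewrite ?ig//; try by move=> t; exact: pw_ge0.
      exact: h3.
    rewrite lee_fin perm [psi a1 a2 u.1]psiE [ `|u.1| <= 1]leNgt r1 /=; apply: ler_wpM2r; last by rewrite /K lerDr.
    by rewrite mulr_ge0 ?pw_ge0 ?psi_ge0.
Qed.

End direct_scaling.

(** * Kernels integrated over the plane *)

Section inverse_scaling.
Context {R : realType}.
Notation mu := (@lebesgue_measure R).
Notation plane := (measurableTypeR R * measurableTypeR R)%type.
Notation lattice := (int * int)%type.
Variables (q C : R) (b : lattice -> R) (g : plane -> R).
Hypothesis hb : power_kernel q C b g.
Hypothesis q32 : 3 / 2 < q < 2.
Let Cq : R := C * 2 `^ q.
Let a' : R := q / 2 - 4^-1.
Let b' : R := q / 2 + 4^-1.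

Definition window_at (X rho y : R) (v : R) : R := \1_(window X) (rho * v + y).

Lemma measurable_window_at X rho y : measurable_fun setT (window_at X rho y).
Proof.
exact: (measurableT_comp (measurable_indic (measurable_window X)) (measurable_affine rho y)).
Qed.

Lemma integral_shifted_window (a X : R) : 0 <= a < 1 -> 0 < X ->
  exists2 K : R, 0 < K & forall y,
    (\int[mu]_v (pw a v * window_at X 1 y v)%:E <= (K * psi 0 a y)%:E)%E.
Proof.
move=> a01 X0; have [K K0 hK] := integral_pw_shift a01 X0; exists K => // y.
apply: le_trans (hK y).
have -> : (\int[mu]_(t in `[(- X)%R, X]) (pw a (t - y))%:E =
    \int[mu]_t (pw a (t - y) * \1_(window X) t)%:E)%E by rewrite integral_mulindic.
have m1 : measurable_fun setT (fun v : R => (pw a (v - y) * \1_(window X) v)%:E).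
  apply/measurable_EFinP; apply: measurable_funM.
    have := measurable_pw_affine a 1 (- y); under eq_fun do rewrite mul1r; exact.
  exact: measurable_indic (measurable_window X).
have pos v : (0 <= (pw a (v - y) * \1_(window X) v)%:E)%E by rewrite lee_fin mulr_ge0 ?pw_ge0.
rewrite le_eqVlt; apply/orP; left; apply/eqP.
etransitivity; last exact: (@ge0_integral_affine R 1 y _ (oner_neq0 R) m1 pos).
rewrite normr1 mul1e; apply: eq_integral => v _.
by rewrite /window_at mul1r addrK.
Qed.

(** A window of length [2 X / rho] at distance about [|y| / rho] from 0: the
    two powers of [rho] cancel because the exponent is exactly 1. *)
Lemma integral_far_window (X rho y : R) : 0 < X -> 0 < rho -> 2 * X < `|y| ->
  (\int[mu]_v (pw 1 v * window_at X rho y v)%:E <= (4 * X * pw 1 y)%:E)%E.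
Proof.
move=> X0 rho0 yX; have y0 : 0 < `|y| by apply: lt_trans yX; rewrite mulr_gt0.
have pw1 z : pw 1 z = `|z|^-1 by rewrite /pw powRN powRr1.
have bound v : pw 1 v * window_at X rho y v <= (2 * rho * pw 1 y) * window_at X rho y v.
  rewrite /window_at indicE windowE; case: (leP `|rho * v + y| X) => [h|_]; last by rewrite !mulr0.
  rewrite !mulr1 !pw1.
  have big : `|y| <= 2 * rho * `|v|.
    have : `|y| <= `|rho * v + y| + `|rho * v|.
      by rewrite (_ : `|y| = `|(rho * v + y) - rho * v|) ?ler_normB//; congr `|_|; ring.
    by rewrite [ `|rho * v|]normrM (gtr0_norm rho0); lra.
  have c0 : 0 < 2 * rho by rewrite mulr_gt0.
  have v0 : 0 < `|v| by rewrite -(pmulr_rgt0 _ c0); exact: lt_le_trans y0 big.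
  by rewrite ler_pdivlMr// mulrC ler_pdivrMr.
apply: (@le_trans _ _ (\int[mu]_v ((2 * rho * pw 1 y) * window_at X rho y v)%:E)%E).
  apply: ge0_le_integral => //.
  - by move=> v _; rewrite lee_fin mulr_ge0 ?pw_ge0.
  - apply/measurable_EFinP; apply: measurable_funM; first exact: measurable_pw.
    exact: measurable_window_at.
  - by apply/measurable_EFinP; apply: measurable_funM => //; exact: measurable_window_at.
  - by move=> v _; rewrite lee_fin.
under eq_integral do rewrite EFinM.
rewrite ge0_integralZl//; last 3 first.
- by apply/measurable_EFinP; exact: measurable_window_at.
- by move=> v _; rewrite lee_fin.
- by rewrite lee_fin mulr_ge0 ?pw_ge0// mulr_ge0// ltW.
have m1 : measurable_fun setT (fun v : R => (\1_(window X) v)%:E : \bar R).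
  by apply/measurable_EFinP; exact: measurable_indic (measurable_window X).
have pos v : (0 <= (\1_(window X) v)%:E :> \bar R)%E by rewrite lee_fin.
have mwin := measurable_window X.
have area : (\int[mu]_v (\1_(window X) v)%:E = (2 * X)%:E)%E.
  by rewrite integral_indic// setIT; exact: (mu_window X0).
have h := etrans (@ge0_integral_affine R rho y _ (lt0r_neq0 rho0) m1 pos) area.
rewrite (_ : 2 * rho * pw 1 y = 2 * pw 1 y * rho); last ring.
rewrite EFinM -muleA -{1}(gtr0_norm rho0) h -EFinM lee_fin.
by rewrite le_eqVlt; apply/orP; left; apply/eqP; ring.
Qed.

Lemma kernel_limit_inverse (m N : nat -> R) :
  (forall k, 1 <= m k) -> (forall k, m k <= N k) ->
  m k @[k --> \oo] --> +oo -> m k / N k @[k --> \oo] --> (0 : R) ->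
  let Phi_oo x u v := g v * \1_(box x) ((v.1 + u.1, u.2) : plane) in
  kernel_limit (fun k x s => m k `^ (q - 2) / Num.sqrt (m k * N k) *
      \sum_(t <- box_pts (m k) (N k) x) b (t - s))
    (fun x u => \int[mu2]_(v in [set: plane]) Phi_oo x u v) /\
  forall x, quadrant x ->
    {ae mu2, forall u : plane, mu2.-integrable setT (EFin \o Phi_oo x u)}.
Proof.
move=> m1 mN moo rho_cv Phi_oo.
have /andP[q32a q32b] := q32; have q2 : q / 2 < 1 by lra.
have m0 k : 0 < m k by exact: lt_le_trans ltr01 (m1 k).
have N0 k : 0 < N k by exact: lt_le_trans (mN k).
have N1 k : 1 <= N k by exact: le_trans (mN k).
have [C0 mg _ gcv] := hb.
have Cq0 : 0 <= Cq by rewrite mulr_ge0 ?powR_ge0.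
pose rho k := m k / N k; have rho0 k : 0 < rho k by rewrite divr_gt0.
have rho1 k : rho k <= 1 by rewrite ler_pdivrMr// mul1r.
have Noo : N k @[k --> \oo] --> +oo.
  apply/cvgryPge => A; move/cvgryPge : moo => /(_ A); apply: filterS => k h.
  exact: le_trans (mN k).
pose G k (t : lattice) := m k `^ q * b t.
pose inT k x (u v : plane) := (cell_index (m k) (m k) v + cell_index (m k) (N k) u)
  \in box_pts (m k) (N k) x.
pose Phi k x (u v : plane) : R := if inT k x u v then G k (cell_index (m k) (m k) v) else 0.
pose X (x : R * R) : R := Num.max 2 (Num.max x.1 x.2).
have X2 x : 2 <= X x by rewrite le_max lexx.
have X0 x : 0 < X x by exact: lt_le_trans (X2 x).
have bound k x (u v : plane) al be : 0 <= al -> 0 <= be -> al + be = q ->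
    v.1 != 0 -> v.2 != 0 ->
    `|Phi k x u v| <= Cq * ((pw al v.1 * window_at (X x) 1 u.1 v.1) *
                            (pw be v.2 * window_at (X x) (rho k) u.2 v.2)).
  move=> al0 be0 ab n1 n2; rewrite /Phi; case: ifP => [uv|_]; last first.
    by rewrite normr0 mulr_ge0// mulr_ge0// mulr_ge0 ?pw_ge0 /window_at.
  have in_window (M z w y : R) : 1 <= M -> y <= X x ->
      0 < ((Num.ceil z + Num.ceil w)%:~R : R) <= M * y -> `|z / M + w / M| <= X x.
    move=> M1 yX; rewrite intrD => /andP[h1 h2]; have M0 : 0 < M by exact: lt_le_trans M1.
    have /andP[z1 z2] := ceil_itv z; have /andP[w1 w2] := ceil_itv w.
    rewrite intrB in z1; rewrite intrB in w1.
    rewrite -mulrDl normrM normfV (gtr0_norm M0) ler_pdivrMr// ler_norml.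
    have : M * y <= M * X x by rewrite ler_pM2l.
    have : 2 <= X x * M by rewrite -[2]mulr1; apply: ler_pM.
    by move=> *; apply/andP; split; lra.
  move: uv; rewrite /inT mem_box_pts /cell_index => /andP[/= uv1 uv2].
  have x1X : x.1 <= X x by rewrite !le_max lexx !orbT.
  have x2X : x.2 <= X x by rewrite !le_max lexx !orbT.
  have w1 := in_window _ _ _ _ (m1 k) x1X uv1.
  have w2 := in_window _ _ _ _ (N1 k) x2X uv2.
  have -> : window_at (X x) 1 u.1 v.1 = 1.
    rewrite /window_at indicE windowE (_ : 1 * v.1 + u.1 = m k * v.1 / m k + m k * u.1 / m k) ?w1//.
    by field; rewrite gt_eqF.
  have -> : window_at (X x) (rho k) u.2 v.2 = 1.
    rewrite /window_at indicE windowE (_ : rho k * v.2 + u.2 = m k * v.2 / N k + N k * u.2 / N k) ?w2//.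
    by rewrite /rho; field; rewrite gt_eqF.
  rewrite !mulr1; apply: (power_kernel_product hb) => //.
    rewrite (le_trans _ (ler_wpM2l _ (le_msize1 _)))//.
    by have := ceil_diff (m k * v.1) 0; rewrite ceil0 !subr0.
  rewrite (le_trans _ (ler_wpM2l _ (le_msize2 _)))//.
  by have := ceil_diff (m k * v.2) 0; rewrite ceil0 !subr0.
have ha : 0 <= a' < 1 by rewrite /a'; apply/andP; split; lra.
have hq : 0 <= q / 2 < 1 by apply/andP; split; lra.
have hq1 : 0 <= q - 1 < 1 by apply/andP; split; lra.
have ae0 : {ae mu2, forall t : plane, t.1 != 0 /\ t.2 != 0}.
  by apply: filterS2 (@ae_coord1_neq R 0) (@ae_coord2_neq R 0).
(* near the axis v.2 = 0 the exponents are equal; far from it the second one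
   exceeds 1, at the expense of the first *)
pose E x (u v : plane) : R :=
  Cq * ((pw (q / 2) v.1 * window_at (X x) 1 u.1 v.1) * near_pw 1 (q / 2) v.2) +
  Cq * ((pw a' v.1 * window_at (X x) 1 u.1 v.1) * far_pw b' v.2).
have mw a x y : measurable_fun setT (fun v => pw a v * window_at (X x) 1 y v).
  by apply: measurable_funM; [exact: measurable_pw|exact: measurable_window_at].
have w0 a x r y v : 0 <= pw a v * window_at (X x) r y v by rewrite mulr_ge0 ?pw_ge0// /window_at.
have mE1 a x y (f : R -> R) : measurable_fun setT f -> measurable_fun setT
    ((fun v => Cq * ((pw a v.1 * window_at (X x) 1 y v.1) * f v.2)) : plane -> R).
  by move=> mf; apply: measurable_funM => //; exact: (measurable_prod_coord (mw a x y) mf).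
have mE x u : measurable_fun setT (E x u).
  by apply: measurable_funD; apply: mE1; [exact: measurable_near_pw|exact: measurable_far_pw].
have E0 x u v : 0 <= E x u v.
  by rewrite /E addr_ge0// mulr_ge0// mulr_ge0// ?near_pw_ge0 ?far_pw_ge0.
have boundE k x u v : v.1 != 0 -> v.2 != 0 -> `|Phi k x u v| <= E x u v.
  move=> n1 n2; have wle r y z : window_at (X x) r y z <= 1 by rewrite /window_at indicE lern1 leq_b1.
  have [v1|v1] := leP `|v.2| 1.
    apply: le_trans (bound k x u v (q / 2) (q / 2) _ _ _ n1 n2) _; [lra|lra|lra|].
    rewrite /E /near_pw /far_pw v1 !mulr0 addr0; apply: ler_wpM2l => //; apply: ler_wpM2l => //.
    by rewrite ler_piMr// pw_ge0.
  apply: le_trans (bound k x u v a' b' _ _ _ n1 n2) _; [by rewrite /a'; lra|by rewrite /b'; lra|by rewrite /a' /b'; lra|].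
  rewrite /E /near_pw /far_pw [ `|v.2| <= 1]leNgt v1 /= !mulr0 add0r; apply: ler_wpM2l => //; apply: ler_wpM2l => //.
  by rewrite ler_piMr// pw_ge0.
have intE : forall x, exists2 K : R, 0 < K & forall u,
    (\int[mu2]_v (E x u v)%:E <= (K * psi 0 a' u.1)%:E)%E.
  move=> x; have [K1 K10 h1] := integral_shifted_window hq (X0 x).
  have [K2 K20 h2] := integral_shifted_window ha (X0 x).
  pose L1 := 2 / (1 - q / 2) * 1 `^ (1 - q / 2); pose L2 := 2 / (b' - 1).
  have L10 : 0 <= L1 by rewrite mulr_ge0 ?powR_ge0// divr_ge0//; lra.
  have L20 : 0 <= L2 by rewrite divr_ge0// /b'; lra.
  exists (Cq * (K1 * L1) + Cq * (K2 * L2) + 1) => [|u].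
    by rewrite ltr_wpDl// addr_ge0// mulr_ge0// mulr_ge0// ltW.
  have b1 : 1 < b' by rewrite /b'; lra.
  under eq_integral do rewrite EFinD.
  rewrite ge0_integralD//=; last 4 first.
  - by move=> v _; rewrite lee_fin mulr_ge0// mulr_ge0// near_pw_ge0.
  - by apply/measurable_EFinP; apply: mE1; exact: measurable_near_pw.
  - by move=> v _; rewrite lee_fin mulr_ge0// mulr_ge0// far_pw_ge0.
  - by apply/measurable_EFinP; apply: mE1; exact: measurable_far_pw.
  rewrite (integral_prod_scaled Cq0 (mw _ _ _) (measurable_near_pw _ _) (w0 _ _ _ _) (near_pw_ge0 _ _)).
  rewrite (integral_prod_scaled Cq0 (mw _ _ _) (measurable_far_pw _) (w0 _ _ _ _) (far_pw_ge0 _)).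
  have i0 (f : R -> R) : (forall t, 0 <= f t) -> (0 <= \int[mu]_t (f t)%:E)%E.
    by move=> f0; apply: integral_ge0 => t _; rewrite lee_fin.
  apply: (@le_trans _ _ ((Cq * ((K1 * psi 0 a' u.1) * L1))%:E + (Cq * ((K2 * psi 0 a' u.1) * L2))%:E)%E).
    have step (I1 I2 : \bar R) (p l : R) : (0 <= I1)%E -> (0 <= I2)%E -> (I1 <= p%:E)%E -> (I2 <= l%:E)%E ->
        (Cq%:E * (I1 * I2) <= (Cq * (p * l))%:E)%E.
      move=> p1 p2 l1 l2; rewrite [leRHS]EFinM [(p * l)%:E]EFinM.
      by apply: lee_pmul; rewrite ?mule_ge0 ?lee_fin//; exact: lee_pmul.
    apply: leeD; apply: step; rewrite ?i0//; try by move=> t; rewrite ?near_pw_ge0 ?far_pw_ge0.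
    - apply: (le_trans (h1 u.1)); rewrite lee_fin; apply: ler_wpM2l; first exact: ltW.
      by apply: psi_decr; rewrite /a'; lra.
    - by apply: integral_near_pw.
    - exact: (integral_far_pw b1).
  rewrite -EFinD lee_fin !mulrDl mul1r.
  have := psi_ge0 0 a' u.1; set p := psi _ _ _ => p0.
  have perm (K L : R) : Cq * (K * p * L) = Cq * (K * L) * p by ring.
  by rewrite !perm lerDl.
have far_bound : forall x, exists2 K : R, 0 < K & forall k (u : plane), 2 * X x < `|u.2| ->
    (\int[mu2]_(v in [set: plane]) (Cq * ((pw (q - 1) v.1 * window_at (X x) 1 u.1 v.1) *
        (pw 1 v.2 * window_at (X x) (rho k) u.2 v.2)))%:E <= (K * (psi 0 a' u.1 * pw 1 u.2))%:E)%E.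
  move=> x; have [K1 K10 h1] := integral_shifted_window hq1 (X0 x).
  exists (Cq * (K1 * (4 * X x)) + 1) => [|k u far].
    by rewrite ltr_wpDl// mulr_ge0// mulr_ge0 ?(ltW K10)// mulr_ge0// ltW.
  have mw2 : measurable_fun setT (fun v => pw 1 v * window_at (X x) (rho k) u.2 v).
    by apply: measurable_funM; [exact: measurable_pw|exact: measurable_window_at].
  rewrite (integral_prod_scaled Cq0 (mw _ _ _) mw2 (w0 _ _ _ _) (w0 _ _ _ _)).
  apply: (@le_trans _ _ (Cq * ((K1 * psi 0 a' u.1) * (4 * X x * pw 1 u.2)))%:E).
    rewrite [leRHS]EFinM; apply: lee_pmul; rewrite ?lee_fin//.
      by apply: mule_ge0; apply: integral_ge0 => t _; rewrite lee_fin.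
    rewrite [leRHS]EFinM; apply: lee_pmul; try by apply: integral_ge0 => t _; rewrite lee_fin.
      apply: (le_trans (h1 u.1)); rewrite lee_fin; apply: ler_wpM2l; first exact: ltW.
      by apply: psi_decr; rewrite /a'; lra.
    exact: integral_far_window.
  have perm (p r : R) : Cq * ((K1 * p) * (4 * X x * r)) = Cq * (K1 * (4 * X x)) * (p * r) by ring.
  rewrite lee_fin perm; apply: ler_wpM2r; last by rewrite lerDl.
  by rewrite mulr_ge0 ?psi_ge0 ?pw_ge0.
pose KE x := projT1 (cid2 (intE x)); pose KF x := projT1 (cid2 (far_bound x)).
pose D x (u : plane) : R := (KE x * (2 * X x) + KF x) * (psi 0 a' u.1 * psi 0 1 u.2).
have KE0 x : 0 < KE x by rewrite /KE; case: cid2.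
have KF0 x : 0 < KF x by rewrite /KF; case: cid2.
apply: (kernel_limit_integral (M1 := m) (M2 := N) (Phi := Phi) (D := D)) => //.
  have inv0 (M : nat -> R) : (forall k, 0 < M k) -> M k @[k --> \oo] --> +oo ->
      (M k)^-1 @[k --> \oo] --> (0 : R).
    by move=> M0 Moo; apply/gtr0_cvgV0 => //; exact: nearW.
  by under eq_fun do rewrite invfM; rewrite -[0](mulr0 0); apply: cvgM; exact: inv0.
move=> x qx; split.
- move=> k u; exact: (measurable_fun_cell (fun t =>
    if t + cell_index (m k) (N k) u \in box_pts (m k) (N k) x then G k t else 0)).
- have mu11 : measurable_fun setT (fun z : plane * plane => z.1.1 : R).
    exact: (measurableT_comp measurable_coord1 measurable_fst).
  have mu12 : measurable_fun setT (fun z : plane * plane => z.1.2 : R).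
    exact: (measurableT_comp measurable_coord2 measurable_fst).
  have mt1 : measurable_fun setT (fun z : plane * plane => z.2.1 : R).
    exact: (measurableT_comp measurable_coord1 measurable_snd).
  have mshift : measurable_fun setT ((fun z => (z.2.1 + z.1.1, z.1.2)) :
      plane * plane -> plane).
    by apply: measurable_fun_pair => //; apply: measurable_funD.
  apply: measurable_funM; first exact: (measurableT_comp mg measurable_snd).
  exact: (measurableT_comp (measurable_indic (measurable_box x)) mshift).
- move=> k u; set s := cell_index (m k) (N k) u.
  pose T' := [fset t - s | t in box_pts (m k) (N k) x]%fset.
  have memT' r : (r \in T') = (r + s \in box_pts (m k) (N k) x).
    apply/imfsetP/idP => [[t /= tT ->]|h]; first by rewrite subrK.
    by exists (r + s) => //; rewrite addrK.
  have [_] := integral_finite_cells (G k) T' (m0 k) (m0 k).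
  have PhiE : Phi k x u = fun v => \sum_(r <- T') G k r * \1_(cell (m k) (m k) r) v.
    by apply/funext => v; rewrite sum_over_cells memT'.
  rewrite PhiE => ->; rewrite big_imfset/=; last by move=> t1 t2 _ _ /addIr.
  have sq0 : Num.sqrt (m k * N k) != 0 by rewrite gt_eqF// sqrtr_gt0 mulr_gt0.
  rewrite -mulr_suml -mulr_sumr.
  have -> : m k `^ q = m k * m k * m k `^ (q - 2).
    have -> : m k * m k = m k `^ 2 by rewrite -expr2 powR_mulrn// ltW.
    rewrite -powRD; first by congr (_ `^ _); ring.
    by rewrite (gt_eqF (m0 k)) implybT.
  by field; rewrite sq0 gt_eqF.
- split.
    by apply: measurable_funM => //; apply: measurable_prod_coord; exact: measurable_psi.
  by apply: integral_prod_sqr_lty; rewrite ?integral_psi_sqr//; try exact: measurable_psi;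
    rewrite /a'; lra.
split.
- apply: aeW => u k; have [near_u|far_u] := leP `|u.2| (2 * X x).
    exists (E x u); split => //.
      by apply: filterS ae0 => v [v1 v2]; exact: boundE.
    rewrite /D /KE; case: cid2 => K K0 hK /=; apply: (le_trans (hK u)); rewrite lee_fin.
    have p1 := psi_ge0 0 a' u.1; have p2 := psi_ge0 0 1 u.2.
    have one : 1 <= 2 * X x * psi 0 1 u.2.
      rewrite psiE pw0; case: ifP => h; first by have := X2 x; lra.
      have u0 : 0 < `|u.2| by apply: lt_trans ltr01 _; rewrite ltNge h.
      by rewrite /pw powRN powRr1// ler_pdivlMr// mul1r.
    apply: (@le_trans _ _ (K * psi 0 a' u.1 * (2 * X x * psi 0 1 u.2))).
      by rewrite ler_peMr// mulr_ge0// ltW.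
    have perm (p r : R) : K * p * (2 * X x * r) = K * (2 * X x) * (p * r) by ring.
    rewrite perm; apply: ler_wpM2r; first exact: mulr_ge0.
    by rewrite lerDl ltW.
  exists (fun v => Cq * ((pw (q - 1) v.1 * window_at (X x) 1 u.1 v.1) *
        (pw 1 v.2 * window_at (X x) (rho k) u.2 v.2))); split.
  + apply: (mE1 (q - 1) x u.1 (fun v => pw 1 v * window_at (X x) (rho k) u.2 v)).
    by apply: measurable_funM; [exact: measurable_pw|exact: measurable_window_at].
  + by move=> v; rewrite mulr_ge0// mulr_ge0.
  + by apply: filterS ae0 => v [v1 v2]; apply: bound => //; lra.
  + rewrite /D /KF; case: cid2 => K K0 hK /=; apply: (le_trans (hK k u far_u)); rewrite lee_fin.
    have u1 : 1 < `|u.2| by apply: lt_trans far_u; have := X2 x; lra.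
    rewrite [psi 0 1 u.2]psiE [ `|u.2| <= 1]leNgt u1 /=.
    apply: ler_wpM2r; first by rewrite mulr_ge0 ?psi_ge0 ?pw_ge0.
    by rewrite lerDr mulr_ge0 ?(ltW (KE0 x))// mulr_ge0// ltW.
- have aeu : {ae mu2, forall t : plane, t.2 != 0 /\ t.2 != x.2}.
    by apply: filterS2 (@ae_coord2_neq R 0) (@ae_coord2_neq R x.2).
  apply: filterS aeu => u [u20 u2x].
  exists 0%N, (E x u); split => //.
  + have [K K0 hK] := intE x; exact: le_lt_trans (hK u) (ltry _).
  + by move=> k _; apply: filterS ae0 => v [v1 v2]; exact: boundE.
  + have aev : {ae mu2, forall t : plane, t.1 != - u.1 /\ t.1 != x.1 - u.1}.
      by apply: filterS2 (@ae_coord1_neq R (- u.1)) (@ae_coord1_neq R (x.1 - u.1)).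
    apply: filterS2 ae0 aev => v [v10 v20] [v1 v1x].
    have scale (M : nat -> R) y : (forall k, 0 < M k) -> (fun k => M k * y / M k) @ \oo --> y.
      by move=> M0; under eq_fun => k do rewrite mulrAC mulfV ?mul1r ?gt_eqF//; exact: cvg_cst.
    have cv1 := cvg_ceil_div m0 moo (scale m v.1 m0).
    have cv2 := cvg_ceil_div m0 moo (scale m v.2 m0).
    have cu1 := cvg_ceil_div m0 moo (scale m u.1 m0).
    have cu2 := cvg_ceil_div N0 Noo (scale N u.2 N0).
    have s1 : (Num.ceil (m k * v.1) + Num.ceil (m k * u.1))%:~R / m k @[k --> \oo] --> v.1 + u.1.
      by under eq_fun do rewrite intrD mulrDl; exact: cvgD.
    have z : (Num.ceil (m k * v.2))%:~R / N k @[k --> \oo] --> (0 : R).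
      rewrite (_ : (fun k => _) = fun k => (Num.ceil (m k * v.2))%:~R / m k * (m k / N k)).
        by rewrite -(mulr0 v.2); exact: cvgM.
      by apply/funext => k; field; rewrite !gt_eqF.
    have s2 : (Num.ceil (m k * v.2) + Num.ceil (N k * u.2))%:~R / N k @[k --> \oo] --> u.2.
      by under eq_fun do rewrite intrD mulrDl; have := cvgD z cu2; rewrite add0r; apply.
    have l10 : v.1 + u.1 != 0 by rewrite addr_eq0.
    have l1x : v.1 + u.1 != x.1 by apply: contra v1x => /eqP <-; rewrite addrK.
    have r1 := eventually_in_range m0 s1 l10 l1x.
    have r2 := eventually_in_range N0 s2 u20 u2x.
    pose inside := (0 < v.1 + u.1 <= x.1) && (0 < u.2 <= x.2).
    have PhiE : \forall k \near \oo, (if inside then G k (cell_index (m k) (m k) v) else 0) =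
        Phi k x u v.
      by apply: filterS2 r1 r2 => k e1 e2; rewrite /Phi /inT mem_box_pts /cell_index /= e1 e2.
    apply: cvg_trans (near_eq_cvg PhiE) _.
    rewrite /Phi_oo indicE.
    have -> : ((v.1 + u.1, u.2) \in box x) = inside.
      by apply/idP/idP => [/set_mem[h1' h2']|/andP[h1' h2']];
        [rewrite /inside h1' h2'|apply/mem_set].
    case: (inside); last by rewrite mulr0; exact: cvg_cst.
    rewrite mulr1.
    have := gcv (fun k => cell_index (m k) (m k) v) m v m0 moo; apply => //.
    by apply: contra v10 => /eqP ->.
Unshelve. all: by end_near. Qed.

End inverse_scaling.

(** * Coordinate changes and transfer to the limit fields *)

Section coordinate_swap.
Context {R : realType}.
Notation plane := (measurableTypeR R * measurableTypeR R)%type.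
Notation lattice := (int * int)%type.

Lemma sum_fset_swap (F : {fset lattice}) (f : lattice -> R) :
  \sum_(s <- [fset (t.2, t.1) | t in F]%fset) f s = \sum_(t <- F) f (t.2, t.1).
Proof. by rewrite big_imfset//= => -[a1 a2] [b1 b2] _ _ [-> ->]. Qed.

Lemma sums_to_swap (f : lattice -> R) v :
  sums_to f v -> sums_to (fun s => f (s.2, s.1)) v.
Proof.
have swapK (F : {fset lattice}) :
    [fset (t.2, t.1) | t in [fset (t.2, t.1) | t in F]]%fset = F.
  apply/fsetP => -[a1 a2]; apply/imfsetP/idP => [[t /imfsetP[s sF ->] /= ->]|aF].
    by rewrite -surjective_pairing.
  by exists (a2, a1) => //; apply/imfsetP; exists (a1, a2).
move=> [h1 h2]; split => [F|eta eta0]; first by rewrite -sum_fset_swap.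
have [F hF] := h2 eta eta0; exists [fset (t.2, t.1) | t in F]%fset.
by rewrite -(sum_fset_swap _ f) swapK.
Qed.

Lemma kernel_limit_swap (c : nat -> R * R -> lattice -> R) (K : R * R -> plane -> R) :
  kernel_limit c K ->
  kernel_limit (fun k x s => c k (x.2, x.1) (s.2, s.1)) (fun x u => K (x.2, x.1) (u.2, u.1)).
Proof.
have mswap : measurable_fun setT ((fun u => (u.2, u.1)) : plane -> plane).
  by apply: measurable_plane; [exact: measurable_coord2|exact: measurable_coord1].
move=> [h1 h2 h3]; split.
- move=> x [x1 x2]; have [mK iK] := h1 (x.2, x.1) (conj x2 x1); split.
    exact: (measurableT_comp mK mswap).
  have /integrableP[mi fi] := iK; apply/integrableP; split.
    exact: (measurableT_comp mi mswap).
  rewrite (ge0_integral_swap (F := fun u => `|(K (x.2, x.1) u ^+ 2)%:E|%E))//.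
  exact: measurableT_comp.
- move=> n x theta qx.
  have qx' j : quadrant ((x j).2, (x j).1) by have [] := qx j.
  have [v v1 v2] := h2 n (fun j => ((x j).2, (x j).1)) theta qx'.
  exists v => [k|]; first exact: (sums_to_swap (v1 k)).
  rewrite (Rintegral_swap (F := fun u => (\sum_j theta j * K ((x j).2, (x j).1) u) ^+ 2))//.
  apply: measurable_funX; apply: measurable_sum => j; apply: measurable_funM => //.
  by have [] := h1 _ (qx' j).
- move=> x eta [x1 x2] eta0; have [N hN] := h3 (x.2, x.1) eta (conj x2 x1) eta0.
  by exists N => k Nk s; exact: hN.
Qed.

Lemma power_kernel_swap (q C : R) b g : power_kernel q C b g ->
  power_kernel q C (fun t => b (t.2, t.1)) (fun u : plane => g (u.2, u.1)).
Proof.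
move=> [C0 mg hb gcv]; split => //.
- have mswap : measurable_fun setT ((fun u => (u.2, u.1)) : plane -> plane).
    by apply: measurable_plane; [exact: measurable_coord2|exact: measurable_coord1].
  exact: (measurableT_comp mg mswap).
- by move=> t; have := hb (t.2, t.1); rewrite /msize /= [Num.max `|t.2%:~R| _]maxC.
- move=> t m w m0 moo c1 c2 w0.
  have := gcv (fun k => ((t k).2, (t k).1)) m (w.2, w.1) m0 moo c2 c1; apply.
  by apply: contra w0 => /eqP[w2 w1]; rewrite [w]surjective_pairing w1 w2.
Qed.

Lemma sum_box_pts_swap (N1 N2 : R) (x : R * R) (b : lattice -> R) (s : lattice) :
  \sum_(t <- box_pts N2 N1 (x.2, x.1)) b ((t - (s.2, s.1)).2, (t - (s.2, s.1)).1) =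
  \sum_(t <- box_pts N1 N2 x) b (t - s).
Proof.
have -> : box_pts N2 N1 (x.2, x.1) = [fset (t.2, t.1) | t in box_pts N1 N2 x]%fset.
  apply/fsetP => -[t1 t2]; rewrite mem_box_pts /= andbC; apply/idP/imfsetP => [h|[[r1 r2] /= + [-> ->]]].
    by exists (t2, t1) => //=; rewrite mem_box_pts.
  by rewrite mem_box_pts.
rewrite (sum_fset_swap _ (fun t => b ((t - (s.2, s.1)).2, (t - (s.2, s.1)).1))).
by apply: eq_bigr => -[t1 t2] _; case: s.
Qed.

End coordinate_swap.

Section transfer.
Context {R : realType}.
Notation mu := (@lebesgue_measure R).
Notation plane := (measurableTypeR R * measurableTypeR R)%type.
Notation lattice := (int * int)%type.

Lemma fine_mulB (k : R) (A B : \bar R) : 0 < k ->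
  fine (k%:E * A - k%:E * B)%E = k * fine (A - B)%E.
Proof.
move=> k0; case: A => [a||]; case: B => [b||];
  rewrite ?gt0_muley ?gt0_muleNy ?lte_fin//= ?mulr0//.
by rewrite mulrBr.
Qed.

(** A substitution rule for nonnegative functions extends to all functions
    that are measurable, integrable or not. *)
Lemma Rintegral_substitution (phi : plane -> plane) (k : R) (f : plane -> R) : 0 < k ->
  (forall F : plane -> \bar R, measurable_fun setT F -> (forall u, 0 <= F u)%E ->
    (k%:E * \int[mu2]_(u in [set: plane]) F (phi u) = \int[mu2]_u F u)%E) ->
  measurable_fun setT f -> k * \int[mu2]_(u in [set: plane]) f (phi u) = \int[mu2]_u f u.
Proof.
move=> k0 H mf; have mE : measurable_fun setT (EFin \o f) by exact/measurable_EFinP.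
rewrite /Rintegral [in RHS]integralE [in LHS]integralE -fine_mulB//; congr (fine (_ - _)%E).
- rewrite -(H (EFin \o f)^\+%E) ?funepos_ge0//; last exact: measurable_funepos.
  by congr (_ * _)%E; apply: eq_integral => u _; rewrite !funeposE.
- rewrite -(H (EFin \o f)^\-%E) ?funeneg_ge0//; last exact: measurable_funeneg.
  by congr (_ * _)%E; apply: eq_integral => u _; rewrite !funenegE.
Qed.

Lemma ge0_integral_translate (v : R * R) (F : plane -> \bar R) :
  measurable_fun setT F -> (forall u, 0 <= F u)%E ->
  (1%:E * \int[mu2]_(u in [set: plane]) F ((u.1 + v.1, u.2 + v.2)%R) = \int[mu2]_u F u)%E.
Proof.
move=> mF F0; rewrite mul1e.
have mv : measurable_fun setT ((fun u => (u.1 + v.1, u.2 + v.2)) : plane -> plane).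
  by apply: measurable_plane; apply: measurable_funD => //;
    solve [exact: measurable_coord1|exact: measurable_coord2].
have line (c : R) (f : R -> \bar R) : measurable_fun setT f -> (forall x, 0 <= f x)%E ->
    (\int[mu]_x f (x + c)%R = \int[mu]_x f x)%E.
  move=> mf f0; rewrite -(@ge0_integral_affine R 1 c f (oner_neq0 R) mf f0) normr1 mul1e.
  by apply: eq_integral => x _; rewrite mul1r.
have mFv := measurableT_comp mF mv.
rewrite [LHS](fubini_tonelli1 (fun u : plane => F (u.1 + v.1, u.2 + v.2)%R))//= [RHS]fubini_tonelli1//=.
rewrite -[RHS](line v.1).
- apply: eq_integral => x _; rewrite /fubini_F /=.
  apply: (line v.2 (fun y => F (x + v.1, y)%R)) => //.
  exact: (measurable_fun_pair2 (x + v.1) mF).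
- exact: (@measurable_fun_fubini_tonelli_F _ _ _ _ _ mu _ mF F0).
- by move=> x; apply: integral_ge0 => y _; exact: F0.
Qed.

Lemma mxact_mul (A D : 'M[R]_2) u : mxact (A *m D) u = mxact A (mxact D u).
Proof.
have two (f : 'I_2 -> R) : \sum_i f i = f 0 + f 1.
  by rewrite !big_ord_recl big_ord0 addr0; congr (_ + f _); exact/val_inj.
by rewrite /mxact !mxE !two /=; congr (_, _); ring.
Qed.

Lemma mxact_mx2 (a b c d : R) u : mxact (mx2 a b c d) u = (a * u.1 + b * u.2, c * u.1 + d * u.2).
Proof. by rewrite /mxact !mxE. Qed.

Lemma mxactB (A : 'M[R]_2) (u v : R * R) : mxact A (u - v) = mxact A u - mxact A v.
Proof.
have pairB (a b c d : R) : (a, b) - (c, d) = (a - c, b - d) by [].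
by case: u => u1 u2; case: v => v1 v2; rewrite /mxact !pairB /=; congr (_, _); ring.
Qed.

Lemma mxact1 u : mxact (1%:M : 'M[R]_2) u = u.
Proof. by case: u => a b; rewrite /mxact !mxE /=; congr (_, _); ring. Qed.

Lemma Lfun2_of_integrable_sqr (f : plane -> R) : measurable_fun setT f ->
  (\int[mu2]_u (f u ^+ 2)%:E < +oo)%E -> f \in Lfun mu2 2%:E.
Proof.
move=> mf fi; rewrite inE; apply/andP; split; rewrite inE/=; first exact: mf.
rewrite /finite_norm unlock; apply: poweR_lty; apply: le_lt_trans fi.
apply: ge0_le_integral => //.
- by move=> u _; rewrite poweR_ge0.
- rewrite (_ : (fun u => _) = fun u => (`|f u| `^ 2)%:E); last first.
    by apply/funext => u; rewrite /= ?poweR_EFin.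
  by apply/measurable_EFinP; apply: (measurableT_comp (measurable_powR _)); exact: measurableT_comp.
- by apply/measurable_EFinP; exact: measurable_funX.
- by move=> u _; rewrite /= ?poweR_EFin lee_fin powR_mulrn// real_normK ?num_real.
Qed.

Lemma scaling_limit_of_kernel d (T : measurableType d) (P : probability T R)
    (eps X : lattice -> {RV P >-> R}) (b : lattice -> R) (G : gaussian_field R)
    (gamma H : R) (K : R * R -> plane -> R) :
  assumptionA eps -> linear_field b eps X -> 0 < H -> gf_well_defined G ->
  (forall n (x : 'I_n -> R * R) (theta : 'I_n -> R), (forall i, quadrant (x i)) ->
    \int[mu2]_(u in [set: plane]) (\sum_j theta j * (gf_scale G * gf_kernel G (x j) u)) ^+ 2 =
    \int[mu2]_u (\sum_j theta j * K (x j) u) ^+ 2) ->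
  (forall lam : nat -> R, (forall k, 1 < lam k) -> lam k @[k --> \oo] --> +oo ->
    kernel_limit (fun k x s => (lam k `^ H)^-1 *
      \sum_(t <- box_pts (lam k) (lam k `^ gamma) x) b (t - s)) K) ->
  scaling_limit G X gamma.
Proof.
move=> hA hX H0 gw EK kl; split => //; exists H => // d' T' P' W V wn gv n x qx f cf [M fM].
pose r lam := \int[P]_w f (\row_i ((lam `^ H)^-1 * partial_sum X lam gamma (x i) w)).
pose l := \int[P']_w f (\row_i V (x i) w).
have psE lam w i : partial_sum X lam gamma (x i) w =
    \sum_(t <- box_pts lam (lam `^ gamma) (x i)) X t w.
  by rewrite /partial_sum fsbig_finite//; exact: finite_box_pts.
have mps lam i : measurable_fun setT
    (fun w => (lam `^ H)^-1 * partial_sum X lam gamma (x i) w).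
  under eq_fun do rewrite psE.
  by apply: measurable_funM => //; apply: measurable_sum.
have rE lam : ('E_P[fun w => f (\row_i ((lam `^ H)^-1 * partial_sum X lam gamma (x i) w))%R])%E
    = (r lam)%:E.
  rewrite unlock /r /Rintegral fineK//; apply: integrable_fin_num => //.
  apply: (@integrable_bounded _ _ _ P _ M) => //.
  exact: (continuous_row_measurable cf fM (mps lam)).
have lE : ('E_P'[fun w => f (\row_i V (x i) w)%R])%E = l%:E.
  rewrite unlock /l /Rintegral fineK//; apply: integrable_fin_num => //.
  apply: (@integrable_bounded _ _ _ P' _ M) => //.
  exact: (continuous_row_measurable cf fM).
rewrite lE; under eq_fun do rewrite rE.
suff rl : r lam @[lam --> +oo] --> l by apply: cvg_EFin => //; exact: nearW.
apply/cvg_pinftyP => u uoo.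
pose lam k := Num.max 2 (u k).
have lam1 k : 1 < lam k by rewrite lt_max ltr1n.
have lamu : \forall k \near \oo, r (lam k) = r (u k).
  move/cvgryPge : (uoo) => /(_ 2); apply: filterS => k uk.
  by rewrite /lam max_r.
have lamoo : lam k @[k --> \oo] --> +oo.
  apply/cvgryPge => A; move/cvgryPge : uoo => /(_ A); apply: filterS => k uk.
  by rewrite le_max uk orbT.
apply: cvg_trans (near_eq_cvg lamu) _.
have [k1 k2 k3] := kl lam lam1 lamoo.
have cosZ theta a : \int[P']_w cos (a + \sum_(j < n) theta j * V (x j) w) =
    expR (- ((\int[mu2]_u (\sum_j theta j * K (x j) u) ^+ 2) / 2)) * cos a.
  pose I j := projT1 (cid2 (gv (x j) (qx j))).
  have hI j : wiener_integral W (gf_kernel G (x j)) (I j) by rewrite /I; case: cid2.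
  have VI j : {ae P', forall w, V (x j) w = gf_scale G * I j w} by rewrite /I; case: cid2.
  transitivity (\int[P']_w cos (a + \sum_(j < n) (theta j * gf_scale G) * I j w)).
    apply: ae_eq_Rintegral.
    - apply: measurable_cos_comp; apply: measurable_funD => //.
      exact: measurable_lincomb.
    - apply: measurable_cos_comp; apply: measurable_funD => //.
      exact: measurable_lincomb.
    - have : {ae P', forall w, forall j, V (x j) w = gf_scale G * I j w}.
        exact: (@filter_forall _ _ (fun j => [set w | V (x j) w = gf_scale G * I j w]) _
          (ae_filter_ringOfSetsType P') VI).
      apply: (@filterS _ _ (ae_filter_ringOfSetsType P')) => w hw.
      by congr (cos (a + _)); apply: eq_bigr => j _; rewrite hw mulrA.
  rewrite (wiener_integral_cos wn _ _ hI) -EK//.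
  congr (expR (- (_ / 2)) * _); apply: eq_Rintegral => v _; congr (_ ^+ 2).
  by apply: eq_bigr => j _; rewrite mulrA.
have := @linear_field_weak_cvg _ _ _ P b eps X hA hX n
  (fun k j => box_pts (lam k) (lam k `^ gamma) (x j)) (fun k => (lam k `^ H)^-1)
  (fun theta => \int[mu2]_u (\sum_j theta j * K (x j) u) ^+ 2) d' T' P' (fun j => V (x j)).
move=> /(_ _ _ cosZ f M cf fM) h.
rewrite /r /l; under eq_fun => k.
  under eq_Rintegral => w _.
    rewrite (_ : (\row_i _) = \row_j ((lam k `^ H)^-1 * \sum_(t <- box_pts (lam k) (lam k `^ gamma) (x j)) X t w)).
      over.
    by apply/rowP => j; rewrite !mxE psE.
  over.
apply: h.
- by move=> theta; exact: k2.
- move=> eta eta0.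
  have /choice[N hN] : forall j : 'I_n, exists N : nat, forall k, (N <= k)%N -> forall s,
      `|(lam k `^ H)^-1 * \sum_(t <- box_pts (lam k) (lam k `^ gamma) (x j)) b (t - s)| <= eta.
    by move=> j; exact: k3.
  exists (\max_j N j)%N => k Nk j s; apply: hN; apply: leq_trans Nk.
  exact: leq_bigmax.
Qed.

Variables (q : R) (B : 'M[R]_2) (Lp Lm : R -> R).
Hypothesis B0 : \det B != 0.
Hypothesis ma : measurable_fun setT (a_oo q q Lp Lm : plane -> R).
Variables (b : lattice -> R) (d : measure_display) (T : measurableType d)
  (P : probability T R) (eps X : lattice -> {RV P >-> R}).
Hypotheses (hA : assumptionA eps) (hX : linear_field b eps X).
Variables (gamma H : R).
Hypothesis H0 : 0 < H.
Let g (u : plane) : R := a_oo q q Lp Lm (mxact B u).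
Let norms (K : R * R -> plane -> R) := forall lam : nat -> R, (forall k, 1 < lam k) ->
  lam k @[k --> \oo] --> +oo ->
  kernel_limit (fun k x s => (lam k `^ H)^-1 *
    \sum_(t <- box_pts (lam k) (lam k `^ gamma) x) b (t - s)) K.

Let detB_gt0 : 0 < `|\det B|. Proof. by rewrite normr_gt0. Qed.
Let lam0 (k : nat) : R := k%:R + 2.
Let lam0_gt1 k : 1 < lam0 k. Proof. by rewrite /lam0 ltr_wpDl// ltr1n. Qed.
Let lam0_oo : lam0 k @[k --> \oo] --> +oo.
Proof.
apply/cvgryPge => A; near=> k; rewrite /lam0 (@le_trans _ _ k%:R) ?lerDl//.
by near: k; exact: nbhs_infty_ger.
Unshelve. all: by end_near. Qed.

Let kernel_L2 K x : norms K -> quadrant x -> measurable_fun setT (K x) /\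
  (\int[mu2]_u (K x u ^+ 2)%:E < +oo)%E.
Proof.
move=> nK qx; have [h _ _] := nK lam0 lam0_gt1 lam0_oo; have [mK iK] := h x qx.
split=> //; have /integrableP[_] := iK.
by under eq_integral do rewrite /= ger0_norm ?sqr_ge0//.
Qed.

Let BV u : mxact B (mxact (invmx B) u) = u.
Proof. by rewrite -mxact_mul mulmxV ?mxact1// unitmxE unitfE. Qed.

Let VB u : mxact (invmx B) (mxact B u) = u.
Proof. by rewrite -mxact_mul mulVmx ?mxact1// unitmxE unitfE. Qed.

Lemma scaling_limit_Vtilde (D E : 'M[R]_2) :
  (forall t, mxact D t = mxact B (mxact E t)) ->
  let K x u := \int[mu2]_(t in [set: plane]) (g (mxact E t - u) * \1_(box x) t) in
  norms K ->
  (forall x, quadrant x -> {ae mu2, forall u : plane,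
     mu2.-integrable setT (EFin \o (fun t : plane => g (mxact E t - u) * \1_(box x) t))}) ->
  scaling_limit (Vtilde q q B Lp Lm D) X gamma.
Proof.
move=> DE K nK iK.
have kE x v : gf_kernel (Vtilde q q B Lp Lm D) x (mxact B v) = K x v.
  rewrite /gf_kernel /K /= Rintegral_mkcond; apply: eq_Rintegral => t _.
  rewrite patchE indicE DE -mxactB.
  by case: (t \in box x); rewrite ?mulr1 ?mulr0.
have kE' x : gf_kernel (Vtilde q q B Lp Lm D) x = K x \o mxact (invmx B).
  by apply/funext => u /=; rewrite -kE BV.
have mk x : quadrant x -> measurable_fun setT (gf_kernel (Vtilde q q B Lp Lm D) x : plane -> R).
  move=> qx; rewrite kE'; have [mK _] := kernel_L2 nK qx.
  exact: (measurableT_comp mK (measurable_mxact _)).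
have detV : \det (invmx B) != 0 by rewrite det_inv invr_eq0.
apply: (scaling_limit_of_kernel (K := K) hA hX H0) => //.
  move=> x qx; split.
    have := ae_mxact detV (iK x qx); apply: filterS => u.
    rewrite /= => h; apply/integrable_mkcond; first exact: measurable_box.
    move: h; apply: eq_integrable => // t _; rewrite patchE /= indicE DE /g.
    rewrite mxactB BV.
    by case: (t \in box x); rewrite ?mulr1 ?mulr0.
  apply: Lfun2_of_integrable_sqr; first exact: mk.
  rewrite -(ge0_integral_mxact B0).
  - under eq_integral do rewrite kE.
    by rewrite lte_mul_pinfty ?lee_fin//; have [] := kernel_L2 nK qx.
  - by apply/measurable_EFinP; apply: measurable_funX; exact: mk.
  - by move=> u; rewrite lee_fin sqr_ge0.
move=> n x theta qx.
pose F (u : plane) : R := (\sum_j theta j * (gf_scale (Vtilde q q B Lp Lm D) *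
  gf_kernel (Vtilde q q B Lp Lm D) (x j) u)) ^+ 2.
have mF : measurable_fun setT F.
  apply: measurable_funX; apply: measurable_sum => j.
  apply: measurable_funM; first exact: measurable_cst.
  by apply: measurable_funM; [exact: measurable_cst|exact: mk].
have subst := @Rintegral_substitution (mxact B) `|\det B| F detB_gt0
  (fun h mh h0 => ge0_integral_mxact B0 mh h0) mF.
etransitivity; first exact: (esym subst).
have sq : (`|\det B| `^ (- 2^-1)) ^+ 2 * `|\det B| = 1.
  rewrite -powR_mulrn ?powR_ge0// -powRrM mulNr mulVf// powRN powRr1 ?(ltW detB_gt0)//.
  by rewrite mulVf// gt_eqF.
have pull (s : R) (f : plane -> R) : 0 < s -> measurable_fun setT f -> (forall u, 0 <= f u) ->
    \int[mu2]_(u in [set: plane]) (s * f u) = s * \int[mu2]_(u in [set: plane]) f u.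
  move=> s0 mf f0; rewrite /Rintegral; under eq_integral do rewrite EFinM.
  rewrite ge0_integralZl//; last 3 first.
  - exact/measurable_EFinP.
  - by move=> u _; rewrite lee_fin.
  - by rewrite lee_fin ltW.
  have := fine_mulB (\int[mu2]_u (f u)%:E) 0 s0.
  by rewrite mule0 !sube0.
have mKs : measurable_fun setT (fun u : plane => (\sum_j theta j * K (x j) u) ^+ 2).
  apply: measurable_funX; apply: measurable_sum => j; apply: measurable_funM => //.
  by have [] := kernel_L2 nK (qx j).
transitivity (`|\det B| * \int[mu2]_(u in [set: plane])
    ((`|\det B| `^ (- 2^-1)) ^+ 2 * (\sum_j theta j * K (x j) u) ^+ 2)).
  congr (_ * _); apply: eq_Rintegral => u _; rewrite /F -exprMn mulr_sumr; congr (_ ^+ 2).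
  by apply: eq_bigr => j _; rewrite kE /= mulrCA.
rewrite pull//; last 2 first.
- by rewrite exprn_gt0// powR_gt0.
- by move=> u; exact: sqr_ge0.
by rewrite mulrA [_ * _ ^+ 2]mulrC sq mul1r.
Qed.

Lemma scaling_limit_Vfield (D E : 'M[R]_2) :
  (forall s, mxact D (mxact B s) = mxact E s) ->
  let K x u := \int[mu2]_(s in [set: plane]) (g s * \1_(box x) (mxact E s + u)) in
  norms K ->
  (forall x, quadrant x -> {ae mu2, forall u : plane,
     mu2.-integrable setT (EFin \o (fun s : plane => g s * \1_(box x) (mxact E s + u)))}) ->
  scaling_limit (Vfield q q B Lp Lm D) X gamma.
Proof.
move=> DE K nK iK.
have mshift (A : 'M[R]_2) (u : R * R) : measurable_fun setT ((fun t => mxact A t + u) : plane -> plane).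
  apply: measurable_plane; apply: measurable_funD => //.
    exact: (measurableT_comp measurable_coord1 (measurable_mxact A)).
  exact: (measurableT_comp measurable_coord2 (measurable_mxact A)).
have mf x u : measurable_fun setT
    ((fun t => a_oo q q Lp Lm t * \1_(box x) (mxact D t + u)) : plane -> R).
  apply: measurable_funM => //.
  exact: (measurableT_comp (measurable_indic (measurable_box x)) (mshift D u)).
have kE x u : gf_kernel (Vfield q q B Lp Lm D) x u = `|\det B| * K x u.
  rewrite /gf_kernel /K /=.
  rewrite -(@Rintegral_substitution (mxact B) `|\det B|)//; last first.
    by move=> F mF F0; exact: ge0_integral_mxact.
  by congr (_ * _); apply: eq_Rintegral => s _; rewrite DE.
apply: (scaling_limit_of_kernel (K := K) hA hX H0) => //.
  move=> x qx; have [mK i2] := kernel_L2 nK qx; split.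
    have := iK x qx; apply: filterS => u /integrableP[_ h]; apply/integrableP; split.
      by apply/measurable_EFinP; exact: mf.
    rewrite -(ge0_integral_mxact B0)//; last first.
      by apply: measurableT_comp => //; apply/measurable_EFinP; exact: mf.
    rewrite lte_mul_pinfty ?lee_fin//.
    move: h; congr (_ < _)%E; apply: eq_integral => s _ /=.
    by rewrite DE.
  rewrite (_ : gf_kernel _ x = fun u => `|\det B| * K x u); last by apply/funext => u; exact: kE.
  apply: Lfun2_of_integrable_sqr; first exact: measurable_funM.
  under eq_integral do rewrite exprMn EFinM.
  rewrite ge0_integralZl//.
  - by rewrite lte_mul_pinfty ?lee_fin ?sqr_ge0.
  - by apply/measurable_EFinP; exact: measurable_funX.
  - by move=> u _; rewrite lee_fin sqr_ge0.
move=> n x theta qx; apply: eq_Rintegral => u _; congr (_ ^+ 2); apply: eq_bigr => j _.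
by rewrite kE /= mulKf// gt_eqF.
Qed.

End transfer.

(** * The scaling regimes *)

Section scaling_regimes.
Context {R : realType}.
Notation plane := (measurableTypeR R * measurableTypeR R)%type.
Notation lattice := (int * int)%type.

Lemma powR_cvg_pinfty (lam : nat -> R) (p : R) : 0 < p -> lam k @[k --> \oo] --> +oo ->
  lam k `^ p @[k --> \oo] --> +oo.
Proof.
move=> p0 loo; apply/cvgryPge => A.
move/cvgryPge : loo => /(_ (`|A| `^ p^-1)); apply: filterS => k h.
apply: (le_trans (ler_norm A)).
rewrite -[leLHS](@powRr1 _ `|A|)// -(@mulVf _ p) ?gt_eqF// powRrM.
by apply: ge0_ler_powR; rewrite ?nnegrE ?powR_ge0 ?(ltW p0)//; apply: le_trans h; exact: powR_ge0.
Qed.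

Lemma powR_cvg0 (lam : nat -> R) (p : R) : (forall k, 0 < lam k) -> p < 0 ->
  lam k @[k --> \oo] --> +oo -> lam k `^ p @[k --> \oo] --> (0 : R).
Proof.
move=> l0 p0 loo; rewrite -[p]opprK; under eq_fun do rewrite powRN.
apply/gtr0_cvgV0; first by apply: nearW => k; exact: powR_gt0.
by apply: powR_cvg_pinfty => //; rewrite oppr_gt0.
Qed.

Lemma powR_mul (x a c : R) : 0 < x -> x `^ a * x `^ c = x `^ (a + c).
Proof. by move=> x0; rewrite powRD// (gt_eqF x0) implybT. Qed.

Lemma powR_div (x a c : R) : 0 < x -> x `^ a / x `^ c = x `^ (a - c).
Proof. by move=> x0; rewrite -powRN powR_mul. Qed.


(** Convergence of the normalized coefficients under the scaling
    [lambda, lambda ^ gamma], along every sequence of scales. *)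
Definition regime (gamma H : R) (b : lattice -> R) (Phi : R * R -> plane -> plane -> R) : Prop :=
  (forall lam : nat -> R, (forall k, 1 < lam k) -> lam k @[k --> \oo] --> +oo ->
    kernel_limit (fun k x s => (lam k `^ H)^-1 *
      \sum_(t <- box_pts (lam k) (lam k `^ gamma) x) b (t - s))
      (fun x u => \int[mu2]_(t in [set: plane]) Phi x u t)) /\
  (forall x, quadrant x -> {ae mu2, forall u : plane, mu2.-integrable setT (EFin \o Phi x u)}).

Lemma regime_of_sequences (gamma H : R) (b : lattice -> R) (Phi : R * R -> plane -> plane -> R) :
  (forall lam : nat -> R, (forall k, 1 < lam k) -> lam k @[k --> \oo] --> +oo ->
    exists2 c, c = (fun k x s => (lam k `^ H)^-1 *
      \sum_(t <- box_pts (lam k) (lam k `^ gamma) x) b (t - s)) &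
    kernel_limit c (fun x u => \int[mu2]_(t in [set: plane]) Phi x u t) /\
    forall x, quadrant x -> {ae mu2, forall u : plane, mu2.-integrable setT (EFin \o Phi x u)}) ->
  regime gamma H b Phi.
Proof.
move=> h; split=> [lam l1 loo|]; first by have [c -> []] := h lam l1 loo.
have [||c _ []//] := h (fun k => k%:R + 2).
- by move=> k; rewrite ltr_wpDl// ltr1n.
- apply/cvgryPge => A; near=> k; rewrite (@le_trans _ _ k%:R) ?lerDl//.
  by near: k; exact: nbhs_infty_ger.
Unshelve. all: by end_near. Qed.

Lemma regime_eq (gamma H : R) (b : lattice -> R) (Phi Phi' : R * R -> plane -> plane -> R) :
  (forall x u t, Phi x u t = Phi' x u t) -> regime gamma H b Phi' -> regime gamma H b Phi.
Proof.
by move=> e; have -> : Phi = Phi' by apply/funext => x; apply/funext => u; apply/funext => t.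
Qed.

Section powers.
Variables (q C : R) (b : lattice -> R) (g : plane -> R).
Hypothesis hC : power_kernel q C b g.

Lemma regime_critical : 1 < q < 2 ->
  regime 1 (3 - q) b (fun x u t => g (mxact 1%:M t - u) * \1_(box x) t).
Proof.
move=> q12.
apply: (@regime_eq _ _ _ _ (fun x u t => g (1 * t.1 - u.1, t.2 - u.2) * \1_(box x) t)).
  by move=> x u t; rewrite mxact1 mul1r; congr (g _ * _); case: t => ? ?; case: u.
apply: regime_of_sequences => lam lam1 loo.
have l0 k : 0 < lam k by apply: lt_trans (lam1 k).
eexists; last exact: (kernel_limit_critical hC q12 l0 loo).
apply/funext => k; apply/funext => x; apply/funext => s; rewrite powRr1 ?(ltW (l0 k))//.
congr (_ * _); rewrite -expr2 -powR_mulrn ?(ltW (l0 k))// powR_div// -powRN.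
by congr (_ `^ _); ring.
Qed.

Lemma regime_above (gamma : R) : 1 < q < 3 / 2 -> 1 < gamma ->
  regime gamma (1 + gamma * (2 - q)) b
    (fun x u t => g (mxact (mx2 0 0 0 1) t - u) * \1_(box x) t).
Proof.
move=> q32 g1.
apply: (@regime_eq _ _ _ _ (fun x u t => g (0 * t.1 - u.1, t.2 - u.2) * \1_(box x) t)).
  move=> x u t; rewrite mxact_mx2; congr (g _ * _); case: t => t1 t2; case: u => u1 u2.
  transitivity ((0 * t1 + 0 * t2) - u1, (0 * t1 + 1 * t2) - u2) => //.
  by congr (_, _) => /=; ring.
apply: regime_of_sequences => lam lam1 loo.
have l0 k : 0 < lam k by apply: lt_trans (lam1 k).
have dmE k : lam k `^ (1 - gamma) * lam k `^ gamma = lam k.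
  by rewrite powR_mul// subrK powRr1// ltW.
have h1 k : 0 < lam k `^ gamma by exact: powR_gt0.
have h2 : lam k `^ gamma @[k --> \oo] --> +oo by apply: powR_cvg_pinfty => //; lra.
have h3 k : 0 < lam k `^ (1 - gamma) by exact: powR_gt0.
have h4 : lam k `^ (1 - gamma) @[k --> \oo] --> (0 : R) by apply: powR_cvg0 => //; lra.
have h5 : lam k `^ (1 - gamma) * lam k `^ gamma @[k --> \oo] --> +oo.
  by under eq_fun do rewrite dmE.
eexists; last exact: (kernel_limit_degenerate hC q32 h1 h2 h3 h4 h5).
apply/funext => k; apply/funext => x; apply/funext => s; rewrite dmE.
congr (_ * _); rewrite -[X in _ / (X * _)](@powRr1 R) ?(ltW (l0 k))//.
rewrite powR_mul// -powRrM powR_div// -powRN.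
by congr (_ `^ _); ring.
Qed.

Lemma regime_inverse_above (gamma : R) : 3 / 2 < q < 2 -> 1 < gamma ->
  regime gamma (2 - q + (1 + gamma) / 2) b
    (fun x u s => g s * \1_(box x) (mxact (mx2 1 0 0 0) s + u)).
Proof.
move=> q32 g1.
apply: (@regime_eq _ _ _ _ (fun x u v => g v * \1_(box x) ((v.1 + u.1, u.2) : plane))).
  move=> x u t; rewrite mxact_mx2; congr (g _ * \1_(box x) _).
  case: t => t1 t2; case: u => u1 u2.
  transitivity ((1 * t1 + 0 * t2) + u1, (0 * t1 + 0 * t2) + u2) => //.
  by congr (_, _) => /=; ring.
apply: regime_of_sequences => lam lam1 loo.
have l0 k : 0 < lam k by apply: lt_trans (lam1 k).
have h1 k : 1 <= lam k by exact: ltW.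
have h2 k : lam k <= lam k `^ gamma.
  by rewrite -[leLHS](@powRr1 R) ?(ltW (l0 k))//; apply: ler_powR; [exact: h1|exact: ltW].
have h3 : lam k / lam k `^ gamma @[k --> \oo] --> (0 : R).
  rewrite (_ : (fun k => _) = fun k => lam k `^ (1 - gamma)); last first.
    by apply/funext => k; rewrite -powR_div// powRr1// ltW.
  by apply: powR_cvg0 => //; lra.
eexists; last exact: (kernel_limit_inverse hC q32 h1 h2 loo h3).
apply/funext => k; apply/funext => x; apply/funext => s.
congr (_ * _); rewrite -powR12_sqrt ?mulr_ge0 ?powR_ge0 ?(ltW (l0 k))//.
rewrite -[X in X * _ `^ gamma](@powRr1 R) ?(ltW (l0 k))// powR_mul//.
by rewrite -powRrM powR_div// -powRN; congr (_ `^ _); field.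
Qed.

End powers.

Lemma indic_box_swap (x v : R * R) : \1_(box (x.2, x.1)) v = \1_(box x) (v.2, v.1) :> R.
Proof.
rewrite !indicE; have -> // : (v \in box (x.2, x.1)) = ((v.2, v.1) \in box x).
by apply/idP/idP => /set_mem[h1 h2]; apply/mem_set.
Qed.

(** Exchanging the coordinates turns the scaling [lambda, lambda ^ gamma] into
    [lambda', lambda' ^ (1 / gamma)] with [lambda' = lambda ^ gamma]. *)
Lemma regime_below (gamma H : R) (b : lattice -> R) (Phi' Phi : R * R -> plane -> plane -> R) :
  0 < gamma -> (forall x u, measurable_fun setT (Phi x u)) ->
  (forall x u t, Phi' (x.2, x.1) (u.2, u.1) t = Phi x u (t.2, t.1)) ->
  regime gamma^-1 H (fun t => b (t.2, t.1)) Phi' -> regime gamma (gamma * H) b Phi.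
Proof.
move=> g0 mPhi PE [h1 h2]; split.
- move=> lam lam1 loo; have l0 k : 0 < lam k by apply: lt_trans (lam1 k).
  have one : (1 : R) `^ gamma = 1 by rewrite powR1.
  have l1 k : 1 < lam k `^ gamma.
    by rewrite -{1}one; apply: gt0_ltr_powR; rewrite ?nnegrE ?ler01 ?(ltW (l0 k)).
  have := kernel_limit_swap (h1 (fun k => lam k `^ gamma) l1 (powR_cvg_pinfty g0 loo)).
  congr (kernel_limit _ _).
    apply/funext => k; apply/funext => x; apply/funext => s.
    rewrite -!powRrM mulfV ?gt_eqF// powRr1 ?(ltW (l0 k))//.
    by rewrite (sum_box_pts_swap (lam k) (lam k `^ gamma) x b s).
  apply/funext => x; apply/funext => u.
  under eq_Rintegral do rewrite PE.
  exact: Rintegral_swap.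
- move=> x [x1 x2]; have := h2 (x.2, x.1) (conj x2 x1).
  have det1 : \det (mx2 0 1 1 0 : 'M[R]_2) != 0.
    by rewrite det_mx22 !mxE /= mulr0 mulr1 sub0r oppr_eq0 oner_eq0.
  move=> /(ae_mxact det1); apply: filterS => u /integrableP[_ fi].
  apply/integrableP; split; first exact/measurable_EFinP.
  rewrite -(ge0_integral_swap (F := fun t => `|(Phi x u t)%:E|%E))//; last first.
    by apply: measurableT_comp => //; exact/measurable_EFinP.
  move: fi; congr (_ < _)%E; apply: eq_integral => t _ /=.
  rewrite -PE (_ : mxact _ u = (u.2, u.1))// mxact_mx2.
  by congr (_, _); ring.
Qed.

End scaling_regimes.

(** * The two transitions *)

Section transition.
Context {R : realType}.
Notation plane := (measurableTypeR R * measurableTypeR R)%type.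
Variables (q : R) (B : 'M[R]_2) (Lp Lm : R -> R) (b : int * int -> R).
Variables (d : measure_display) (T : measurableType d) (P : probability T R).
Variables (eps X : int * int -> {RV P >-> R}).
Hypotheses (q12 : 1 < q < 2) (hA : assumptionA eps) (hX : linear_field b eps X).
Hypothesis hB : assumptionB q q B Lp Lm b.
Let g (u : plane) : R := a_oo q q Lp Lm (mxact B u).

Let q_gt0 : 0 < q. Proof. by case/andP: q12 => h _; apply: lt_trans h. Qed.
Let B0 : \det B != 0. Proof. by have [] := hB. Qed.
Let ma : measurable_fun setT (a_oo q q Lp Lm : plane -> R).
Proof. by have [_ [c1 c2 _ _] _] := hB; exact: measurable_a_oo. Qed.
Let hb : exists C, power_kernel q C b g.
Proof. by have [_ [c1 c2 e1 e2] ho] := hB; exact: power_kernel_a_oo. Qed.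
Let mg : measurable_fun setT g.
Proof. exact: (measurableT_comp ma (measurable_mxact B)). Qed.

Let mtilde (E : 'M[R]_2) (x u : R * R) :
  measurable_fun setT ((fun t => g (mxact E t - u) * \1_(box x) t) : plane -> R).
Proof.
apply: measurable_funM; last exact: measurable_indic (measurable_box x).
apply: (measurableT_comp mg); apply: measurable_plane; apply: measurable_funB => //.
  exact: (measurableT_comp measurable_coord1 (measurable_mxact E)).
exact: (measurableT_comp measurable_coord2 (measurable_mxact E)).
Qed.

Let mfield (E : 'M[R]_2) (x u : R * R) :
  measurable_fun setT ((fun s => g s * \1_(box x) (mxact E s + u)) : plane -> R).
Proof.
apply: measurable_funM => //.
apply: (measurableT_comp (measurable_indic (measurable_box x))); apply: measurable_plane;
  apply: measurable_funD => //.
  exact: (measurableT_comp measurable_coord1 (measurable_mxact E)).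
exact: (measurableT_comp measurable_coord2 (measurable_mxact E)).
Qed.

Let Vtilde_limit (gamma H : R) (D E : 'M[R]_2) : 0 < H ->
  (forall t, mxact D t = mxact B (mxact E t)) ->
  regime gamma H b (fun x u t => g (mxact E t - u) * \1_(box x) t) ->
  scaling_limit (Vtilde q q B Lp Lm D) X gamma.
Proof. by move=> H0 DE [h1 h2]; exact: (scaling_limit_Vtilde B0 hA hX H0 DE h1 h2). Qed.

Let Vfield_limit (gamma H : R) (D E : 'M[R]_2) : 0 < H ->
  (forall s, mxact D (mxact B s) = mxact E s) ->
  regime gamma H b (fun x u s => g s * \1_(box x) (mxact E s + u)) ->
  scaling_limit (Vfield q q B Lp Lm D) X gamma.
Proof. by move=> H0 DE [h1 h2]; exact: (scaling_limit_Vfield B0 ma hA hX H0 DE h1 h2). Qed.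

Lemma scaling_transition_low : q < 3 / 2 ->
  scaling_transition X 1 (Vtilde02 q q B Lp Lm) (Vtilde01 q q B Lp Lm) (Vtilde0 q q B Lp Lm).
Proof.
move=> q32; have [C hC] := hb; have /andP[q1 q2] := q12.
have q132 : 1 < q < 3 / 2 by rewrite q1.
move=> gamma g0; split=> [g1|g1|->].
- apply: (Vtilde_limit _ _ (regime_above hC q132 g1)).
    by rewrite addr_gt0// mulr_gt0//; lra.
  by move=> t; rewrite !mxact_mx2 /mxact /=; congr (_, _); ring.
- have g1' : 1 < gamma^-1 by rewrite invf_gt1.
  have r := regime_above (power_kernel_swap hC) q132 g1'.
  apply: (@Vtilde_limit gamma (gamma * (1 + gamma^-1 * (2 - q))) _ (mx2 1 0 0 0)).
  + by rewrite mulr_gt0// addr_gt0// mulr_gt0 ?invr_gt0//; lra.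
  + by move=> t; rewrite !mxact_mx2 /mxact /=; congr (_, _); ring.
  + apply: (regime_below g0 _ _ r) => // x u t.
    have arg : ((mxact (mx2 0 0 0 1) t - (u.2, u.1)).2, (mxact (mx2 0 0 0 1) t - (u.2, u.1)).1) =
        mxact (mx2 1 0 0 0) (t.2, t.1) - u.
      rewrite !mxact_mx2; case: u => u1 u2; case: t => t1 t2.
      transitivity ((0 * t1 + 1 * t2) - u1, (0 * t1 + 0 * t2) - u2); first by [].
      transitivity ((1 * t2 + 0 * t1) - u1, (0 * t2 + 0 * t1) - u2); last by [].
      by congr (_, _); ring.
    exact: (congr2 (fun y z : R => y * z) (congr1 g arg) (indic_box_swap x t)).
- apply: (Vtilde_limit _ _ (regime_critical hC q12)); first lra.
  by move=> t; rewrite mxact1.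
Qed.

Lemma scaling_transition_high : 3 / 2 < q ->
  scaling_transition X 1 (V10 q q B Lp Lm) (V20 q q B Lp Lm) (V0 q q B Lp Lm).
Proof.
move=> q32; have [C hC] := hb; have /andP[q1 q2] := q12.
have q322 : 3 / 2 < q < 2 by rewrite q32.
have detE : \det B = B 0 0 * B 1 1 - B 0 1 * B 1 0 by exact: det_mx22.
move=> gamma g0; split=> [g1|g1|->].
- apply: (Vfield_limit _ _ (regime_inverse_above hC q322 g1)).
    by rewrite addr_gt0// ?divr_gt0//; lra.
  move=> s; rewrite mxact_mx2 /mxact !mxE /=; congr (_, _); last ring.
  by move: B0; rewrite detE => D0; field.
- have g1' : 1 < gamma^-1 by rewrite invf_gt1.
  have r := regime_inverse_above (power_kernel_swap hC) q322 g1'.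
  apply: (@Vfield_limit gamma (gamma * (2 - q + (1 + gamma^-1) / 2)) _ (mx2 0 0 0 1)).
  + have gi : 0 < gamma^-1 by rewrite invr_gt0.
    by rewrite mulr_gt0//; lra.
  + move=> s; rewrite mxact_mx2 /mxact !mxE /=; congr (_, _); first ring.
    by move: B0; rewrite detE => D0; field.
  + apply: (regime_below g0 _ _ r) => // x u t.
    pose v := mxact (mx2 1 0 0 0) t + (u.2, u.1).
    have arg : (v.2, v.1) = mxact (mx2 0 0 0 1) (t.2, t.1) + u.
      rewrite /v !mxact_mx2; case: u @v => u1 u2; case: t => t1 t2 v.
      transitivity ((0 * t1 + 0 * t2) + u1, (1 * t1 + 0 * t2) + u2); first by [].
      transitivity ((0 * t2 + 0 * t1) + u1, (0 * t2 + 1 * t1) + u2); last by [].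
      by congr (_, _); ring.
    exact: (congr2 (fun y z : R => y * z) (erefl (g (t.2, t.1)))
      (etrans (indic_box_swap x v) (congr1 \1_(box x) arg))).
- have [h1 h2] := regime_critical hC q12.
  apply: (@Vfield_limit 1 (3 - q) _ 1%:M); first lra.
    by move=> s; rewrite -!mxact_mul mulVmx// unitmxE unitfE.
  have shift x u : \int[mu2]_(t in [set: plane]) (g (mxact 1%:M t - u) * \1_(box x) t) =
      \int[mu2]_(t in [set: plane]) (g t * \1_(box x) (mxact 1%:M t + u)).
    have := @Rintegral_substitution R (fun t => (t.1 + u.1, t.2 + u.2)) 1 _ ltr01
      (fun F mF F0 => ge0_integral_translate u mF F0) (mtilde 1%:M x u).
    rewrite mul1r => <-; apply: eq_Rintegral => t _; rewrite !mxact1.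
    have -> : (t.1 + u.1, t.2 + u.2) = t + u by case: t; case: u.
    by rewrite addrK.
  split.
    move=> lam l1 loo; have := h1 lam l1 loo; congr (kernel_limit _ _).
    by apply/funext => x; apply/funext => u; exact: shift.
  move=> x qx; have := h2 x qx; apply: filterS => u /integrableP[_ fi].
  apply/integrableP; split; first by apply/measurable_EFinP; exact: mfield.
  pose F (t : plane) : \bar R := (`|(g (mxact 1%:M t - u) * \1_(box x) t)%:E|)%E.
  have mF : measurable_fun setT F.
    by apply: measurableT_comp => //; apply/measurable_EFinP; exact: mtilde.
  have e := etrans (esym (mul1e _)) (ge0_integral_translate u mF (fun=> abse_ge0 _)).
  have addE (y z : R * R) : (y.1 + z.1, y.2 + z.2) = y + z by case: y; case: z.
  have e2 : (\int[mu2]_(t in [set: plane]) `|(g t * \1_(box x) (mxact 1%:M t + u))%R%:E| =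
      \int[mu2]_(t in [set: plane]) F ((t.1 + u.1, t.2 + u.2)%R))%E.
    apply: eq_integral => t _; rewrite /F !mxact1.
    by rewrite addE addrK.
  exact: (eq_ind_r (fun z => (z < +oo)%E) fi (etrans e2 e)).
Qed.

End transition.

Theorem theorem2p5 (R : realType) (q1 q2 : R) (B : 'M[R]_2) (Lp Lm : R -> R)
    (b : int * int -> R) (d : measure_display) (T : measurableType d)
    (P : probability T R) (eps X : int * int -> {RV P >-> R})
    (q1_gt0 : 0 < q1) (q2_gt0 : 0 < q2) (hQ : 1 < Qsum q1 q2 < 2)
    (hA : assumptionA eps) (hB : assumptionB q1 q2 B Lp Lm b)
    (hX : linear_field b eps X) (q12 : q1 = q2) :
  [/\ (1 < q1 < 3 / 2) <-> (1 < Qtilde q1 q2 q1),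
      1 < q1 < 3 / 2 ->
        scaling_transition X 1 (Vtilde02 q1 q2 B Lp Lm)
          (Vtilde01 q1 q2 B Lp Lm) (Vtilde0 q1 q2 B Lp Lm),
      (3 / 2 < q1 < 2) <-> (Qtilde q1 q2 q1 < 1) &
      3 / 2 < q1 < 2 ->
        scaling_transition X 1 (V10 q1 q2 B Lp Lm)
          (V20 q1 q2 B Lp Lm) (V0 q1 q2 B Lp Lm)].
Proof.
subst q2; have q0 := lt0r_neq0 q1_gt0.
have QE : Qsum q1 q1 = 2 / q1 by rewrite /Qsum; field.
have QtE : Qtilde q1 q1 q1 = 3 / 2 / q1 by rewrite /Qtilde /Qsum; field.
have q12 : 1 < q1 < 2.
  move: hQ; rewrite QE ltr_pdivlMr// ltr_pdivrMr// => /andP[h1 h2].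
  by apply/andP; split; lra.
have /andP[q1a q1b] := q12; rewrite QtE; split.
- by rewrite (ltr_pdivlMr _ _ q1_gt0) mul1r q1a.
- by move=> /andP[_ h]; exact: (scaling_transition_low q12 hA hX hB).
- by rewrite (ltr_pdivrMr _ _ q1_gt0) mul1r q1b andbT.
- by move=> /andP[h _]; exact: (scaling_transition_high q12 hA hX hB).
Qed.
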